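(* Let $n=\dim_{\mathbb C}G$ and let $U$ be a simply connected Riemann surface. (i) If $f_0\colon U\to\mathbb R^n$ is a conformal minimal immersion, then there is a conformal immersion $f\colon U\to N=G/H$ with holomorphic right Gauss map whose induced metric equals the metric induced by $f_0$. (ii) Conversely, if $f\colon U\to N=G/H$ is a conformal immersion with holomorphic right Gauss map, then there is a conformal minimal immersion $f_0\colon U\to\mathbb R^n$ whose induced metric equals the metric induced by $f$. In other words, any simply connected region of a minimal surface in $\mathbb R^n$ can be isometrically realized as a surface in $G/H$ with holomorphic right Gauss map, and vice versa.
   Context: Let $\widetilde G$ be a simply connected complex semisimple Lie group with Lie algebra $\mathfrak g$, $n=\dim_{\mathbb C}\mathfrak g$, and let $B$ be the (complex bilinear) Killing form of $\mathfrak g$. Let $\mathfrak h\subset\mathfrak g$ be a compact real form: a real Lie subalgebra with $\mathfrak g=\mathfrak h\oplus\sqrt{-1}\,\mathfrak h$ on which $B$ is negative definite. Let $\sigma_0\colon\mathfrak g\to\mathfrak g$ be complex conjugation with respect to this decomposition, $\widetilde\sigma$ the involution of $\widetilde G$ with differential $\sigma_0$ at the identity, and $\widetilde H$ its fixed point set. Choose a basis $e_1,\dots,e_n$ of $\mathfrak h$ with $B(e_i,e_j)=-\delta_{ij}$; it is also a complex basis of $\mathfrak g$, and it identifies $\mathrm{GL}(\mathfrak g)$ with $\mathrm{GL}(n,\mathbb C)$. Put $G=\mathrm{Ad}(\widetilde G)\subset \mathrm{SL}(n,\mathbb C)$ and $H=\mathrm{Ad}(\widetilde H)\subset\mathrm{SU}(n)$,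 and identify $\mathfrak g$ with $\mathrm{ad}(\mathfrak g)\subset\mathfrak{sl}(n,\mathbb C)$, the Lie algebra of $G$. For a matrix $a$, $a^*$ denotes the conjugate transpose; $*$ preserves $G$ and $\mathfrak g$. $N=G/H=\widetilde G/\widetilde H$ is the symmetric space of non-compact type with the $G$-invariant Riemannian metric equal to $B$ on $T_oN\cong\sqrt{-1}\,\mathfrak h$ ($o=eH$). $N$ is identified with a subset of $G\subset \mathrm{SL}(n,\mathbb C)$ by the Cartan embedding $aH\mapsto aa^*$. For a conformal immersion $f\colon M\to N\subset G$ of a Riemann surface, the right Gauss map is $\nu_R\colon M\to P(\mathfrak g)$, $\nu_R=[f_zf^{-1}]$, where $z$ is any local complex coordinate, the product is matrix multiplication, and $P(\mathfrak g)$ is the projective space of the complex vector space $\mathfrak g$; it does not depend on the choice of $z$. *)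

(* Defs.v *)
From HB Require Import structures.
From mathcomp Require Import all_boot all_order all_algebra complex.
From mathcomp Require Import all_classical all_reals all_analysis.

Set Implicit Arguments.
Unset Strict Implicit.
Unset Printing Implicit Defensive.

Import Order.TTheory GRing.Theory Num.Theory numFieldNormedType.Exports.

Local Open Scope classical_set_scope.
Local Open Scope complex_scope.
Local Open Scope sesquilinear_scope.
Local Open Scope ring_scope.

(* MathComp-Analysis gives a topology and a norm to [K^o] for K : numFieldType;
   this transports them to [R[i]], so that [differentiable] and ['D_v f] below
   mean complex differentiability. *)
HB.instance Definition _ (R : realType) := NormedModule.copy R[i] R[i]^o.

Section RealCalculus.
Context {R : realType} {m : nat}.
Implicit Types (D : set 'cV[R[i]]_m) (v x : 'cV[R[i]]_m).

(* The derivative along v over the reals, C^m being viewed as R^(2m). *)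
Definition rdiff {V : normedModType R} v (g : 'cV[R[i]]_m -> V)
    : 'cV[R[i]]_m -> V :=
  fun x => derive1 (fun t : R => g (x + t%:C *: v)) 0.

Fixpoint Ck_on {V : normedModType R} k D (g : 'cV[R[i]]_m -> V) : Prop :=
  (forall x, D x -> {for x, continuous g}) /\
  if k is k'.+1 then
    forall v, (forall x, D x -> derivable (fun t : R => g (x + t%:C *: v)) 0 1)
              /\ Ck_on k' D (rdiff v g)
  else True.

Definition smooth_on {V : normedModType R} D (g : 'cV[R[i]]_m -> V) : Prop :=
  forall k, Ck_on k D g.

(* Complex matrices are not a normed module over R in the library: their real
   derivatives are taken on the real and imaginary parts of the entries. *)
Definition rdiff_mx {p q} v (F : 'cV[R[i]]_m -> 'M[R[i]]_(p, q))
    : 'cV[R[i]]_m -> 'M[R[i]]_(p, q) :=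
  fun x => \matrix_(i, j) (rdiff v (fun y => complex.Re (F y i j)) x
                           +i* rdiff v (fun y => complex.Im (F y i j)) x).

Definition smooth_mx_on {p q} D (F : 'cV[R[i]]_m -> 'M[R[i]]_(p, q)) : Prop :=
  forall i j, smooth_on D (fun y => complex.Re (F y i j)) /\
              smooth_on D (fun y => complex.Im (F y i j)).

End RealCalculus.

(* [coord] is only meaningful on [dom], and [param], its inverse, on [cod]. *)
Record chart (R : realType) (m : nat) (M : topologicalType) := Chart {
  dom : set M;
  coord : M -> 'cV[R[i]]_m;
  param : 'cV[R[i]]_m -> M }.

Definition cod R m M (c : chart R m M) : set 'cV[R[i]]_m := coord c @` dom c.

Record is_chart R m M (c : chart R m M) : Prop := IsChart {
  chart_open_dom : open (dom c);
  chart_open_cod : open (cod c);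
  chart_coord_cont : forall p, dom c p -> {for p, continuous (coord c)};
  chart_param_cont : forall z, cod c z -> {for z, continuous (param c)};
  chart_coordK : forall p, dom c p -> param c (coord c p) = p }.

Structure complexManifold (R : realType) (m : nat) := ComplexManifold {
  manifold_carrier :> topologicalType;
  atlas : set (chart R m manifold_carrier);
  manifold_hausdorff : hausdorff_space manifold_carrier;
  manifold_second_countable : @second_countable manifold_carrier;
  atlas_chart : forall c, atlas c -> is_chart c;
  atlas_cover : forall p, exists2 c, atlas c & dom c p;
  atlas_compatible : forall c d, atlas c -> atlas d ->
    forall z, cod c z -> dom d (param c z) ->
    differentiable (fun w => coord d (param c w)) z }.

(* A Riemann surface that is connected as soon as it is [simply_connected]. *)
Notation riemannSurface R := (complexManifold R 1).

Definition is_path (R : realType) (T : topologicalType) (g : R -> T) x y :=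
  [/\ {within `[0, 1], continuous g}, g 0 = x & g 1 = y].

Definition simply_connected (R : realType) (T : topologicalType) : Prop :=
  (forall x y : T, exists g : R -> T, is_path g x y) /\
  (forall (x : T) (g : R -> T), is_path g x x ->
     exists H : R * R -> T,
       [/\ {within `[0, 1] `*` `[0, 1], continuous H},
           forall t, t \in `[0, 1] -> H (0, t) = g t /\ H (1, t) = x
         & forall s, s \in `[0, 1] -> H (s, 0) = x /\ H (s, 1) = x]).

Structure complexLieGroup (R : realType) (n : nat) := ComplexLieGroup {
  lie_manifold :> complexManifold R n;
  lie_mul : lie_manifold -> lie_manifold -> lie_manifold;
  lie_one : lie_manifold;
  lie_inv : lie_manifold -> lie_manifold;
  lie_mulA : associative lie_mul;
  lie_mul1g : left_id lie_one lie_mul;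
  lie_mulVg : left_inverse lie_one lie_inv lie_mul;
  lie_mul_cont :
    continuous (fun p : lie_manifold * lie_manifold => lie_mul p.1 p.2);
  lie_inv_cont : continuous lie_inv;
  lie_mul_holo : forall b c d,
    atlas b -> atlas c -> atlas d ->
    forall x y, cod b x -> cod c y -> dom d (lie_mul (param b x) (param c y)) ->
    differentiable (fun w : 'cV[R[i]]_n * 'cV[R[i]]_n =>
      coord d (lie_mul (param b w.1) (param c w.2))) (x, y);
  lie_inv_holo : forall b c,
    atlas b -> atlas c ->
    forall x, cod b x -> dom c (lie_inv (param b x)) ->
    differentiable (fun w => coord c (lie_inv (param b w))) x }.

(* The Lie algebra g is the tangent space at the identity, written in a chart
   phi around the identity: its underlying vector space is C^n. *)
Section LieAlgebra.
Context {R : realType} {n : nat} (Gt : complexLieGroup R n) (phi : chart R n Gt).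
Implicit Types (X Y : 'cV[R[i]]_n) (a : Gt).

(* The differential at the identity of x |-> a x a^-1. *)
Definition Ad a : 'M[R[i]]_n :=
  \matrix_(i, j) 'D_(delta_mx j 0) (fun x =>
     coord phi (lie_mul (lie_mul a (param phi x)) (lie_inv a)) i 0)
   (coord phi (lie_one Gt)).

(* The differential of Ad at the identity. *)
Definition ad X : 'M[R[i]]_n :=
  \matrix_(i, j) 'D_X (fun x => Ad (param phi x) i j) (coord phi (lie_one Gt)).

Definition bracket X Y : 'cV[R[i]]_n := ad X *m Y.

Definition killing X Y : R[i] := \tr (ad X *m ad Y).

Definition derived_space (I : {vspace 'cV[R[i]]_n}) : {vspace 'cV[R[i]]_n} :=
  <<[seq bracket X Y | X <- vbasis I, Y <- vbasis I]>>%VS.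

Definition semisimple : Prop :=
  forall I : {vspace 'cV[R[i]]_n},
    (forall X Y, Y \in I -> bracket X Y \in I) ->
    (exists k, iter k derived_space I = 0%VS) -> I = 0%VS.

Record compact_real_form (h : set 'cV[R[i]]_n) : Prop := CompactRealForm {
  real_form0 : h 0;
  real_formD : forall X Y, h X -> h Y -> h (X + Y);
  real_formZ : forall (r : R) X, h X -> h (r%:C *: X);
  real_form_bracket : forall X Y, h X -> h Y -> h (bracket X Y);
  real_form_span : forall X, exists Y Z, [/\ h Y, h Z & X = Y + 'i *: Z];
  real_form_direct : forall X, h X -> h ('i *: X) -> X = 0;
  real_form_neg : forall X, h X -> X != 0 -> killing X X < 0 }.

Definition is_conjugation (h : set 'cV[R[i]]_n)
    (sigma0 : 'cV[R[i]]_n -> 'cV[R[i]]_n) : Prop :=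
  forall Y Z, h Y -> h Z -> sigma0 (Y + 'i *: Z) = Y - 'i *: Z.

(* Linear independence follows from the orthonormality relations. *)
Definition orthonormal_basis (h : set 'cV[R[i]]_n)
    (e : 'I_n -> 'cV[R[i]]_n) : Prop :=
  [/\ forall i, h (e i),
      forall X, h X -> exists r : 'I_n -> R, X = \sum_i (r i)%:C *: e i
    & forall i j, killing (e i) (e j) = - (i == j)%:R].

(* An involutive automorphism of the real Lie group underlying Gt whose
   differential at the identity is sigma0. *)
Record involution_with_differential (sigma : Gt -> Gt)
    (sigma0 : 'cV[R[i]]_n -> 'cV[R[i]]_n) : Prop := InvolutionWithDifferential {
  sigma_mul : {morph sigma : a b / lie_mul a b};
  sigmaK : involutive sigma;
  sigma_cont : continuous sigma;
  sigma_smooth : forall c d, atlas c -> atlas d ->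
    smooth_mx_on (cod c `&` [set z | dom d (sigma (param c z))])
                 (fun z => coord d (sigma (param c z)));
  sigma_diff : forall X,
    rdiff_mx X (fun x => coord phi (sigma (param phi x)))
             (coord phi (lie_one Gt)) = sigma0 X }.

End LieAlgebra.

Section SymmetricSpace.
Context {R : realType} {n : nat} (Gt : complexLieGroup R n) (phi : chart R n Gt).
Context (h : set 'cV[R[i]]_n) (sigma : Gt -> Gt) (e : 'I_n -> 'cV[R[i]]_n).
Local Notation mx := 'M[R[i]]_n.

(* The matrix in the basis e of an endomorphism of g. *)
Definition in_basis (A : mx) : mx :=
  let E : mx := \matrix_(i, j) e j i 0 in invmx E *m A *m E.

Definition adjoint_group : set mx := [set in_basis (Ad phi a) | a in setT].

Definition isotropy_group : set mx :=
  [set in_basis (Ad phi a) | a in [set a | sigma a = a]].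

Definition adg (X : 'cV[R[i]]_n) : mx := in_basis (ad phi X).

(* N = G/H, as the set of left cosets aH. *)
Definition symmetric_space : set (set mx) :=
  [set [set a *m b | b in isotropy_group] | a in adjoint_group].

(* The Cartan embedding aH |-> a a^*: the elements of H being unitary, a a^*
   does not depend on the element a of the coset x. *)
Definition cartan (x : set mx) : mx := xget 0 [set a *m a^t* | a in x].

(* The differential at o of the Cartan embedding,
   d/dt exp(t X) exp(t X)^* at t = 0. *)
Definition dcartan (X : 'cV[R[i]]_n) : mx := adg X + (adg X)^t*.

(* The tangent space of the Cartan image of N at p. *)
Definition tangentN (p : mx) : set mx :=
  [set V | exists a X, [/\ adjoint_group a, h X, p = a *m a^t*
                         & V = a *m dcartan ('i *: X) *m a^t*]].

(* [gN p V W] is the inner product of V, W in T_pN; in the Cartan embedding,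
   a in G acts on N by p |-> a p a^*. *)
Record invariant_metric (gN : mx -> mx -> mx -> R) : Prop := InvariantMetric {
  metric_base : forall X Y, h X -> h Y ->
    (gN 1%:M (dcartan ('i *: X)) (dcartan ('i *: Y)))%:C =
    killing phi ('i *: X) ('i *: Y);
  metric_invariant : forall a b, adjoint_group a -> adjoint_group b ->
    let p := b *m b^t* in
    forall V W, tangentN p V -> tangentN p W ->
    gN (a *m p *m a^t*) (a *m V *m a^t*) (a *m W *m a^t*) = gN p V W }.

End SymmetricSpace.

Section Surfaces.
Context {R : realType} {U : riemannSurface R}.

(* The value at (c, z, v, w) of a Riemannian metric on U is the inner product at
   the point of coordinate z in the chart c of the tangent vectors of
   coordinates v and w. *)
Definition surface_metric :=
  chart R 1 U -> 'cV[R[i]]_1 -> 'cV[R[i]]_1 -> 'cV[R[i]]_1 -> R.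

Definition same_metric (I J : surface_metric) : Prop :=
  forall c, atlas c -> forall z, cod c z -> forall v w, I c z v w = J c z v w.

(* I is a positive multiple of |dz|^2 at each point. *)
Definition conformal (I : surface_metric) : Prop :=
  forall c, atlas c -> forall z, cod c z ->
  exists2 l : R, 0 < l &
    forall v w, I c z v w = l * complex.Re ((v 0 0)^* * w 0 0).

(* The coordinate directions d/dx and d/dy, where z = x + iy. *)
Definition dirx : 'cV[R[i]]_1 := const_mx 1.
Definition diry : 'cV[R[i]]_1 := const_mx 'i.

Section Euclidean.
Context {n : nat}.

Definition dot (u v : 'cV[R]_n) : R := \sum_i u i 0 * v i 0.

Definition induced_Rn (f0 : U -> 'cV[R]_n) : surface_metric :=
  fun c z v w => let F y := f0 (param c y) in
    dot (rdiff v F z) (rdiff w F z).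

Definition conformal_immersion_Rn (f0 : U -> 'cV[R]_n) : Prop :=
  (forall c, atlas c -> smooth_on (cod c) (fun y => f0 (param c y))) /\
  conformal (induced_Rn f0).

(* Half the trace, with respect to the first fundamental form, of the second
   fundamental form, i.e. of the normal part of the second derivatives. *)
Definition mean_curvature_vector (F : 'cV[R[i]]_1 -> 'cV[R]_n)
    (z : 'cV[R[i]]_1) : 'cV[R]_n :=
  let dir (i : 'I_2) := if i == 0 then dirx else diry in
  let d i := rdiff (dir i) F z in
  let dd i j := rdiff (dir i) (rdiff (dir j) F) z in
  let ginv : 'M[R]_2 := invmx (\matrix_(i, j) dot (d i) (d j)) in
  let normal u := u - \sum_i \sum_j (ginv i j * dot u (d j)) *: d i in
  2^-1 *: \sum_i \sum_j ginv i j *: normal (dd i j).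

Definition minimal (f0 : U -> 'cV[R]_n) : Prop :=
  forall c, atlas c -> forall z, cod c z ->
    mean_curvature_vector (fun y => f0 (param c y)) z = 0.

(* Points of P(C^n) are lines with the origin removed. *)
Definition projective_point (L : set 'cV[R[i]]_n) : Prop :=
  exists2 X, X != 0 & L = [set k *: X | k in [set k | k != 0]].

Definition affine_dom (j : 'I_n) : set (set 'cV[R[i]]_n) :=
  [set L | exists2 X : 'cV[R[i]]_n, L X & X j 0 != 0].

(* The j-th affine chart of P(C^n), [X] |-> X / X_j. *)
Definition affine_coord (j : 'I_n) (L : set 'cV[R[i]]_n) : 'cV[R[i]]_n :=
  xget 0 [set (X j 0)^-1 *: X | X in L `&` [set X | X j 0 != 0]].

Definition holomorphic_to_projective (nu : U -> set 'cV[R[i]]_n) : Prop :=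
  (forall p, projective_point (nu p)) /\
  (forall c, atlas c -> forall z, cod c z ->
   forall j, affine_dom j (nu (param c z)) ->
     (\forall w \near z, affine_dom j (nu (param c w))) /\
     differentiable (fun w => affine_coord j (nu (param c w))) z).

End Euclidean.

Section IntoN.
Context {n : nat} (Gt : complexLieGroup R n) (phi : chart R n Gt).
Context (sigma : Gt -> Gt) (e : 'I_n -> 'cV[R[i]]_n).
Context (gN : 'M[R[i]]_n -> 'M[R[i]]_n -> 'M[R[i]]_n -> R).
Implicit Type f : U -> set 'M[R[i]]_n.

Definition induced_N f : surface_metric :=
  fun c z v w => let F y := cartan (f (param c y)) in
    gN (F z) (rdiff_mx v F z) (rdiff_mx w F z).

Definition conformal_immersion_N f : Prop :=
  [/\ forall p, symmetric_space phi sigma e (f p),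
      forall c, atlas c -> smooth_mx_on (cod c) (fun y => cartan (f (param c y)))
    & conformal (induced_N f)].

(* d/dz = (d/dx - i d/dy) / 2 *)
Definition dz (F : 'cV[R[i]]_1 -> 'M[R[i]]_n) (z : 'cV[R[i]]_1) : 'M[R[i]]_n :=
  2^-1 *: (rdiff_mx dirx F z - 'i *: rdiff_mx diry F z).

(* The line in g, identified with ad(g), spanned by f_z f^-1; all charts around
   p give the same line. *)
Definition right_gauss_map f (p : U) : set 'cV[R[i]]_n :=
  [set X | exists c k, [/\ atlas c, dom c p, k != 0 &
     let F y := cartan (f (param c y)) in
     let z := coord c p in adg phi e X = k *: (dz F z *m invmx (F z))]].

End IntoN.
End Surfaces.

(* Main.v *)
Require Import Defs.
From HB Require Import structures.
From mathcomp Require Import all_boot all_order all_algebra complex.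
From mathcomp Require Import all_classical all_reals all_analysis.
From mathcomp Require Import ring lra.

Set Implicit Arguments.
Unset Strict Implicit.
Unset Printing Implicit Defensive.

Import Order.TTheory GRing.Theory Num.Theory numFieldNormedType.Exports.

Local Open Scope classical_set_scope.
Local Open Scope complex_scope.
Local Open Scope sesquilinear_scope.
Local Open Scope ring_scope.
Local Notation coord := Defs.coord.

(** Both sides of the correspondence are encoded by a g-valued holomorphic 1-form.

    A conformal minimal immersion f0 is harmonic ([minimal_harmonic]), so that
    its complex gradient y = f0_y + i f0_x, for which df0(v) = Im (v y), is
    holomorphic ([harmonic_cgrad]). Reading y in the orthonormal basis e of the
    compact real form gives a form with values in g, and the linear equation
    F' = F ad(y) has a solution on the simply connected surface
    ([ode_surface], by local Picard iteration and monodromy). It stays in the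
    adjoint group G ([transport]): the transported bracket is constant, so F
    takes its values in the automorphism group of g, in which G is open
    ([adjoint_near1]) because derivations are inner ([deriv_inner]). The surface
    f is the coset of F. Since the elements of the isotropy group are unitary,
    its Cartan embedding is F F^*, whose derivative along v is
    F (2 i ad (Im (v y))) F^*: by invariance of the metric, f induces the metric
    of f0 ([frame_metric]), and f_z f^-1 = F ad(y) F^-1 = ad (F y) is
    holomorphic ([frame_dz]).

    Conversely let P be the Cartan embedding of f and write P_z P^-1 = ad(xi).
    The Gauss map is the line of xi; if it is holomorphic then dbar xi = mu xi
    for some function mu. As P is hermitian and second derivatives commute,
    mu P_z is hermitian, which for an immersion forces mu = 0
    ([gauss_holomorphic]); thus xi itself is holomorphic. Solving K' = - K ad(xi)
    makes K P K^* constant, whence P = F F^* with F' = F ad(y) and y holomorphic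
    ([holomorphic_frame]). The imaginary part of a primitive of y is the
    required minimal surface ([realize]).

    Complex analysis is developed from real Frechet derivatives [fd], in the
    norm [nm] given by the sum of the absolute values of real and imaginary
    parts; [mder F z A] says that F has the complex derivative A at z. *)

(** * Norms on complex matrices and real Frechet derivatives *)

Section Norms.
Context {R : realType}.
Local Notation C := R[i].

Definition nc (z : C) : R := `|complex.Re z| + `|complex.Im z|.

Lemma ReD (a b : C) : complex.Re (a + b) = complex.Re a + complex.Re b.
Proof. by case: a b => [a1 a2] [b1 b2]. Qed.
Lemma ImD (a b : C) : complex.Im (a + b) = complex.Im a + complex.Im b.
Proof. by case: a b => [a1 a2] [b1 b2]. Qed.
Lemma ReN (a : C) : complex.Re (- a) = - complex.Re a.
Proof. by case: a. Qed.
Lemma ImN (a : C) : complex.Im (- a) = - complex.Im a.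
Proof. by case: a. Qed.
Lemma ReM (a b : C) : complex.Re (a * b) =
  complex.Re a * complex.Re b - complex.Im a * complex.Im b.
Proof. by case: a b => [a1 a2] [b1 b2]. Qed.
Lemma ImM (a b : C) : complex.Im (a * b) =
  complex.Re a * complex.Im b + complex.Im a * complex.Re b.
Proof. by case: a b => [a1 a2] [b1 b2]. Qed.
Lemma ReC (a : C) : complex.Re (a^*) = complex.Re a.
Proof. by case: a. Qed.
Lemma ImC (a : C) : complex.Im (a^*) = - complex.Im a.
Proof. by case: a. Qed.
Lemma Re0 : complex.Re (0 : C) = 0. Proof. by []. Qed.
Lemma Im0 : complex.Im (0 : C) = 0. Proof. by []. Qed.
Lemma Re1 : complex.Re (1 : C) = 1. Proof. by []. Qed.
Lemma Im1 : complex.Im (1 : C) = 0. Proof. by []. Qed.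
Lemma Rei : complex.Re ('i : C) = 0. Proof. by []. Qed.
Lemma Imi : complex.Im ('i : C) = 1. Proof. by []. Qed.
Lemma Rer (x : R) : complex.Re (x%:C : C) = x. Proof. by []. Qed.
Lemma Imr (x : R) : complex.Im (x%:C : C) = 0. Proof. by []. Qed.
Definition reim := (ReD, ImD, ReN, ImN, ReM, ImM, ReC, ImC, Re0, Im0, Re1, Im1,
  Rei, Imi, Rer, Imr).

Lemma Re_sum I (r : seq I) P (F : I -> C) :
  complex.Re (\sum_(i <- r | P i) F i) = \sum_(i <- r | P i) complex.Re (F i).
Proof. by apply: (big_morph _ ReD). Qed.
Lemma Im_sum I (r : seq I) P (F : I -> C) :
  complex.Im (\sum_(i <- r | P i) F i) = \sum_(i <- r | P i) complex.Im (F i).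
Proof. by apply: (big_morph _ ImD). Qed.

Lemma cE (a b : C) : complex.Re a = complex.Re b ->
  complex.Im a = complex.Im b -> a = b.
Proof. by case: a b => [a1 a2] [b1 b2] /= -> ->. Qed.

Lemma creim (z : C) : z = (complex.Re z)%:C + 'i * (complex.Im z)%:C.
Proof. by apply: cE; rewrite !reim; lra. Qed.

Lemma nc_ge0 z : 0 <= nc z. Proof. by rewrite addr_ge0. Qed.
Lemma nc0 : nc 0 = 0. Proof. by rewrite /nc !reim normr0 addr0. Qed.
Lemma nc_eq0 z : nc z = 0 -> z = 0.
Proof.
move/eqP; rewrite paddr_eq0 // !normr_eq0 => /andP[/eqP ? /eqP ?].
by apply: cE.
Qed.
Lemma nc_gt0 z : z != 0 -> 0 < nc z.
Proof.
move=> z0; rewrite lt_neqAle nc_ge0 andbT; apply: contra z0 => /eqP.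
by move=> /esym/nc_eq0 ->.
Qed.
Lemma ncN z : nc (- z) = nc z. Proof. by rewrite /nc !reim !normrN. Qed.
Lemma nc_conj (z : C) : nc (z^*) = nc z. Proof. by rewrite /nc !reim !normrN. Qed.
Lemma ncD z w : nc (z + w) <= nc z + nc w.
Proof.
rewrite /nc !reim; have := ler_normD (complex.Re z) (complex.Re w).
have := ler_normD (complex.Im z) (complex.Im w); lra.
Qed.
Lemma ncB z w : nc (z - w) <= nc z + nc w.
Proof. by rewrite -(ncN w) ncD. Qed.
Lemma ncBC z w : nc (z - w) = nc (w - z).
Proof. by rewrite -ncN opprB. Qed.
Lemma ncM z w : nc (z * w) <= nc z * nc w.
Proof.
rewrite /nc !reim mulrDl !mulrDr -!normrM.
have := ler_normB (complex.Re z * complex.Re w) (complex.Im z * complex.Im w).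
have := ler_normD (complex.Re z * complex.Im w) (complex.Im z * complex.Re w).
lra.
Qed.
Lemma nc_r (x : R) : nc (x%:C) = `|x|. Proof. by rewrite /nc !reim normr0 addr0. Qed.
Lemma nc1 : nc 1 = 1. Proof. by rewrite /nc !reim normr0 addr0 normr1. Qed.
Lemma nci : nc 'i = 1. Proof. by rewrite /nc !reim normr0 add0r normr1. Qed.
Lemma ncrM (x : R) z : nc (x%:C * z) = `|x| * nc z.
Proof. by rewrite /nc !reim !mul0r subr0 addr0 !normrM mulrDr. Qed.
Lemma nciM z : nc ('i * z) = nc z.
Proof. by rewrite /nc !reim !mul0r !mul1r sub0r add0r normrN addrC. Qed.
Lemma nc_Re z : `|complex.Re z| <= nc z. Proof. by rewrite lerDl. Qed.
Lemma nc_Im z : `|complex.Im z| <= nc z. Proof. by rewrite lerDr. Qed.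
Lemma nc_sum I (r : seq I) P (F : I -> C) :
  nc (\sum_(i <- r | P i) F i) <= \sum_(i <- r | P i) nc (F i).
Proof.
elim/big_ind2: _ => [|x1 x2 y1 y2 h1 h2|//]; first by rewrite nc0.
by apply: le_trans (ncD _ _) _; rewrite lerD.
Qed.

Lemma nc_inv (z : C) : z != 0 -> nc z * nc z^-1 <= 2.
Proof.
move=> z0.
have d0 : 0 < complex.Re z ^+ 2 + complex.Im z ^+ 2.
  rewrite lt_neqAle addr_ge0 ?sqr_ge0// andbT eq_sym paddr_eq0 ?sqr_ge0//.
  apply: contra z0; rewrite !expf_eq0/= => /andP[/eqP a /eqP b].
  by apply/eqP/cE.
case: z z0 d0 => a b z0 /= d0; rewrite /nc /= normrN.
rewrite !normrM (ger0_norm (x := (_)^-1)); last by rewrite invr_ge0 ltW.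
rewrite -mulrDl mulrA -expr2 ler_pdivrMr//.
rewrite -(real_normK (num_real a)) -(real_normK (num_real b)).
have := sqr_ge0 (`|a| - `|b|); nra.
Qed.

Definition nm {p q} (A : 'M[C]_(p, q)) : R := \sum_i \sum_j nc (A i j).

Lemma nm_ge0 p q (A : 'M[C]_(p, q)) : 0 <= nm A.
Proof. by apply: sumr_ge0 => i _; apply: sumr_ge0 => j _; apply: nc_ge0. Qed.
Lemma nm0 p q : nm (0 : 'M[C]_(p, q)) = 0.
Proof. by apply: big1 => i _; apply: big1 => j _; rewrite mxE nc0. Qed.
Lemma nm_le p q (A : 'M[C]_(p, q)) i j : nc (A i j) <= nm A.
Proof.
rewrite /nm (bigD1 i)//= (bigD1 j)//= -addrA lerDl addr_ge0//.
  by apply: sumr_ge0 => ? _; apply: nc_ge0.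
by apply: sumr_ge0 => ? _; apply: sumr_ge0 => ? _; apply: nc_ge0.
Qed.
Lemma nm_eq0 p q (A : 'M[C]_(p, q)) : nm A = 0 -> A = 0.
Proof.
move=> A0; apply/matrixP => i j; rewrite mxE; apply: nc_eq0.
by apply/eqP; rewrite eq_le nc_ge0 -A0 nm_le.
Qed.
Lemma nm_gt0 p q (A : 'M[C]_(p, q)) : A != 0 -> 0 < nm A.
Proof.
move=> z0; rewrite lt_neqAle nm_ge0 andbT; apply: contra z0 => /eqP.
by move=> /esym/nm_eq0 ->.
Qed.
Lemma nmN p q (A : 'M[C]_(p, q)) : nm (- A) = nm A.
Proof. by apply: eq_bigr => i _; apply: eq_bigr => j _; rewrite mxE ncN. Qed.
Lemma nmD p q (A B : 'M[C]_(p, q)) : nm (A + B) <= nm A + nm B.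
Proof.
rewrite /nm -big_split; apply: ler_sum => i _; rewrite -big_split.
by apply: ler_sum => j _; rewrite mxE ncD.
Qed.
Lemma nmB p q (A B : 'M[C]_(p, q)) : nm (A - B) <= nm A + nm B.
Proof. by rewrite -(nmN B) nmD. Qed.
Lemma nmBC p q (A B : 'M[C]_(p, q)) : nm (A - B) = nm (B - A).
Proof. by rewrite -nmN opprB. Qed.
Lemma nmT p q (A : 'M[C]_(p, q)) : nm (A^T) = nm A.
Proof.
rewrite /nm exchange_big; apply: eq_bigr => i _.
by apply: eq_bigr => j _; rewrite mxE.
Qed.
Lemma nmZ p q z (A : 'M[C]_(p, q)) : nm (z *: A) <= nc z * nm A.
Proof.
rewrite /nm mulr_sumr; apply: ler_sum => i _; rewrite mulr_sumr.
by apply: ler_sum => j _; rewrite mxE ncM.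
Qed.
Lemma nmrZ p q (r : R) (A : 'M[C]_(p, q)) : nm (r%:C *: A) = `|r| * nm A.
Proof.
rewrite /nm mulr_sumr; apply: eq_bigr => i _; rewrite mulr_sumr.
by apply: eq_bigr => j _; rewrite mxE ncrM.
Qed.
Lemma nmM p q r (A : 'M[C]_(p, q)) (B : 'M[C]_(q, r)) : nm (A *m B) <= nm A * nm B.
Proof.
rewrite {2}/nm mulr_suml; apply: ler_sum => i _.
apply: (@le_trans _ _ (\sum_k \sum_j nc (A i j) * nc (B j k))).
  apply: ler_sum => k _; rewrite mxE; apply: le_trans (nc_sum _ _ _) _.
  by apply: ler_sum => j _; apply: ncM.
rewrite exchange_big /= mulr_suml; apply: ler_sum => j _.
rewrite -mulr_sumr ler_wpM2l ?nc_ge0//.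
rewrite /nm (bigD1 j)//= lerDl.
by apply: sumr_ge0 => ? _; apply: sumr_ge0 => ? _; apply: nc_ge0.
Qed.
Lemma nm11 (A : 'M[C]_1) : nm A = nc (A 0 0).
Proof. by rewrite /nm !big_ord1. Qed.
Lemma nm_const (z : C) : nm (const_mx z : 'cV[C]_1) = nc z.
Proof. by rewrite nm11 mxE. Qed.
Lemma nm_sum p q I (r : seq I) P (F : I -> 'M[C]_(p, q)) :
  nm (\sum_(i <- r | P i) F i) <= \sum_(i <- r | P i) nm (F i).
Proof.
elim/big_ind2: _ => [|x1 x2 y1 y2 h1 h2|//]; first by rewrite nm0.
by apply: le_trans (nmD _ _) _; rewrite lerD.
Qed.
Lemma nm_bound p q (A : 'M[C]_(p, q)) e : (forall i j, nc (A i j) <= e) ->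
  nm A <= (p * q)%:R * e.
Proof.
move=> h; apply: (@le_trans _ _ (\sum_(i < p) \sum_(j < q) e)).
  by apply: ler_sum => i _; apply: ler_sum => j _.
rewrite !sumr_const !card_ord -mulrnA mulr_natl mulnC//.
Qed.

End Norms.

Section FrechetDerivative.
Context {R : realType}.
Local Notation C := R[i].

Definition rlin {m} (l : 'cV[C]_m -> C) :=
  (forall v w, l (v + w) = l v + l w) /\
  (forall (r : R) v, l (r%:C *: v) = r%:C * l v).

Definition fd {m} (f : 'cV[C]_m -> C) x (l : 'cV[C]_m -> C) : Prop :=
  rlin l /\ forall e : R, 0 < e -> exists2 d : R, 0 < d &
    forall w, nm w < d -> nc (f (x + w) - f x - l w) <= e * nm w.

Lemma rlin0 m (l : 'cV[C]_m -> C) : rlin l -> l 0 = 0.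
Proof. by case=> _ h; rewrite -(scale0r 0) -[0 in LHS]/((0:R)%:C) h mul0r. Qed.
Lemma rlinN m (l : 'cV[C]_m -> C) v : rlin l -> l (- v) = - l v.
Proof.
by move=> [_ h]; have := h (-1) v; rewrite rmorphN1 scaleN1r mulN1r.
Qed.
Lemma rlinB m (l : 'cV[C]_m -> C) v w : rlin l -> l (v - w) = l v - l w.
Proof. by move=> h; rewrite h.1 rlinN. Qed.
Lemma rlin_sum m (l : 'cV[C]_m -> C) I (r : seq I) P (F : I -> _) : rlin l ->
  l (\sum_(i <- r | P i) F i) = \sum_(i <- r | P i) l (F i).
Proof. by move=> h; apply: (big_morph _ h.1 (rlin0 h)). Qed.

Lemma cV_reim m (v : 'cV[C]_m) : v = \sum_k ((complex.Re (v k 0))%:C *: delta_mx k 0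
  + (complex.Im (v k 0))%:C *: ('i *: delta_mx k 0)).
Proof.
rewrite {1}[v]matrix_sum_delta; apply: eq_bigr => k _.
by rewrite big_ord1 {1}(creim (v k 0)) scalerDl scalerA [_ * 'i]mulrC.
Qed.

Lemma rlinE m (l : 'cV[C]_m -> C) v : rlin l -> l v =
  \sum_k ((complex.Re (v k 0))%:C * l (delta_mx k 0)
         + (complex.Im (v k 0))%:C * l ('i *: delta_mx k 0)).
Proof.
move=> h; rewrite {1}(cV_reim v) rlin_sum//; apply: eq_bigr => k _.
by rewrite h.1 !h.2.
Qed.

Lemma rlin_bounded m (l : 'cV[C]_m -> C) : rlin l ->
  exists2 K : R, 0 < K & forall v, nc (l v) <= K * nm v.
Proof.
move=> h; pose K := \sum_k (nc (l (delta_mx k 0)) + nc (l ('i *: delta_mx k 0))).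
have K0 : 0 <= K by apply: sumr_ge0 => k _; rewrite addr_ge0 ?nc_ge0.
exists (K + 1) => [|v]; first lra.
rewrite (rlinE _ h); apply: le_trans (nc_sum _ _ _) _.
apply: (@le_trans _ _ (K * nm v)); last by rewrite ler_wpM2r ?nm_ge0//; lra.
rewrite /K mulr_suml; apply: ler_sum => k _.
apply: le_trans (ncD _ _) _; rewrite !ncrM mulrDl lerD//.
  rewrite mulrC ler_wpM2l ?nc_ge0//; apply: le_trans (nm_le v k 0).
  exact: nc_Re.
rewrite mulrC ler_wpM2l ?nc_ge0//; apply: le_trans (nm_le v k 0).
exact: nc_Im.
Qed.

Lemma fd_ext m (f g : 'cV[C]_m -> C) x l l' d : 0 < d ->
  (forall w, nm w < d -> g (x + w) = f (x + w)) -> l' =1 l -> fd f x l -> fd g x l'.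
Proof.
move=> d0 fg ll [[l1 l2] h]; split; first by split=> *; rewrite !ll ?l1 ?l2.
move=> e /h[d' d'0 h']; exists (Num.min d d') => [|w]; first by rewrite lt_min d0.
rewrite lt_min => /andP[wd wd']; rewrite fg// ll.
by have := fg 0; rewrite nm0 !addr0 => ->//; apply: h'.
Qed.

Lemma fd_eq m (f g : 'cV[C]_m -> C) x l l' : g =1 f -> l' =1 l -> fd f x l -> fd g x l'.
Proof. by move=> fg ll; apply: (@fd_ext _ _ _ _ _ _ 1). Qed.

Lemma fd_unique m (f : 'cV[C]_m -> C) x l l' : fd f x l -> fd f x l' -> l =1 l'.
Proof.
move=> [r h] [r' h'] v; apply/eqP; rewrite -subr_eq0; apply/negP => /negP z0.
have v0 : 0 < nm v.
  apply: nm_gt0; apply: contra_neq z0 => ->.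
  by rewrite !rlin0// subrr.
pose e := nc (l v - l' v) / (4 * nm v).
have e0 : 0 < e by rewrite divr_gt0 ?nc_gt0// mulr_gt0.
have [d d0 hd] := h _ e0; have [d' d'0 hd'] := h' _ e0.
pose t := Num.min d d' / (2 * nm v).
have t0 : 0 < t by rewrite divr_gt0 ?mulr_gt0 ?lt_min ?d0.
have nt : nm (t%:C *: v) = Num.min d d' / 2.
  by rewrite nmrZ gtr0_norm// /t; field; lra.
have dd0 : 0 < Num.min d d' by rewrite lt_min d0.
have lt1 : nm (t%:C *: v) < Num.min d d' by rewrite nt; lra.
move: lt1; rewrite lt_min => /andP[/hd A /hd' B].
have : nc (l' (t%:C *: v) - l (t%:C *: v)) <= 2 * (e * nm (t%:C *: v)).
  have -> : l' (t%:C *: v) - l (t%:C *: v) = (f (x + t%:C *: v) - f x - l (t%:C *: v))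
     - (f (x + t%:C *: v) - f x - l' (t%:C *: v)) by ring.
  by apply: le_trans (ncB _ _) _; lra.
rewrite r.2 r'.2 -mulrBr ncrM nmrZ gtr0_norm// ncBC.
rewrite /e; have -> : 2 * (nc (l v - l' v) / (4 * nm v) * (t * nm v)) = 
   t * nc (l v - l' v) / 2 by field; lra.
have := nc_gt0 z0; nra.
Qed.

Lemma fd_cst m (c : C) x : fd (fun _ : 'cV[C]_m => c) x (fun=> 0).
Proof.
split; first by split=> *; rewrite ?addr0 ?mulr0.
move=> e e0; exists 1 => // w _; rewrite !subrr nc0 mulr_ge0 ?nm_ge0//; exact: ltW.
Qed.

Lemma fd_coord m (i : 'I_m) (j : 'I_1) (x : 'cV[C]_m) : fd (fun v => v i j) x (fun v => v i j).
Proof.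
split; first by split=> *; rewrite !mxE.
move=> e e0; exists 1 => // w _; rewrite mxE.
have -> : x i j + w i j - x i j - w i j = 0 by ring.
by rewrite nc0 mulr_ge0 ?nm_ge0//; exact: ltW.
Qed.

Lemma fd_add m (f g : 'cV[C]_m -> C) x l k : fd f x l -> fd g x k ->
  fd (fun v => f v + g v) x (fun v => l v + k v).
Proof.
move=> [[r1 r2] h] [[s1 s2] h']; split.
  by split=> *; rewrite ?r1 ?r2 ?s1 ?s2; ring.
move=> e e0; have e2 : 0 < e / 2 by lra.
have [d d0 hd] := h _ e2; have [d' d'0 hd'] := h' _ e2.
exists (Num.min d d') => [|w]; first by rewrite lt_min d0.
rewrite lt_min => /andP[/hd A /hd' B].
have -> : f (x + w) + g (x + w) - (f x + g x) - (l w + k w) =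
  (f (x + w) - f x - l w) + (g (x + w) - g x - k w) by ring.
by apply: le_trans (ncD _ _) _; lra.
Qed.

Lemma fd_cont m (f : 'cV[C]_m -> C) x l : fd f x l -> forall e : R, 0 < e ->
  exists2 d : R, 0 < d & forall w, nm w < d -> nc (f (x + w) - f x) < e.
Proof.
move=> [r h] e e0; have [K K0 hK] := rlin_bounded r.
have [d d0 hd] := h 1 ltr01.
pose d' := Num.min d (e / (2 * (K + 1))).
have d'0 : 0 < d' by rewrite lt_min d0 divr_gt0//; lra.
exists d' => // w; rewrite lt_min => /andP[/hd A B].
have -> : f (x + w) - f x = (f (x + w) - f x - l w) + l w by ring.
apply: le_lt_trans (ncD _ _) _; have := hK w => C.
have : nm w * (K + 1) < e / 2.
  move: B; rewrite ltr_pdivlMr; last lra.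
  lra.
lra.
Qed.

Lemma fd_mul m (f g : 'cV[C]_m -> C) x l k : fd f x l -> fd g x k ->
  fd (fun v => f v * g v) x (fun v => l v * g x + f x * k v).
Proof.
move=> hf hg; have [r h] := hf; have [s h'] := hg.
split; first by case: r s => [r1 r2] [s1 s2]; split=> *; rewrite ?r1 ?r2 ?s1 ?s2; ring.
move=> e e0; have [K K0 hK] := rlin_bounded r.
pose a := nc (f x) + nc (g x) + 3 + K.
have a0 : 0 < a by rewrite /a; have := nc_ge0 (f x); have := nc_ge0 (g x); lra.
pose e' := Num.min 1 (e / (3 * a)).
have e'0 : 0 < e' by rewrite lt_min ltr01 divr_gt0//; lra.
have [d d0 hd] := h _ e'0; have [d' d'0 hd'] := h' _ e'0.
have [d2 d20 hd2] := fd_cont hg e'0.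
exists (Num.min d (Num.min d' d2)) => [|w]; first by rewrite !lt_min d0 d'0.
rewrite !lt_min => /and3P[/hd A /hd' B /hd2 D].
have -> : f (x + w) * g (x + w) - f x * g x - (l w * g x + f x * k w) =
  (f (x + w) - f x - l w) * g (x + w) + l w * (g (x + w) - g x)
  + f x * (g (x + w) - g x - k w) by ring.
have gw : nc (g (x + w)) <= nc (g x) + 1.
  have -> : g (x + w) = g x + (g (x + w) - g x) by ring.
  apply: le_trans (ncD _ _) _; rewrite lerD2l; apply: le_trans (ltW D) _.
  by rewrite ge_min lexx.
have e'1 : e' * (3 * a) <= e.
  by rewrite -ler_pdivlMr ?mulr_gt0// ge_min lexx orbT.
have w0 := nm_ge0 w.
have T1 : nc ((f (x + w) - f x - l w) * g (x + w)) <= e' * nm w * a.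
  apply: le_trans (ncM _ _) _; apply: ler_pM; rewrite ?nc_ge0//.
  by apply: le_trans gw _; rewrite /a; have := nc_ge0 (f x); lra.
have T2 : nc (l w * (g (x + w) - g x)) <= e' * nm w * a.
  apply: le_trans (ncM _ _) _; rewrite [e' * _]mulrC -mulrA [e' * a]mulrC.
  rewrite mulrA [nm w * a]mulrC; apply: ler_pM; rewrite ?nc_ge0 ?(ltW D)//.
  apply: le_trans (hK w) _; rewrite ler_wpM2r// /a.
  by have := nc_ge0 (f x); have := nc_ge0 (g x); lra.
have T3 : nc (f x * (g (x + w) - g x - k w)) <= e' * nm w * a.
  apply: le_trans (ncM _ _) _; rewrite mulrC; apply: ler_pM; rewrite ?nc_ge0//.
  by rewrite /a; have := nc_ge0 (g x); lra.
apply: le_trans (ncD _ _) _; apply: (@le_trans _ _ (3 * (e' * nm w * a))).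
  have := ncD ((f (x + w) - f x - l w) * g (x + w)) (l w * (g (x + w) - g x)).
  lra.
have -> : 3 * (e' * nm w * a) = e' * (3 * a) * nm w by ring.
exact: ler_wpM2r.
Qed.

Lemma fd_sum m I (r : seq I) (P : pred I) (F : I -> 'cV[C]_m -> C) x L :
  (forall i, P i -> fd (F i) x (L i)) ->
  fd (fun v => \sum_(i <- r | P i) F i v) x (fun v => \sum_(i <- r | P i) L i v).
Proof.
move=> h; elim: r => [|i r IH].
  by apply: fd_eq (fd_cst 0 x) => v; rewrite big_nil.
case Pi : (P i); last by apply: fd_eq IH => v; rewrite big_cons Pi.
by apply: fd_eq (fd_add (h _ Pi) IH) => v; rewrite big_cons Pi.
Qed.

Lemma fd_conj m (f : 'cV[C]_m -> C) x l : fd f x l ->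
  fd (fun v => (f v)^*) x (fun v => (l v)^*).
Proof.
move=> [[r1 r2] h]; split.
  split=> [v w|a v]; first by rewrite r1 rmorphD.
  rewrite r2 rmorphM; congr (_ * _); apply: cE; rewrite !reim //; lra.
move=> e /h[d d0 hd]; exists d => // w /hd.
by rewrite -!rmorphB nc_conj.
Qed.

Definition fdm {m p q} (F : 'cV[C]_m -> 'M[C]_(p, q)) x (L : 'cV[C]_m -> 'M[C]_(p, q)) :=
  forall i j, fd (fun v => F v i j) x (fun v => L v i j).

Lemma fdm_small m p q (F : 'cV[C]_m -> 'M[C]_(p, q)) x L : fdm F x L ->
  forall e : R, 0 < e -> exists2 d : R, 0 < d &
    forall w, nm w < d -> nm (F (x + w) - F x - L w) <= e * nm w.
Proof.
move=> h e e0; pose s : R := (p * q)%:R + 1.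
have s0 : 0 < s by rewrite /s ltr_wpDl.
have es : 0 < e / s by rewrite divr_gt0.
have : forall ij : 'I_p * 'I_q, exists d : R, 0 < d /\ forall w, nm w < d ->
    nc (F (x + w) ij.1 ij.2 - F x ij.1 ij.2 - L w ij.1 ij.2) <= e / s * nm w.
  by move=> [i j]; have [d ? ?] := (h i j).2 _ es; exists d.
move=> /choice[D hD]; exists (\big[Num.min/1]_ij D ij).
  by apply: lt_bigmin => // ij _; case: (hD ij).
move=> w wd; apply: (@le_trans _ _ ((p * q)%:R * (e / s * nm w))).
  apply: nm_bound => i j; have [_ /(_ w)] := hD (i, j).
  rewrite !mxE => /=; apply; apply: lt_le_trans wd _.
  exact: bigmin_le_cond.
rewrite mulrA ler_wpM2r ?nm_ge0// mulrCA ler_piMr ?(ltW e0)// ler_pdivrMr// mul1r.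
by rewrite /s lerDl.
Qed.

Lemma fdm_cont m p q (F : 'cV[C]_m -> 'M[C]_(p, q)) x L : fdm F x L ->
  forall e : R, 0 < e -> exists2 d : R, 0 < d &
    forall w, nm w < d -> nm (F (x + w) - F x) < e.
Proof.
move=> h e e0; pose s : R := (p * q)%:R + 1.
have s0 : 0 < s by rewrite /s ltr_wpDl.
have es : 0 < e / s by rewrite divr_gt0.
have : forall ij : 'I_p * 'I_q, exists d : R, 0 < d /\ forall w, nm w < d ->
    nc (F (x + w) ij.1 ij.2 - F x ij.1 ij.2) < e / s.
  by move=> [i j]; have [d ? ?] := fd_cont (h i j) es; exists d.
move=> /choice[D hD]; exists (\big[Num.min/1]_ij D ij).
  by apply: lt_bigmin => // ij _; case: (hD ij).
move=> w wd; apply: (@le_lt_trans _ _ ((p * q)%:R * (e / s))).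
  apply: nm_bound => i j; have [_ /(_ w)] := hD (i, j).
  rewrite !mxE => /= H; apply/ltW/H; apply: lt_le_trans wd _.
  exact: bigmin_le_cond.
by rewrite mulrCA gtr_pMr// ltr_pdivrMr// mul1r /s ltrDl.
Qed.

Lemma fd_comp m p (f : 'cV[C]_p -> C) (g : 'cV[C]_m -> 'cV[C]_p) x l L :
  fd f (g x) l -> fdm g x L -> fd (f \o g) x (l \o L).
Proof.
move=> [r h] hg; split.
  split=> [v w|a v] /=.
    rewrite -r.1; congr l; apply/matrixP => i j; rewrite mxE.
    by have [[-> _] _] := hg i j.
  rewrite -r.2; congr l; apply/matrixP => i j; rewrite mxE.
  by have [[_ ->] _] := hg i j.
have [K0 K00 hK] := rlin_bounded r.
have [M M0 hM] : exists2 M : R, 0 < M & forall w, nm (L w) <= M * nm w.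
  have : forall i : 'I_p, exists M : R, 0 < M /\ forall w, nc (L w i 0) <= M * nm w.
    by move=> i; have [M ? ?] := rlin_bounded (hg i 0).1; exists M.
  move=> /choice[M hM]; exists (\sum_i M i + 1).
    rewrite ltr_wpDl//; apply: sumr_ge0 => i _; apply: ltW; exact: (hM i).1.
  move=> w; rewrite /nm; under eq_bigr do rewrite big_ord1.
  rewrite mulrDl mul1r; apply: (@le_trans _ _ ((\sum_i M i) * nm w)).
    by rewrite mulr_suml; apply: ler_sum => i _; apply: (hM i).2.
  by rewrite lerDl nm_ge0.
move=> e e0; pose e1 := e / (2 * (M + 1)).
have e10 : 0 < e1 by rewrite divr_gt0//; lra.
have [d d0 hd] := h _ e10.
pose e2 := Num.min 1 (e / (2 * K0)).
have e20 : 0 < e2 by rewrite lt_min ltr01 divr_gt0//; lra.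
have [d2 d20 hd2] := fdm_small hg e20.
have [d3 d30 hd3] := fdm_cont hg d0.
exists (Num.min d2 d3) => [|w]; first by rewrite lt_min d20.
rewrite lt_min => /andP[/hd2 A /hd3 B] /=.
have gE : g (x + w) = g x + (g (x + w) - g x) by rewrite [RHS]addrC subrK.
have := hd _ B; rewrite -gE => A1.
have -> : f (g (x + w)) - f (g x) - l (L w) = (f (g (x + w)) - f (g x) - l (g (x + w) - g x))
   + l (g (x + w) - g x - L w) by rewrite (rlinB _ (L w) r); ring.
apply: le_trans (ncD _ _) _.
have w0 := nm_ge0 w.
have A2 : nm (g (x + w) - g x) <= (M + 1) * nm w.
  rewrite -(subrK (L w) (g (x + w) - g x)); apply: le_trans (nmD _ _) _.
  have := hM w; have : e2 * nm w <= 1 * nm w by rewrite ler_wpM2r// ge_min lexx.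
  by move: A; lra.
have A3 : e1 * nm (g (x + w) - g x) <= e / 2 * nm w.
  apply: (@le_trans _ _ (e1 * ((M + 1) * nm w))); first by rewrite ler_wpM2l// ltW.
  rewrite mulrA ler_wpM2r// /e1 le_eqVlt; apply/orP; left; apply/eqP; field; lra.
have A4 : nc (l (g (x + w) - g x - L w)) <= e / 2 * nm w.
  apply: le_trans (hK _) _; apply: (@le_trans _ _ (K0 * (e2 * nm w))).
    by rewrite ler_wpM2l// ltW.
  rewrite mulrA ler_wpM2r//; have : e2 <= e / (2 * K0) by rewrite ge_min lexx orbT.
  rewrite ler_pdivlMr; lra.
lra.
Qed.

Lemma fdm_ext m p q (F G : 'cV[C]_m -> 'M[C]_(p, q)) x L L' d : 0 < d ->
  (forall w, nm w < d -> G (x + w) = F (x + w)) -> L' =1 L -> fdm F x L -> fdm G x L'.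
Proof.
move=> d0 h k hF i j; apply: fd_ext d0 _ _ (hF i j) => [w wd|w]; first by rewrite h.
by rewrite k.
Qed.

Lemma fdm_eq m p q (F G : 'cV[C]_m -> 'M[C]_(p, q)) x L L' :
  G =1 F -> L' =1 L -> fdm F x L -> fdm G x L'.
Proof. by move=> h k; apply: (@fdm_ext _ _ _ _ _ _ _ _ 1). Qed.

Lemma fdm_unique m p q (F : 'cV[C]_m -> 'M[C]_(p, q)) x L L' :
  fdm F x L -> fdm F x L' -> L =1 L'.
Proof. by move=> h h' v; apply/matrixP => i j; apply: (fd_unique (h i j) (h' i j)). Qed.

Lemma fdm_cst m p q (A : 'M[C]_(p, q)) x : fdm (fun _ : 'cV[C]_m => A) x (fun=> 0).
Proof. by move=> i j; apply: fd_eq (fd_cst (A i j) x) => // v; rewrite mxE. Qed.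

Lemma fdm_id m (x : 'cV[C]_m) : fdm id x id.
Proof. by move=> i j; apply: fd_coord. Qed.

Lemma fdm_add m p q (F G : 'cV[C]_m -> 'M[C]_(p, q)) x L K : fdm F x L -> fdm G x K ->
  fdm (fun v => F v + G v) x (fun v => L v + K v).
Proof. by move=> h k i j; apply: fd_eq (fd_add (h i j) (k i j)) => v; rewrite mxE. Qed.

Lemma fdm_mul m p q r (F : 'cV[C]_m -> 'M[C]_(p, q)) (G : 'cV[C]_m -> 'M[C]_(q, r)) x L K :
  fdm F x L -> fdm G x K ->
  fdm (fun v => F v *m G v) x (fun v => L v *m G x + F x *m K v).
Proof.
move=> h k i j.
apply: fd_eq (@fd_sum _ _ (index_enum 'I_q) xpredT _ x _ (fun s _ => fd_mul (h i s) (k s j))).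
  by move=> v; rewrite mxE.
by move=> v; rewrite !mxE big_split.
Qed.

Lemma fdm_tr m p q (F : 'cV[C]_m -> 'M[C]_(p, q)) x L : fdm F x L ->
  fdm (fun v => (F v)^T) x (fun v => (L v)^T).
Proof. by move=> h i j; apply: fd_eq (h j i) => v; rewrite mxE. Qed.

Lemma fdm_adj m p q (F : 'cV[C]_m -> 'M[C]_(p, q)) x L : fdm F x L ->
  fdm (fun v => (F v)^t* ) x (fun v => (L v)^t* ).
Proof. by move=> h i j; apply: fd_eq (fd_conj (h j i)) => v; rewrite !mxE. Qed.

Lemma fdm_mull m p q r (A : 'M[C]_(r, p)) (F : 'cV[C]_m -> 'M[C]_(p, q)) x L :
  fdm F x L -> fdm (fun v => A *m F v) x (fun v => A *m L v).
Proof.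
by move=> h; apply: fdm_eq (fdm_mul (fdm_cst A x) h) => v //; rewrite mul0mx add0r.
Qed.

Lemma fdm_mulr m p q r (A : 'M[C]_(q, r)) (F : 'cV[C]_m -> 'M[C]_(p, q)) x L :
  fdm F x L -> fdm (fun v => F v *m A) x (fun v => L v *m A).
Proof.
by move=> h; apply: fdm_eq (fdm_mul h (fdm_cst A x)) => v //; rewrite mulmx0 addr0.
Qed.

Lemma fd_scale m (c : C) (f : 'cV[C]_m -> C) x l :
  fd f x l -> fd (fun v => c * f v) x (fun v => c * l v).
Proof.
by move=> h; apply: fd_eq (fd_mul (fd_cst c x) h) => v //; rewrite mul0r add0r.
Qed.

Lemma fd_opp m (f : 'cV[C]_m -> C) x l :
  fd f x l -> fd (fun v => - f v) x (fun v => - l v).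
Proof. by move=> h; apply: fd_eq (fd_scale (-1) h) => v; rewrite mulN1r. Qed.

Lemma fdm_scale m p q (c : C) (F : 'cV[C]_m -> 'M[C]_(p, q)) x L :
  fdm F x L -> fdm (fun v => c *: F v) x (fun v => c *: L v).
Proof. by move=> h i j; apply: fd_eq (fd_scale c (h i j)) => v; rewrite mxE. Qed.

Lemma fdm_opp m p q (F : 'cV[C]_m -> 'M[C]_(p, q)) x L :
  fdm F x L -> fdm (fun v => - F v) x (fun v => - L v).
Proof. by move=> h i j; apply: fd_eq (fd_opp (h i j)) => v; rewrite mxE. Qed.

Lemma fdm_comp m p q r (F : 'cV[C]_p -> 'M[C]_(q, r)) (g : 'cV[C]_m -> 'cV[C]_p) x L M :
  fdm F (g x) L -> fdm g x M -> fdm (F \o g) x (L \o M).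
Proof. by move=> h k i j; apply: (fd_comp (h i j) k). Qed.

Lemma fdm_rlin m p q (F : 'cV[C]_m -> 'M[C]_(p, q)) x L : fdm F x L ->
  (forall v w, L (v + w) = L v + L w) /\ (forall (r : R) v, L (r%:C *: v) = r%:C *: L v).
Proof.
by move=> h; split=> *; apply/matrixP => i j; rewrite mxE;
  have [[a b] _] := h i j; rewrite ?a ?b.
Qed.

Lemma fd_inv m (f : 'cV[C]_m -> C) x l : f x != 0 -> fd f x l ->
  fd (fun v => (f v)^-1) x (fun v => - l v / (f x) ^+ 2).
Proof.
move=> fx0 h; have [r hd] := h.
split; first by case: r => r1 r2; split=> *; rewrite ?r1 ?r2; ring.
move=> e e0; have [K K0 hK] := rlin_bounded r.
pose a := nc (f x)^-1; pose b := nc (f x).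
have b0 : 0 < b by apply: nc_gt0.
have a0 : 0 < a by apply: nc_gt0; rewrite invr_eq0.
(* on this neighbourhood the inverse stays bounded by 4/b *)
have [d1 d10 h1] := fd_cont h (divr_gt0 b0 (ltr0n _ 2)).
have [d2 d20 h2] := hd (e / (2 * a ^+ 2)) ltac:(by rewrite divr_gt0// mulr_gt0// exprn_gt0).
pose k := e / (2 * (4 / b * a ^+ 2 * (K + 1))).
have c0 : 0 < 4 / b * a ^+ 2 * (K + 1) by rewrite !mulr_gt0// ?exprn_gt0// ?invr_gt0//; lra.
have k0 : 0 < k by rewrite divr_gt0// mulr_gt0.
have [d3 d30 h3] := fd_cont h k0.
have [d4 d40 h4] := hd 1 ltr01.
exists (Num.min (Num.min d1 d4) (Num.min d2 d3)) => [|w].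
  by rewrite !lt_min d10 d20 d30 d40.
rewrite !lt_min => /andP[/andP[/h1 A1 /h4 A4] /andP[/h2 A2 /h3 A3]].
have bfw : b / 2 <= nc (f (x + w)).
  have : b <= nc (f (x + w)) + nc (f (x + w) - f x).
    rewrite /b {1}(_ : f x = f (x + w) - (f (x + w) - f x)); last by ring.
    exact: ncB.
  lra.
have fw0 : f (x + w) != 0.
  by apply/eqP => E; move: bfw; rewrite E nc0; lra.
have bi : nc (f (x + w))^-1 <= 4 / b.
  have := nc_inv fw0; have := nc_ge0 (f (x + w))^-1.
  by rewrite ler_pdivlMr//; nra.
have dw : nc (f (x + w) - f x) <= (K + 1) * nm w.
  rewrite -(subrK (l w) (f (x + w) - f x)); apply: le_trans (ncD _ _) _.
  by have := hK w; lra.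
have -> : (f (x + w))^-1 - (f x)^-1 - - l w / f x ^+ 2 =
  ((f x)^-1 * (f x)^-1) * ((f (x + w))^-1 * ((f (x + w) - f x) * (f (x + w) - f x))
  - (f (x + w) - f x - l w)).
  by field; rewrite fx0 fw0.
apply: le_trans (ncM _ _) _.
have w0 := nm_ge0 w.
apply: (@le_trans _ _ (a ^+ 2 * (4 / b * (k * ((K + 1) * nm w)) + e / (2 * a ^+ 2) * nm w))).
  apply: ler_pM; rewrite ?nc_ge0//; first by rewrite expr2; exact: ncM.
  apply: le_trans (ncB _ _) _; rewrite lerD//.
  apply: le_trans (ncM _ _) _; apply: ler_pM; rewrite ?nc_ge0//.
  apply: le_trans (ncM _ _) _; apply: ler_pM; rewrite ?nc_ge0// ltW//.
rewrite /k le_eqVlt; apply/orP; left; apply/eqP; field.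
by rewrite !gt_eqF//; lra.
Qed.
End FrechetDerivative.

(** * Covering arguments and derivatives of functions of one real variable *)

Section Cousin.
Context {R : realType}.

Lemma half_power_small (x e : R) : 0 < e -> exists n : nat, x / 2 ^+ n < e.
Proof.
move=> e0; pose y := `|x| + 1; have y0 : 0 < y by rewrite /y ltr_wpDl.
have ey : 0 < e / y by rewrite divr_gt0.
have [n _ /(_ n (leqnn n)) h] := near_infty_natSinv_expn_lt (PosNum ey).
exists n; move: h => /=; rewrite ltr_pdivlMr// mul1r; apply: le_lt_trans.
rewrite [leRHS]mulrC ler_wpM2r ?invr_ge0 ?exprn_ge0//.
by rewrite /y; have := ler_norm x; lra.
Qed.

Definition rect := (R * R * (R * R))%type.

Lemma nested_intervals (a b : nat -> R) : (forall n, a n <= a n.+1) ->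
  (forall n, b n.+1 <= b n) -> (forall n, a n <= b n) ->
  exists x, forall n, a n <= x <= b n.
Proof.
move=> ha hb hab.
have am m n : (m <= n)%N -> a m <= a n.
  by move=> /subnK <-; elim: (n - m)%N => // k /le_trans; apply; rewrite addSn.
have bm m n : (m <= n)%N -> b n <= b m.
  move=> /subnK <-; elim: (n - m)%N => // k IH; apply: le_trans IH.
  by rewrite addSn.
have ab m n : a m <= b n.
  apply: (le_trans (am _ (maxn m n) _)); first exact: leq_maxl.
  by apply: (le_trans (hab _)); apply: bm; exact: leq_maxr.
have hs : has_sup (range a).
  split; first by exists (a 0%N), 0%N.
  by exists (b 0%N) => _ [m _ <-].
exists (sup (range a)) => n; apply/andP; split.
  by apply: sup_upper_bound => //; exists n.
by apply: ge_sup; [exists (a 0%N), 0%N | move=> _ [m _ <-]].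
Qed.

Lemma cousin2 (P : R -> R -> R -> R -> Prop) (a b c d : R) : a <= b -> c <= d ->
  (forall a b c d, a <= b -> c <= d ->
     P a ((a + b) / 2) c ((c + d) / 2) -> P ((a + b) / 2) b c ((c + d) / 2) ->
     P a ((a + b) / 2) ((c + d) / 2) d -> P ((a + b) / 2) b ((c + d) / 2) d ->
     P a b c d) ->
  (forall x y, a <= x <= b -> c <= y <= d -> exists2 e : R, 0 < e &
     forall a' b' c' d', a <= a' -> a' <= x <= b' -> b' <= b ->
       c <= c' -> c' <= y <= d' -> d' <= d -> b' - a' < e -> d' - c' < e ->
       P a' b' c' d') ->
  P a b c d.
Proof.
move=> ab cd hsplit hloc; apply: contrapT => nP.
pose bad (q : rect) := [/\ q.1.1 <= q.1.2, q.2.1 <= q.2.2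
  & ~ P q.1.1 q.1.2 q.2.1 q.2.2].
pose sub (q r : rect) := [/\ q.1.1 <= r.1.1, r.1.2 <= q.1.2, q.2.1 <= r.2.1
  & r.2.2 <= q.2.2] /\ r.1.2 - r.1.1 = (q.1.2 - q.1.1) / 2 /\
  r.2.2 - r.2.1 = (q.2.2 - q.2.1) / 2.
have step : forall q, exists r, bad q -> bad r /\ sub q r.
  move=> [[p1 p2] [p3 p4]].
  have [[/= h1 h2 h3]|nb] := pselect (bad (p1, p2, (p3, p4))); last first.
    by exists (p1, p2, (p3, p4)).
  apply: contrapT => nex; apply: h3.
  apply: hsplit => //; apply: contrapT => nP'; apply: nex.
  - exists (p1, (p1 + p2) / 2, (p3, (p3 + p4) / 2)) => _.
    by do !split => //=; lra.
  - exists ((p1 + p2) / 2, p2, (p3, (p3 + p4) / 2)) => _.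
    by do !split => //=; lra.
  - exists (p1, (p1 + p2) / 2, ((p3 + p4) / 2, p4)) => _.
    by do !split => //=; lra.
  exists ((p1 + p2) / 2, p2, ((p3 + p4) / 2, p4)) => _.
  by do !split => //=; lra.
have /choice[next hnext] := step.
pose q n := iter n next (a, b, (c, d)).
have qbad n : bad (q n).
  by elim: n => [|n IH]; [split | apply: (hnext _ IH).1].
have qsub n : sub (q n) (q n.+1) by apply: (hnext _ (qbad n)).2.
have [x hx] := @nested_intervals (fun n => (q n).1.1) (fun n => (q n).1.2)
  (fun n => let: conj (And4 h _ _ _) _ := qsub n in h)
  (fun n => let: conj (And4 _ h _ _) _ := qsub n in h)
  (fun n => let: And3 h _ _ := qbad n in h).
have [y hy] := @nested_intervals (fun n => (q n).2.1) (fun n => (q n).2.2)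
  (fun n => let: conj (And4 _ _ h _) _ := qsub n in h)
  (fun n => let: conj (And4 _ _ _ h) _ := qsub n in h)
  (fun n => let: And3 _ h _ := qbad n in h).
have [e e0 he] := hloc x y (hx 0%N) (hy 0%N).
have w n : (q n).1.2 - (q n).1.1 = (b - a) / 2 ^+ n /\
           (q n).2.2 - (q n).2.1 = (d - c) / 2 ^+ n.
  elim: n => [|n [IH1 IH2]]; first by rewrite expr0 !divr1.
  have [_ [-> ->]] := qsub n; rewrite IH1 IH2 exprS invfM.
  by split; rewrite -mulrA [_^-1 * 2^-1]mulrC.
have inn n : [/\ a <= (q n).1.1, (q n).1.2 <= b, c <= (q n).2.1 & (q n).2.2 <= d].
  elim: n => [|n [IH1 IH2 IH3 IH4]]; first by split.
  have [[s1 s2 s3 s4] _] := qsub n.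
  by split; [apply: le_trans s1|apply: le_trans IH2|apply: le_trans s3|apply: le_trans IH4].
have [n hn] := half_power_small (Num.max (b - a) (d - c)) e0.
have [_ _ +] := qbad n; apply; have [i1 i2 i3 i4] := inn n; have [w1 w2] := w n.
apply: he => //; rewrite ?w1 ?w2; apply: le_lt_trans hn;
  by rewrite ler_wpM2r ?invr_ge0 ?exprn_ge0// le_max lexx ?orbT.
Qed.

Lemma cousin1 (P : R -> R -> Prop) (a b : R) : a <= b ->
  (forall a b, a <= b -> P a ((a + b) / 2) -> P ((a + b) / 2) b -> P a b) ->
  (forall x, a <= x <= b -> exists2 e : R, 0 < e &
     forall a' b', a <= a' -> a' <= x <= b' -> b' <= b -> b' - a' < e -> P a' b') ->
  P a b.
Proof.
move=> ab hs hl; apply: (@cousin2 (fun a b _ _ => P a b) a b 0 0) => //.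
  by move=> a' b' _ _ ab' _ h1 h2 _ _; apply: hs.
by move=> x y /hl[e e0 he] _; exists e => // *; apply: he.
Qed.

End Cousin.

Section RealDerivative.
Context {R : realType} {V : normedModType R}.

Definition rder (f : R -> V) (t : R) (l : V) := forall e : R, 0 < e ->
  exists2 d : R, 0 < d & forall s : R, `|s - t| < d ->
    `|f s - f t - (s - t) *: l| <= e * `|s - t|.

Lemma rderP (f : R -> V) t l : rder f t l <-> is_derive t 1 f l.
Proof.
split=> [h|h].
  have c : h^-1 *: ((f \o shift t) (h *: (1 : R)) - f t) @[h --> 0^'] --> l.
    apply/cvgrPdist_le => e e0; have [d d0 hd] := h e e0.
    near=> u; have u0 : u != 0 by near: u; exact: nbhs_dnbhs_neq.
    have ud : `|u| < d by near: u; apply: dnbhs0_lt.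
    have := hd (u + t); rewrite addrK => /(_ ud).
    rewrite /= [u *: 1]mulr1 => H.
    rewrite -(ler_pM2l (x := `|u|)) ?normr_gt0// [leRHS]mulrC -normrZ scalerBr.
    by rewrite scalerA divff// scale1r -normrN opprB.
  by apply: DeriveDef; [apply/cvg_ex; exists l | apply/cvg_lim].
move=> e e0; have [/derivable_nbhs _ <-] := h.
have : h^-1 *: ((f \o shift t) (h *: (1 : R)) - f t) @[h --> 0^'] --> 'D_1 f t.
  by case: h.
move=> /cvgrPdist_le /(_ _ e0); rewrite near_withinE.
move=> /nbhs_ballP[d /= d0 hd]; exists d => // s sd.
have [->|st] := eqVneq s t; first by rewrite !subrr scale0r subr0 !normr0 mulr0.
have u0 : s - t != 0 by rewrite subr_eq0.
have := hd (s - t); rewrite /ball /= sub0r normrN => /(_ sd u0).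
rewrite [(s - t) *: 1]mulr1 subrK.
rewrite -(ler_pM2l (x := `|s - t|)) ?normr_gt0// [leRHS]mulrC -normrZ scalerBr.
by rewrite scalerA divff// scale1r -normrN opprB.
Unshelve. all: by end_near. Qed.

End RealDerivative.

Section Primitives.
Context {R : realType}.
Local Notation C := R[i].
Implicit Types (a b t s lo hi : R) (K k : R -> C).

Definition prim lo hi K k := forall t, lo <= t <= hi -> forall e : R, 0 < e ->
  exists2 d : R, 0 < d & forall s, lo <= s <= hi -> `|s - t| < d ->
    nc (K s - K t - (s - t)%:C * k t) <= e * `|s - t|.

Lemma prim_sub lo hi lo' hi' K k : lo <= lo' -> hi' <= hi ->
  prim lo hi K k -> prim lo' hi' K k.
Proof.
move=> h1 h2 h t /andP[t1 t2] e e0.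
have [|d d0 hd] := h t _ e e0; first by apply/andP; split; lra.
by exists d => // s /andP[s1 s2]; apply: hd; apply/andP; split; lra.
Qed.

Lemma prim_growth lo hi K k (phi : C -> R) M : lo <= hi ->
  (forall z w, phi (z + w) <= phi z + phi w) -> (forall z, phi z <= nc z) ->
  (forall t (r : R), 0 <= r -> lo <= t <= hi -> phi (r%:C * k t) <= r * M) ->
  (forall z, phi (- z) <= nc z) ->
  prim lo hi K k -> phi (K hi - K lo) <= M * (hi - lo).
Proof.
move=> lh pD pn pk pN h; apply/ler_addgt0Pr => e' e'0.
pose e := e' / (2 * (hi - lo + 1)).
have e0 : 0 < e by rewrite divr_gt0//; lra.
apply: (@le_trans _ _ ((M + 2 * e) * (hi - lo))); last first.
  have eE : e * (2 * (hi - lo + 1)) = e' by rewrite /e; field; lra.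
  by clearbody e; nra.
apply: (@cousin1 _ (fun a b => phi (K b - K a) <= (M + 2 * e) * (b - a))) => //.
  move=> a b ab h1 h2.
  have -> : K b - K a = (K b - K ((a + b) / 2)) + (K ((a + b) / 2) - K a) by ring.
  by apply: le_trans (pD _ _) _; nra.
move=> x hx; have [d d0 hd] := h x hx e e0; exists d => // a b a0 /andP[ax xb] b0 ba.
have [/andP[lx xh]] := hx.
have := hd a; have := hd b.
have -> : `|b - x| = b - x by rewrite ger0_norm// subr_ge0.
have -> : `|a - x| = x - a by rewrite ler0_norm ?opprB// subr_le0.
move=> B A.
have {}B : nc (K b - K x - (b - x)%:C * k x) <= e * (b - x).
  by apply: B; [apply/andP; split|]; lra.
have {}A : nc (K a - K x - (a - x)%:C * k x) <= e * (x - a).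
  by apply: A; [apply/andP; split|]; lra.
have -> : K b - K a = ((K b - K x - (b - x)%:C * k x) +
   - (K a - K x - (a - x)%:C * k x)) + (b - a)%:C * k x.
  by rewrite !rmorphB /=; ring.
apply: le_trans (pD _ _) _.
have := pk x (b - a) ltac:(lra) hx.
have := pD (K b - K x - (b - x)%:C * k x) (- (K a - K x - (a - x)%:C * k x)).
have := pn (K b - K x - (b - x)%:C * k x).
have := pN (K a - K x - (a - x)%:C * k x).
nra.
Qed.

Lemma prim_bound lo hi K k M : lo <= hi -> prim lo hi K k ->
  (forall t, lo <= t <= hi -> nc (k t) <= M) -> nc (K hi - K lo) <= M * (hi - lo).
Proof.
move=> lh h kM; apply: (@prim_growth _ _ _ k nc M) => // [z w|t r r0 ht|z].
- exact: ncD.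
- by rewrite ncrM ger0_norm// ler_wpM2l// kM.
by rewrite ncN.
Qed.

Lemma prim_lin lo hi K K' k k' (c : C) : prim lo hi K k -> prim lo hi K' k' ->
  prim lo hi (fun t => K t - c * K' t) (fun t => k t - c * k' t).
Proof.
move=> h h' t ht e e0.
pose e1 := e / (2 * (nc c + 1)); have c0 := nc_ge0 c.
have e10 : 0 < e1 by rewrite divr_gt0//; lra.
have [d d0 hd] := h t ht (e / 2) ltac:(lra); have [d' d'0 hd'] := h' t ht e1 e10.
exists (Num.min d d') => [|s hs]; first by rewrite lt_min d0.
rewrite lt_min => /andP[/(hd _ hs) A /(hd' _ hs) B].
have -> : K s - c * K' s - (K t - c * K' t) - (s - t)%:C * (k t - c * k' t) =
  (K s - K t - (s - t)%:C * k t) - c * (K' s - K' t - (s - t)%:C * k' t) by ring.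
apply: le_trans (ncB _ _) _.
have := ncM c (K' s - K' t - (s - t)%:C * k' t) => D.
have E : nc c * nc (K' s - K' t - (s - t)%:C * k' t) <= e / 2 * `|s - t|.
  apply: (@le_trans _ _ ((nc c + 1) * (e1 * `|s - t|))).
    by apply: ler_pM; rewrite ?nc_ge0//; lra.
  by rewrite mulrA ler_wpM2r// le_eqVlt /e1; apply/orP; left; apply/eqP; field; lra.
lra.
Qed.

Lemma prim_inj lo hi K K' k a b : prim lo hi K k -> prim lo hi K' k ->
  lo <= a <= hi -> lo <= b <= hi -> K b - K a = K' b - K' a.
Proof.
move=> h h'.
have key x y : lo <= x <= hi -> lo <= y <= hi -> x <= y -> K y - K x = K' y - K' x.
  move=> /andP[x1 x2] /andP[y1 y2] xy.
  have P := prim_sub x1 y2 (prim_lin 1 h h').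
  apply/eqP; rewrite -subr_eq0; apply/eqP.
  have -> : K y - K x - (K' y - K' x) = K y - 1 * K' y - (K x - 1 * K' x) by ring.
  apply: nc_eq0; apply/eqP; rewrite eq_le nc_ge0 andbT.
  have := prim_bound xy P (M := 0); rewrite mul0r; apply => t _.
  by rewrite mul1r subrr nc0.
move=> ha hb; have [ab|/ltW ba] := leP a b; first exact: key.
by rewrite -opprB (key b a)// opprB.
Qed.

Definition rcont lo hi k := forall t, lo <= t <= hi -> forall e : R, 0 < e ->
  exists2 d : R, 0 < d & forall s, lo <= s <= hi -> `|s - t| < d -> nc (k s - k t) <= e.

Lemma prim_ex_real lo hi (u : R -> R) : lo <= hi ->
  (forall t, lo <= t <= hi -> forall e : R, 0 < e ->
  exists2 d : R, 0 < d & forall s, lo <= s <= hi -> `|s - t| < d -> `|u s - u t| <= e) ->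
  exists U : R -> R, forall t, lo <= t <= hi -> forall e : R, 0 < e ->
  exists2 d : R, 0 < d & forall s, lo <= s <= hi -> `|s - t| < d ->
    `|U s - U t - (s - t) * u t| <= e * `|s - t|.
Proof.
move=> lh hu; pose cl t := Num.max lo (Num.min t hi).
have cl1 t : lo <= cl t <= hi by rewrite /cl le_max lexx ge_max lh ge_min lexx orbT.
have cl2 t : lo <= t <= hi -> cl t = t.
  by move=> /andP[? ?]; rewrite /cl min_l// max_r.
have cl3 s t : `|cl s - cl t| <= `|s - t|.
  rewrite /cl; have := ler_norm (s - t).
  have := ler_norm (- (s - t)); rewrite normrN => ? ?.
  have clE x : [\/ cl x = lo /\ x <= lo, cl x = x /\ (lo <= x <= hi) | cl x = hi /\ hi <= x].
    have [xl|/ltW lx] := leP x lo.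
      by constructor 1; rewrite /cl min_l ?max_l//; apply: le_trans lh.
    have [xh|/ltW hx] := leP x hi; first by constructor 2; rewrite ?cl2 ?lx ?xh.
    by constructor 3; rewrite /cl min_r// max_r.
  have [[a1 a2]|[a1 /andP[a2 a3]]|[a1 a2]] := clE s;
  have [[b1 b2]|[b1 /andP[b2 b3]]|[b1 b2]] := clE t;
  rewrite -/(cl s) -/(cl t) a1 b1 ler_norml; apply/andP; split; lra.
pose v t := u (cl t).
have vc : continuous v.
  move=> t; apply/cvgrPdist_le => e e0.
  have [d d0 hd] := hu _ (cl1 t) e e0.
  near=> s; rewrite distrC; apply: hd => //; apply: le_lt_trans (cl3 _ _) _.
  by rewrite distrC; near: s; apply: cvgr_dist_lt.
pose mu := @lebesgue_measure R.
have iv : mu.-integrable `[lo - 1, hi + 1] (EFin \o v).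
  apply: continuous_compact_integrable; first exact: segment_compact.
  exact: continuous_subspaceT.
exists (fun x => (\int[mu]_(t in [set` `[lo - 1, x]]) (v t))%R) => t ht e e0.
have [dU U't] := @continuous_FTC1_closed R v (lo - 1) t (hi + 1) ltac:(lra) iv ltac:(lra) (vc t).
have /rderP : is_derive t 1 (fun x => (\int[mu]_(t in [set` `[lo - 1, x]]) (v t))%R) (u t).
  by apply: DeriveDef => //; rewrite -derive1E U't /v cl2.
by move=> /(_ e e0)[d d0 hd]; exists d => // s _; apply: hd.
Unshelve. all: by end_near. Qed.

End Primitives.

(** * Integrals and Goursat's theorem *)

Section Goursat.
Context {R : realType}.
Local Notation C := R[i].
Implicit Types (a b c d t s lo hi x y : R) (K k : R -> C) (f : C -> C).

Lemma prim_ex lo hi k : lo <= hi -> rcont lo hi k -> exists K, prim lo hi K k.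
Proof.
move=> lh h.
have [|U hU] := @prim_ex_real _ lo hi (fun t => complex.Re (k t)) lh.
  move=> t ht e e0; have [d d0 hd] := h t ht e e0; exists d => // s hs /(hd _ hs).
  by apply: le_trans; rewrite -ReN -ReD nc_Re.
have [|V hV] := @prim_ex_real _ lo hi (fun t => complex.Im (k t)) lh.
  move=> t ht e e0; have [d d0 hd] := h t ht e e0; exists d => // s hs /(hd _ hs).
  by apply: le_trans; rewrite -ImN -ImD nc_Im.
exists (fun t => Complex (U t) (V t)) => t ht e e0.
have [d d0 hd] := hU t ht (e / 2) ltac:(lra).
have [d' d'0 hd'] := hV t ht (e / 2) ltac:(lra).
exists (Num.min d d') => [|s hs]; first by rewrite lt_min d0.
rewrite lt_min => /andP[/(hd _ hs) A /(hd' _ hs) B].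
by rewrite /nc !reim /= !mul0r subr0 addr0; lra.
Qed.

(** Stated as an opaque existence so that conversion never unfolds the
    integral. *)
Lemma integral_ex : {I : R -> R -> (R -> C) -> C | forall lo hi K k a b,
  prim lo hi K k -> lo <= a <= hi -> lo <= b <= hi -> I a b k = K b - K a}.
Proof.
exists (fun a b k =>
  xget 0 [set I | exists K, prim (Num.min a b) (Num.max a b) K k /\ I = K b - K a]).
move=> lo hi K k a b h /andP[a1 a2] /andP[b1 b2].
have h' : prim (Num.min a b) (Num.max a b) K k.
  by apply: prim_sub h; rewrite ?le_min ?ge_max ?a1 ?a2.
case: xgetP => [I _ [K' [hK' ->]]|/(_ (K b - K a))[]]; last by exists K.
by apply: (prim_inj hK' h'); rewrite ge_min le_max lexx ?orbT.
Qed.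

Definition J : R -> R -> (R -> C) -> C := sval integral_ex.

Lemma J_prim lo hi K k a b : prim lo hi K k -> lo <= a <= hi -> lo <= b <= hi ->
  J a b k = K b - K a.
Proof. exact: (svalP integral_ex). Qed.

Lemma J_add lo hi k a b c : rcont lo hi k -> lo <= a <= hi -> lo <= b <= hi ->
  lo <= c <= hi -> J a c k = J a b k + J b c k.
Proof.
move=> h ha hb hc; have lh : lo <= hi by move: ha => /andP[]; apply: le_trans.
have [K hK] := prim_ex lh h.
by rewrite !(J_prim hK)//; ring.
Qed.

Lemma J_lin lo hi k k' (z : C) a b : rcont lo hi k -> rcont lo hi k' ->
  lo <= a <= hi -> lo <= b <= hi ->
  J a b (fun t => k t - z * k' t) = J a b k - z * J a b k'.
Proof.
move=> h h' ha hb; have lh : lo <= hi by move: ha => /andP[]; apply: le_trans.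
have [K hK] := prim_ex lh h; have [K' hK'] := prim_ex lh h'.
by rewrite (J_prim (prim_lin z hK hK'))// (J_prim hK)// (J_prim hK')//; ring.
Qed.

Lemma J_swap lo hi k a b : rcont lo hi k -> lo <= a <= hi -> lo <= b <= hi ->
  J a b k = - J b a k.
Proof.
move=> h ha hb; have lh : lo <= hi by move: ha => /andP[]; apply: le_trans.
by have [K hK] := prim_ex lh h; rewrite !(J_prim hK)//; ring.
Qed.

Lemma J_bound lo hi k a b M : rcont lo hi k -> lo <= a <= hi -> lo <= b <= hi ->
  (forall t, Num.min a b <= t <= Num.max a b -> nc (k t) <= M) ->
  nc (J a b k) <= M * `|b - a|.
Proof.
move=> h ha hb; wlog ab : a b ha hb / a <= b => [H|].
  case/orP: (le_total a b) => [|ba]; first exact: H.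
  rewrite (J_swap h)// ncN distrC => hM. by apply: H => // t; rewrite minC maxC; apply: hM.
have lh : lo <= hi by move: ha => /andP[]; apply: le_trans.
have [K hK] := prim_ex lh h; rewrite (J_prim hK)//.
rewrite min_l// max_r// ger0_norm ?subr_ge0//; apply: prim_bound => //.
by move: ha hb => /andP[? ?] /andP[? ?]; apply: prim_sub hK.
Qed.

Definition cder f (z l : C) := forall e : R, 0 < e -> exists2 d : R, 0 < d &
  forall h : C, nc h < d -> nc (f (z + h) - f z - l * h) <= e * nc h.

Lemma cder_cont f z l : cder f z l -> forall e : R, 0 < e -> exists2 d : R, 0 < d &
  forall h : C, nc h < d -> nc (f (z + h) - f z) <= e.
Proof.
move=> h e e0; have [d d0 hd] := h 1 ltr01; have l0 := nc_ge0 l.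
exists (Num.min d (e / (nc l + 1))) => [|w].
  by rewrite lt_min d0 divr_gt0//; lra.
rewrite lt_min => /andP[/hd A]; rewrite ltr_pdivlMr; last lra.
have -> : f (z + w) - f z = (f (z + w) - f z - l * w) + l * w by ring.
have := ncM l w; have := ncD (f (z + w) - f z - l * w) (l * w).
have := nc_ge0 w; nra.
Qed.

Lemma cder_rcontH f lo hi y :
  (forall x, lo <= x <= hi -> exists l, cder f (Complex x y) l) ->
  rcont lo hi (fun x => f (Complex x y)).
Proof.
move=> h t /h[l hl] e e0; have [d d0 hd] := cder_cont hl e0.
exists d => // s _ sd; have -> : Complex s y = Complex t y + (s - t)%:C.
  by apply: cE; rewrite !reim /=; lra.
by apply: hd; rewrite nc_r.
Qed.

Lemma cder_rcontV f lo hi x :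
  (forall y, lo <= y <= hi -> exists l, cder f (Complex x y) l) ->
  rcont lo hi (fun y => f (Complex x y)).
Proof.
move=> h t /h[l hl] e e0; have [d d0 hd] := cder_cont hl e0.
exists d => // s _ sd; have -> : Complex x s = Complex x t + 'i * (s - t)%:C.
  by apply: cE; rewrite !reim /=; lra.
by apply: hd; rewrite nciM nc_r.
Qed.

Lemma cder_primH (Phi f : C -> C) lo hi y :
  (forall x, lo <= x <= hi -> cder Phi (Complex x y) (f (Complex x y))) ->
  prim lo hi (fun x => Phi (Complex x y)) (fun x => f (Complex x y)).
Proof.
move=> h t /h hl e e0; have [d d0 hd] := hl e e0.
exists d => // s _ sd; have -> : Complex s y = Complex t y + (s - t)%:C.
  by apply: cE; rewrite !reim /=; lra.
rewrite [_ * f _]mulrC -nc_r. by have := hd (s - t)%:C; rewrite nc_r => /(_ sd).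
Qed.

Lemma cder_primV (Phi f : C -> C) lo hi x :
  (forall y, lo <= y <= hi -> cder Phi (Complex x y) (f (Complex x y))) ->
  prim lo hi (fun y => - 'i * Phi (Complex x y)) (fun y => f (Complex x y)).
Proof.
move=> h t /h hl e e0; have [d d0 hd] := hl e e0.
exists d => // s _ sd; have -> : Complex x s = Complex x t + 'i * (s - t)%:C.
  by apply: cE; rewrite !reim /=; lra.
have i2 : ('i : C) * 'i = -1 by apply: cE; rewrite !reim; lra.
set h' := 'i * _; set z := Complex x t.
have -> : - 'i * Phi (z + h') - - 'i * Phi z - (s - t)%:C * f z =
  - ('i * (Phi (z + h') - Phi z - f z * h')).
  rewrite /h' mulrBr.
  have -> : 'i * (f z * ('i * (s - t)%:C)) = ('i * 'i) * ((s - t)%:C * f z) by ring.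
  by rewrite i2; ring.
by rewrite ncN nciM; have := hd h'; rewrite nciM nc_r => /(_ sd).
Qed.

Definition RI f a b c d : C :=
  J a b (fun x => f (Complex x c)) + 'i * J c d (fun y => f (Complex b y))
  - J a b (fun x => f (Complex x d)) - 'i * J c d (fun y => f (Complex a y)).

Definition hol_on f a b c d := forall x y, a <= x <= b -> c <= y <= d ->
  exists l, cder f (Complex x y) l.

Lemma hol_rcontH f a b c d y : hol_on f a b c d -> c <= y <= d ->
  rcont a b (fun x => f (Complex x y)).
Proof. by move=> h hy; apply: cder_rcontH => x hx; apply: h. Qed.
Lemma hol_rcontV f a b c d x : hol_on f a b c d -> a <= x <= b ->
  rcont c d (fun y => f (Complex x y)).
Proof. by move=> h hx; apply: cder_rcontV => y hy; apply: h. Qed.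
Lemma hol_on_sub f a b c d a' b' c' d' : hol_on f a b c d -> a <= a' -> b' <= b ->
  c <= c' -> d' <= d -> hol_on f a' b' c' d'.
Proof.
move=> h h1 h2 h3 h4 x y /andP[x1 x2] /andP[y1 y2].
by apply: h; apply/andP; split; lra.
Qed.

Lemma RI_splitH f a m b c d :
  rcont a b (fun x => f (Complex x c)) -> rcont a b (fun x => f (Complex x d)) ->
  a <= m <= b -> RI f a b c d = RI f a m c d + RI f m b c d.
Proof.
move=> h1 h2 hm; have /andP[am mb] := hm; have ab := le_trans am mb.
have ha : a <= a <= b by rewrite lexx.
have hb : a <= b <= b by rewrite lexx ab.
by rewrite /RI (J_add h1 ha hm hb) (J_add h2 ha hm hb); ring.
Qed.

Lemma RI_splitV f a b c m d :
  rcont c d (fun y => f (Complex a y)) -> rcont c d (fun y => f (Complex b y)) ->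
  c <= m <= d -> RI f a b c d = RI f a b c m + RI f a b m d.
Proof.
move=> h1 h2 hm; have /andP[am mb] := hm; have ab := le_trans am mb.
have ha : c <= c <= d by rewrite lexx.
have hb : c <= d <= d by rewrite lexx ab.
by rewrite /RI (J_add h1 ha hm hb) (J_add h2 ha hm hb); ring.
Qed.

Lemma RI_exact (Phi f : C -> C) a b c d : a <= b -> c <= d ->
  (forall x y, a <= x <= b -> c <= y <= d -> cder Phi (Complex x y) (f (Complex x y))) ->
  RI f a b c d = 0.
Proof.
move=> ab cd h; rewrite /RI.
have H y : c <= y <= d -> prim a b (fun x => Phi (Complex x y)) (fun x => f (Complex x y)).
  by move=> hy; apply: cder_primH => x hx; apply: h.
have V x : a <= x <= b -> prim c d (fun y => - 'i * Phi (Complex x y)) (fun y => f (Complex x y)).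
  by move=> hy; apply: cder_primV => y hx; apply: h.
have ha : a <= a <= b by rewrite lexx.
have hb : a <= b <= b by rewrite lexx ab.
have hc : c <= c <= d by rewrite lexx.
have hd : c <= d <= d by rewrite lexx cd.
rewrite (J_prim (H c hc) ha hb) (J_prim (H d hd) ha hb).
rewrite (J_prim (V a ha) hc hd) (J_prim (V b hb) hc hd).
have i2 : ('i : C) * 'i = -1 by apply: cE; rewrite !reim; lra.
have E u v : 'i * (- 'i * u - - 'i * v) = u - v :> C.
  have -> : 'i * (- 'i * u - - 'i * v) = ('i * 'i) * (v - u) by ring.
  by rewrite i2; ring.
by rewrite !E; ring.
Qed.

Lemma RI_lin f g (z : C) a b c d : a <= b -> c <= d ->
  rcont a b (fun x => f (Complex x c)) -> rcont a b (fun x => f (Complex x d)) ->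
  rcont c d (fun y => f (Complex a y)) -> rcont c d (fun y => f (Complex b y)) ->
  rcont a b (fun x => g (Complex x c)) -> rcont a b (fun x => g (Complex x d)) ->
  rcont c d (fun y => g (Complex a y)) -> rcont c d (fun y => g (Complex b y)) ->
  RI (fun w => f w - z * g w) a b c d = RI f a b c d - z * RI g a b c d.
Proof.
move=> ab cd f1 f2 f3 f4 g1 g2 g3 g4; rewrite /RI.
have ha : a <= a <= b by rewrite lexx.
have hb : a <= b <= b by rewrite lexx ab.
have hc : c <= c <= d by rewrite lexx.
have hd : c <= d <= d by rewrite lexx cd.
rewrite (J_lin z f1 g1 ha hb) (J_lin z f2 g2 ha hb).
rewrite (J_lin z f3 g3 hc hd) (J_lin z f4 g4 hc hd).
by ring.
Qed.

Lemma RI_bound f a b c d M : a <= b -> c <= d ->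
  rcont a b (fun x => f (Complex x c)) -> rcont a b (fun x => f (Complex x d)) ->
  rcont c d (fun y => f (Complex a y)) -> rcont c d (fun y => f (Complex b y)) ->
  (forall x, a <= x <= b -> nc (f (Complex x c)) <= M /\ nc (f (Complex x d)) <= M) ->
  (forall y, c <= y <= d -> nc (f (Complex a y)) <= M /\ nc (f (Complex b y)) <= M) ->
  nc (RI f a b c d) <= 2 * M * ((b - a) + (d - c)).
Proof.
move=> ab cd f1 f2 f3 f4 hH hV; rewrite /RI.
apply: le_trans (ncB _ _) _; rewrite nciM.
set A := J _ _ _; set B := J _ _ _; set D := J _ _ _; set E := J _ _ _.
have := ncB (A + 'i * B) D; have := ncD A ('i * B); rewrite nciM.
have hA : nc A <= M * (b - a).
  rewrite -[b - a]ger0_norm ?subr_ge0//; apply: (J_bound f1); rewrite ?lexx ?ab//.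
  by move=> t; rewrite min_l// max_r// => /hH[].
have hB : nc B <= M * (d - c).
  rewrite -[d - c]ger0_norm ?subr_ge0//; apply: (J_bound f4); rewrite ?lexx ?cd//.
  by move=> t; rewrite min_l// max_r// => /hV[].
have hD : nc D <= M * (b - a).
  rewrite -[b - a]ger0_norm ?subr_ge0//; apply: (J_bound f2); rewrite ?lexx ?ab//.
  by move=> t; rewrite min_l// max_r// => /hH[].
have hE : nc E <= M * (d - c).
  rewrite -[d - c]ger0_norm ?subr_ge0//; apply: (J_bound f3); rewrite ?lexx ?cd//.
  by move=> t; rewrite min_l// max_r// => /hV[].
lra.
Qed.

Lemma cder_affine (z0 c0 l z : C) :
  cder (fun z => c0 * z + l * (z - z0) ^+ 2 / 2) z (c0 + l * (z - z0)).
Proof.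
move=> e e0; have l0 := nc_ge0 (l / 2).
exists (e / (nc (l / 2) + 1)); first by rewrite divr_gt0//; lra.
move=> h; rewrite ltr_pdivlMr; last lra.
move=> hd; have -> : c0 * (z + h) + l * (z + h - z0) ^+ 2 / 2
    - (c0 * z + l * (z - z0) ^+ 2 / 2) - (c0 + l * (z - z0)) * h = (l / 2 * h) * h.
  by field.
apply: le_trans (ncM _ _) _; rewrite ler_wpM2r ?nc_ge0//.
apply: le_trans (ncM _ _) _; have := nc_ge0 h; nra.
Qed.

Theorem goursat f a b c d : a <= b -> c <= d -> hol_on f a b c d -> RI f a b c d = 0.
Proof.
move=> ab cd hf; apply: nc_eq0; apply/eqP; rewrite eq_le nc_ge0 andbT.
apply/ler_addgt0Pr => e' e'0; rewrite add0r.
pose p := (b - a) + (d - c); pose e := e' / (2 * (p ^+ 2 + 1)).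
have p0 : 0 < p ^+ 2 + 1 by rewrite ltr_wpDl ?sqr_ge0.
have e0 : 0 < e by rewrite divr_gt0// mulr_gt0.
apply: (@le_trans _ _ (2 * e * p ^+ 2)); last first.
  have : e * (2 * (p ^+ 2 + 1)) = e' by rewrite /e; field; lra.
  by clearbody e; nra.
suff : a <= a -> b <= b -> c <= c -> d <= d ->
  nc (RI f a b c d) <= 2 * e * ((b - a) + (d - c)) ^+ 2 by apply.
apply: (@cousin2 _ (fun a' b' c' d' => a <= a' -> b' <= b -> c <= c' -> d' <= d ->
  nc (RI f a' b' c' d') <= 2 * e * ((b' - a') + (d' - c')) ^+ 2)) => //.
  move=> p1 p2 p3 p4 p12 p34 h1 h2 h3 h4 q1 q2 q3 q4.
  have hs := hol_on_sub hf q1 q2 q3 q4.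
  rewrite (@RI_splitH _ p1 ((p1 + p2) / 2)); last 3 first.
  - by apply: hol_rcontH hs _; rewrite lexx.
  - by apply: hol_rcontH hs _; rewrite lexx p34.
  - by apply/andP; split; lra.
  rewrite (@RI_splitV _ p1 _ p3 ((p3 + p4) / 2)); last 3 first.
  - by apply: hol_rcontV hs _; rewrite lexx.
  - by apply: hol_rcontV hs _; apply/andP; split; lra.
  - by apply/andP; split; lra.
  rewrite (@RI_splitV _ _ p2 p3 ((p3 + p4) / 2)); last 3 first.
  - by apply: hol_rcontV hs _; apply/andP; split; lra.
  - by apply: hol_rcontV hs _; rewrite lexx p12.
  - by apply/andP; split; lra.
  have {}h1 := h1 ltac:(lra) ltac:(lra) ltac:(lra) ltac:(lra).
  have {}h2 := h2 ltac:(lra) ltac:(lra) ltac:(lra) ltac:(lra).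
  have {}h3 := h3 ltac:(lra) ltac:(lra) ltac:(lra) ltac:(lra).
  have {}h4 := h4 ltac:(lra) ltac:(lra) ltac:(lra) ltac:(lra).
  move: h1 h2 h3 h4; set A := RI _ _ _ _ _; set B := RI _ _ _ _ _.
  set D := RI _ _ _ _ _; set E := RI _ _ _ _ _ => h1 h2 h3 h4.
  apply: le_trans (ncD _ _) _; have := ncD A D; have := ncD B E.
  nra.
move=> x y hx hy; have [l hl] := hf x y hx hy; have [δ δ0 hδ] := hl e e0.
exists (δ / 2); first lra.
move=> p1 p2 p3 p4 q1 /andP[x1 x2] q2 q3 /andP[y1 y2] q4 w1 w2 _ _ _ _.
have p12 : p1 <= p2 by lra. have p34 : p3 <= p4 by lra.
have hs := hol_on_sub hf q1 q2 q3 q4.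
set z0 := Complex x y; pose g z := f z0 + l * (z - z0).
have hg : hol_on g p1 p2 p3 p4.
  move=> s t _ _; exists l => e1 e10; exists 1 => // h _.
  have -> : g (Complex s t + h) - g (Complex s t) - l * h = 0 by rewrite /g; ring.
  by rewrite nc0 mulr_ge0 ?nc_ge0// ltW.
have -> : RI f p1 p2 p3 p4 = RI (fun w => f w - 1 * g w) p1 p2 p3 p4.
  rewrite RI_lin//; try by [apply: hol_rcontH hs _; rewrite ?lexx ?p34|
    apply: hol_rcontH hg _; rewrite ?lexx ?p34|apply: hol_rcontV hs _; rewrite ?lexx ?p12|
    apply: hol_rcontV hg _; rewrite ?lexx ?p12].
  rewrite (@RI_exact (fun z => f z0 * z + l * (z - z0) ^+ 2 / 2) g) ?mulr0 ?subr0//.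
  by move=> *; apply: cder_affine.
have hr : hol_on (fun w => f w - 1 * g w) p1 p2 p3 p4.
  move=> s t hs' ht; have [m hm] := hs s t hs' ht; exists (m - l) => e1 e10.
  have [d' d'0 hd'] := hm e1 e10; exists d' => // h /hd'.
  set z := Complex s t.
  by have -> : f (z + h) - 1 * g (z + h) - (f z - 1 * g z) - (m - l) * h =
    f (z + h) - f z - m * h by rewrite /g; ring.
have key s t : p1 <= s <= p2 -> p3 <= t <= p4 ->
    nc (f (Complex s t) - 1 * g (Complex s t)) <= e * ((p2 - p1) + (p4 - p3)).
  move=> /andP[s1 s2] /andP[t1 t2].
  pose h := Complex (s - x) (t - y).
  have -> : Complex s t = z0 + h by apply: cE; rewrite /= addrC subrK.
  have nh : nc h <= (p2 - p1) + (p4 - p3).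
    by rewrite /nc /= lerD// ler_norml; apply/andP; split; lra.
  have -> : f (z0 + h) - 1 * g (z0 + h) = f (z0 + h) - f z0 - l * h by rewrite /g; ring.
  apply: le_trans (hδ _ _) _; first lra.
  by rewrite ler_wpM2l// ltW.
apply: le_trans (RI_bound (M := e * ((p2 - p1) + (p4 - p3))) _ _ _ _ _ _ _ _) _ => //;
  try by [apply: hol_rcontH hr _; rewrite ?lexx ?p34|apply: hol_rcontV hr _; rewrite ?lexx ?p12].
- by move=> s hs'; split; apply: key; rewrite ?lexx ?p34.
- by move=> s hs'; split; apply: key; rewrite ?lexx ?p12.
by rewrite expr2 -!mulrA.
Qed.

End Goursat.

(** * Calculus of complex derivatives *)

Section CauchyEstimate.
Context {R : realType}.
Local Notation C := R[i].
Implicit Types (a b c d t s lo hi x y r : R) (K k : R -> C) (f g : C -> C).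

Lemma cder_fd f z l : cder f z l <->
  fd (fun v : 'cV[C]_1 => f (v 0 0)) (const_mx z) (fun v => l * v 0 0).
Proof.
split=> [h|[_ h] e e0].
  split; first by split=> *; rewrite !mxE; ring.
  move=> e e0; have [d d0 hd] := h e e0; exists d => // w.
  by rewrite nm11 !mxE => /hd.
have [d d0 hd] := h e e0; exists d => // w wd.
by have := hd (const_mx w); rewrite nm_const !mxE => /(_ wd).
Qed.

Lemma cder_eq f g z l l' : f =1 g -> l = l' -> cder f z l -> cder g z l'.
Proof.
by move=> fg <- h e e0; have [d d0 hd] := h e e0; exists d => // w /hd; rewrite !fg.
Qed.

Lemma cder_cst (c z : C) : cder (fun=> c) z 0.
Proof.
by move=> e e0; exists 1 => // h _; rewrite subrr mul0r subrr nc0 mulr_ge0 ?nc_ge0// ltW.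
Qed.
Lemma cder_id (z : C) : cder id z 1.
Proof.
move=> e e0; exists 1 => // h _; rewrite (_ : _ - _ - _ = 0); last by ring.
by rewrite nc0 mulr_ge0 ?nc_ge0// ltW.
Qed.
Lemma cder_add f g z l m : cder f z l -> cder g z m ->
  cder (fun w => f w + g w) z (l + m).
Proof.
move=> /cder_fd h /cder_fd k; apply/cder_fd.
by apply: fd_eq (fd_add h k) => v //; ring.
Qed.
Lemma cder_mul f g z l m : cder f z l -> cder g z m ->
  cder (fun w => f w * g w) z (l * g z + f z * m).
Proof.
move=> /cder_fd h /cder_fd k; apply/cder_fd.
by apply: fd_eq (fd_mul h k) => v //; rewrite mxE; ring.
Qed.
Lemma cder_inv (z : C) : z != 0 -> exists l, cder (fun w : C => w^-1) z l.
Proof.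
move=> z0; exists (- 1 / z ^+ 2); apply/cder_fd.
have /cder_fd h := cder_id z.
have z0' : (const_mx z : 'cV[C]_1) 0 0 != 0 by rewrite mxE.
by apply: fd_eq (fd_inv z0' h) => v //; rewrite mxE; ring.
Qed.

Lemma J_lower lo hi k a b m (s t : R) : `|s| <= 1 -> `|t| <= 1 ->
  rcont lo hi k -> lo <= a -> a <= b -> b <= hi ->
  (forall u, a <= u <= b -> m <= s * complex.Re (k u) + t * complex.Im (k u)) ->
  m * (b - a) <= s * complex.Re (J a b k) + t * complex.Im (J a b k).
Proof.
move=> s1 t1 h la ab bh hm; have lh : lo <= hi by lra.
have [K hK] := prim_ex lh h; rewrite (J_prim hK) ?la ?bh ?andbT ?(le_trans ab) ?(le_trans la)//.
have B z : `|s * complex.Re z + t * complex.Im z| <= nc z.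
  apply: le_trans (ler_normD _ _) _; rewrite !normrM /nc lerD//; exact: ler_piMl.
rewrite -lerN2 -mulNr.
apply: (@prim_growth _ _ _ K k (fun z => - (s * complex.Re z + t * complex.Im z)) (- m)) => //.
- by move=> z w; rewrite !reim; lra.
- by move=> z; apply: le_trans (ler_norm _) _; rewrite normrN.
- move=> u r r0 /hm hu; rewrite !reim !mul0r subr0 addr0 mulrN lerN2.
  have -> : s * (r * complex.Re (k u)) + t * (r * complex.Im (k u)) =
    r * (s * complex.Re (k u) + t * complex.Im (k u)) by ring.
  exact: ler_wpM2l.
- by move=> z; rewrite !reim !mulrN -opprD opprK; apply: le_trans (ler_norm _) (B z).
exact: prim_sub hK.
Qed.

Lemma hol_on_off0 f a b c d : (forall x y, a <= x <= b -> c <= y <= d ->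
    (x != 0) || (y != 0) -> exists l, cder f (Complex x y) l) ->
  a <= b -> c <= d -> (0 < a) || (b < 0) || (0 < c) || (d < 0) -> RI f a b c d = 0.
Proof.
move=> h ab cd ok; apply: goursat => // x y hx hy; apply: h => //.
rewrite -negb_and; apply/negP => /andP[/eqP x0 /eqP y0]; subst x y.
move: ok hx hy => /orP[/orP[/orP[]|]|] ? /andP[? ?] /andP[? ?]; lra.
Qed.

Lemma ring_contour f r r' : 0 < r' -> r' < r ->
  (forall z, `|complex.Re z| <= r -> `|complex.Im z| <= r -> z != 0 -> exists l, cder f z l) ->
  RI f (- r) r (- r) r = RI f (- r') r' (- r') r'.
Proof.
move=> r'0 rr' hf.
have h x y : - r <= x <= r -> - r <= y <= r -> (x != 0) || (y != 0) ->
    exists l, cder f (Complex x y) l.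
  move=> hx hy xy; apply: hf; rewrite ?ler_norml//=.
  apply: contraTneq xy => /(f_equal (fun z => (complex.Re z, complex.Im z)))/= [-> ->].
  by rewrite eqxx.
have hH y : - r <= y <= r -> y != 0 -> rcont (- r) r (fun x => f (Complex x y)).
  by move=> hy y0; apply: cder_rcontH => x hx; apply: h; rewrite ?y0 ?orbT.
have hV x : - r <= x <= r -> x != 0 -> rcont (- r) r (fun y => f (Complex x y)).
  by move=> hy y0; apply: cder_rcontV => y hx; apply: h; rewrite ?y0 ?orbT.
rewrite (@RI_splitH _ _ _ (- r')); last 3 first.
- by apply: hH; [apply/andP; split|]; lra.
- by apply: hH; [apply/andP; split|]; lra.
- by apply/andP; split; lra.
rewrite (@hol_on_off0 f (- r) (- r')); last 4 first.
- by move=> x y /andP[? ?] ?; apply: h => //; apply/andP; split; lra.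
- lra.
- lra.
- by apply/orP; left; apply/orP; left; apply/orP; right; lra.
have sub k : rcont (- r) r k -> rcont (- r') r k.
  move=> hk t /andP[? ?] e e0; have [|d d0 hd] := hk t _ e e0; first by apply/andP; split; lra.
  by exists d => // s /andP[? ?]; apply: hd; apply/andP; split; lra.
rewrite add0r (@RI_splitH _ _ _ r'); last 3 first.
- by apply/sub/hH; [apply/andP; split|]; lra.
- by apply/sub/hH; [apply/andP; split|]; lra.
- by apply/andP; split; lra.
rewrite (@hol_on_off0 f r' r); last 4 first.
- by move=> x y /andP[? ?] ?; apply: h => //; apply/andP; split; lra.
- lra.
- lra.
- by apply/orP; left; apply/orP; left; apply/orP; left; lra.
rewrite addr0 (@RI_splitV _ _ _ _ _ (- r')); last 3 first.
- by apply: hV; [apply/andP; split|]; lra.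
- by apply: hV; [apply/andP; split|]; lra.
- by apply/andP; split; lra.
rewrite (@hol_on_off0 f _ _ (- r) (- r')); last 4 first.
- by move=> x y /andP[? ?] /andP[? ?]; apply: h => //; apply/andP; split; lra.
- lra.
- lra.
- by apply/orP; right; lra.
rewrite add0r (@RI_splitV _ _ _ _ _ r'); last 3 first.
- by apply/sub/hV; [apply/andP; split|]; lra.
- by apply/sub/hV; [apply/andP; split|]; lra.
- by apply/andP; split; lra.
rewrite (@hol_on_off0 f _ _ r' r); last 4 first.
- by move=> x y /andP[? ?] /andP[? ?]; apply: h => //; apply/andP; split; lra.
- lra.
- lra.
- by apply/orP; left; apply/orP; right; lra.
by rewrite addr0.
Qed.

Lemma nc_inv_le (z : C) r : 0 < r -> r <= nc z -> nc z^-1 <= 2 / r.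
Proof.
move=> r0 rz; have z0 : z != 0 by apply/eqP => z0; move: rz; rewrite z0 nc0; lra.
have := nc_inv z0; rewrite ler_pdivlMr//; have := nc_ge0 z^-1; nra.
Qed.

Lemma contour_inv r : 0 < r -> 4 <= nc (RI (fun z => z^-1) (- r) r (- r) r).
Proof.
move=> r0; set f := (fun z : C => z^-1).
have h x y : (x != 0) || (y != 0) -> exists l, cder f (Complex x y) l.
  move=> xy; apply: cder_inv.
  apply: contraTneq xy => /(f_equal (fun z => (complex.Re z, complex.Im z)))/= [-> ->].
  by rewrite eqxx.
have hH y : y != 0 -> rcont (- r) r (fun x => f (Complex x y)).
  by move=> y0; apply: cder_rcontH => x hx; apply: h; rewrite ?y0 ?orbT.
have hV x : x != 0 -> rcont (- r) r (fun y => f (Complex x y)).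
  by move=> y0; apply: cder_rcontV => y hx; apply: h; rewrite ?y0 ?orbT.
have rn : r != 0 by rewrite gt_eqF.
have key u : - r <= u <= r -> 1 / (2 * r) <= r / (r ^+ 2 + u ^+ 2).
  move=> /andP[u1 u2]; have p : 0 < r ^+ 2 + u ^+ 2 by nra.
  by rewrite ler_pdivlMr// mulrAC ler_pdivrMr; nra.
have imInv x y : complex.Im (Complex x y)^-1 = - (y / (x ^+ 2 + y ^+ 2)) by [].
have reInv x y : complex.Re (Complex x y)^-1 = x / (x ^+ 2 + y ^+ 2) by [].
have one : 1 / (2 * r) * (r - - r) = 1 by field.
have n0 : `|0 : R| <= 1 by rewrite normr0.
have n1 : `|1 : R| <= 1 by rewrite normr1.
have nN1 : `|-1 : R| <= 1 by rewrite normrN1.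
have B : 1 <= 0 * complex.Re (J (- r) r (fun x => f (Complex x (- r)))) +
              1 * complex.Im (J (- r) r (fun x => f (Complex x (- r)))).
  rewrite -[leLHS]one; apply: (J_lower (m := 1 / (2 * r)) n0 n1 (hH (- r) _)); rewrite ?oppr_eq0//; try lra.
  by move=> u hu; rewrite /f imInv sqrrN mulNr (addrC (u ^+ 2)); have := key u hu; move: (r / _) (1 / (2 * r)) => q p; lra.
have T : 1 <= 0 * complex.Re (J (- r) r (fun x => f (Complex x r))) +
              -1 * complex.Im (J (- r) r (fun x => f (Complex x r))).
  rewrite -[leLHS]one; apply: (J_lower (m := 1 / (2 * r)) n0 nN1 (hH r _))=> //; try lra.
  by move=> u hu; rewrite /f imInv (addrC (u ^+ 2)); have := key u hu; move: (r / _) (1 / (2 * r)) => q p; lra.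
have D : 1 <= 1 * complex.Re (J (- r) r (fun y => f (Complex r y))) +
              0 * complex.Im (J (- r) r (fun y => f (Complex r y))).
  rewrite -[leLHS]one; apply: (J_lower (m := 1 / (2 * r)) n1 n0 (hV r _))=> //; try lra.
  by move=> u hu; rewrite /f reInv ?sqrrN ?mulNr; have := key u hu; move: (r / _) (1 / (2 * r)) => q p; lra.
have L : 1 <= -1 * complex.Re (J (- r) r (fun y => f (Complex (- r) y))) +
              0 * complex.Im (J (- r) r (fun y => f (Complex (- r) y))).
  rewrite -[leLHS]one; apply: (J_lower (m := 1 / (2 * r)) nN1 n0 (hV (- r) _)); rewrite ?oppr_eq0//; try lra.
  by move=> u hu; rewrite /f reInv ?sqrrN ?mulNr; have := key u hu; move: (r / _) (1 / (2 * r)) => q p; lra.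
apply: le_trans (le_trans (ler_norm _) (nc_Im _)); rewrite /RI !reim; lra.
Qed.

End CauchyEstimate.

(** * Cauchy estimates *)

Section CauchyEstimate2.
Context {R : realType}.
Local Notation C := R[i].
Implicit Types (a b c d t s lo hi x y r : R) (K k : R -> C) (f g : C -> C).

Theorem cauchy_estimate g g' r M : 0 < r ->
  (forall z, `|complex.Re z| <= r -> `|complex.Im z| <= r ->
     cder g z (g' z) /\ nc (g z) <= M) ->
  nc (g' 0) <= 32 * M / r.
Proof.
move=> r0 hg.
have [d0 M0] : cder g 0 (g' 0) /\ nc (g 0) <= M by apply: hg; rewrite normr0 ltW.
pose u z := (g z - g 0) * (z^-1 * z^-1).
pose v z : C := z^-1.
have hu z : `|complex.Re z| <= r -> `|complex.Im z| <= r -> z != 0 -> exists l, cder u z l.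
  move=> h1 h2 z0; have [dz _] := hg z h1 h2; have [l hl] := cder_inv z0.
  by eexists; apply: cder_mul (cder_mul hl hl); apply: cder_add dz (cder_cst _ _).
have hv z : `|complex.Re z| <= r -> `|complex.Im z| <= r -> z != 0 -> exists l, cder v z l.
  by move=> h1 h2 z0; apply: cder_inv.
have huv z : `|complex.Re z| <= r -> `|complex.Im z| <= r -> z != 0 ->
    exists l, cder (fun z => u z - g' 0 * v z) z l.
  move=> h1 h2 z0; have [l hl] := hu z h1 h2 z0; have [m hm] := hv z h1 h2 z0.
  eexists; apply: cder_eq (cder_add hl (cder_mul (cder_cst (- g' 0) z) hm)); last reflexivity.
  by move=> w; rewrite mulNr.
have ed w s : 0 < s -> s <= r -> - s <= w <= s -> forall f,
    (forall z, `|complex.Re z| <= r -> `|complex.Im z| <= r -> z != 0 -> exists l, cder f z l) ->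
  [/\ exists l, cder f (Complex w (- s)) l, exists l, cder f (Complex w s) l,
      exists l, cder f (Complex (- s) w) l & exists l, cder f (Complex s w) l].
  move=> s0 sr /andP[w1 w2] f hf.
  have nz : (s != 0) && (- s != 0) by rewrite oppr_eq0 gt_eqF.
  have /andP[nz1 nz2] := nz.
  by split; apply: hf; rewrite /= ?ler_norml; try (apply/andP; split; lra);
    apply/eqP => /(f_equal (fun z => (complex.Re z, complex.Im z)))/= [] ? ?; lra.
have edH s f : 0 < s -> s <= r ->
    (forall z, `|complex.Re z| <= r -> `|complex.Im z| <= r -> z != 0 -> exists l, cder f z l) ->
    [/\ rcont (- s) s (fun x => f (Complex x (- s))), rcont (- s) s (fun x => f (Complex x s)),
      rcont (- s) s (fun y => f (Complex (- s) y)) & rcont (- s) s (fun y => f (Complex s y))].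
  move=> s0 sr hf; split; [apply: cder_rcontH|apply: cder_rcontH|apply: cder_rcontV|apply: cder_rcontV];
    by move=> w hw; have [] := ed w s s0 sr hw f hf.
have I0 : RI (fun z => u z - g' 0 * v z) (- r) r (- r) r = 0.
  apply: nc_eq0; apply/eqP; rewrite eq_le nc_ge0 andbT.
  apply/ler_addgt0Pr => e' e'0; rewrite add0r.
  pose e := e' / 32; have e0 : 0 < e by rewrite /e; lra.
  have [d dp hd] := d0 e e0.
  pose s := Num.min (r / 2) (d / 3).
  have s0 : 0 < s by rewrite lt_min; apply/andP; split; lra.
  have sr : s <= r / 2 by rewrite ge_min lexx.
  have sd : s <= d / 3 by rewrite ge_min lexx orbT.
  rewrite (ring_contour s0 _ huv); last lra.
  have B z : s <= nc z -> nc z <= 2 * s -> nc (u z - g' 0 * v z) <= 4 * e / s.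
    move=> z1 z2; have zn : z != 0 by apply/eqP => z0; move: z1; rewrite z0 nc0; lra.
    have -> : u z - g' 0 * v z = (g z - g 0 - g' 0 * z) * (z^-1 * z^-1).
      by rewrite /u /v; field.
    apply: le_trans (ncM _ _) _.
    have := hd z; rewrite add0r => /(_ ltac:(lra)) H.
    have I1 := nc_inv zn; have I2 := nc_inv_le s0 z1; have I3 := nc_ge0 z^-1.
    apply: (@le_trans _ _ (e * nc z * (nc z^-1 * nc z^-1))).
      by apply: ler_pM; rewrite ?nc_ge0 ?ncM.
    have -> : e * nc z * (nc z^-1 * nc z^-1) = e * (nc z * nc z^-1) * nc z^-1 by ring.
    have -> : 4 * e / s = e * 2 * (2 / s) by ring.
    apply: ler_pM => //; first by rewrite !mulr_ge0 ?nc_ge0// ltW.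
    by rewrite ler_wpM2l// ltW.
  have [f1 f2 f3 f4] := edH s _ s0 ltac:(lra) huv.
  apply: le_trans (RI_bound (M := 4 * e / s) _ _ f1 f2 f3 f4 _ _) _; try lra.
  - move=> x /andP[x1 x2]; have := ler_norml x s; rewrite x1 x2 => /= nx.
    by split; apply: B; rewrite /nc /= ?normrN (gtr0_norm s0); have := normr_ge0 x; lra.
  - move=> x /andP[x1 x2]; have := ler_norml x s; rewrite x1 x2 => /= nx.
    by split; apply: B; rewrite /nc /= ?normrN (gtr0_norm s0); have := normr_ge0 x; lra.
  by rewrite le_eqVlt; apply/orP; left; apply/eqP; rewrite /e; field; lra.
have [u1 u2 u3 u4] := edH r _ r0 (lexx _) hu; have [v1 v2 v3 v4] := edH r _ r0 (lexx _) hv.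
have rr : - r <= r by lra.
move: I0; rewrite RI_lin// => /eqP; rewrite subr_eq0 => /eqP I0.
have Iv := contour_inv r0; set I1 := RI v _ _ _ _ in I0; rewrite -/I1 in Iv.
have I1n : I1 != 0 by apply/eqP => E; move: Iv; rewrite E nc0; lra.
have Iu : nc (RI u (- r) r (- r) r) <= 64 * M / r.
  have B z : `|complex.Re z| <= r -> `|complex.Im z| <= r -> r <= nc z ->
      nc (u z) <= 8 * M / (r * r).
    move=> h1 h2 h3; apply: le_trans (ncM _ _) _.
    have -> : 8 * M / (r * r) = (2 * M) * ((2 / r) * (2 / r)).
      by field; rewrite gt_eqF.
    have I2 := nc_inv_le r0 h3; have I3 := nc_ge0 z^-1.
    apply: ler_pM; rewrite ?nc_ge0//.
      by apply: le_trans (ncB _ _) _; have [_ ?] := hg z h1 h2; lra.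
    by apply: le_trans (ncM _ _) _; apply: ler_pM. apply: le_trans (RI_bound (M := 8 * M / (r * r)) _ _ u1 u2 u3 u4 _ _) _; try lra.
  - move=> x /andP[x1 x2]; have := ler_norml x r; rewrite x1 x2 => /= nx.
    by split; apply: B; rewrite /nc /= ?normrN ?(gtr0_norm r0) //; have := normr_ge0 x; lra.
  - move=> x /andP[x1 x2]; have := ler_norml x r; rewrite x1 x2 => /= nx.
    by split; apply: B; rewrite /nc /= ?normrN ?(gtr0_norm r0) //; have := normr_ge0 x; lra.
  by rewrite le_eqVlt; apply/orP; left; apply/eqP; field; lra. have -> : g' 0 = RI u (- r) r (- r) r * I1^-1 by rewrite I0 mulfK.
apply: le_trans (ncM _ _) _.
have f4 : (0 : R) < 4 by lra.
have := nc_inv_le f4 Iv.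
have -> : 32 * M / r = 64 * M / r * (2 / 4) by field; rewrite gt_eqF.
by move=> Q; apply: ler_pM; rewrite ?nc_ge0.
Qed.

End CauchyEstimate2.

(** * Primitives *)

Section HolPrimitive.
Context {R : realType}.
Local Notation C := R[i].
Implicit Types (a b c d t s lo hi x y r : R) (K k : R -> C) (f g : C -> C).

Definition Pr f p q (z : C) : C :=
  J p (complex.Re z) (fun x => f (Complex x q)) +
  'i * J q (complex.Im z) (fun y => f (Complex (complex.Re z) y)).

Lemma signed_goursat f a b c d x x' y y' : hol_on f a b c d ->
  a <= x <= b -> a <= x' <= b -> c <= y <= d -> c <= y' <= d -> RI f x x' y y' = 0.
Proof.
move=> h hx hx' hy hy'.
have G1 u u' w w' : a <= u <= b -> a <= u' <= b -> u <= u' ->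
    c <= w <= d -> c <= w' <= d -> w <= w' -> RI f u u' w w' = 0.
  move=> /andP[u1 u2] /andP[u1' u2'] uu /andP[? ?] /andP[? ?] ww; apply: goursat => //.
  by apply: hol_on_sub h _ _ _ _.
have G2 w w' : c <= w <= d -> c <= w' <= d -> w <= w' -> RI f x x' w w' = 0.
  move=> hw hw' ww; case/orP: (le_total x x') => xx; first exact: G1.
  have := G1 _ _ _ _ hx' hx xx hw hw' ww; rewrite /RI.
  rewrite (J_swap (hol_rcontH h hw) hx' hx) (J_swap (hol_rcontH h hw') hx' hx).
  move: (J _ _ _) (J _ _ _) (J _ _ _) (J _ _ _) => A B D E H.
  by apply: oppr_inj; rewrite oppr0 -[RHS]H; ring.
case/orP: (le_total y y') => yy; first exact: G2.
have := G2 _ _ hy' hy yy; rewrite /RI.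
rewrite (J_swap (hol_rcontV h hx) hy' hy) (J_swap (hol_rcontV h hx') hy' hy).
move: (J _ _ _) (J _ _ _) (J _ _ _) (J _ _ _) => A B D E H.
by apply: oppr_inj; rewrite oppr0 -[RHS]H; ring.
Qed.

Lemma Pr_diff f a b c d p q z h : hol_on f a b c d -> a <= p <= b -> c <= q <= d ->
  a <= complex.Re z <= b -> c <= complex.Im z <= d ->
  a <= complex.Re (z + h) <= b -> c <= complex.Im (z + h) <= d ->
  Pr f p q (z + h) - Pr f p q z =
  J (complex.Re z) (complex.Re (z + h)) (fun x => f (Complex x (complex.Im z))) +
  'i * J (complex.Im z) (complex.Im (z + h)) (fun y => f (Complex (complex.Re (z + h)) y)).
Proof.
rewrite /Pr; move: (complex.Re (z + h)) (complex.Im (z + h)) => x' y'.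
move: (complex.Re z) (complex.Im z) => x y hf hp hq hx hy hx' hy'.
have G := signed_goursat hf hx hx' hq hy; rewrite /RI in G.
rewrite (J_add (hol_rcontH hf hq) hp hx hx') (J_add (hol_rcontV hf hx') hq hy hy').
move: G; move: (J x x' _) (J q y _) (J x x' _) (J q y _) (J p x _) (J y y' _) => A B D E F G.
by move=> H; apply/eqP; rewrite -subr_eq0 -[X in _ == X]H; apply/eqP; ring.
Qed.

Lemma rcont_cst lo hi (z : C) : rcont lo hi (fun=> z).
Proof. by move=> t _ e e0; exists 1 => // s _ _; rewrite subrr nc0 ltW. Qed.

Lemma J_cst a b (z : C) : J a b (fun=> z) = (b - a)%:C * z.
Proof.
have h : prim (Num.min a b) (Num.max a b) (fun t => t%:C * z) (fun=> z).
  move=> t _ e e0; exists 1 => // s _ _; rewrite (_ : _ - _ - _ = 0).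
    by rewrite nc0 mulr_ge0// ltW.
  by rewrite rmorphB /=; ring.
rewrite (J_prim h); first by rewrite rmorphB /=; ring.
  by rewrite ge_min le_max lexx.
by rewrite ge_min le_max lexx !orbT.
Qed.

Lemma J_near lo hi k a b (z : C) e : rcont lo hi k -> lo <= a <= hi -> lo <= b <= hi ->
  (forall t, Num.min a b <= t <= Num.max a b -> nc (k t - z) <= e) ->
  nc (J a b k - (b - a)%:C * z) <= e * `|b - a|.
Proof.
move=> h ha hb H; have E := J_lin 1 h (@rcont_cst lo hi z) ha hb.
rewrite J_cst !mul1r in E; rewrite -E; apply: (J_bound (lo := lo) (hi := hi)) => //.
  move=> t ht e' e'0; have [d d0 hd] := h t ht e' e'0; exists d => // s hs /(hd _ hs).
  by have -> : k s - z - (k t - z) = k s - k t by ring.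
Qed.

Lemma between_near a b t e : `|b - a| < e -> Num.min a b <= t <= Num.max a b -> `|t - a| < e.
Proof.
case/orP: (le_total a b) => ab; [rewrite min_l// max_r//|rewrite min_r// max_l//];
  rewrite !ltr_norml => /andP[? ?] /andP[? ?]; apply/andP; split; lra.
Qed.

Lemma Pr_cder f a b c d p q z : hol_on f a b c d -> a <= p <= b -> c <= q <= d ->
  a < complex.Re z < b -> c < complex.Im z < d -> cder (Pr f p q) z (f z).
Proof.
move=> hf hp hq /andP[a1 a2] /andP[c1 c2] e e0.
have hx : a <= complex.Re z <= b by apply/andP; split; lra.
have hy : c <= complex.Im z <= d by apply/andP; split; lra.
have [l hl] := hf _ _ hx hy.
have zE : Complex (complex.Re z) (complex.Im z) = z by case: (z).
rewrite zE in hl; have [r r0 hr] := cder_cont hl e0.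
pose m := Num.min (Num.min (complex.Re z - a) (b - complex.Re z))
   (Num.min (complex.Im z - c) (d - complex.Im z)).
exists (Num.min (r / 2) m).
  by rewrite !lt_min; do !(apply/andP; split); lra.
move=> h; rewrite !lt_min => /andP[hr2 /andP[/andP[m1 m2] /andP[m3 m4]]].
have hRe := nc_Re h; have hIm := nc_Im h.
have hx' : a <= complex.Re (z + h) <= b.
  move: hRe; rewrite ReD ler_norml => /andP[? ?]; apply/andP; split; lra.
have hy' : c <= complex.Im (z + h) <= d.
  move: hIm; rewrite ImD ler_norml => /andP[? ?]; apply/andP; split; lra.
rewrite (Pr_diff hf hp hq)//.
have dx : complex.Re (z + h) - complex.Re z = complex.Re h by rewrite ReD; ring.
have dy : complex.Im (z + h) - complex.Im z = complex.Im h by rewrite ImD; ring.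
have key x y : `|x - complex.Re z| < r / 2 -> `|y - complex.Im z| < r / 2 ->
    nc (f (Complex x y) - f z) <= e.
  move=> xr yr; have -> : Complex x y = z + Complex (x - complex.Re z) (y - complex.Im z).
    by apply: cE; rewrite !reim /= addrC subrK.
  by apply: hr; rewrite /nc /=; lra.
have A : nc (J (complex.Re z) (complex.Re (z + h)) (fun x => f (Complex x (complex.Im z)))
    - (complex.Re (z + h) - complex.Re z)%:C * f z) <= e * `|complex.Re (z + h) - complex.Re z|.
  apply: (J_near (hol_rcontH hf hy) hx hx') => t ht; apply: key.
    by apply: between_near ht; rewrite dx; lra.
  by rewrite subrr normr0; lra.
have B : nc (J (complex.Im z) (complex.Im (z + h)) (fun y => f (Complex (complex.Re (z + h)) y))
    - (complex.Im (z + h) - complex.Im z)%:C * f z) <= e * `|complex.Im (z + h) - complex.Im z|.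
  apply: (J_near (hol_rcontV hf hx') hy hy') => t ht; apply: key.
    by rewrite dx; lra.
  by apply: between_near ht; rewrite dy; lra.
move: A B; rewrite dx dy; move: (J _ _ _) (J _ _ _) => B A hA hB.
have -> : A + 'i * B - f z * h = (A - (complex.Re h)%:C * f z) + 'i * (B - (complex.Im h)%:C * f z).
  by rewrite {1}(creim h); ring.
by apply: le_trans (ncD _ _) _; rewrite nciM {3}/nc mulrDr lerD.
Qed.

Lemma Pr_bound f a b c d p q z M : hol_on f a b c d -> a <= p <= b -> c <= q <= d ->
  (forall x y, a <= x <= b -> c <= y <= d -> nc (f (Complex x y)) <= M) ->
  a <= complex.Re z <= b -> c <= complex.Im z <= d ->
  nc (Pr f p q z) <= M * nc (z - Complex p q).
Proof.
move=> hf hp hq hM hx hy; rewrite /Pr; apply: le_trans (ncD _ _) _; rewrite nciM.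
have /andP[x1 x2] := hx; have /andP[y1 y2] := hy.
have /andP[p1 p2] := hp; have /andP[q1 q2] := hq.
have A : nc (J p (complex.Re z) (fun x => f (Complex x q))) <= M * `|complex.Re z - p|.
  apply: (J_bound (hol_rcontH hf hq) hp hx) => t /andP[t1 t2]; apply: hM => //.
  apply/andP; split; first by apply: le_trans t1; rewrite le_min p1.
  by apply: le_trans t2 _; rewrite ge_max p2.
have B : nc (J q (complex.Im z) (fun y => f (Complex (complex.Re z) y)))
    <= M * `|complex.Im z - q|.
  apply: (J_bound (hol_rcontV hf hx) hq hy) => t /andP[t1 t2]; apply: hM => //.
  apply/andP; split; first by apply: le_trans t1; rewrite le_min q1.
  by apply: le_trans t2 _; rewrite ge_max q2.
by apply: le_trans (lerD A B) _; rewrite -mulrDr /nc !reim.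
Qed.

Lemma Pr_base f p q : Pr f p q (Complex p q) = 0.
Proof.
have J0 a k : J a a k = 0.
  have P : prim a a (fun t => (t - a)%:C * k a) k.
    move=> t /andP[t1 t2] e e0; exists 1 => // s /andP[s1 s2] _.
    have -> : s = a by lra.
    have -> : t = a by lra.
    by rewrite !subrr !mul0r !subrr nc0 normr0 mulr0.
  by rewrite (J_prim P) ?lexx ?subrr.
by rewrite /Pr /= !J0 mulr0 addr0.
Qed.

End HolPrimitive.

(** * Limits of holomorphic functions *)

Section Regularity.
Context {R : realType}.
Local Notation C := R[i].

Definition cfd {m} (f : 'cV[C]_m -> C) x (l : 'cV[C]_m -> C) :=
  fd f x l /\ forall (z : C) v, l (z *: v) = z * l v.

Lemma fd_partials m (f : 'cV[C]_m -> C) x0 (lam : 'I_m -> C -> C) :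
  (forall k z w, lam k (z + w) = lam k z + lam k w) ->
  (forall k (r : R) z, lam k (r%:C * z) = r%:C * lam k z) ->
  (forall e : R, 0 < e -> exists2 d : R, 0 < d & forall k x t, nm (x - x0) < d ->
     nc t < d -> nc (f (x + t *: delta_mx k 0) - f x - lam k t) <= e * nc t) ->
  fd f x0 (fun w => \sum_k lam k (w k 0)).
Proof.
move=> lD lZ h; split.
  split=> [v w|r v].
    by rewrite -big_split; apply: eq_bigr => k _; rewrite mxE lD.
  by rewrite mulr_sumr; apply: eq_bigr => k _; rewrite mxE lZ.
move=> e /h[d d0 hd]; exists d => // w wd.
pose p j : 'cV[C]_m := \sum_(k < m | (k < j)%N) w k 0 *: delta_mx k 0.
have p0 : p 0%N = 0 by apply: big1.
have pm : p m = w.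
  rewrite [RHS]matrix_sum_delta /p; apply: eq_big => [k|k _]; first by rewrite ltn_ord.
  by rewrite big_ord1.
have pS (j : 'I_m) : p j.+1 = p j + w j 0 *: delta_mx j 0.
  rewrite /p (bigD1 j) ?ltnSn//= addrC; congr (_ + _); apply: eq_bigl => k.
  by rewrite ltnS ltn_neqAle andbC.
have pn j : nm (p j) <= nm w.
  rewrite /nm; apply: ler_sum => i _; rewrite !big_ord1 /p summxE.
  have [ij|ij] := boolP (i < j)%N.
    rewrite (bigD1 i)//= big1 ?addr0 ?mxE ?eqxx ?mulr1// => k /andP[_ ki].
    by rewrite !mxE eq_sym (negPf ki) mulr0.
  rewrite big1 ?nc0 ?nc_ge0// => k kj; rewrite !mxE.
  have -> : (i == k) = false by apply: contraNF ij => /eqP ->.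
  by rewrite mulr0.
have -> : f (x0 + w) - f x0 = \sum_(j < m) (f (x0 + p j.+1) - f (x0 + p j)).
  rewrite -(big_mkord xpredT (fun j => f (x0 + p j.+1) - f (x0 + p j))).
  by rewrite telescope_sumr// p0 pm addr0.
rewrite -sumrB; apply: le_trans (nc_sum _ _ _) _.
rewrite [in leRHS]/nm mulr_sumr; apply: ler_sum => j _; rewrite big_ord1 pS addrA.
apply: hd; last by apply: le_lt_trans (nm_le w j 0) wd.
by rewrite [_ + p j]addrC addrK; apply: le_lt_trans (pn j) wd.
Qed.

Lemma fd_rlin m (l : 'cV[C]_m -> C) x : rlin l -> fd l x l.
Proof.
move=> h; split=> // e e0; exists 1 => // w _; rewrite h.1.
rewrite (_ : _ - _ - _ = 0); last by ring.
by rewrite nc0 mulr_ge0 ?nm_ge0// ltW.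
Qed.

Lemma fd_shift m (f : 'cV[C]_m -> C) x w l : fd f (x + w) l -> fd (fun y => f (y + w)) x l.
Proof.
move=> [r h]; split=> // e /h[d d0 hd]; exists d => // v /hd.
by rewrite -!addrA [v + w]addrC.
Qed.

Lemma cder_line m (f : 'cV[C]_m -> C) x v z l : cfd f (x + z *: v) l ->
  cder (fun z => f (x + z *: v)) z (l v).
Proof.
move=> [[r h] lz] e e0; have v0 := nm_ge0 v.
pose e' := e / (nm v + 1); have e'0 : 0 < e' by rewrite divr_gt0//; lra.
have [d d0 hd] := h _ e'0; exists (d / (nm v + 1)); first by rewrite divr_gt0//; lra.
move=> w; rewrite ltr_pdivlMr; last lra.
move=> wd; have B := nmZ w v; have w0 := nc_ge0 w.
rewrite scalerDl addrA [l v * w]mulrC -lz; apply: le_trans (hd _ _) _; first lra.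
apply: (@le_trans _ _ (e' * ((nm v + 1) * nc w))).
  by apply: ler_wpM2l; [exact: ltW|lra].
by rewrite mulrA /e' le_eqVlt; apply/orP; left; apply/eqP; field; lra.
Qed.

Lemma fd_prim m (f : 'cV[C]_m -> C) (L : 'cV[C]_m -> 'cV[C]_m -> C) x w lo hi :
  (forall t : R, lo <= t <= hi -> fd f (x + t%:C *: w) (L (x + t%:C *: w))) ->
  prim lo hi (fun t => f (x + t%:C *: w)) (fun t => L (x + t%:C *: w) w).
Proof.
move=> h t /h[r ht] e e0; have v0 := nm_ge0 w.
pose e' := e / (nm w + 1); have e'0 : 0 < e' by rewrite divr_gt0//; lra.
have [d d0 hd] := ht _ e'0; exists (d / (nm w + 1)); first by rewrite divr_gt0//; lra.
move=> s _; rewrite ltr_pdivlMr; last lra.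
move=> sd; have w0 := normr_ge0 (s - t).
have -> : x + s%:C *: w = x + t%:C *: w + (s - t)%:C *: w.
  by rewrite -addrA -scalerDl -rmorphD /= [t + _]addrC subrK.
rewrite -r.2; apply: le_trans (hd _ _) _; rewrite nmrZ; first lra.
apply: (@le_trans _ _ (e' * ((nm w + 1) * `|s - t|))).
  by apply: ler_wpM2l; [exact: ltW|lra].
by rewrite mulrA /e' le_eqVlt; apply/orP; left; apply/eqP; field; lra.
Qed.

Lemma mean_value m (f : 'cV[C]_m -> C) (L : 'cV[C]_m -> 'cV[C]_m -> C) x w K :
  (forall t : R, 0 <= t <= 1 -> fd f (x + t%:C *: w) (L (x + t%:C *: w)) /\
     nc (L (x + t%:C *: w) w) <= K) ->
  nc (f (x + w) - f x) <= K.
Proof.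
move=> h; have P := fd_prim (fun t ht => (h t ht).1).
have := prim_bound ler01 P (fun t ht => (h t ht).2).
by rewrite scale1r scale0r addr0 subr0 mulr1.
Qed.

Lemma cauchy_ball m (f : 'cV[C]_m -> C) (L : 'cV[C]_m -> 'cV[C]_m -> C) x v rho M :
  0 < rho ->
  (forall y, nm (y - x) < rho -> cfd f y (L y) /\ nc (f y) <= M) ->
  nc (L x v) <= 128 * M / rho * nm v.
Proof.
move=> rho0 h.
have [[[rl _] cl] M0] : cfd f x (L x) /\ nc (f x) <= M by apply: h; rewrite subrr nm0.
have [->|v0] := eqVneq v 0; first by rewrite (rlin0 rl) nc0 nm0 mulr0.
have nv := nm_gt0 v0.
pose r := rho / (4 * nm v); have r0 : 0 < r by rewrite divr_gt0// mulr_gt0.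
have := @cauchy_estimate R (fun z => f (x + z *: v)) (fun z => L (x + z *: v) v) r M r0.
rewrite scale0r addr0 => H.
have -> : 128 * M / rho * nm v = 32 * M / r by rewrite /r; field; lra.
apply: H => z z1 z2; have [|h1 h2] := h (x + z *: v).
  rewrite addrC addKr; apply: le_lt_trans (nmZ _ _) _.
  have : nc z <= 2 * r by rewrite /nc; lra.
  move=> /(ler_wpM2r (ltW nv)) /le_lt_trans; apply.
  have -> : 2 * r * nm v = rho / 2 by rewrite /r; field; lra.
  lra.
by split=> //; apply: cder_line.
Qed.

(* A family whose oscillation is controlled by the parameter has a limit,
   found as a supremum. *)
Lemma cauchy_limit (T : Type) (q : T -> C) (n : T -> R) (K : R) : inhabited T ->
  (forall s t, nc (q s - q t) <= K * (n s + n t)) ->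
  exists l, forall t, nc (q t - l) <= 2 * (K * n t).
Proof.
move=> [t0] h.
have real (g : T -> R) : (forall s t, `|g s - g t| <= K * (n s + n t)) ->
    exists l, forall t, `|g t - l| <= K * n t.
  move=> hg; pose A := range (fun t => g t - K * n t).
  have ub t : ubound A (g t + K * n t).
    by move=> _ [s _ <-]; have := hg s t; rewrite ler_norml mulrDr => /andP[? ?]; lra.
  have hs : has_sup A by split; [exists (g t0 - K * n t0), t0 | exists (g t0 + K * n t0)].
  exists (sup A) => t; rewrite ler_norml; apply/andP; split.
    have : sup A <= g t + K * n t by apply: ge_sup (ub t); exists (g t0 - K * n t0), t0.
    lra.
  have : g t - K * n t <= sup A by apply: sup_upper_bound => //; exists t.
  lra.
have [a ha] := real (fun t => complex.Re (q t))
  (fun s t => le_trans (eq_ind _ (fun x => `|x| <= nc (q s - q t)) (nc_Re _) _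
     (etrans (ReD _ _) (f_equal _ (ReN _)))) (h s t)).
have [b hb] := real (fun t => complex.Im (q t))
  (fun s t => le_trans (eq_ind _ (fun x => `|x| <= nc (q s - q t)) (nc_Im _) _
     (etrans (ImD _ _) (f_equal _ (ImN _)))) (h s t)).
exists (Complex a b) => t; rewrite /nc !reim /=; have := ha t; have := hb t; lra.
Qed.

Section Gradient.
Context {m : nat} (f : 'cV[C]_m -> C) (L : 'cV[C]_m -> 'cV[C]_m -> C) (x0 : 'cV[C]_m).
Context (rho : R) (M : R) (rho0 : 0 < rho).
Implicit Types (x y u v w : 'cV[C]_m).
Hypothesis hf : forall y, nm (y - x0) < 2 * rho -> cfd f y (L y) /\ nc (f y) <= M.

Let hf2 y : nm (y - x0) < 2 * rho -> cfd f y (L y). Proof. by case/hf. Qed.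
Let hf1 y : nm (y - x0) < 2 * rho -> fd f y (L y). Proof. by case/hf2. Qed.
Let K1 := 128 * M / rho.
Let M0 : 0 <= M.
Proof.
have [|_] := @hf x0; first by rewrite subrr nm0 mulr_gt0.
by apply: le_trans; apply: nc_ge0.
Qed.
Let K10 : 0 <= K1. Proof. by rewrite /K1 !mulr_ge0// invr_ge0 ltW. Qed.

Let L_bound x v : nm (x - x0) < rho -> nc (L x v) <= K1 * nm v.
Proof.
have rho0' := rho0.
move=> hx; apply: (cauchy_ball (f := f)) => // y hy; apply: hf.
rewrite -(subrK x y) -addrA; apply: le_lt_trans (nmD _ _) _; lra.
Qed.

Let seg x w (t : R) a b : 0 <= t <= 1 -> nm (x - x0) < a -> nm w <= b ->
  nm (x + t%:C *: w - x0) < a + b.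
Proof.
have rho0' := rho0.
move=> /andP[t0 t1] ha hb; rewrite addrAC; apply: le_lt_trans (nmD _ _) _.
rewrite nmrZ ger0_norm//; have := nm_ge0 w; nra.
Qed.

Let f_lip x w : nm (x - x0) < rho / 2 -> nm w <= rho / 2 ->
  nc (f (x + w) - f x) <= K1 * nm w.
Proof.
have rho0' := rho0.
move=> hx hw; apply: (mean_value (L := L)) => t ht.
have := seg ht hx hw => H; split; first by apply: hf1; lra.
by apply: L_bound; lra.
Qed.

Let K2 := 128 * K1 / (rho / 4).
Let K20 : 0 <= K2. Proof. by rewrite /K2 !mulr_ge0// invr_ge0 ltW// divr_gt0. Qed.

Lemma gradient_lip x w v : nm (x - x0) < rho / 4 -> nm w <= rho / 2 ->
  nc (L (x + w) v - L x v) <= K2 * nm w * nm v.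
Proof.
have rho0' := rho0.
move=> hx hw.
have -> : K2 * nm w * nm v = 128 * (K1 * nm w) / (rho / 4) * nm v by rewrite /K2; ring.
apply: (@cauchy_ball _ (fun y => f (y + w) - f y) (fun y v => L (y + w) v - L y v)).
  lra.
move=> y hy; have hy2 : nm (y - x0) < rho / 2.
  by rewrite -(subrK x y) -addrA; apply: le_lt_trans (nmD _ _) _; lra.
have [[h1 h1'] _] : cfd f y (L y) /\ nc (f y) <= M by apply: hf; lra.
have [[h2 h2'] _] : cfd f (y + w) (L (y + w)) /\ nc (f (y + w)) <= M.
  by apply: hf; rewrite addrAC; apply: le_lt_trans (nmD _ _) _; lra.
split; last exact: f_lip.
split; last by move=> z u; rewrite h1' h2'; ring.
exact: fd_add (fd_shift h2) (fd_opp h1).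
Qed.

Let taylor x w : nm (x - x0) < rho / 4 -> nm w <= rho / 2 ->
  nc (f (x + w) - f x - L x w) <= K2 * nm w ^+ 2.
Proof.
have rho0' := rho0.
move=> hx hw; have [[[rx hx'] _] _] : cfd f x (L x) /\ nc (f x) <= M by apply: hf; lra.
have := @mean_value m (fun y => f y - L x y) (fun y v => L y v - L x v) x w (K2 * nm w ^+ 2).
have -> : f (x + w) - L x (x + w) - (f x - L x x) = f (x + w) - f x - L x w.
  by rewrite rx.1; ring.
apply=> t ht; have H := seg ht hx hw; split.
  by apply: fd_add (fd_opp (fd_rlin _ rx)); apply: hf1; lra.
have w0 := nm_ge0 w; have /andP[t0 t1] := ht.
have tw : nm (t%:C *: w) <= nm w by rewrite nmrZ ger0_norm//; nra.
apply: le_trans (gradient_lip _ hx (le_trans tw hw)) _.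
by rewrite expr2 mulrA ler_wpM2r// ler_wpM2l.
Qed.

Let sd := { t : C | (t != 0) && (nc t < rho / 4) }.
Context (v : 'cV[C]_m) (k : 'I_m).
Let ek : 'cV[C]_m := delta_mx k 0.
Let nek (t : C) : nm (t *: ek) = nc t.
Proof.
have rho0' := rho0.
rewrite /nm (bigD1 k)//= big_ord1 !mxE !eqxx mulr1 big1 ?addr0// => i ik.
by rewrite big_ord1 !mxE (negPf ik) mulr0 nc0.
Qed.

Let K3 := 128 * (2 * K2) / (rho / 8) * nm v.

Lemma gradient_partial x : nm (x - x0) < rho / 8 ->
  exists l, forall t, t != 0 -> nc t < rho / 4 ->
    nc ((L (x + t *: ek) v - L x v) * t^-1 - l) <= 2 * (K3 * nc t).
Proof.
have rho0' := rho0.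
move=> hx; pose q (t : sd) := (L (x + val t *: ek) v - L x v) * (val t)^-1.
have [||l hl] := @cauchy_limit sd q (fun t => nc (val t)) K3.
- constructor; exists ((rho / 5)%:C).
  rewrite nc_r gtr0_norm; last lra.
  apply/andP; split; last lra.
  by apply/eqP => /(f_equal (@complex.Re _)) /=; lra.
- move=> ss tt; rewrite /q; have := valP ss; have := valP tt.
  move: (val ss) (val tt) => s t /andP[t0 tr] /andP[s0 sr].
  pose g y := (f (y + s *: ek) - f y) * s^-1 - (f (y + t *: ek) - f y) * t^-1.
  pose Lg y u := (L (y + s *: ek) u - L y u) * s^-1 - (L (y + t *: ek) u - L y u) * t^-1.
  have -> : K3 * (nc s + nc t) = 128 * (2 * K2 * (nc s + nc t)) / (rho / 8) * nm v.
    by rewrite /K3; ring.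
  apply: (@cauchy_ball _ g Lg); first lra.
  move=> y hy; have hy2 : nm (y - x0) < rho / 4.
    by rewrite -(subrK x y) -addrA; apply: le_lt_trans (nmD _ _) _; lra.
  have [[h1 h1'] _] : cfd f y (L y) /\ nc (f y) <= M by apply: hf; lra.
  have sh (u : C) : nc u < rho / 4 -> cfd f (y + u *: ek) (L (y + u *: ek)).
    move=> ur; apply: hf2; rewrite addrAC; apply: le_lt_trans (nmD _ _) _.
    by rewrite nek; lra.
  have [h2 h2'] := sh s sr; have [h3 h3'] := sh t tr.
  split.
    split; last by move=> z u; rewrite /Lg h1' h2' h3'; ring.
    apply: fd_eq (fd_add (fd_scale s^-1 (fd_add (fd_shift h2) (fd_opp h1)))
      (fd_scale (- t^-1) (fd_add (fd_shift h3) (fd_opp h1)))) => u;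
    by rewrite /g /Lg; ring.
  have est (u : C) : u != 0 -> nc u < rho / 4 ->
      nc ((f (y + u *: ek) - f y) * u^-1 - L y ek) <= 2 * K2 * nc u.
    move=> u0 ur; have := @taylor y (u *: ek) hy2; rewrite nek => /(_ ltac:(lra)).
    rewrite h1' => H; have -> : (f (y + u *: ek) - f y) * u^-1 - L y ek =
      (f (y + u *: ek) - f y - u * L y ek) * u^-1 by field.
    apply: le_trans (ncM _ _) _.
    apply: (@le_trans _ _ (K2 * nc u ^+ 2 * nc u^-1)); first by rewrite ler_wpM2r ?nc_ge0.
    have := nc_inv u0; have u1 := nc_ge0 u => H2.
    have -> : K2 * nc u ^+ 2 * nc u^-1 = (nc u * nc u^-1) * (K2 * nc u) by ring.
    have -> : 2 * K2 * nc u = 2 * (K2 * nc u) by ring.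
    by rewrite ler_wpM2r// mulr_ge0.
  have -> : g y = ((f (y + s *: ek) - f y) * s^-1 - L y ek) -
     ((f (y + t *: ek) - f y) * t^-1 - L y ek) by rewrite /g; ring.
  by apply: le_trans (ncB _ _) _; have := est s s0 sr; have := est t t0 tr; lra.
exists l => t t0 tr; have tP : (t != 0) && (nc t < rho / 4) by rewrite t0.
exact: (hl (exist _ t tP)).
Qed.

End Gradient.

End Regularity.

(** * Partial derivatives of holomorphic functions are holomorphic *)

Section Regularity2.
Context {R : realType}.
Local Notation C := R[i].

Theorem cfd_gradient m (f : 'cV[C]_m -> C) (L : 'cV[C]_m -> 'cV[C]_m -> C)
    (x0 : 'cV[C]_m) (r : R) :
  0 < r -> (forall y, nm (y - x0) < r -> cfd f y (L y)) ->
  forall v, exists l, cfd (fun y => L y v) x0 l.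
Proof.
move=> r0 hL v.
have [d d0 hd] : exists2 d : R, 0 < d & forall w, nm w < d -> nc (f (x0 + w) - f x0) < 1.
  by apply: fd_cont ltr01; apply: (hL x0 _).1; rewrite subrr nm0.
pose M : R := nc (f x0) + 1; pose rho : R := Num.min r d / 2.
have m0 : 0 < Num.min r d by rewrite lt_min r0.
have rho0 : 0 < rho by rewrite /rho; lra.
have hf y : nm (y - x0) < 2 * rho -> cfd f y (L y) /\ nc (f y) <= M.
  have -> : 2 * rho = Num.min r d by rewrite /rho; field.
  rewrite lt_min => /andP[yr yd]; split; first exact: hL.
  have := hd _ yd; rewrite [_ + (_ - _)]addrC subrK => H.
  rewrite -(subrK (f x0) (f y)); apply: le_trans (ncD _ _) _; rewrite /M; lra.
have lip (x w : 'cV[C]_m) : nm (x - x0) < rho / 4 -> nm w <= rho / 2 -> _ :=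
  @gradient_lip R m f L x0 rho M rho0 hf x w v.
have part k (x : 'cV[C]_m) : nm (x - x0) < rho / 8 -> _ :=
  @gradient_partial R m f L x0 rho M rho0 hf v k x.
cbv zeta in lip, part.
move: lip part; set K2 := 128 * (128 * M / rho) / (rho / 4).
set K3 := 128 * (2 * K2) / (rho / 8) * nm v => lip part.
have M0 : 0 <= M by rewrite /M; have := nc_ge0 (f x0); lra.
have v0 := nm_ge0 v.
have ri : 0 <= rho^-1 by rewrite invr_ge0 ltW.
have ri4 : 0 <= (rho / 4)^-1 by rewrite invr_ge0 ltW//; lra.
have ri8 : 0 <= (rho / 8)^-1 by rewrite invr_ge0 ltW//; lra.
have K20 : 0 <= K2 by rewrite /K2 !mulr_ge0.
have K30 : 0 <= K3 by rewrite /K3 !mulr_ge0.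
have nek k (t : C) : nm (t *: (delta_mx k 0 : 'cV[C]_m)) = nc t.
  rewrite /nm (bigD1 k)//= big_ord1 !mxE !eqxx mulr1 big1 ?addr0// => i ik.
  by rewrite big_ord1 !mxE (negPf ik) mulr0 nc0.
have /choice[l hl] : forall kx : 'I_m * 'cV[C]_m, exists l, nm (kx.2 - x0) < rho / 8 ->
    forall t, t != 0 -> nc t < rho / 4 ->
    nc ((L (kx.2 + t *: delta_mx kx.1 0) v - L kx.2 v) * t^-1 - l) <= 2 * (K3 * nc t).
  move=> [k x]; have [h|h] := ltP (nm (x - x0)) (rho / 8); last by exists 0.
  by have [l hl] := part k x h; exists l.
pose l0 k := l (k, x0).
(* the partial derivatives are continuous at x0, being uniform limits of
   Lipschitz difference quotients *)
have cont e : 0 < e -> exists2 d : R, 0 < d & forall k x, nm (x - x0) < d ->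
    nc (l (k, x) - l0 k) <= e.
  move=> e0; pose t := Num.min (rho / 8) (e / (8 * (K3 + 1))).
  have t0 : 0 < t by rewrite lt_min !divr_gt0//; lra.
  have tr : t <= rho / 8 by rewrite ge_min lexx.
  have te : K3 * t <= e / 8.
    have : t <= e / (8 * (K3 + 1)) by rewrite ge_min lexx orbT.
    by rewrite ler_pdivlMr; [nra|lra].
  pose b := t * e / (8 * (K2 * nm v + 1)).
  have b0 : 0 < b.
    by rewrite divr_gt0 ?mulr_gt0// ltr_wpDl// mulr_ge0.
  exists (Num.min (rho / 8) b) => [|k x]; first by rewrite lt_min b0 andbT; lra.
  rewrite lt_min => /andP[xr xb].
  have tn : t%:C != 0 :> C by apply/eqP => /(f_equal (@complex.Re _))/=; lra.
  have ntt : nc (t%:C : C) = t by rewrite nc_r gtr0_norm.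
  have h0 : nm (x0 - x0) < rho / 8 by rewrite subrr nm0; lra.
  have := hl (k, x) xr t%:C tn; have := hl (k, x0) h0 t%:C tn.
  rewrite !ntt /= => /(_ ltac:(lra)) A /(_ ltac:(lra)) B.
  set q := fun y => (L (y + t%:C *: delta_mx k 0) v - L y v) * (t%:C)^-1.
  have Q : nc (q x - q x0) <= e / 2.
    have -> : q x - q x0 = (t%:C)^-1 * ((L (x0 + t%:C *: delta_mx k 0 + (x - x0)) v
       - L (x0 + t%:C *: delta_mx k 0) v) - (L (x0 + (x - x0)) v - L x0 v)).
      have E1 : x0 + t%:C *: delta_mx k 0 + (x - x0) = x + t%:C *: delta_mx k 0.
        by rewrite addrAC [x0 + _]addrC subrK.
      have E2 : x0 + (x - x0) = x by rewrite addrC subrK.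
      by rewrite E1 E2 /q; ring.
    apply: le_trans (ncM _ _) _.
    have -> : nc ((t%:C)^-1 : C) = t^-1 by rewrite -fmorphV nc_r gtr0_norm// invr_gt0.
    rewrite mulrC ler_pdivrMr//; apply: le_trans (ncB _ _) _.
    have h1 : nm (x0 + t%:C *: delta_mx k 0 - x0) < rho / 4.
      by rewrite addrAC subrr add0r nek ntt; lra.
    have := lip _ (x - x0) h1 ltac:(lra); have := lip x0 (x - x0) ltac:(lra) ltac:(lra).
    have : K2 * nm (x - x0) * nm v <= t * e / 8.
      have -> : K2 * nm (x - x0) * nm v = (K2 * nm v) * nm (x - x0) by ring.
      have c0 : 0 <= K2 * nm v by rewrite mulr_ge0.
      apply: (@le_trans _ _ ((K2 * nm v + 1) * b)).
        by apply: ler_pM; rewrite ?nm_ge0// ?ltW//; lra.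
      by rewrite /b le_eqVlt; apply/orP; left; apply/eqP; field; lra.
    by move=> *; nra.
  have -> : l (k, x) - l0 k = (q x - q x0) - (q x - l (k, x)) + (q x0 - l (k, x0)).
    by rewrite /l0; ring.
  apply: le_trans (ncD _ _) _; have := ncB (q x - q x0) (q x - l (k, x)).
  rewrite /q in A B Q *; lra.
exists (fun w => \sum_k w k 0 * l0 k); split; last first.
  by move=> z w; rewrite mulr_sumr; apply: eq_bigr => k _; rewrite mxE mulrA.
apply: (@fd_partials R m (fun y => L y v) x0 (fun k t => t * l0 k)).
- by move=> k z w; ring.
- by move=> k s z; ring.
move=> e e0; have [b b0 hb] := cont (e / 2) ltac:(lra).
pose c := Num.min (rho / 4) (e / (4 * (K3 + 1))).
have c0 : 0 < c by rewrite lt_min !divr_gt0//; lra.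
exists (Num.min (rho / 8) (Num.min b c)) => [|k x t].
  by rewrite !lt_min b0 !divr_gt0//; lra.
rewrite !lt_min => /and3P[xr xb xc] /and3P[tr tb /andP[t4 te]].
have [->|t0] := eqVneq t 0.
  by rewrite scale0r addr0 subrr mul0r subr0 nc0 mulr0.
have A := hl (k, x) xr t t0 t4; have B := hb k x xb.
have t1 := nc_ge0 t.
have C1 : 2 * (K3 * nc t) <= e / 2.
  by move: te; rewrite ltr_pdivlMr; [nra|lra].
have -> : L (x + t *: delta_mx k 0) v - L x v - t * l0 k =
  t * (((L (x + t *: delta_mx k 0) v - L x v) * t^-1 - l (k, x)) + (l (k, x) - l0 k)).
  by rewrite /l0; field.
apply: le_trans (ncM _ _) _; rewrite mulrC ler_wpM2r//.
apply: le_trans (ncD _ _) _; rewrite /= in A; lra.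
Qed.

End Regularity2.

(** * Comparison with the derivatives of the normed module *)

Section Bridge.
Context {R : realType}.
Local Notation C := R[i].

Lemma norm_nc (z : C) : `|z| <= (nc z)%:C.
Proof.
rewrite {1}(creim z); apply: le_trans (ler_normD _ _) _.
have nr (x : R) : `|x%:C : C| = (`|x|)%:C.
  by rewrite normc_def /= expr0n /= addr0 sqrtr_sqr.
have -> : `|'i * (complex.Im z)%:C : C| = (`|complex.Im z|)%:C.
  rewrite normrM nr; have -> : `|'i : C| = 1.
    by rewrite normc_def /= expr0n /= add0r expr1n sqrtr1.
  by rewrite mul1r.
by rewrite nr -rmorphD /= lecR.
Qed.

Lemma nc_norm (z : C) : (nc z)%:C <= 2 * `|z|.
Proof.
have h1 : (`|complex.Re z|)%:C <= `|z| by apply: normc_ge_Re.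
have h2 : (`|complex.Im z|)%:C <= `|z|.
  by rewrite normc_def lecR -sqrtr_sqr ler_wsqrtr// lerDr sqr_ge0.
by rewrite /nc rmorphD /= mulr_natl mulr2n lerD.
Qed.

Lemma gt0C (e : C) : 0 < e -> exists2 r : R, 0 < r & e = r%:C.
Proof.
rewrite ltcE /= => /andP[/eqP e1 e2]; exists (complex.Re e) => //.
by apply: cE.
Qed.

Lemma norm_realC p q (A : 'M[C]_(p, q)) : exists2 r : R, 0 <= r & `|A| = r%:C.
Proof.
have : 0 <= `|A| by apply: normr_ge0.
rewrite lecE /= => /andP[/eqP e1 e2]; exists (complex.Re `|A|) => //.
by apply: cE.
Qed.

Lemma mx_norm_lt p q (A : 'M[C]_(p, q)) (r : R) : 0 < r ->
  (`|A| < r%:C) <-> forall i j, `|A i j| < r%:C.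
Proof.
move=> r0; have E : ball 0 r%:C (- A) <-> `|A| < r%:C.
  by rewrite mx_norm_ball /ball_ /= sub0r opprK.
split=> [/E [_ h] i j|h].
  by have := h i j; rewrite /ball /= !mxE sub0r opprK.
apply/E; split; first by rewrite ltcR.
by move=> i j; rewrite /ball /= !mxE sub0r opprK; apply: h.
Qed.

Lemma norm_entry p q (A : 'M[C]_(p, q)) i j : `|A i j| <= `|A|.
Proof.
have [a a0 aE] := norm_realC A.
have : 0 <= `|A i j| by [].
rewrite lecE /= => /andP[/eqP e1 e2].
have bE : `|A i j| = (complex.Re `|A i j|)%:C by apply: cE.
rewrite aE bE lecR leNgt; apply/negP => ab.
have b0 : 0 < complex.Re `|A i j| by apply: le_lt_trans ab.
have : `|A| < (complex.Re `|A i j|)%:C by rewrite aE ltcR.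
by move=> /(mx_norm_lt _ b0) /(_ i j); rewrite -bE ltxx.
Qed.

Lemma norm_nm p q (A : 'M[C]_(p, q)) : `|A| <= (nm A)%:C.
Proof.
have [a a0 aE] := norm_realC A; rewrite aE lecR; apply/ler_addgt0Pr => e e0.
have h : `|A| < (nm A + e)%:C.
  apply/mx_norm_lt; first by have := nm_ge0 A; lra.
  move=> i j; apply: le_lt_trans (norm_nc _) _; rewrite ltcR.
  by have := nm_le A i j; lra.
by move: h; rewrite aE ltcR => /ltW.
Qed.

Lemma nm_norm p q (A : 'M[C]_(p, q)) : (nm A)%:C <= (2 * (p * q)%:R) * `|A|.
Proof.
have [a a0 aE] := norm_realC A.
have -> : (2 * (p * q)%:R) * `|A| = (2 * (p * q)%:R * a)%:C :> C.
  by rewrite aE !rmorphM /= !rmorph_nat.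
rewrite lecR.
have -> : 2 * (p * q)%:R * a = (p * q)%:R * (2 * a) :> R by ring.
apply: nm_bound => i j.
have := le_trans (nc_norm (A i j)) (ler_wpM2l (ler0n _ 2) (norm_entry A i j)).
by rewrite aE -(rmorph_nat (real_complex R) 2) -rmorphM lecR.
Qed.

Lemma nbhs_nm m (x : 'cV[C]_m) (P : set 'cV[C]_m) :
  nbhs x P <-> exists2 d : R, 0 < d & forall w, nm w < d -> P (x + w).
Proof.
split=> [/nbhs_ballP[e /= /gt0C[r r0 ->] h]|[d d0 h]].
  exists r => // w wr; apply: h; rewrite mx_norm_ball /ball_ /= opprD addNKr normrN.
  by apply: le_lt_trans (norm_nm w) _; rewrite ltcR.
apply/nbhs_ballP; pose e : R := d / (2 * (m * 1)%:R + 1).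
have p0 : (0 : R) <= (m * 1)%:R by apply: ler0n.
have e0 : 0 < e by rewrite divr_gt0//; lra.
exists (e%:C) => /=; first by rewrite ltcR.
move=> y; rewrite mx_norm_ball /ball_ /= => hy.
have -> : y = x + (y - x) by rewrite addrC subrK.
apply: h; have := nm_norm (y - x); rewrite -normrN opprB.
have [a a0 aE] := norm_realC (x - y); rewrite aE in hy *.
have -> : (2 * (m * 1)%:R) * a%:C = (2 * (m * 1)%:R * a)%:C :> C.
  by rewrite !rmorphM /= !rmorph_nat.
rewrite lecR; rewrite ltcR in hy => H; apply: le_lt_trans H _.
apply: (@le_lt_trans _ _ (2 * (m * 1)%:R * e)).
  by apply: ler_wpM2l; [lra|exact: ltW].
by rewrite /e mulrA ltr_pdivrMr; [lra|lra].
Qed.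

Lemma open_nm m (D : set 'cV[C]_m) x : open D -> D x ->
  exists2 d : R, 0 < d & forall w, nm w < d -> D (x + w).
Proof. by move=> oD Dx; apply/nbhs_nm; apply: open_nbhs_nbhs. Qed.

Lemma cont_nm m (V : normedModType R) (g : 'cV[C]_m -> V) x :
  {for x, continuous g} <-> forall e : R, 0 < e -> exists2 d : R, 0 < d &
    forall w, nm w < d -> `|g (x + w) - g x| <= e.
Proof.
have P := @cvgrPdist_le R V _ (nbhs x) (nbhs_filter x) g (g x).
split=> [/P h e /h /nbhs_nm[d d0 hd]|h].
  by exists d => // w /hd; rewrite distrC.
apply/P => e /h[d d0 hd]; apply/nbhs_nm; exists d => // w /hd.
by rewrite distrC.
Qed.

Lemma diff_fdm m p (f : 'cV[C]_m -> 'cV[C]_p) x : differentiable f x ->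
  exists A : 'M[C]_(p, m), fdm f x (fun w => A *m w).
Proof.
move=> df; pose A : 'M[C]_(p, m) := \matrix_(i, j) ('d f x (delta_mx j 0)) i 0.
have AE w : 'd f x w = A *m w.
  apply/matrixP => i j; rewrite ord1 {1}[w]matrix_sum_delta !mxE.
  rewrite linear_sum summxE; apply: eq_bigr => k _; rewrite big_ord1 linearZ /=.
  by rewrite !mxE mulrC.
exists A => i j; split.
  by split=> *; rewrite ?mulmxDr -?scalemxAr mxE.
move=> e e0; have /eqaddoP h := diff_locally df.
have e20 : (0 : C) < (e / 2)%:C by rewrite ltcR; lra.
have /nbhs_nm[d d0 hd] := h _ e20; exists d => // w /hd.
rewrite add0r /= -[(_ - _) w]/(f (w + x) - (f x + 'd f x w)) AE [w + x]addrC => H.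
rewrite -lecR; apply: le_trans (nc_norm _) _.
set u := f (x + w) - (f x + A *m w) in H.
have -> : f (x + w) i j - f x i j - (A *m w) i j = u i j by rewrite /u !mxE; ring.
apply: (@le_trans _ _ (2 * `|u|)); first by rewrite ler_wpM2l// norm_entry.
apply: (@le_trans _ _ (2 * ((e / 2)%:C * (nm w)%:C))).
  rewrite ler_wpM2l//; apply: le_trans H _; rewrite ler_wpM2l ?norm_nm//.
  exact: ltW.
have -> : (e * nm w)%:C = 2 * ((e / 2)%:C * (nm w)%:C) :> C.
  by rewrite -(rmorph_nat (real_complex R) 2) -!rmorphM; congr (_%:C); field.
by [].
Qed.

Lemma fdm_diff m p (f : 'cV[C]_m -> 'cV[C]_p) x (A : 'M[C]_(p, m)) :
  fdm f x (fun w => A *m w) -> differentiable f x.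
Proof.
move=> h; have cA : continuous (mulmx A : 'cV[C]_m -> 'cV[C]_p).
  move=> y U /= /nbhs_nm[d d0 hd]; apply/nbhs_nm.
  have A0 := nm_ge0 A.
  exists (d / (nm A + 1)); first by rewrite divr_gt0//; lra.
  move=> w wd; rewrite /= mulmxDr; apply: hd; apply: le_lt_trans (nmM _ _) _.
  by move: wd; have := nm_ge0 w; rewrite ltr_pdivlMr; [nra|lra].
pose lA : {linear 'cV[C]_m -> 'cV[C]_p} := mulmx A.
have := @diff_unique C 'cV[C]_m 'cV[C]_p f lA x cA.
set E := (X in (X -> _) -> _) => dE; have hE : E.
  rewrite /E; apply/eqaddoP => e /gt0C[r r0 ->].
  have r10 : 0 < r / (2 * (p * 1)%:R + 1).
    by rewrite divr_gt0// ltr_wpDl// mulr_ge0.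
  apply/nbhs_nm.
    have m0 : (0 : R) < 2 * (m * 1)%:R + 1 by rewrite ltr_wpDl// mulr_ge0.
    have r20 : 0 < r / (2 * (m * 1)%:R + 1) by rewrite divr_gt0.
    have [d d0 hd] := fdm_small h r20.
    exists d => // w /hd; rewrite add0r.
    rewrite -[(_ - _) w]/(f (w + x) - (f x + A *m w)) [w + x]addrC opprD addrA => H.
    apply: le_trans (norm_nm _) _; rewrite -lecR in H; apply: le_trans H _.
    have [a a0 aE] := norm_realC w.
    have := nm_norm w; rewrite aE.
    have -> : (2 * (m * 1)%:R) * a%:C = (2 * (m * 1)%:R * a)%:C :> C.
      by rewrite !rmorphM /= !rmorph_nat.
    have -> : r%:C * a%:C = (r * a)%:C :> C by rewrite rmorphM.
    rewrite !lecR => H'; apply: (@le_trans _ _ (r / (2 * (m * 1)%:R + 1) * (2 * (m * 1)%:R * a))).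
      by apply: ler_wpM2l => //; exact: ltW.
    by rewrite mulrAC ler_pdivrMr//; nra.
by apply/diff_locallyP; rewrite (dE hE).
Qed.

Lemma derive_cfd m (f : 'cV[C]_m -> C) x l v : cfd f x l -> 'D_v f x = l v.
Proof.
move=> [[r h] lz]; apply: cvg_lim; first exact: norm_hausdorff.
apply/cvgrPdist_le => e /gt0C[e' e'0 ->].
have v0 := nm_ge0 v.
have [d d0 hd] := h (e' / (2 * (nm v + 1))) ltac:(by rewrite divr_gt0//; lra).
rewrite near_withinE; apply/nbhs_ballP; exists ((d / (nm v + 1) / 2)%:C) => /=.
  by rewrite ltcR !divr_gt0//; lra.
move=> t; rewrite /ball /= sub0r normrN => td t0.
have td' : nc t < d / (nm v + 1).
  rewrite -ltcR; apply: le_lt_trans (nc_norm t) _.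
  have -> : (d / (nm v + 1))%:C = 2 * (d / (nm v + 1) / 2)%:C :> C.
    by rewrite -(rmorph_nat (real_complex R) 2) -rmorphM; congr (_%:C); field; lra.
  by rewrite ltr_pM2l.
have B := nmZ t v; have t1 := nc_ge0 t.
move: td'; rewrite ltr_pdivlMr; last lra.
move=> td'; have {hd} := hd (t *: v) ltac:(lra); rewrite lz [x + _]addrC => H.
apply: le_trans (norm_nc _) _; rewrite lecR.
have -> : l v - t^-1 *: (f (t *: v + x) - f x) = - (t^-1 * (f (t *: v + x) - f x - t * l v)).
  by rewrite -[t^-1 *: _]/(t^-1 * _); field.
rewrite ncN; apply: le_trans (ncM _ _) _.
have H2 := nc_inv t0; have t2 := nc_ge0 t^-1.
apply: (@le_trans _ _ (nc t^-1 * (e' / (2 * (nm v + 1)) * (nc t * nm v)))).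
  rewrite ler_wpM2l//; apply: le_trans H _; rewrite ler_wpM2l//.
  by rewrite divr_ge0//; lra.
have -> : nc t^-1 * (e' / (2 * (nm v + 1)) * (nc t * nm v)) =
  (nc t * nc t^-1) * (e' * (nm v / (2 * (nm v + 1)))) by ring.
apply: (@le_trans _ _ (2 * (e' * (nm v / (2 * (nm v + 1)))))).
  by rewrite ler_wpM2r// !mulr_ge0// ?invr_ge0; lra.
have -> : 2 * (e' * (nm v / (2 * (nm v + 1)))) = e' * (nm v / (nm v + 1)) by field; lra.
by rewrite ger_pMr// ler_pdivrMr; lra.
Qed.

End Bridge.

(** * Functions of class C^k over the reals *)

Section RealSmooth.
Context {R : realType}.
Local Notation C := R[i].

Lemma rder_rdiff m (V : normedModType R) (g : 'cV[C]_m -> V) v x l :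
  rder (fun t : R => g (x + t%:C *: v)) 0 l ->
  derivable (fun t : R => g (x + t%:C *: v)) 0 1 /\ rdiff v g x = l.
Proof. by move=> /rderP[h <-]; rewrite /rdiff derive1E. Qed.

Lemma derivable_rder m (V : normedModType R) (g : 'cV[C]_m -> V) v x :
  derivable (fun t : R => g (x + t%:C *: v)) 0 1 ->
  rder (fun t : R => g (x + t%:C *: v)) 0 (rdiff v g x).
Proof. by move=> h; apply/rderP; rewrite /rdiff derive1E; exact: derivableP. Qed.

Lemma fd_rder m (f : 'cV[C]_m -> C) x l v (phi : C -> R) :
  (forall a b, phi (a - b) = phi a - phi b) -> (forall (r : R) a, phi (r%:C * a) = r * phi a) ->
  (forall a, `|phi a| <= nc a) -> fd f x l ->
  rder (fun t : R => phi (f (x + t%:C *: v))) 0 (phi (l v)).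
Proof.
move=> pB pZ pn [r h] e e0; have v0 := nm_ge0 v.
have [d d0 hd] := h (e / (nm v + 1)) ltac:(by rewrite divr_gt0//; lra).
exists (d / (nm v + 1)); first by rewrite divr_gt0//; lra.
move=> s; rewrite subr0 ltr_pdivlMr; last lra.
move=> sd; have s0 := normr_ge0 s; have := hd (s%:C *: v).
rewrite nmrZ => /(_ ltac:(lra)) H; rewrite scale0r addr0 -[s *: _]/(s * _) -pZ -r.2 -!pB.
apply: le_trans (pn _) _; apply: le_trans H _.
have -> : e / (nm v + 1) * (`|s| * nm v) = (e * `|s|) * (nm v / (nm v + 1)) by ring.
by apply: ler_piMr; [rewrite mulr_ge0// ltW|rewrite ler_pdivrMr; lra].
Qed.

Lemma fd_rderRe m (f : 'cV[C]_m -> C) x l v : fd f x l ->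
  rder (fun t : R => complex.Re (f (x + t%:C *: v))) 0 (complex.Re (l v)).
Proof.
apply: fd_rder => [a b|r a|a]; first by rewrite !reim.
  by rewrite !reim mul0r subr0.
exact: nc_Re.
Qed.

Lemma fd_rderIm m (f : 'cV[C]_m -> C) x l v : fd f x l ->
  rder (fun t : R => complex.Im (f (x + t%:C *: v))) 0 (complex.Im (l v)).
Proof.
apply: fd_rder => [a b|r a|a]; first by rewrite !reim.
  by rewrite !reim mul0r addr0.
exact: nc_Im.
Qed.

Lemma fd_rdiff m (f : 'cV[C]_m -> C) x l v : fd f x l ->
  rdiff v (fun y => complex.Re (f y)) x = complex.Re (l v) /\
  rdiff v (fun y => complex.Im (f y)) x = complex.Im (l v).
Proof.
move=> h; split.
  exact: (@rder_rdiff _ _ (fun y => complex.Re (f y)) _ _ _ (fd_rderRe v h)).2.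
exact: (@rder_rdiff _ _ (fun y => complex.Im (f y)) _ _ _ (fd_rderIm v h)).2.
Qed.

Lemma fdm_rdiff m p q (F : 'cV[C]_m -> 'M[C]_(p, q)) x L v : fdm F x L ->
  rdiff_mx v F x = L v.
Proof.
move=> h; apply/matrixP => i j; rewrite mxE; have [-> ->] := fd_rdiff v (h i j).
by case: (L v i j).
Qed.

Lemma c1_step m (g : 'cV[C]_m -> R) (y b : 'cV[C]_m) (a q e : R) (p : R -> R) :
  (forall s, 0 <= s <= 1 -> rder (fun t : R => g (y + (s * a)%:C *: b + t%:C *: b)) 0 (p s) /\
     `|p s - q| <= e) ->
  `|g (y + a%:C *: b) - g y - a * q| <= e * `|a|.
Proof.
move=> h.
pose K s := (g (y + (s * a)%:C *: b) - s * a * q)%:C : C.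
pose k s := (a * (p s - q))%:C : C.
have P : prim 0 1 K k.
  move=> s hs e1 e10; have a0 := normr_ge0 a.
  have [hr _] := h s hs.
  have [d d0 hd] := hr (e1 / (`|a| + 1)) ltac:(by rewrite divr_gt0//; lra).
  exists (d / (`|a| + 1)); first by rewrite divr_gt0//; lra.
  move=> s' _; rewrite ltr_pdivlMr; last lra.
  move=> sd; have s0 := normr_ge0 (s' - s).
  have := hd ((s' - s) * a); rewrite subr0 normrM => /(_ ltac:(lra)).
  have E : y + (s * a)%:C *: b + ((s' - s) * a)%:C *: b = y + (s' * a)%:C *: b.
    by rewrite -addrA -scalerDl -rmorphD /=; congr (_ + _%:C *: _); ring.
  rewrite scale0r addr0 E => H; rewrite /K /k -!rmorphB -rmorphM -rmorphB nc_r.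
  set A := g _; set B := g _.
  have -> : A - s' * a * q - (B - s * a * q) - (s' - s) * (a * (p s - q)) =
    A - B - ((s' - s) * a) *: p s by rewrite -[_ *: p s]/(_ * p s); ring.
  apply: le_trans H _.
  have -> : e1 / (`|a| + 1) * (`|s' - s| * `|a|) = (e1 * `|s' - s|) * (`|a| / (`|a| + 1)) by ring.
  by apply: ler_piMr; [rewrite mulr_ge0// ltW|rewrite ler_pdivrMr; lra].
have := @prim_bound _ _ _ _ _ (e * `|a|) ler01 P.
rewrite /K /k subr0 mulr1 mul0r scale0r addr0 !mul0r subr0 !mul1r -rmorphB nc_r addrAC.
apply=> t /h[_ ht]; rewrite nc_r normrM mulrC ler_wpM2r//.
Qed.

Lemma cont_rdiff m (V : normedModType R) k D (g : 'cV[C]_m -> V) v x :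
  Ck_on k.+1 D g -> D x -> {for x, continuous (rdiff v g)}.
Proof. by move=> [_ /(_ v)[_ ]]; case: k => [|k] [h _]; apply: h. Qed.

Lemma Ck_derivable m (V : normedModType R) k D (g : 'cV[C]_m -> V) v x :
  Ck_on k.+1 D g -> D x -> rder (fun t : R => g (x + t%:C *: v)) 0 (rdiff v g x).
Proof. by move=> [_ /(_ v)[h _]] Dx; apply/derivable_rder/h. Qed.

Lemma subtract_increments (A1 A2 A3 A4 p1 p2 z e t : R) :
  `|A1 - A3 - z * p1| <= e / 2 * t -> `|A2 - A4 - z * p2| <= e / 2 * t ->
  `|A2 - A1 - (A4 - A3) - z * (p2 - p1)| <= e * t.
Proof.
move=> H1 H2; have -> : A2 - A1 - (A4 - A3) - z * (p2 - p1) =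
  (A2 - A4 - z * p2) - (A1 - A3 - z * p1) by ring.
by apply: le_trans (ler_normB _ _) _; lra.
Qed.

Lemma two_step_error (p1 p2 p3 p4 p5 t1 t2 a b : R) : `|p4 - p5 - t1 * p1| <= a ->
  `|p3 - p4 - t2 * p2| <= b -> `|p3 - p5 - (t1 * p1 + t2 * p2)| <= a + b.
Proof.
move=> ha hb; apply: le_trans (lerD ha hb).
have -> : p3 - p5 - (t1 * p1 + t2 * p2) = (p4 - p5 - t1 * p1) + (p3 - p4 - t2 * p2) by ring.
exact: ler_normD.
Qed.

(** Continuous partial derivatives give a Frechet derivative. *)
Lemma fd_C1 m k (D : set 'cV[C]_m) (g : 'cV[C]_m -> R) x : open D -> Ck_on k.+1 D g -> D x ->
  fd (fun y => (g y)%:C) x (fun w => (rdiff w g x)%:C).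
Proof.
move=> oD gC Dx.
pose lam (k : 'I_m) z : C := (complex.Re z * rdiff (delta_mx k 0) g x +
  complex.Im z * rdiff ('i *: delta_mx k 0) g x)%:C.
suff h : fd (fun y => (g y)%:C) x (fun w => \sum_k lam k (w k 0)).
  apply: fd_eq (h) => // w; have [+ _] := fd_rdiff w h.
  move=> -> /=; rewrite -[LHS]/((complex.Re _)%:C); apply: cE => //=.
  by rewrite Im_sum big1.
apply: fd_partials => [j z w|j r z|e e0].
- rewrite /lam; move: (rdiff _ g x) (rdiff _ g x) => a b.
  by apply: cE; rewrite !reim; ring.
- rewrite /lam; move: (rdiff _ g x) (rdiff _ g x) => a b.
  by apply: cE; rewrite !reim; ring.
have [d d0 hd] := open_nm oD Dx.
have cts v : exists d : R, 0 < d /\ forall w, nm w < d -> `|rdiff v g (x + w) - rdiff v g x| <= e.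
  have /cont_nm/(_ e e0)[c c0 hc] := cont_rdiff (v := v) gC Dx.
  by exists c.
have /choice[d1 hd1] := fun j : 'I_m => cts (delta_mx j 0).
have /choice[d2 hd2] := fun j : 'I_m => cts ('i *: delta_mx j 0).
pose c := \big[Num.min/d]_j Num.min (d1 j) (d2 j).
have c0 : 0 < c.
  by apply: lt_bigmin => // j _; rewrite lt_min (hd1 j).1 (hd2 j).1.
have cd : c <= d by apply: bigmin_le_id.
have cc j : c <= Num.min (d1 j) (d2 j) by apply: bigmin_le_cond.
have c1 j : c <= d1 j by have := cc j; rewrite le_min => /andP[].
have c2 j : c <= d2 j by have := cc j; rewrite le_min => /andP[].
exists (c / 3); first lra.
move=> j y t yx tc.
set b1 := delta_mx j 0 : 'cV[C]_m; set b2 := 'i *: delta_mx j 0 : 'cV[C]_m.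
have nb1 (s : R) : nm (s%:C *: b1) = `|s|.
  rewrite nmrZ /nm (bigD1 j)//= big_ord1 !mxE !eqxx nc1 big1 ?addr0 ?mulr1// => i ij.
  by rewrite big_ord1 !mxE (negPf ij) nc0.
have nb2 (s : R) : nm (s%:C *: b2) = `|s|.
  rewrite nmrZ /nm (bigD1 j)//= big_ord1 !mxE !eqxx mulr1 nci big1 ?addr0 ?mulr1// => i ij.
  by rewrite big_ord1 !mxE (negPf ij) mulr0 nc0.
have tR := nc_Re t; have tI := nc_Im t.
have S1 : `|g (y + (complex.Re t)%:C *: b1) - g y - complex.Re t * rdiff b1 g x| <=
    e * `|complex.Re t|.
  apply: (@c1_step _ _ _ _ _ _ _ (fun s => rdiff b1 g (y + (s * complex.Re t)%:C *: b1))).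
  move=> s /andP[s0 s1].
  have n1 : nm (y + (s * complex.Re t)%:C *: b1 - x) < c.
    rewrite addrAC; apply: le_lt_trans (nmD _ _) _; rewrite nb1 normrM ger0_norm//.
    have := normr_ge0 (complex.Re t); nra.
  have E : y + (s * complex.Re t)%:C *: b1 = x + (y + (s * complex.Re t)%:C *: b1 - x).
    by rewrite [RHS]addrC subrK.
  split; first by apply: Ck_derivable gC _; rewrite E; apply: hd; lra.
  by rewrite {1}E; apply: (hd1 j).2; apply: lt_le_trans n1 _.
have S2 : `|g (y + (complex.Re t)%:C *: b1 + (complex.Im t)%:C *: b2)
     - g (y + (complex.Re t)%:C *: b1) - complex.Im t * rdiff b2 g x| <= e * `|complex.Im t|.
  apply: (@c1_step _ _ _ _ _ _ _ (fun s => rdiff b2 g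
     (y + (complex.Re t)%:C *: b1 + (s * complex.Im t)%:C *: b2))).
  move=> s /andP[s0 s1]; set y1 := y + _ *: b1.
  have n1 : nm (y1 + (s * complex.Im t)%:C *: b2 - x) < c.
    rewrite /y1 addrAC; apply: le_lt_trans (nmD _ _) _; rewrite nb2 normrM ger0_norm//.
    rewrite addrAC; have := nmD (y - x) ((complex.Re t)%:C *: b1); rewrite nb1.
    have := normr_ge0 (complex.Im t); nra.
  have E : y1 + (s * complex.Im t)%:C *: b2 = x + (y1 + (s * complex.Im t)%:C *: b2 - x).
    by rewrite [RHS]addrC subrK.
  split; first by apply: Ck_derivable gC _; rewrite E; apply: hd; lra.
  by rewrite {1}E; apply: (hd2 j).2; apply: lt_le_trans n1 _.
have -> : y + t *: delta_mx j 0 = y + (complex.Re t)%:C *: b1 + (complex.Im t)%:C *: b2.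
  by rewrite -addrA /b2 scalerA -scalerDl [_ * 'i]mulrC -creim.
rewrite /lam -/b1 -/b2 -!rmorphB nc_r [in leRHS]/nc mulrDr.
exact: two_step_error S1 S2.
Qed.

Lemma Ck_le m (V : normedModType R) k D (g : 'cV[C]_m -> V) : Ck_on k.+1 D g -> Ck_on k D g.
Proof.
elim: k g => [|k IH] g; first by case.
move=> [c h]; split=> // v; have [h1 h2] := h v; split=> //; exact: IH.
Qed.

Lemma Ck_cont m (V : normedModType R) k D (g : 'cV[C]_m -> V) : Ck_on k D g ->
  forall x, D x -> {for x, continuous g}.
Proof. by case: k => [|k] []. Qed.

Lemma rdiff_ext m (V : normedModType R) (D : set 'cV[C]_m) (f g : 'cV[C]_m -> V) v x :
  open D -> D x -> (forall y, D y -> f y = g y) ->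
  derivable (fun t : R => f (x + t%:C *: v)) 0 1 ->
  derivable (fun t : R => g (x + t%:C *: v)) 0 1 /\ rdiff v g x = rdiff v f x.
Proof.
move=> oD Dx fg; have [d d0 hd] := open_nm oD Dx.
have v0 := nm_ge0 v.
pose c := d / (nm v + 1); have c0 : 0 < c by rewrite divr_gt0//; lra.
have near s : `|s| < c -> f (x + s%:C *: v) = g (x + s%:C *: v).
  rewrite ltr_pdivlMr; last lra.
  by move=> sc; apply/fg/hd; rewrite nmrZ; have := normr_ge0 s; nra.
move=> /derivable_rder h; apply: rder_rdiff => e /h[b b0 hb].
exists (Num.min b c); first by rewrite lt_min b0.
move=> s; rewrite lt_min => /andP[/hb + sc].
by rewrite !near// ?normr0//; move: sc; rewrite subr0.
Qed.

Lemma cont_ext m (V : normedModType R) (D : set 'cV[C]_m) (f g : 'cV[C]_m -> V) x :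
  open D -> D x -> (forall y, D y -> f y = g y) ->
  {for x, continuous f} -> {for x, continuous g}.
Proof.
move=> oD Dx fg /cont_nm h; apply/cont_nm => e /h[d d0 hd].
have [c c0 hc] := open_nm oD Dx; exists (Num.min d c); first by rewrite lt_min d0.
move=> w; rewrite lt_min => /andP[wd wc].
by rewrite -(fg _ (hc _ wc)) -(fg _ Dx); exact: hd.
Qed.

Lemma Ck_ext m (V : normedModType R) (D : set 'cV[C]_m) k (f g : 'cV[C]_m -> V) :
  open D -> (forall y, D y -> f y = g y) -> Ck_on k D f -> Ck_on k D g.
Proof.
move=> oD; elim: k f g => [|k IH] f g fg [c h].
  by split=> // x Dx; apply: cont_ext fg _ => //; apply: c.
split=> [x Dx|v]; first by apply: cont_ext fg _ => //; apply: c.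
have [h1 h2] := h v; split=> [x Dx|]; first by apply: (rdiff_ext oD Dx fg _).1; apply: h1.
apply: IH h2 => y Dy; apply/esym; apply: (rdiff_ext oD Dy fg _).2; exact: h1.
Qed.

Lemma rder_add (f g : R -> R) t l k : rder f t l -> rder g t k -> rder (fun s => f s + g s) t (l + k).
Proof. by move=> /rderP h /rderP h'; apply/rderP; apply: is_deriveD. Qed.

Lemma rder_mul (f g : R -> R) t l k : rder f t l -> rder g t k ->
  rder (fun s => f s * g s) t (l * g t + f t * k).
Proof.
move=> /rderP h /rderP h'; apply/rderP.
by apply: is_derive_eq (is_deriveM h h') _; rewrite -![_ *: _]/(_ * _); ring.
Qed.

Lemma Ck_cst m k D (c : R) : Ck_on k D (fun _ : 'cV[C]_m => c).
Proof.
elim: k c => [|k IH] c; first by split=> // x _; exact: cst_continuous.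
split=> [x _|v]; first exact: cst_continuous.
split=> [x _|]; first exact: derivable_cst.
have -> : rdiff v (fun _ : 'cV[C]_m => c) = fun=> 0; last exact: IH.
by apply: funext => y; rewrite /rdiff derive1_cst.
Qed.

Lemma Ck_add m k (D : set 'cV[C]_m) (f g : 'cV[C]_m -> R) : open D ->
  Ck_on k D f -> Ck_on k D g -> Ck_on k D (fun y => f y + g y).
Proof.
move=> oD; elim: k f g => [|k IH] f g [cf hf] [cg hg].
  split=> // x Dx; exact: (cvgD (cf x Dx) (cg x Dx)).
split=> [x Dx|v]; first by exact: (cvgD (cf x Dx) (cg x Dx)).
have [f1 f2] := hf v; have [g1 g2] := hg v.
have key x : D x -> derivable (fun t : R => f (x + t%:C *: v) + g (x + t%:C *: v)) 0 1 /\
    rdiff v (fun y => f y + g y) x = rdiff v f x + rdiff v g x.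
  move=> Dx; apply: (@rder_rdiff _ _ (fun y => f y + g y)); apply: rder_add;
  apply: derivable_rder; [exact: f1|exact: g1].
split=> [x /key[]//|]; apply: Ck_ext (IH _ _ f2 g2) => // y /key[_ ->] //.
Qed.

Lemma Ck_mul m k (D : set 'cV[C]_m) (f g : 'cV[C]_m -> R) : open D ->
  Ck_on k D f -> Ck_on k D g -> Ck_on k D (fun y => f y * g y).
Proof.
move=> oD; elim: k f g => [|k IH] f g Hf Hg; have [cf hf] := Hf; have [cg hg] := Hg.
  split=> // x Dx; exact: (cvgM (cf x Dx) (cg x Dx)).
split=> [x Dx|v]; first by exact: (cvgM (cf x Dx) (cg x Dx)).
have [f1 f2] := hf v; have [g1 g2] := hg v.
have key x : D x -> derivable (fun t : R => f (x + t%:C *: v) * g (x + t%:C *: v)) 0 1 /\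
    rdiff v (fun y => f y * g y) x = rdiff v f x * g x + f x * rdiff v g x.
  move=> Dx; apply: (@rder_rdiff _ _ (fun y => f y * g y)).
  have := rder_mul (derivable_rder (f1 x Dx)) (derivable_rder (g1 x Dx)).
  by rewrite scale0r addr0.
split=> [x /key[]//|].
apply: Ck_ext (Ck_add oD (IH _ _ f2 (Ck_le Hg)) (IH _ _ (Ck_le Hf) g2)) => // y /key[_ ->] //.
Qed.

Lemma Ck_sum m k (D : set 'cV[C]_m) I (r : seq I) (F : I -> 'cV[C]_m -> R) : open D ->
  (forall i, Ck_on k D (F i)) -> Ck_on k D (fun y => \sum_(i <- r) F i y).
Proof.
move=> oD h; elim: r => [|i r IH].
  by apply: Ck_ext (Ck_cst k D 0) => // y _; rewrite big_nil.
by apply: Ck_ext (Ck_add oD (h i) IH) => // y _; rewrite big_cons.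
Qed.

Lemma hol_Ck m (D : set 'cV[C]_m) (f : 'cV[C]_m -> C) L k : open D ->
  (forall x, D x -> cfd f x (L x)) ->
  Ck_on k D (fun y => complex.Re (f y)) /\ Ck_on k D (fun y => complex.Im (f y)).
Proof.
move=> oD; elim: k f L => [|k IH] f L h.
  have cts x (phi : C -> R) : D x -> (forall a b, phi (a - b) = phi a - phi b) ->
      (forall a, `|phi a| <= nc a) -> {for x, continuous (fun y => phi (f y))}.
    move=> Dx pB pn; apply/cont_nm => e e0; have [d d0 hd] := fd_cont (h x Dx).1 e0.
    by exists d => // w /hd; rewrite -pB => H; apply: le_trans (pn _) (ltW H).
  split; split=> // x Dx; apply: cts => //.
  - by move=> a b; rewrite !reim.
  - exact: nc_Re.
  - by move=> a b; rewrite !reim.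
  - exact: nc_Im.
have c1 x : D x -> _ := fun Dx => (h x Dx).1.
have [/Ck_cont cR /Ck_cont cI] := IH f L h.
have next v : exists M, forall x, D x -> cfd (fun y => L y v) x (M x).
  have : forall x, exists l : 'cV[C]_m -> C, D x -> cfd (fun y => L y v) x l.
    move=> x; have [Dx|nDx] := pselect (D x); last by exists (fun=> 0).
    have [d d0 hd] := open_nm oD Dx.
    have [|l hl] := @cfd_gradient R m f L x d d0 _ v; last by exists l.
    by move=> y yd; apply: h; rewrite -(subrK x y) addrC; apply: hd.
  by move=> /choice[M hM]; exists M.
split; split=> // v; have [M hM] := next v; have [IR II] := IH _ _ hM; split.
- move=> x Dx.
  exact: (@rder_rdiff _ _ (fun y => complex.Re (f y)) _ _ _ (fd_rderRe v (h x Dx).1)).1.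
- by apply: Ck_ext IR => // y Dy; have [-> _] := fd_rdiff v (h y Dy).1.
- move=> x Dx.
  exact: (@rder_rdiff _ _ (fun y => complex.Im (f y)) _ _ _ (fd_rderIm v (h x Dx).1)).1.
- by apply: Ck_ext II => // y Dy; have [_ ->] := fd_rdiff v (h y Dy).1.
Qed.

(* The double difference of g along v and w is s^2 times the mixed derivative, up to
   o(s^2); it is symmetric in v and w. *)
Lemma mixed_difference m (D : set 'cV[C]_m) (g : 'cV[C]_m -> R) x v w e : open D ->
  Ck_on 2 D g -> D x -> 0 < e -> exists2 d : R, 0 < d & forall s, 0 < s -> s < d ->
  `|g (x + s%:C *: v + s%:C *: w) - g (x + s%:C *: v) - g (x + s%:C *: w) + g x -
    s ^+ 2 * rdiff w (rdiff v g) x| <= e * s ^+ 2.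
Proof.
move=> oD gC Dx e0; have v0 := nm_ge0 v; have w0 := nm_ge0 w.
have C1 : Ck_on 1 D (rdiff v g) by have [_ /(_ v)[]] := gC.
have [[r1 r2] h] := fd_C1 oD C1 Dx.
pose K := 2 * (nm v + nm w + 1).
have [d d0 hd] := h (e / K) ltac:(by rewrite divr_gt0// /K; lra).
have [c c0 hc] := open_nm oD Dx.
pose q := Num.min d c / (nm v + nm w + 1).
have q0 : 0 < q by rewrite divr_gt0 ?lt_min ?d0//; lra.
exists q => // s s0; rewrite ltr_pdivlMr; last lra.
rewrite lt_min => /andP[sd sc].
pose p u := rdiff v g (x + s%:C *: w + (u * s)%:C *: v) - rdiff v g (x + (u * s)%:C *: v).
pose G y := g (y + s%:C *: w) - g y.
have := @c1_step _ G x v s (s * rdiff w (rdiff v g) x) (e * s) p.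
have -> : G (x + s%:C *: v) - G x - s * (s * rdiff w (rdiff v g) x) =
  g (x + s%:C *: v + s%:C *: w) - g (x + s%:C *: v) - g (x + s%:C *: w) + g x -
    s ^+ 2 * rdiff w (rdiff v g) x by rewrite /G; ring.
have -> : e * s * `|s| = e * s ^+ 2 by rewrite gtr0_norm//; ring.
apply=> u /andP[u0 u1].
have n1 : nm ((u * s)%:C *: v) <= s * nm v.
  by rewrite nmrZ ger0_norm ?mulr_ge0 ?(ltW s0)// ler_wpM2r//; nra.
have n2 : nm (s%:C *: w) = s * nm w by rewrite nmrZ gtr0_norm.
have n3 := nmD (s%:C *: w) ((u * s)%:C *: v).
have sv : 0 <= s * nm v by rewrite mulr_ge0// ltW.
have sw : 0 <= s * nm w by rewrite mulr_ge0// ltW.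
have g1 : D (x + (u * s)%:C *: v) by apply: hc; lra.
have g2 : D (x + s%:C *: w + (u * s)%:C *: v) by rewrite -addrA; apply: hc; lra.
split.
  have A := Ck_derivable v (Ck_le gC) g1; have B := Ck_derivable v (Ck_le gC) g2.
  move=> e1 e10; have [a a0 ha] := A (e1 / 2) ltac:(lra); have [b b0 hb] := B (e1 / 2) ltac:(lra).
  exists (Num.min a b); first by rewrite lt_min a0.
  move=> t; rewrite lt_min => /andP[/ha H1 /hb H2]; rewrite /G /p.
  have E z : x + (u * s)%:C *: v + z%:C *: v + s%:C *: w = 
    x + s%:C *: w + (u * s)%:C *: v + z%:C *: v.
    by rewrite addrAC [x + _ + _ in LHS]addrAC.
  rewrite !E.
  exact: subtract_increments H1 H2.
have H1 := hd ((u * s)%:C *: v) ltac:(lra).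
have H2 := hd (s%:C *: w + (u * s)%:C *: v) ltac:(lra).
have E1 : (rdiff (s%:C *: w + (u * s)%:C *: v) (rdiff v g) x)%:C =
    s%:C * (rdiff w (rdiff v g) x)%:C + (rdiff ((u * s)%:C *: v) (rdiff v g) x)%:C :> C.
  exact: etrans (r1 _ _) (f_equal (fun z => z + _) (r2 _ _)).
have E3 : x + (s%:C *: w + (u * s)%:C *: v) = x + s%:C *: w + (u * s)%:C *: v := addrA _ _ _.
rewrite E3 E1 in H2.
have e1 : 0 <= e / K by rewrite divr_ge0 ?(ltW e0)// /K; lra.
rewrite -nc_r /p.
move: H1 H2; move: (rdiff v g (x + (u * s)%:C *: v)) => a1.
move: (rdiff v g (x + s%:C *: w + (u * s)%:C *: v)) => a2.
move: (rdiff v g x) (rdiff w (rdiff v g) x) (rdiff _ (rdiff v g) x) => a0 l k H1 H2.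
have -> : (a2 - a1 - s * l)%:C = (a2%:C - a0%:C - (s%:C * l%:C + k%:C))
   - (a1%:C - a0%:C - k%:C) :> C.
  by rewrite !rmorphB rmorphM /=; ring.
apply: le_trans (ncB _ _) _; apply: le_trans (lerD H2 H1) _.
rewrite -mulrDr; apply: (@le_trans _ _ (e / K * (K * s))).
  by apply: ler_wpM2l => //; rewrite /K; lra.
by rewrite le_eqVlt; apply/orP; left; apply/eqP; field; rewrite /K; lra.
Qed.

Theorem clairaut m (D : set 'cV[C]_m) (g : 'cV[C]_m -> R) x v w : open D ->
  Ck_on 2 D g -> D x -> rdiff w (rdiff v g) x = rdiff v (rdiff w g) x.
Proof.
move=> oD gC Dx; apply/eqP; rewrite -subr_eq0 -normr_eq0 eq_le normr_ge0 andbT.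
apply/ler_addgt0Pr => e e0; rewrite add0r.
have [d d0 hd] := mixed_difference v w oD gC Dx (e := e / 2) ltac:(lra).
have [c c0 hc] := mixed_difference w v oD gC Dx (e := e / 2) ltac:(lra).
pose s := Num.min d c / 2; have m0 : 0 < Num.min d c by rewrite lt_min d0.
have s0 : 0 < s by rewrite /s; lra.
have : s < Num.min d c by rewrite /s; lra.
rewrite lt_min => /andP[/(hd _ s0) A /(hc _ s0) B].
rewrite -(ler_pM2l (x := s ^+ 2)) ?exprn_gt0// -{1}(ger0_norm (x := s ^+ 2)) ?sqr_ge0//.
rewrite -normrM; move: A B; rewrite [x + _ *: w + _]addrAC.
move: (rdiff w _ _) (rdiff v _ _) => p q.
move: (g _) (g _) (g _) (g _) => a c' b gx A B.
have -> : s ^+ 2 * (p - q) = (gx - c' - b + a - s ^+ 2 * q) - (gx - b - c' + a - s ^+ 2 * p).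
  by ring.
by apply: le_trans (ler_normB _ _) _; have -> : s ^+ 2 * e = e / 2 * s ^+ 2 + e / 2 * s ^+ 2;
  [field|rewrite lerD].
Qed.

End RealSmooth.

(** * Linear differential equations on a square *)

Section HolomorphicODE.
Context {R : realType}.
Local Notation C := R[i].
Implicit Types (f g : C -> C).

Definition osq (z0 : C) (s : R) (z : C) :=
  `|complex.Re z - complex.Re z0| < s /\ `|complex.Im z - complex.Im z0| < s.

Lemma Pr_open f z0 s : 0 < s -> (forall z, osq z0 s z -> exists l, cder f z l) ->
  forall z, osq z0 s z ->
  cder (Pr f (complex.Re z0) (complex.Im z0)) z (f z) /\
  forall M, (forall w, osq z0 s w -> nc (f w) <= M) ->
    nc (Pr f (complex.Re z0) (complex.Im z0) z) <= M * nc (z - z0).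
Proof.
move=> s0 hf z [zr zi].
pose m := Num.max `|complex.Re z - complex.Re z0| `|complex.Im z - complex.Im z0|.
have m1 : `|complex.Re z - complex.Re z0| <= m by rewrite le_max lexx.
have m2 : `|complex.Im z - complex.Im z0| <= m by rewrite le_max lexx orbT.
have ms : m < s by rewrite gt_max zr.
pose t := (m + s) / 2.
have t0 : 0 < t by rewrite /t; have := normr_ge0 (complex.Re z - complex.Re z0); lra.
have ts : t < s by rewrite /t; lra.
have mt : m < t by rewrite /t; lra.
move: m1 m2; rewrite !ler_norml => /andP[a1 a2] /andP[b1 b2].
have [p Ep] : exists p, complex.Re z0 = p by exists (complex.Re z0).
have [q Eq] : exists q, complex.Im z0 = q by exists (complex.Im z0).
rewrite Ep Eq in a1 a2 b1 b2 *.
have inO x y : p - t <= x <= p + t -> q - t <= y <= q + t -> osq z0 s (Complex x y).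
  move=> /andP[? ?] /andP[? ?]; rewrite /osq /= Ep Eq !ltr_norml.
  by split; apply/andP; split; lra.
have H : hol_on f (p - t) (p + t) (q - t) (q + t).
  by move=> x y hx hy; apply/hf/inO.
have hp : p - t <= p <= p + t by apply/andP; split; lra.
have hq : q - t <= q <= q + t by apply/andP; split; lra.
split; first by apply: (Pr_cder H hp hq); apply/andP; split; lra.
move=> M hM.
have -> : z0 = Complex p q by apply: cE.
by apply: (Pr_bound H hp hq) => [x y hx hy| |]; [apply/hM/inO| |]; apply/andP; split; lra.
Qed.

Lemma cder_mv f z h M (l : C -> C) :
  (forall t : R, 0 <= t <= 1 -> cder f (z + t%:C * h) (l (z + t%:C * h)) /\
     nc (l (z + t%:C * h)) <= M) -> nc (f (z + h) - f z) <= M * nc h.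
Proof.
move=> H; pose F (v : 'cV[C]_1) := f (v 0 0).
have E t : (const_mx z + t *: const_mx h : 'cV[C]_1) = const_mx (z + t * h).
  by apply/matrixP => i j; rewrite !mxE.
have := @mean_value R 1 F (fun v w => l (v 0 0) * w 0 0) (const_mx z) (const_mx h) (M * nc h).
rewrite /F !mxE; apply=> t /H[h1 h2]; rewrite E; split.
  by rewrite mxE; apply/cder_fd.
by rewrite !mxE; apply: le_trans (ncM _ _) _; rewrite ler_wpM2r ?nc_ge0.
Qed.

Lemma convex_lt (a b t lo : R) : lo < a -> lo < a + b -> 0 <= t -> t <= 1 -> lo < a + t * b.
Proof. by move=> h1 h2 t0 t1; have [b0|b0] := leP 0 b; nra. Qed.

Lemma osq_segment z0 s z h t : osq z0 s z -> osq z0 s (z + h) -> 0 <= t <= 1 ->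
  osq z0 s (z + t%:C * h).
Proof.
move=> [a1 a2] [b1 b2] /andP[t0 t1]; move: a1 a2 b1 b2.
rewrite /osq !reim !mul0r subr0 addr0 !ltr_norml.
move=> /andP[h1 h2] /andP[h3 h4] /andP[h5 h6] /andP[h7 h8].
have A1 := @convex_lt (complex.Re z - complex.Re z0) (complex.Re h) t (- s) ltac:(lra) ltac:(lra) t0 t1.
have A2 := @convex_lt (complex.Re z0 - complex.Re z) (- complex.Re h) t (- s) ltac:(lra) ltac:(lra) t0 t1.
have A3 := @convex_lt (complex.Im z - complex.Im z0) (complex.Im h) t (- s) ltac:(lra) ltac:(lra) t0 t1.
have A4 := @convex_lt (complex.Im z0 - complex.Im z) (- complex.Im h) t (- s) ltac:(lra) ltac:(lra) t0 t1.
by split; apply/andP; split; lra.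
Qed.

Lemma osq_open z0 s z : osq z0 s z -> exists2 d : R, 0 < d & forall h, nc h < d -> osq z0 s (z + h).
Proof.
move=> [a1 a2]; pose d := Num.min (s - `|complex.Re z - complex.Re z0|) (s - `|complex.Im z - complex.Im z0|).
exists d; first by rewrite lt_min !subr_gt0 a1.
move=> h; rewrite lt_min => /andP[h1 h2]; have := nc_Re h; have := nc_Im h => H1 H2.
rewrite /osq !reim; split.
  by rewrite addrAC; apply: le_lt_trans (ler_normD _ _) _; lra.
by rewrite addrAC; apply: le_lt_trans (ler_normD _ _) _; lra.
Qed.

(* Uniform convergence of the derivatives passes to the limit. *)
Lemma cder_limit z0 s (S dS : nat -> C -> C) (F G : C -> C) (c : nat -> R) :
  (forall e : R, 0 < e -> exists n0, forall n, (n0 <= n)%N -> c n < e) ->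
  (forall n z, osq z0 s z -> [/\ cder (S n) z (dS n z), nc (S n z - F z) <= c n &
     nc (dS n z - G z) <= c n]) ->
  forall z, osq z0 s z -> cder F z (G z).
Proof.
move=> hc H z hz e e0.
have [N hN] := hc (e / 8) ltac:(lra).
have cN : c N < e / 8 by apply: hN.
have [dz Fz Gz] := H N z hz.
have [d d0 hd] := dz (e / 4) ltac:(lra).
have [d' d'0 hd'] := osq_open hz.
exists (Num.min d d') => [|h]; first by rewrite lt_min d0.
rewrite lt_min => /andP[/hd A /hd' hzh].
have h0 := nc_ge0 h.
have B : nc ((F (z + h) - S N (z + h)) - (F z - S N z)) <= e / 4 * nc h.
  apply/ler_addgt0Pr => e1 e10.
  have [M hM] := hc (e1 / 2) ltac:(lra).
  pose k := maxn N M.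
  have ck1 : c k < e / 8 by apply: hN; exact: leq_maxl.
  have ck2 : c k < e1 / 2 by apply: hM; exact: leq_maxr.
  have D : nc ((S k (z + h) - S N (z + h)) - (S k z - S N z)) <= e / 4 * nc h.
    apply: (@cder_mv (fun w => S k w - S N w) z h (e / 4) (fun w => dS k w - dS N w)).
    move=> t ht; have ho := osq_segment hz hzh ht.
    have [k1 _ k3] := H k _ ho; have [n1 _ n3] := H N _ ho; split.
      apply: cder_eq (cder_add k1 (cder_mul (cder_cst (-1) _) n1)).
        by move=> w; rewrite mulN1r.
      by rewrite mul0r add0r mulN1r.
    have := ncB (dS k (z + t%:C * h) - G (z + t%:C * h)) (dS N (z + t%:C * h) - G (z + t%:C * h)).
    rewrite opprB addrA subrK; lra.
  have [_ f1 _] := H k _ hz; have [_ f2 _] := H k _ hzh.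
  have -> : (F (z + h) - S N (z + h)) - (F z - S N z) =
    ((S k (z + h) - S N (z + h)) - (S k z - S N z)) - ((S k (z + h) - F (z + h)) - (S k z - F z)).
    by ring.
  apply: le_trans (ncB _ _) _; have := ncB (S k (z + h) - F (z + h)) (S k z - F z); lra.
have -> : F (z + h) - F z - G z * h = ((F (z + h) - S N (z + h)) - (F z - S N z)) +
  ((S N (z + h) - S N z - dS N z * h) + (dS N z - G z) * h) by ring.
apply: le_trans (ncD _ _) _.
have := ncD (S N (z + h) - S N z - dS N z * h) ((dS N z - G z) * h).
have : nc ((dS N z - G z) * h) <= e / 8 * nc h.
  by apply: le_trans (ncM _ _) _; rewrite ler_wpM2r//; lra.
have := mulr_ge0 (ltW e0) h0; lra.
Qed.

Lemma unitmx_near1 n (A : 'M[C]_n) : nm (A - 1%:M) < 1 -> A \in unitmx.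
Proof.
move=> h; rewrite -row_free_unit; apply/row_freeP/row_freeP.
rewrite -kermx_eq0; apply/eqP/row_matrixP => i; rewrite row0; apply: nm_eq0.
have : row i (kermx A) *m A = 0 by apply/sub_kermxP; exact: row_sub.
move: (row i (kermx A)) => u uA.
have : nm u <= nm u * nm (A - 1%:M).
  by apply: le_trans (nmM _ _); rewrite mulmxBr uA mulmx1 sub0r nmN.
have := nm_ge0 u; nra.
Qed.

Definition cderm {p q} (F : C -> 'M[C]_(p, q)) z (L : 'M[C]_(p, q)) :=
  forall i j, cder (fun w => F w i j) z (L i j).

Lemma cder_sum I (r : seq I) (F : I -> C -> C) z L : (forall i, cder (F i) z (L i)) ->
  cder (fun w => \sum_(i <- r) F i w) z (\sum_(i <- r) L i).
Proof.
move=> h; elim: r => [|i r IH].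
  by apply: cder_eq (cder_cst 0 z) => [w|]; rewrite big_nil.
by apply: cder_eq (cder_add (h i) IH) => [w|]; rewrite big_cons.
Qed.

Lemma cderm_mul p q r (F : C -> 'M[C]_(p, q)) (G : C -> 'M[C]_(q, r)) z L K :
  cderm F z L -> cderm G z K -> cderm (fun w => F w *m G w) z (L *m G z + F z *m K).
Proof.
move=> h k i j.
apply: cder_eq (cder_sum (index_enum 'I_q) (fun s => cder_mul (h i s) (k s j))).
  by move=> w; rewrite mxE.
by rewrite !mxE big_split.
Qed.

Section Picard.
Context {n : nat} (phi : C -> 'M[C]_n) (z0 : C) (r : R) (r0 : 0 < r).
Hypothesis hphi : forall z, osq z0 r z -> exists A, cderm phi z A.

Let bounded : exists s B : R, [/\ 0 < s, s <= r, 0 < B & forall z, osq z0 s z -> nm (phi z) <= B].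
Proof.
have r0' := r0.
have o0 : osq z0 r z0 by rewrite /osq !subrr !normr0.
have [A hA] := hphi o0.
have h (ij : 'I_n * 'I_n) : exists d : R, 0 < d /\ forall h, nc h < d ->
    nc (phi (z0 + h) ij.1 ij.2 - phi z0 ij.1 ij.2) <= 1.
  by have [d ? ?] := cder_cont (hA ij.1 ij.2) ltr01; exists d.
have /choice[d hd] := h.
pose s0 := \big[Num.min/r]_ij d ij.
have s00 : 0 < s0 by apply: lt_bigmin => // ij _; case: (hd ij).
have sr : s0 <= r by apply: bigmin_le_id.
pose B : R := nm (phi z0) + (n * n)%:R.
exists (s0 / 2), (B + 1); split; [lra|lra| |].
  have : 0 <= B by rewrite addr_ge0 ?nm_ge0// ler0n.
  lra.
move=> z [z1 z2].
have zE : z = z0 + (z - z0) by rewrite [RHS]addrC subrK.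
have nz : nc (z - z0) < s0 by rewrite /nc !reim; lra.
apply: (@le_trans _ _ B); last lra.
rewrite -(subrK (phi z0) (phi z)); apply: le_trans (nmD _ _) _; rewrite addrC lerD2l.
rewrite -[leRHS]mulr1; apply: nm_bound => i j.
have := (hd (i, j)).2 (z - z0); rewrite /= -zE !mxE; apply.
by apply: lt_le_trans nz _; apply: bigmin_le_cond.
Qed.

Theorem picard : exists2 rho : R, 0 < rho & exists F : C -> 'M[C]_n,
  F z0 = 1%:M /\ forall z, osq z0 rho z -> cderm F z (F z *m phi z) /\ F z \in unitmx.
Proof.
have [s1 [B [s10 s1r B0 hB]]] := bounded.
pose D : R := (n * n)%:R + 1.
have D0 : 0 < D by rewrite /D ltr_wpDl.
have DB : 0 < 4 * (D * B) by rewrite !mulr_gt0.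
pose s := Num.min s1 (1 / (4 * (D * B))).
have s0 : 0 < s by rewrite lt_min s10 divr_gt0.
have ss1 : s <= s1 by rewrite ge_min lexx.
have sDB : D * B * (2 * s) <= 1 / 2.
  have : s <= 1 / (4 * (D * B)) by rewrite ge_min lexx orbT.
  by rewrite ler_pdivlMr//; lra.
have osub t z : t <= r -> osq z0 t z -> osq z0 r z.
  by move=> tr [? ?]; split; lra.
have osub1 z : osq z0 s z -> osq z0 s1 z by move=> [? ?]; split; lra.
pose p := complex.Re z0; pose q := complex.Im z0.
pose T (F : C -> 'M[C]_n) z : 'M[C]_n := \matrix_(i, j) Pr (fun w => (F w *m phi w) i j) p q z.
pose Fk k := iter k T (fun=> 1%:M).
pose N : R := nm (1%:M : 'M[C]_n).
have N0 : 0 <= N by apply: nm_ge0.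
have step k : (forall w, osq z0 s w -> exists A, cderm (Fk k) w A) ->
    forall i j w, osq z0 s w -> exists l, cder (fun w => (Fk k w *m phi w) i j) w l.
  move=> IH i j w hw; have [A hA] := IH w hw.
  have [A' hA'] := hphi (osub _ _ s1r (osub1 _ hw)).
  by eexists; apply: (cderm_mul hA hA' i j).
have dstep k : (forall w, osq z0 s w -> exists A, cderm (Fk k) w A) ->
    forall z, osq z0 s z -> cderm (Fk k.+1) z (Fk k z *m phi z).
  move=> IH z hz i j; have [h _] := Pr_open s0 (step k IH i j) hz.
  by apply: cder_eq h => // w; rewrite /Fk iterS mxE.
have Fhol k : forall z, osq z0 s z -> exists A, cderm (Fk k) z A.
  elim: k => [|k IH] z hz; last by exists (Fk k z *m phi z); apply: dstep.
  exists 0 => i j; have -> : (0 : 'M[C]_n) i j = 0 by rewrite mxE.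
  exact: cder_cst.
have Fb k z : osq z0 s z -> nm (Fk k z) <= N / 2 ^+ k.
  elim: k z => [|k IH] z hz; first by rewrite expr0 divr1.
  apply: (@le_trans _ _ ((n * n)%:R * (N / 2 ^+ k * B * (2 * s)))).
    apply: nm_bound => i j; rewrite /Fk iterS mxE.
    have [_ h] := Pr_open s0 (step k (Fhol k) i j) hz.
    apply: le_trans (h (N / 2 ^+ k * B) _) _.
      move=> w hw; apply: le_trans (nm_le _ i j) _; apply: le_trans (nmM _ _) _.
      by apply: ler_pM; rewrite ?nm_ge0 ?IH ?hB//; exact: osub1.
    rewrite ler_wpM2l ?mulr_ge0 ?invr_ge0 ?exprn_ge0 ?(ltW B0)//.
    by move: hz => [? ?]; rewrite /nc !reim; lra.
  have -> : (n * n)%:R * (N / 2 ^+ k * B * (2 * s)) = N / 2 ^+ k * ((n * n)%:R * B * (2 * s)) by ring.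
  have -> : N / 2 ^+ k.+1 = N / 2 ^+ k * (1 / 2) by rewrite exprS invfM; ring.
  rewrite ler_wpM2l ?mulr_ge0 ?invr_ge0 ?exprn_ge0//.
  apply: le_trans sDB; rewrite !ler_wpM2r ?mulr_ge0 ?(ltW s0) ?(ltW B0)//.
  by rewrite /D lerDl.
pose S k z := \sum_(l < k.+1) Fk l z.
have SS k z : S k.+1 z = S k z + Fk k.+1 z by rewrite /S big_ord_recr.
have tail k l z : osq z0 s z -> nm (S (k + l)%N z - S k z) <= N / 2 ^+ k - N / 2 ^+ (k + l).
  move=> hz; elim: l => [|l IH]; first by rewrite addn0 !subrr nm0.
  rewrite addnS SS addrAC; apply: le_trans (nmD _ _) _.
  have := Fb (k + l).+1 z hz.
  have -> : N / 2 ^+ (k + l).+1 = N / 2 ^+ (k + l) / 2 by rewrite exprS invfM; ring.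
  lra.
have cauchy k l z : osq z0 s z -> nm (S k z - S l z) <= N / 2 ^+ k + N / 2 ^+ l.
  move=> hz; have pos m : 0 <= N / 2 ^+ m by rewrite mulr_ge0 ?invr_ge0 ?exprn_ge0.
  have h a b : nm (S (a + b)%N z - S a z) <= N / 2 ^+ a.
    by have := tail a b z hz; have := pos (a + b)%N; lra.
  case/orP: (leq_total k l) => kl.
    by rewrite -(subnKC kl) nmBC; have := h k (l - k)%N; have := pos (k + (l - k))%N; lra.
  by rewrite -(subnKC kl); have := h l (k - l)%N; have := pos (l + (k - l))%N; lra.
have lims z : exists A : 'M[C]_n, osq z0 s z -> forall k i j,
    nc (S k z i j - A i j) <= 2 * (N / 2 ^+ k).
  have [hz|nz] := pselect (osq z0 s z); last by exists 0.
  have : forall ij : 'I_n * 'I_n, exists l, forall k, nc (S k z ij.1 ij.2 - l) <= 2 * (N / 2 ^+ k).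
    move=> ij; have [k l|a ha] := @cauchy_limit R nat (fun k => S k z ij.1 ij.2)
      (fun k => (2 ^+ k)^-1) N (inhabits 0%N); last by exists a.
    rewrite mulrDr; apply: le_trans (cauchy k l z hz).
    by have := nm_le (S k z - S l z) ij.1 ij.2; rewrite !mxE.
  move=> /choice[a ha]; exists (\matrix_(i, j) a (i, j)) => _ k i j.
  by rewrite mxE; apply: (ha (i, j)).
have /choice[F hF] := lims.
have small (c : R) : 0 <= c -> forall e : R, 0 < e -> exists n0, forall m, (n0 <= m)%N -> c / 2 ^+ m < e.
  move=> c0 e e0; have [n0 h] := half_power_small c e0; exists n0 => m nm'.
  apply: le_lt_trans h; rewrite ler_wpM2l// lef_pV2 ?posrE ?exprn_gt0//.
  by rewrite ler_eXn2l// ltr1n.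
(* the value at the centre: all iterates but the first vanish there *)
have F0 : F z0 = 1%:M.
  have hz0 : osq z0 s z0 by rewrite /osq !subrr !normr0.
  have Sz0 k : S k z0 = 1%:M.
    elim: k => [|k IH]; first by rewrite /S big_ord1.
    rewrite SS IH; apply/matrixP => i j; rewrite mxE /Fk iterS [X in _ + X]mxE.
    have -> : z0 = Complex p q by apply: cE.
    by rewrite Pr_base addr0.
  apply/matrixP => i j; apply/eqP; rewrite -subr_eq0; apply/eqP/nc_eq0/eqP.
  rewrite eq_le nc_ge0 andbT; apply/ler_addgt0Pr => e e0; rewrite add0r.
  have [n0 h] := small (2 * N) ltac:(lra) e e0.
  rewrite ncBC; have := hF z0 hz0 n0 i j; rewrite Sz0 => H; apply: le_trans H _.
  by rewrite mulrA ltW// h.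
have Fd z : osq z0 s z -> cderm F z (F z *m phi z).
  move=> hz i j.
  pose c k : R := 4 * (N * (B + 1)) / 2 ^+ k.
  have NB : 0 <= N * (B + 1) by rewrite mulr_ge0// addr_ge0// ltW.
  apply: (@cder_limit z0 s (fun k w => S k.+1 w i j) (fun k w => (S k w *m phi w) i j)
    (fun w => F w i j) (fun w => (F w *m phi w) i j) (fun k => D * c k)) hz.
    move=> e e0; have [|n0 h] := small (D * (4 * (N * (B + 1)))) _ e e0.
      by apply: mulr_ge0; [exact: ltW|apply: mulr_ge0].
    by exists n0 => m /h; rewrite /c !mulrA.
  move=> k w hw; have pos : 0 <= (2 ^+ k)^-1 :> R by rewrite invr_ge0 exprn_ge0.
  have D1 : 1 <= D by rewrite /D lerDr ler0n.
  have key m : nc (S m w i j - F w i j) <= 2 * (N / 2 ^+ m) by apply: hF.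
  split.
  - apply: cder_eq (cder_add (cder_cst ((Fk 0%N w) i j) w)
      (cder_sum (index_enum 'I_k.+1) (fun l => dstep l (Fhol l) w hw i j))).
      move=> u; have -> : S k.+1 u = Fk 0%N u + \sum_(l < k.+1) Fk l.+1 u.
        by rewrite /S big_ord_recl.
      by rewrite [RHS]mxE; congr (_ + _); rewrite summxE.
    by rewrite add0r /S mulmx_suml summxE.
  - apply: le_trans (key _) _; rewrite /c exprS invfM.
    have X0 : 0 <= N / 2 ^+ k by rewrite mulr_ge0.
    have -> : 2 * (N * (2^-1 / 2 ^+ k)) = N / 2 ^+ k by field; rewrite expf_neq0.
    have -> : D * (4 * (N * (B + 1)) / 2 ^+ k) = (D * (4 * (B + 1))) * (N / 2 ^+ k) by ring.
    by rewrite ler_peMl//; nra.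
  have -> : (S k w *m phi w) i j - (F w *m phi w) i j = ((S k w - F w) *m phi w) i j.
    by rewrite mulmxBl !mxE.
  apply: le_trans (nm_le _ i j) _; apply: le_trans (nmM _ _) _.
  have X0 : 0 <= N / 2 ^+ k by rewrite mulr_ge0.
  have b1 : nm (S k w - F w) <= D * (2 * (N / 2 ^+ k)).
    apply: (@le_trans _ _ ((n * n)%:R * (2 * (N / 2 ^+ k)))).
      by apply: nm_bound => i' j'; rewrite !mxE; apply: hF.
    by rewrite ler_wpM2r ?mulr_ge0// /D lerDl.
  apply: (@le_trans _ _ (D * (2 * (N / 2 ^+ k)) * B)).
    by apply: ler_pM; rewrite ?nm_ge0//; apply/hB/osub1.
  have -> : D * c k = D * (2 * (N / 2 ^+ k)) * (2 * (B + 1)) by rewrite /c; ring.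
  by rewrite ler_wpM2l ?mulr_ge0 ?(ltW D0)//; lra.
have hz0 : osq z0 s z0 by rewrite /osq !subrr !normr0.
(* F is continuous and F z0 = 1, so it stays invertible near z0 *)
have Dn : 0 < 1 / (D + D) by rewrite divr_gt0//; lra.
have hc (ij : 'I_n * 'I_n) : exists d : R, 0 < d /\ forall h, nc h < d ->
    nc (F (z0 + h) ij.1 ij.2 - F z0 ij.1 ij.2) <= 1 / (D + D).
  by have [d ? ?] := cder_cont (Fd z0 hz0 ij.1 ij.2) Dn; exists d.
have /choice[d hd] := hc.
pose t := \big[Num.min/s]_ij d ij.
have t0 : 0 < t by apply: lt_bigmin => // ij _; case: (hd ij).
have ts : t <= s by apply: bigmin_le_id.
exists (t / 2); first lra.
exists F; split=> // z hz; split.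
  by apply: Fd; move: hz => [? ?]; split; lra.
apply: unitmx_near1; rewrite -F0.
have zE : z = z0 + (z - z0) by rewrite [RHS]addrC subrK.
have nz : nc (z - z0) < t by move: hz => [? ?]; rewrite /nc !reim; lra.
apply: (@le_lt_trans _ _ ((n * n)%:R * (1 / (D + D)))).
  apply: nm_bound => i j; have := (hd (i, j)).2 (z - z0); rewrite /= -zE !mxE; apply.
  by apply: lt_le_trans nz _; apply: bigmin_le_cond.
by rewrite mulrA mulr1 ltr_pdivrMr ?mul1r /D; have := ler0n R (n * n)%N; lra.
Qed.

End Picard.

End HolomorphicODE.

(** * Monodromy on simply connected spaces *)

Section PathContinuity.
Context {R : realType} {T : topologicalType}.

Definition pcont (g : R -> T) := forall t, 0 <= t <= 1 -> forall O, nbhs (g t) O ->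
  exists2 d : R, 0 < d & forall s, 0 <= s <= 1 -> `|s - t| < d -> O (g s).

Definition scont (H : R -> R -> T) := forall s t, 0 <= s <= 1 -> 0 <= t <= 1 ->
  forall O, nbhs (H s t) O -> exists2 d : R, 0 < d & forall s' t', 0 <= s' <= 1 ->
   0 <= t' <= 1 -> `|s' - s| < d -> `|t' - t| < d -> O (H s' t').

Lemma pcontP (g : R -> T) : {within `[0, 1], continuous g} <-> pcont g.
Proof.
split=> [/subspace_continuousP h t ht O hO|h].
  have /= := h t; rewrite in_itv /= => /(_ ht O hO).
  rewrite /= /within /= => /nbhs_ballP[d /= d0 hd]; exists d => // s hs sd.
  by apply: hd; rewrite ?in_itv// /ball /= distrC.
apply/subspace_continuousP => t /=; rewrite in_itv /= => ht O hO.
have [d d0 hd] := h t ht O hO; apply/nbhs_ballP; exists d => // s.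
by rewrite /ball /= distrC => sd; rewrite in_itv /= => hs; apply: hd.
Qed.

Lemma scontP (H : R * R -> T) : {within `[0, 1] `*` `[0, 1], continuous H} ->
  scont (fun s t => H (s, t)).
Proof.
move=> /subspace_continuousP h s t hs ht O hO.
have /= := h (s, t); rewrite !in_itv /= => /(_ (conj hs ht) O hO).
rewrite /= /within /= => /nbhs_ballP[d /= d0 hd]; exists d => // s' t' hs' ht' sd td.
by apply: (hd (s', t')); rewrite ?in_itv//; split; rewrite /ball /= distrC.
Qed.

End PathContinuity.

Section Monodromy.
Context {R : realType} {T : topologicalType} {N : nat}.
Local Notation mx := 'M[R[i]]_N.
Context (Sol : T -> (T -> mx) -> Prop).

Hypothesis Sol_ex : forall p, exists s, Sol p s.
Hypothesis Sol_unit : forall p s, Sol p s -> s p \in unitmx.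
Hypothesis Sol_open : forall p s, Sol p s -> \forall q \near p, Sol q s.
Hypothesis Sol_unique : forall p s1 s2, Sol p s1 -> Sol p s2 ->
  exists2 A, A \in unitmx & \forall q \near p, s2 q = A *m s1 q.
Hypothesis Sol_mul : forall p s A, Sol p s -> A \in unitmx -> Sol p (fun q => A *m s q).
Hypothesis Sol_germ : forall p s s', Sol p s -> (\forall q \near p, s' q = s q) -> Sol p s'.
Hypothesis small_paths : forall p (V : set T), nbhs p V -> \forall q \near p,
  exists g : R -> T, [/\ pcont g, g 0 = p, g 1 = q & forall t, 0 <= t <= 1 -> V (g t)].

Lemma locally_constant (X : Type) (g : R -> X) (a b : R) : a <= b ->
  (forall t, a <= t <= b -> exists2 d : R, 0 < d & forall s, a <= s <= b ->
     `|s - t| < d -> g s = g t) -> g a = g b.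
Proof.
move=> ab h; apply: (@cousin1 R (fun a b => g a = g b)) => // [? ? _ -> //|t ht].
have [d d0 hd] := h t ht; exists d => // u v au /andP[ut tv] vb uv.
by rewrite (hd u) ?(hd v) //; rewrite ?ler_norml ?ltr_norml; apply/andP; split; lra.
Qed.

Definition flat_at (H : R -> R -> T) (W : R -> R -> mx) a b c d s t :=
  exists2 sg, Sol (H s t) sg & exists2 e : R, 0 < e & forall s' t',
    a <= s' <= b -> c <= t' <= d -> `|s' - s| < e -> `|t' - t| < e ->
    W s' t' = sg (H s' t').

Definition flat (H : R -> R -> T) (W : R -> R -> mx) a b c d :=
  forall s t, a <= s <= b -> c <= t <= d -> flat_at H W a b c d s t.

Lemma Sol_eq p s1 s2 : Sol p s1 -> Sol p s2 -> s1 p = s2 p ->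
  \forall q \near p, s2 q = s1 q.
Proof.
move=> h1 h2 e; have [A _ hA] := Sol_unique h1 h2.
have A1 : A = 1%:M.
  have := nbhs_singleton hA; rewrite -e => /(f_equal (mulmx^~ (invmx (s1 p)))).
  by rewrite mulmxV ?mulmxK ?Sol_unit.
by apply: filterS hA => q ->; rewrite A1 mul1mx.
Qed.

Lemma flat_glue H W1 W2 a m b c d : scont H -> 0 <= a -> a <= m -> m <= b -> b <= 1 ->
  0 <= c -> c <= d -> d <= 1 ->
  flat H W1 a m c d -> flat H W2 m b c d -> exists W, flat H W a b c d.
Proof.
move=> Hc a0 am mb b1 c0 cd d1 h1 h2.
have inm s t : a <= s <= b -> c <= t <= d -> (0 <= s <= 1) /\ (0 <= t <= 1).
  by move=> /andP[? ?] /andP[? ?]; split; apply/andP; split; lra.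
have hm1 : a <= m <= m by rewrite am lexx.
have hm2 : m <= m <= b by rewrite mb lexx.
have hm : a <= m <= b by rewrite am mb.
have unit W x y x' y' t : flat H W x x' y y' -> x <= m <= x' -> y <= t <= y' ->
    W m t \in unitmx.
  move=> h hx hy; have [sg S [e e0 he]] := h m t hx hy.
  by rewrite (he m t)// ?subrr ?normr0//; apply: Sol_unit.
pose g t := W1 m t *m invmx (W2 m t).
have edge t : c <= t <= d -> exists s1 s2 A, [/\ Sol (H m t) s1, Sol (H m t) s2, A \in unitmx &
   exists2 e : R, 0 < e & [/\ forall s' t', a <= s' <= m -> c <= t' <= d -> `|s' - m| < e ->
     `|t' - t| < e -> W1 s' t' = s1 (H s' t'),
     forall s' t', m <= s' <= b -> c <= t' <= d -> `|s' - m| < e ->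
     `|t' - t| < e -> W2 s' t' = s2 (H s' t') & forall s' t', a <= s' <= b -> c <= t' <= d ->
     `|s' - m| < e -> `|t' - t| < e -> s1 (H s' t') = A *m s2 (H s' t')]].
  move=> ht; have [s1 S1 [e1 e10 he1]] := h1 m t hm1 ht.
  have [s2 S2 [e2 e20 he2]] := h2 m t hm2 ht.
  have [A uA hA] := Sol_unique S2 S1.
  have [k1 k2] := inm m t hm ht; have [e3 e30 he3] := Hc m t k1 k2 _ hA.
  exists s1, s2, A; split=> //; exists (Num.min e1 (Num.min e2 e3)).
    by rewrite !lt_min e10 e20.
  split=> s' t' hs' ht'; rewrite !lt_min => /and3P[? ? ?] /and3P[? ? ?].
  - exact: he1.
  - exact: he2.
  by have [? ?] := inm s' t' hs' ht'; apply: he3.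
have gA t : c <= t <= d -> exists2 e : R, 0 < e & forall s, c <= s <= d -> `|s - t| < e -> g s = g t.
  move=> ht; have [s1 [s2 [A [S1 S2 uA [e e0 [k1 k2 k3]]]]]] := edge t ht.
  exists e => // s hs st.
  have key u : c <= u <= d -> `|u - t| < e -> g u = A.
    move=> hu ut; have uW := unit _ _ _ _ _ _ h2 hm2 hu.
    have n0 : `|m - m| < e by rewrite subrr normr0.
    by rewrite /g (k1 m u)// (k3 m u)// -(k2 m u)// mulmxK.
  by rewrite !key// subrr normr0.
have gconst u v : c <= u -> u <= v -> v <= d -> g u = g v.
  move=> cu uv vd; apply: locally_constant => // t /andP[t1 t2].
  have [|e e0 he] := gA t; first by apply/andP; split; lra.
  by exists e => // s /andP[s1 s2]; apply: he; apply/andP; split; lra.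
pose A0 := g c.
have gA0 t : c <= t <= d -> g t = A0.
  by move=> /andP[? ?]; rewrite /A0 (@gconst c t).
have uA0 : A0 \in unitmx.
  have hc : c <= c <= d by rewrite lexx.
  by rewrite /A0 /g unitmx_mul unitmx_inv (unit _ _ _ _ _ _ h1 hm1 hc) (unit _ _ _ _ _ _ h2 hm2 hc).
exists (fun s t => if s <= m then W1 s t else A0 *m W2 s t) => s t hs ht.
have /andP[as_ sb] := hs.
have [sm|ms|->] := ltgtP s m.
- have hs1 : a <= s <= m by rewrite as_ ltW.
  have [sg S [e e0 he]] := h1 s t hs1 ht.
  exists sg => //; exists (Num.min e (m - s)); first by rewrite lt_min e0 subr_gt0.
  move=> s' t' /andP[as' sb'] ht'; rewrite !lt_min => /andP[? sm'] /andP[? _].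
  have sm1 : s' <= m by move: sm'; rewrite ltr_norml => /andP[? ?]; lra.
  by rewrite sm1; apply: he => //; rewrite as'.
- have hs1 : m <= s <= b by rewrite sb ltW.
  have [sg S [e e0 he]] := h2 s t hs1 ht.
  exists (fun q => A0 *m sg q); first exact: Sol_mul.
  exists (Num.min e (s - m)); first by rewrite lt_min e0 subr_gt0.
  move=> s' t' /andP[as' sb'] ht'; rewrite !lt_min => /andP[? sm'] /andP[? _].
  have sm1 : m < s' by move: sm'; rewrite ltr_norml => /andP[? ?]; lra.
  by rewrite leNgt sm1 /= (he s' t')// sb' ltW.
have [s1 [s2 [A [S1 S2 uA [e e0 [k1 k2 k3]]]]]] := edge t ht.
have AA : A = A0.
  have n0 : `|m - m| < e by rewrite subrr normr0.
  have n1 : `|t - t| < e by rewrite subrr normr0.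
  have uW := unit _ _ _ _ _ _ h2 hm2 ht.
  by rewrite -(gA0 t ht) /g (k1 m t)// (k3 m t)// -(k2 m t)// mulmxK.
exists s1 => //; exists e => // s' t' hs' ht' se te.
have /andP[as' sb'] := hs'; have [sm|sm] := leP s' m.
  by apply: k1 => //; rewrite as'.
by rewrite (k3 s' t')// AA (k2 s' t')// sb' ltW.
Qed.

Lemma flat_swap H W a b c d : flat (fun s t => H t s) (fun s t => W t s) c d a b ->
  flat H W a b c d.
Proof.
move=> h s t hs ht; have [sg S [e e0 he]] := h t s ht hs.
by exists sg => //; exists e => // s' t' *; apply: he.
Qed.

Lemma flat_ex H : scont H -> exists W, flat H W 0 1 0 1.
Proof.
move=> Hc.
suff : (0 : R) <= 0 -> (1 : R) <= 1 -> (0 : R) <= 0 -> (1 : R) <= 1 -> exists W, flat H W 0 1 0 1 by apply.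
apply: (@cousin2 R (fun a b c d => 0 <= a -> b <= 1 -> 0 <= c -> d <= 1 ->
  exists W, flat H W a b c d)) => //.
  move=> a b c d ab cd h1 h2 h3 h4 a0 b1 c0 d1.
  pose m := (a + b) / 2; pose k := (c + d) / 2.
  have am : a <= m by rewrite /m; lra.
  have mb : m <= b by rewrite /m; lra.
  have ck : c <= k by rewrite /k; lra.
  have kd : k <= d by rewrite /k; lra.
  have m0 : 0 <= m := le_trans a0 am. have m1 : m <= 1 := le_trans mb b1.
  have k0 : 0 <= k := le_trans c0 ck. have k1 : k <= 1 := le_trans kd d1.
  have [W1 f1] := h1 a0 m1 c0 k1. have [W2 f2] := h2 m0 b1 c0 k1.
  have [W3 f3] := h3 a0 m1 k0 d1. have [W4 f4] := h4 m0 b1 k0 d1.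
  have [W5 f5] := flat_glue Hc a0 am mb b1 c0 ck k1 f1 f2.
  have [W6 f6] := flat_glue Hc a0 am mb b1 k0 kd d1 f3 f4.
  have Hc' : scont (fun s t => H t s).
    move=> s t hs ht O hO; have [e e0 he] := Hc t s ht hs O hO.
    by exists e => // *; apply: he.
  have sw W a' b' c' d' : flat H W a' b' c' d' -> flat (fun s t => H t s) (fun s t => W t s) c' d' a' b'.
    by move=> f; apply: flat_swap.
  have [W7 f7] := flat_glue Hc' c0 ck kd d1 a0 ab b1 (sw _ _ _ _ _ f5) (sw _ _ _ _ _ f6).
  by exists (fun s t => W7 t s); apply: flat_swap.
move=> x y hx hy; have [sg S] := Sol_ex (H x y).
have [e e0 he] := Hc x y hx hy _ (Sol_open S); exists e => //.
move=> a b c d a0 /andP[ax xb] b1 c0 /andP[cy yd] d1 w1 w2 _ _ _ _.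
exists (fun s t => sg (H s t)) => s t /andP[s1 s2] /andP[t1 t2].
exists sg; last by exists 1.
by apply: he; rewrite ?ltr_norml; apply/andP; split; lra.
Qed.

Definition lflat (g : R -> T) (u : R -> mx) := forall t, 0 <= t <= 1 ->
  exists2 sg, Sol (g t) sg & exists2 e : R, 0 < e & forall s, 0 <= s <= 1 -> `|s - t| < e ->
    u s = sg (g s).

Lemma lflat_unit g u t : lflat g u -> 0 <= t <= 1 -> u t \in unitmx.
Proof.
move=> h ht; have [sg S [e e0 he]] := h t ht.
by rewrite (he t)// ?subrr ?normr0//; apply: Sol_unit.
Qed.

Lemma lflat_mul g u A : A \in unitmx -> lflat g u -> lflat g (fun t => A *m u t).
Proof.
move=> uA h t ht; have [sg S [e e0 he]] := h t ht.
exists (fun q => A *m sg q); first exact: Sol_mul.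
by exists e => // s hs /he ->.
Qed.

Lemma h01 : 0 <= (0 : R) <= 1. Proof. by rewrite lexx ler01. Qed.
Lemma h11 : 0 <= (1 : R) <= 1. Proof. by rewrite lexx ler01. Qed.

Lemma lflat_ex g : pcont g -> exists2 u, lflat g u & u 0 = 1%:M.
Proof.
move=> gc; have [W hW] : exists W, flat (fun _ t => g t) W 0 1 0 1.
  apply: flat_ex => s t _ ht O hO; have [d d0 hd] := gc t ht O hO.
  by exists d => // s' t' _ ht' _; apply: hd.
have h : lflat g (W 0).
  move=> t ht; have [sg S [e e0 he]] := hW 0 t h01 ht.
  by exists sg => //; exists e => // s hs st; apply: he; rewrite ?h01 ?subrr ?normr0.
have u0 := lflat_unit h h01.
exists (fun t => invmx (W 0 0) *m W 0 t); last by rewrite mulVmx.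
by apply: lflat_mul => //; rewrite unitmx_inv.
Qed.

Lemma lflat_unique g u v : pcont g -> lflat g u -> lflat g v -> u 0 = v 0 -> u 1 = v 1.
Proof.
move=> gc hu hv e0.
pose q t := u t *m invmx (v t).
have : q 0 = q 1.
  apply: locally_constant => // t ht.
  have [s1 S1 [e1 e10 he1]] := hu t ht; have [s2 S2 [e2 e20 he2]] := hv t ht.
  have [A uA hA] := Sol_unique S2 S1; have [e3 e30 he3] := gc t ht _ hA.
  exists (Num.min e1 (Num.min e2 e3)); first by rewrite !lt_min e10 e20.
  have key s : 0 <= s <= 1 -> `|s - t| < Num.min e1 (Num.min e2 e3) -> q s = A.
    move=> hs; rewrite !lt_min => /and3P[? ? ?]; have uv := lflat_unit hv hs.
    by rewrite /q (he1 s)// (he3 s)// -(he2 s)// mulmxK.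
  by move=> s hs st; rewrite !key// subrr normr0 !lt_min e10 e20.
rewrite /q e0 mulmxV ?(lflat_unit hv h01)// => /(f_equal (mulmx^~ (v 1))).
by rewrite mul1mx mulmxKV ?(lflat_unit hv h11).
Qed.

Lemma lflat_const p u : lflat (fun=> p) u -> u 0 = u 1.
Proof.
move=> h; apply: locally_constant => // t ht; have [sg S [e e0 he]] := h t ht.
by exists e => // s hs st; rewrite (he s)// (he t)// subrr normr0.
Qed.

Lemma lflat_ext g g' u u' : (forall t, 0 <= t <= 1 -> g t = g' t) ->
  (forall t, 0 <= t <= 1 -> u t = u' t) -> lflat g u -> lflat g' u'.
Proof.
move=> gg uu h t ht; have [sg S [e e0 he]] := h t ht.
exists sg; first by rewrite -gg.
by exists e => // s hs st; rewrite -uu// -gg//; apply: he.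
Qed.

(* Affine reparametrization *)
Lemma lflat_affine g u (a b : R) : `|b| <= 1 -> (forall t, 0 <= t <= 1 -> 0 <= a + b * t <= 1) ->
  lflat g u -> lflat (fun t => g (a + b * t)) (fun t => u (a + b * t)).
Proof.
move=> b1 hab h t ht; have [sg S [e e0 he]] := h _ (hab t ht).
exists sg => //; exists e => // s hs st; apply: he; first exact: hab.
have -> : a + b * s - (a + b * t) = b * (s - t) by ring.
by rewrite normrM; have := normr_ge0 (s - t); nra.
Qed.

Definition concat (X : Type) (g1 g2 : R -> X) t := if t <= 1 / 2 then g1 (2 * t) else g2 (2 * t - 1).

Lemma concat_pcont (g1 g2 : R -> T) : pcont g1 -> pcont g2 -> g1 1 = g2 0 -> pcont (concat g1 g2).
Proof.
move=> c1 c2 e t ht O; have /andP[t0 t1] := ht; rewrite /concat.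
have [th|th|th] := ltgtP t (1 / 2) => hO.
- have [|d d0 hd] := c1 (2 * t) _ O hO; first by apply/andP; split; lra.
  exists (Num.min (d / 2) (1 / 2 - t)); first by rewrite lt_min divr_gt0// subr_gt0.
  move=> s /andP[s0 s1]; rewrite lt_min !ltr_norml => /andP[/andP[? ?] /andP[? ?]].
  have -> : s <= 1 / 2 by lra.
  by apply: hd; rewrite ?ltr_norml; apply/andP; split; lra.
- have [|d d0 hd] := c2 (2 * t - 1) _ O hO; first by apply/andP; split; lra.
  exists (Num.min (d / 2) (t - 1 / 2)); first by rewrite lt_min divr_gt0// subr_gt0.
  move=> s /andP[s0 s1]; rewrite lt_min !ltr_norml => /andP[/andP[? ?] /andP[? ?]].
  have -> : (s <= 1 / 2) = false by apply/negbTE; rewrite -ltNge; lra.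
  by apply: hd; rewrite ?ltr_norml; apply/andP; split; lra.
have E1 : 2 * t = 1 by lra.
rewrite E1 in hO; have hO2 := hO; rewrite e in hO2.
have [d d0 hd] := c1 1 h11 O hO; have [d' d'0 hd'] := c2 0 h01 O hO2.
exists (Num.min (d / 2) (d' / 2)); first by rewrite lt_min !divr_gt0.
move=> s /andP[s0 s1]; rewrite lt_min !ltr_norml => /andP[/andP[? ?] /andP[? ?]].
have [sh|sh] := leP s (1 / 2).
  by apply: hd; rewrite ?ltr_norml; apply/andP; split; lra.
by apply: hd'; rewrite ?ltr_norml; apply/andP; split; lra.
Qed.

Lemma rev_pcont (g : R -> T) : pcont g -> pcont (fun t => g (1 - t)).
Proof.
move=> c t /andP[t0 t1] O hO; have [|d d0 hd] := c (1 - t) _ O hO.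
  by apply/andP; split; lra.
exists d => // s /andP[s0 s1]; rewrite ltr_norml => /andP[? ?].
by apply: hd; rewrite ?ltr_norml; apply/andP; split; lra.
Qed.

Hypothesis sc : simply_connected R T.

Lemma endpoint_unique p0 p g1 g2 u1 u2 : pcont g1 -> pcont g2 -> g1 0 = p0 -> g2 0 = p0 ->
  g1 1 = p -> g2 1 = p -> lflat g1 u1 -> lflat g2 u2 -> u1 0 = 1%:M -> u2 0 = 1%:M ->
  u1 1 = u2 1.
Proof.
move=> c1 c2 a1 a2 b1 b2 f1 f2 i1 i2.
pose g := concat g1 (fun t => g2 (1 - t)).
have gc : pcont g by apply: concat_pcont => //; [exact: rev_pcont|rewrite subr0 b1].
have half0 : (0 : R) <= 1 / 2 by lra.
have half1 : ((1 : R) <= 1 / 2) = false by apply/negbTE; rewrite -ltNge; lra.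
have gp : is_path g p0 p0.
  split; first exact/pcontP.
  - by rewrite /g /concat half0 mulr0.
  - by rewrite /g /concat half1 mulr1 (_ : 1 - (2 - 1) = 0) ?a2//; ring.
have [H [Hc H1 H2]] := sc.2 p0 g gp.
have [W hW] := flat_ex (scontP Hc).
have along a b : `|b| <= 1 -> forall W', flat (fun s t => H (s, t)) W' 0 1 0 1 -> True by [].
have vert s : 0 <= s <= 1 -> lflat (fun t => H (s, t)) (W s).
  move=> hs t ht; have [sg S [e e0 he]] := hW s t hs ht.
  by exists sg => //; exists e => // t' ht' tt; apply: he; rewrite ?subrr ?normr0.
have hor t : 0 <= t <= 1 -> lflat (fun s => H (s, t)) (W^~ t).
  move=> ht s hs; have [sg S [e e0 he]] := hW s t hs ht.
  by exists sg => //; exists e => // s' hs' ss; apply: he; rewrite ?subrr ?normr0.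
have itv (t : R) : 0 <= t <= 1 -> t \in `[0, 1] by rewrite in_itv.
have K1 : W 0 0 = W 1 0.
  apply: (@lflat_const p0 (W^~ 0)); apply: lflat_ext (hor 0 h01) => // s hs.
  by have [-> _] := H2 s (itv s hs).
have K2 : W 0 1 = W 1 1.
  apply: (@lflat_const p0 (W^~ 1)); apply: lflat_ext (hor 1 h11) => // s hs.
  by have [_ ->] := H2 s (itv s hs).
have K3 : W 1 0 = W 1 1.
  apply: (@lflat_const p0 (W 1)); apply: lflat_ext (vert 1 h11) => // t ht.
  by have [_ ->] := H1 t (itv t ht).
have uW : W 0 0 \in unitmx by apply: lflat_unit (vert 0 h01) h01.
pose A := invmx (W 0 0); have uA : A \in unitmx by rewrite unitmx_inv.
have lg : lflat g (fun t => A *m W 0 t).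
  apply: lflat_mul => //; apply: lflat_ext (vert 0 h01) => // t ht.
  by have [-> _] := H1 t (itv t ht).
have n2 : `|1 / 2 : R| <= 1 by rewrite ger0_norm; lra.
have n2' : `|- (1 / 2) : R| <= 1 by rewrite normrN ger0_norm; lra.
have r1 (t : R) : 0 <= t <= 1 -> 0 <= 0 + 1 / 2 * t <= 1.
  by move=> /andP[? ?]; apply/andP; split; lra.
have r2 (t : R) : 0 <= t <= 1 -> 0 <= 1 + - (1 / 2) * t <= 1.
  by move=> /andP[? ?]; apply/andP; split; lra.
have l1 : lflat g1 (fun t => A *m W 0 (0 + 1 / 2 * t)).
  apply: lflat_ext (lflat_affine n2 r1 lg) => // t /andP[t0 t1].
  rewrite /g /concat; have -> : 0 + 1 / 2 * t <= 1 / 2 by lra.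
  by congr g1; field.
have l2 : lflat g2 (fun t => A *m W 0 (1 + - (1 / 2) * t)).
  apply: lflat_ext (lflat_affine n2' r2 lg) => // t /andP[t0 t1].
  rewrite /g /concat.
  have [th|th] := leP (1 + - (1 / 2) * t) (1 / 2); last by congr g2; field.
  have -> : t = 1 by lra.
  by rewrite (_ : 2 * _ = 1) ?b1 ?b2//; field.
have e1 := lflat_unique c1 f1 l1; have e2 := lflat_unique c2 f2 l2.
rewrite e1; last by rewrite i1 mulr0 addr0 mulVmx.
rewrite e2; last by rewrite i2 mulr0 addr0 K2 -K3 -K1 mulVmx.
by congr (_ *m W 0 _); field.
Qed.

Theorem monodromy p0 : exists F, F p0 = 1%:M /\ forall p, Sol p F.
Proof.
have hp p : exists gu : (R -> T) * (R -> mx), [/\ pcont gu.1, gu.1 0 = p0, gu.1 1 = p,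
   lflat gu.1 gu.2 & gu.2 0 = 1%:M].
  have [g [/pcontP gc g0 g1]] := sc.1 p0 p; have [u hu u0] := lflat_ex gc.
  by exists (g, u).
have /choice[P hP] := hp.
pose F p := (P p).2 1.
have Fval p g u : pcont g -> g 0 = p0 -> g 1 = p -> lflat g u -> u 0 = 1%:M -> F p = u 1.
  move=> gc g0 g1 hu u0; have [c b0 b1 l l0] := hP p.
  exact: (endpoint_unique c gc b0 g0 b1 g1 l hu l0 u0).
exists F; split.
  have gc : pcont (fun _ : R => p0).
    by move=> t ht O hO; exists 1 => // s hs st; exact: (nbhs_singleton hO).
  have [u hu u0] := lflat_ex gc.
  by rewrite (Fval p0 (fun=> p0) u)// -(lflat_const hu).
move=> p; have [c b0 b1 l l0] := hP p; set g := (P p).1 in c b0 b1 l.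
set u := (P p).2 in l l0.
have [s0 S0] := Sol_ex p; have us := Sol_unit S0.
have uF : F p \in unitmx by apply: lflat_unit l h11.
pose sg q := F p *m invmx (s0 p) *m s0 q.
have S : Sol p sg by apply: Sol_mul S0 _; rewrite unitmx_mul uF unitmx_inv.
have sgp : sg p = F p by rewrite /sg mulmxKV.
apply: (Sol_germ S); have := @small_paths p _ (Sol_open S).
apply: filterS => q [k [kc k0 k1 kV]].
pose v := concat u (fun t => sg (k t)).
have half0 : (0 : R) <= 1 / 2 by lra.
have half1 : ((1 : R) <= 1 / 2) = false by apply/negbTE; rewrite -ltNge; lra.
have E1 : (2 * 1 - 1 : R) = 1 by ring.
rewrite (Fval q (concat g k) v).
- by rewrite /v /concat half1 E1 k1.
- by apply: concat_pcont => //; rewrite b1 k0.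
- by rewrite /concat half0 mulr0.
- by rewrite /concat half1 E1.
- move=> t /andP[t0 t1]; rewrite /v /concat.
  have [th|th|th] := ltgtP t (1 / 2).
  + have [|tau St [e e0 he]] := l (2 * t); first by apply/andP; split; lra.
    exists tau => //; exists (Num.min (e / 2) (1 / 2 - t)); first by rewrite lt_min divr_gt0// subr_gt0.
    move=> s /andP[s0' s1]; rewrite lt_min !ltr_norml => /andP[/andP[? ?] /andP[? ?]].
    have -> : s <= 1 / 2 by lra.
    by apply: he; rewrite ?ltr_norml; apply/andP; split; lra.
  + exists sg; first by apply: kV; apply/andP; split; lra.
    exists (t - 1 / 2); first by rewrite subr_gt0.
    move=> s /andP[s0' s1]; rewrite ltr_norml => /andP[? ?].
    by have -> : (s <= 1 / 2) = false by apply/negbTE; rewrite -ltNge; lra.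
  have E2 : 2 * t = 1 by lra.
  rewrite E2 b1; have [tau St [e e0 he]] := l 1 h11; rewrite b1 in St.
  have tp : tau p = sg p.
    have n1 : `|1 - 1 : R| < e by rewrite subrr normr0.
    by rewrite sgp -{1}b1 -(he 1 h11 n1).
  have [d d0 hd] := c 1 h11 _ (eq_ind_r (fun q => nbhs q _) (Sol_eq St S tp) b1).
  exists sg => //; exists (Num.min (e / 2) (d / 2)); first by rewrite lt_min !divr_gt0.
  move=> s /andP[s0' s1]; rewrite lt_min !ltr_norml => /andP[/andP[? ?] /andP[? ?]].
  have [sh|//] := leP s (1 / 2).
  rewrite he ?hd// ?ltr_norml; apply/andP; split; lra.
by rewrite /v /concat half0 mulr0.
Qed.

End Monodromy.

(** * Linear differential equations on a Riemann surface *)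

Section LinearODE.
Context {R : realType}.
Local Notation C := R[i].

Definition mder {p q} (F : 'cV[C]_1 -> 'M[C]_(p, q)) z (A : 'M[C]_(p, q)) :=
  fdm F z (fun w => w 0 0 *: A).

Lemma mder_ext p q (F G : 'cV[C]_1 -> 'M[C]_(p, q)) z A :
  (\forall y \near z, G y = F y) -> mder F z A -> mder G z A.
Proof. by move=> /nbhs_nm[d d0 h]; apply: (fdm_ext d0). Qed.

Lemma mder_mul p q r (F : 'cV[C]_1 -> 'M[C]_(p, q)) (G : 'cV[C]_1 -> 'M[C]_(q, r)) z A B :
  mder F z A -> mder G z B -> mder (fun y => F y *m G y) z (A *m G z + F z *m B).
Proof.
move=> h k; apply: fdm_eq (fdm_mul h k) => // w.
by rewrite scalerDr scalemxAl scalemxAr.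
Qed.

Lemma mder_mull p q r (A : 'M[C]_(r, p)) (F : 'cV[C]_1 -> 'M[C]_(p, q)) z B :
  mder F z B -> mder (fun y => A *m F y) z (A *m B).
Proof. by move=> h; apply: fdm_eq (fdm_mull A h) => // w; rewrite scalemxAr. Qed.

Lemma mder_add p q (F G : 'cV[C]_1 -> 'M[C]_(p, q)) z A B :
  mder F z A -> mder G z B -> mder (fun y => F y + G y) z (A + B).
Proof. by move=> h k; apply: fdm_eq (fdm_add h k) => // w; rewrite scalerDr. Qed.

Lemma mder_opp p q (F : 'cV[C]_1 -> 'M[C]_(p, q)) z A :
  mder F z A -> mder (fun y => - F y) z (- A).
Proof. by move=> h; apply: fdm_eq (fdm_opp h) => // w; rewrite scalerN. Qed.

Lemma mder_tr p q (F : 'cV[C]_1 -> 'M[C]_(p, q)) z A :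
  mder F z A -> mder (fun y => (F y)^T) z A^T.
Proof. by move=> h; apply: fdm_eq (fdm_tr h) => // w; rewrite linearZ. Qed.

Lemma mder_mulr p q r (A : 'M[C]_(q, r)) (F : 'cV[C]_1 -> 'M[C]_(p, q)) z B :
  mder F z B -> mder (fun y => F y *m A) z (B *m A).
Proof. by move=> h; apply: fdm_eq (fdm_mulr A h) => // w; rewrite scalemxAl. Qed.

Lemma mder_comp p q (F : 'cV[C]_1 -> 'M[C]_(p, q)) (t : 'cV[C]_1 -> 'cV[C]_1) z A T :
  mder F (t z) A -> mder t z T -> mder (F \o t) z (T 0 0 *: A).
Proof.
by move=> h k; apply: fdm_eq (fdm_comp h k) => // w; rewrite /= mxE scalerA.
Qed.

Lemma diff_mder (f : 'cV[C]_1 -> 'cV[C]_1) z : differentiable f z -> exists A, mder f z A.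
Proof.
move=> /diff_fdm[A hA]; exists A; apply: fdm_eq hA => // w.
by apply/matrixP => i j; rewrite !ord1 !mxE big_ord1 mulrC.
Qed.

Lemma near_bounded p q (F : 'cV[C]_1 -> 'M[C]_(p, q)) z L : fdm F z L ->
  exists2 B : R, 0 < B & \forall y \near z, nm (F y) <= B.
Proof.
move=> h; have [d d0 hd] := fdm_cont h ltr01.
exists (nm (F z) + 1); first by have := nm_ge0 (F z); lra.
apply/nbhs_nm; exists d => // w /hd H.
by rewrite -(subrK (F z) (F (z + w))); apply: le_trans (nmD _ _) _; lra.
Qed.

Lemma growth p q (W G : 'cV[C]_1 -> 'M[C]_(p, q)) z0 (K : R) : 0 <= K ->
  (\forall y \near z0, mder W y (G y) /\ nm (G y) <= K * nm (W y)) -> W z0 = 0 ->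
  \forall y \near z0, W y = 0.
Proof.
move=> K0 hn W0.
have [h0 _] := nbhs_singleton hn.
have [B B0 /nbhs_nm[d1 d10 hB]] := near_bounded h0.
have [d2 d20 h] := (nbhs_nm _ _).1 hn.
pose D : R := (p * q)%:R + 1.
have D1 : 1 <= D by rewrite /D lerDr ler0n.
have DK : 0 < 2 * (D * (K + 1)) by rewrite !mulr_gt0//; lra.
pose rho := Num.min (Num.min d1 d2) (1 / (2 * (D * (K + 1)))).
have r0 : 0 < rho by rewrite !lt_min d10 d20 divr_gt0.
have rD : D * (K * rho) <= 1 / 2.
  have : rho <= 1 / (2 * (D * (K + 1))) by rewrite ge_min lexx orbT.
  by rewrite ler_pdivlMr//; nra.
have key k : forall w, nm w < rho -> nm (W (z0 + w)) <= B / 2 ^+ k.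
  elim: k => [|k IH] w wr.
    by rewrite expr0 divr1; apply: hB; apply: lt_le_trans wr _; rewrite !ge_min lexx.
  have w0 := nm_ge0 w.
  have bk : 0 <= B / 2 ^+ k by rewrite mulr_ge0 ?invr_ge0 ?exprn_ge0// ltW.
  apply: (@le_trans _ _ ((p * q)%:R * (K * (B / 2 ^+ k) * rho))).
    apply: nm_bound => i j.
    have -> : W (z0 + w) i j = W (z0 + w) i j - W z0 i j by rewrite W0 mxE subr0.
    apply: (@mean_value R 1 (fun y => W y i j) (fun y v => v 0 0 * G y i j)) => t /andP[t0 t1].
    have tw : nm (t%:C *: w) < rho by rewrite nmrZ ger0_norm//; nra.
    have [|hd hb] := h (t%:C *: w); first by apply: lt_le_trans tw _; rewrite !ge_min lexx orbT.
    split; first by apply: fd_eq (hd i j) => // v; rewrite mxE.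
    apply: le_trans (ncM _ _) _; rewrite mulrC; apply: ler_pM; rewrite ?nc_ge0//.
      apply: le_trans (nm_le _ i j) _; apply: le_trans hb _.
      by rewrite ler_wpM2l//; apply: IH.
    by apply: le_trans (nm_le w 0 0) _; exact: ltW.
  have -> : B / 2 ^+ k.+1 = B / 2 ^+ k * (1 / 2) by rewrite exprS invfM; ring.
  have -> : (p * q)%:R * (K * (B / 2 ^+ k) * rho) = (B / 2 ^+ k) * ((p * q)%:R * (K * rho)) by ring.
  rewrite ler_wpM2l//; apply: le_trans rD.
  by rewrite ler_wpM2r ?mulr_ge0 ?(ltW r0)// /D lerDl.
apply/nbhs_nm; exists rho => // w wr; apply: nm_eq0; apply/eqP.
rewrite eq_le nm_ge0 andbT; apply/ler_addgt0Pr => e e0; rewrite add0r.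
have [k hk] := half_power_small B e0.
by apply: le_trans (key k w wr) (ltW hk).
Qed.

Lemma ode_unique n (phi F1 F2 : 'cV[C]_1 -> 'M[C]_n) z0 L : fdm phi z0 L ->
  (\forall y \near z0, mder F1 y (F1 y *m phi y)) ->
  (\forall y \near z0, mder F2 y (F2 y *m phi y)) -> F1 z0 \in unitmx ->
  \forall y \near z0, F2 y = (F2 z0 *m invmx (F1 z0)) *m F1 y.
Proof.
move=> hphi h1 h2 u1; set A := _ *m invmx _.
have [B B0 hB] := near_bounded hphi.
pose W y := F2 y - A *m F1 y.
have : \forall y \near z0, W y = 0.
  apply: (@growth _ _ W (fun y => W y *m phi y) z0 B (ltW B0)).
    near=> y; split; last first.
      apply: le_trans (nmM _ _) _; rewrite mulrC ler_wpM2r ?nm_ge0//.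
      by near: y.
    have k1 : mder F1 y (F1 y *m phi y) by near: y.
    have k2 : mder F2 y (F2 y *m phi y) by near: y.
    have -> : W y *m phi y = F2 y *m phi y + - (A *m (F1 y *m phi y)).
      by rewrite /W mulmxBl mulmxA.
    exact: mder_add k2 (mder_opp (mder_mull A k1)).
  by rewrite /W /A mulmxKV// subrr.
by apply: filterS => y /eqP; rewrite subr_eq0 => /eqP.
Unshelve. all: by end_near. Qed.

Lemma ode_exists n (phi : 'cV[C]_1 -> 'M[C]_n) z0 :
  (\forall y \near z0, exists A, mder phi y A) ->
  exists2 F : 'cV[C]_1 -> 'M[C]_n, F z0 = 1%:M &
    \forall y \near z0, mder F y (F y *m phi y) /\ F y \in unitmx.
Proof.
move=> /nbhs_nm[d d0 h].
have vE (v : 'cV[C]_1) : const_mx (v 0 0) = v by apply/matrixP => i j; rewrite !ord1 mxE.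
have conv p q (F : C -> 'M[C]_(p, q)) z A : cderm F z A ->
    mder (fun v => F (v 0 0)) (const_mx z) A.
  move=> hF i j; have /cder_fd := hF i j; apply: fd_eq => // w.
  by rewrite mxE mulrC.
have [|rho r0 [F [F1 hF]]] := @picard R n (fun z => phi (const_mx z)) (z0 0 0) (d / 2) ltac:(lra).
  move=> z [zr zi]; have [|A hA] := h (const_mx z - z0).
    by rewrite nm11 !mxE /nc !reim; lra.
  rewrite addrC subrK in hA; exists A => i j; apply/cder_fd.
  apply: fd_eq (hA i j) => [v|v]; first by rewrite vE.
  by rewrite mxE mulrC.
exists (fun v => F (v 0 0)) => //; apply/nbhs_nm; exists rho => // w wr.
have [|hd hu] := hF (z0 0 0 + w 0 0).
  have := nc_Re (w 0 0); have := nc_Im (w 0 0); move: wr; rewrite nm11 => *.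
  by rewrite /osq !reim; split; rewrite addrC addKr; lra.
rewrite !mxE; split=> //; have := conv _ _ _ _ _ hd.
have -> : const_mx (z0 0 0 + w 0 0) = z0 + w :> 'cV[C]_1.
  by apply/matrixP => i j; rewrite !ord1 !mxE.
by [].
Qed.

End LinearODE.

Section Charts.
Context {R : realType} {m : nat} (M : complexManifold R m).
Local Notation C := R[i].
Implicit Types (c d : chart R m M).

Lemma codP c : atlas c -> forall z, cod c z -> dom c (param c z) /\ coord c (param c z) = z.
Proof.
move=> ac z [p dp <-]; have K := chart_coordK (atlas_chart ac) dp.
by rewrite K.
Qed.

Lemma dom_near c p : atlas c -> dom c p -> \forall q \near p, dom c q.
Proof. by move=> ac dp; apply: open_nbhs_nbhs; split=> //; apply: (chart_open_dom (atlas_chart ac)). Qed.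

Lemma cod_near c z : atlas c -> cod c z -> \forall y \near z, cod c y.
Proof. by move=> ac dp; apply: open_nbhs_nbhs; split=> //; apply: (chart_open_cod (atlas_chart ac)). Qed.

Lemma coord_cod c p : dom c p -> cod c (coord c p).
Proof. by exists p. Qed.

Lemma near_param c z (P : set M) : atlas c -> cod c z -> nbhs (param c z) P ->
  \forall y \near z, P (param c y).
Proof. by move=> ac cz; apply: (chart_param_cont (atlas_chart ac)). Qed.

Lemma near_coord c p (P : set 'cV[C]_m) : atlas c -> dom c p -> nbhs (coord c p) P ->
  \forall q \near p, P (coord c q).
Proof. by move=> ac cz; apply: (chart_coord_cont (atlas_chart ac)). Qed.

Lemma paramK c p : atlas c -> dom c p -> param c (coord c p) = p.
Proof. by move=> ac; apply: (chart_coordK (atlas_chart ac)). Qed.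

End Charts.

Section Surface.
Context {R : realType} (U : riemannSurface R).
Local Notation C := R[i].
Implicit Types (c d : chart R 1 U).

Lemma transition c d z : atlas c -> atlas d -> cod c z -> dom d (param c z) ->
  exists T, mder (fun w => coord d (param c w)) z T.
Proof. by move=> ac ad cz dz; apply/diff_mder/atlas_compatible. Qed.

Lemma surface_small_paths (p : U) (V : set U) : nbhs p V -> \forall q \near p,
  exists g : R -> U, [/\ pcont g, g 0 = p, g 1 = q & forall t, 0 <= t <= 1 -> V (g t)].
Proof.
move=> nV; have [c ac dp] := atlas_cover p.
have cz := coord_cod dp; have E := paramK ac dp.
have nV' : nbhs (param c (coord c p)) V by rewrite E.
have /nbhs_nm[e1 e10 h1] := near_param ac cz nV'.
have /nbhs_nm[e2 e20 h2] := cod_near ac cz.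
pose e := Num.min e1 e2; have e0 : 0 < e by rewrite lt_min e10.
have nb : \forall y \near coord c p, nm (y - coord c p) < e.
  by apply/nbhs_nm; exists e => // w; rewrite addrC addKr.
near=> q.
have dq : dom c q by near: q; apply: dom_near.
have qe : nm (coord c q - coord c p) < e by near: q; apply: (@near_coord R 1 U c p (fun y => nm (y - coord c p) < e)).
pose l t := coord c p + t%:C *: (coord c q - coord c p).
have le t : 0 <= t <= 1 -> nm (t%:C *: (coord c q - coord c p)) < e.
  move=> /andP[t0 t1]; rewrite nmrZ ger0_norm//; have := nm_ge0 (coord c q - coord c p); nra.
exists (fun t => param c (l t)); split.
- move=> t ht O hO; have lt := le t ht; move: (lt); rewrite lt_min => /andP[_ le2].
  have /nbhs_nm[k k0 hk] := near_param ac (h2 _ le2) hO.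
  have n0 := nm_ge0 (coord c q - coord c p).
  exists (k / (nm (coord c q - coord c p) + 1)); first by rewrite divr_gt0//; lra.
  move=> s hs; rewrite ltr_pdivlMr; last lra.
  move=> sk; have -> : l s = l t + (s - t)%:C *: (coord c q - coord c p).
    by rewrite /l -addrA -scalerDl -rmorphD /= [t + _]addrC subrK.
  by apply: hk; rewrite nmrZ; have := normr_ge0 (s - t); nra.
- by rewrite /l scale0r addr0.
- by rewrite /l scale1r addrC subrK paramK.
by move=> t /le; rewrite lt_min => /andP[/h1].
Unshelve. all: by end_near. Qed.

Hypothesis U_sc : simply_connected R U.

Lemma surface_locally_constant (X : Type) (f : U -> X) :
  (forall p, \forall q \near p, f q = f p) -> forall p q, f p = f q.
Proof.
move=> h p q; have [g [/pcontP gc <- <-]] := U_sc.1 p q.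
apply: (@locally_constant R X (fun t => f (g t)) 0 1 ler01) => t ht.
by have [d d0 hd] := gc t ht _ (h (g t)); exists d.
Qed.

Definition holform {p q} (A : chart R 1 U -> 'cV[C]_1 -> 'M[C]_(p, q)) :=
  (forall c, atlas c -> forall z, cod c z -> exists B, mder (A c) z B) /\
  (forall c d, atlas c -> atlas d -> forall z, cod c z -> dom d (param c z) ->
   forall T, mder (fun w => coord d (param c w)) z T ->
     A c z = T 0 0 *: A d (coord d (param c z))).

Theorem ode_surface n (A : chart R 1 U -> 'cV[C]_1 -> 'M[C]_n) p0 : holform A ->
  exists F : U -> 'M[C]_n, [/\ F p0 = 1%:M, forall p, F p \in unitmx &
    forall c, atlas c -> forall z, cod c z ->
      mder (fun y => F (param c y)) z (F (param c z) *m A c z)].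
Proof.
move=> [Ah Ac].
pose good (s : U -> 'M[C]_n) q := (forall c, atlas c -> dom c q ->
    mder (fun y => s (param c y)) (coord c q) (s q *m A c (coord c q))) /\ s q \in unitmx.
pose Sol (p : U) s := \forall q \near p, good s q.
have [||||||F [F0 hF]] := @monodromy R U n Sol _ _ _ _ _ _ (@surface_small_paths) U_sc p0.
- move=> p; have [c ac dp] := atlas_cover p.
  have cz := coord_cod dp.
  have [|F F1 hF] := @ode_exists R n (A c) (coord c p).
    by apply: filterS (cod_near ac cz) => y; apply: Ah.
  exists (fun q => F (coord c q)).
  have := near_coord ac dp hF; have := dom_near ac dp; apply: filterS2 => q dq [h1 h2].
  split; last exact: h2.
  move=> d ad dq'.
  have cz' := coord_cod dq'; have E := paramK ad dq'.
  have dq2 : dom c (param d (coord d q)) by rewrite E.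
  have [T hT] := transition ad ac cz' dq2.
  rewrite (Ac _ _ ad ac _ cz' dq2 _ hT) E -scalemxAr.
  by apply: mder_comp hT; rewrite E.
- by move=> p s /nbhs_singleton[].
- by move=> p s; rewrite /Sol => h; exact: nbhs_interior.
- move=> p s1 s2 S1 S2; have [c ac dp] := atlas_cover p.
  have cz := coord_cod dp; have E := paramK ac dp.
  have [_ u1] := nbhs_singleton S1; have [_ u2] := nbhs_singleton S2.
  have [B hB] := Ah c ac _ cz.
  have tr s : Sol p s -> \forall y \near coord c p,
      mder (fun y => s (param c y)) y (s (param c y) *m A c y).
    rewrite /Sol -{1}E => /(near_param ac cz); have := cod_near ac cz.
    apply: filterS2 => y cy [h _]; have [d1 d2] := codP ac cy.
    by have := h c ac d1; rewrite d2.
  have := ode_unique hB (tr _ S1) (tr _ S2); rewrite E => /(_ u1) H.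
  exists (s2 p *m invmx (s1 p)); first by rewrite unitmx_mul u2 unitmx_inv.
  have := near_coord ac dp H; have := dom_near ac dp.
  by apply: filterS2 => q dq; rewrite paramK.
- move=> p s B h uB; apply: filterS h => q [h1 h2]; split; last by rewrite unitmx_mul uB.
  move=> c ac dq; rewrite -mulmxA; apply: mder_mull; exact: h1.
- move=> p s s' h e; have e' := nbhs_interior e.
  rewrite /Sol; apply: filterS2 h e' => q [h1 h2] eq.
  have eqq : s' q = s q by exact: nbhs_singleton eq.
  split; last by rewrite eqq.
  move=> c ac dq; rewrite eqq; apply: mder_ext (h1 c ac dq).
  apply: (@near_param R 1 U c _ (fun x => s' x = s x)) => //; first exact: coord_cod.
  by rewrite paramK.
exists F; split=> // [p|c ac z cz]; first by have [] := nbhs_singleton (hF p).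
have [dz E] := codP ac cz.
by have [/(_ c ac dz)] := nbhs_singleton (hF (param c z)); rewrite E.
Qed.

End Surface.

(** * Charts of a complex Lie group and the adjoint representation *)

Section LieGroup.
Context {R : realType} {n : nat} (Gt : complexLieGroup R n).
Local Notation C := R[i].
Local Notation "x ** y" := (@lie_mul R n Gt x y) (at level 40, left associativity).
Local Notation inv := (@lie_inv R n Gt).
Local Notation one := (@lie_one R n Gt).

Lemma lie_mulgV (a : Gt) : a ** inv a = one.
Proof.
rewrite -[LHS](lie_mul1g) -(lie_mulVg (inv a)) -lie_mulA (lie_mulA (inv a)).
by rewrite lie_mulVg lie_mul1g.
Qed.
Lemma lie_mulg1 (a : Gt) : a ** one = a.
Proof. by rewrite -(lie_mulVg a) lie_mulA lie_mulgV lie_mul1g. Qed.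
Lemma lie_mulKg (a b : Gt) : inv a ** (a ** b) = b.
Proof. by rewrite lie_mulA lie_mulVg lie_mul1g. Qed.
Lemma lie_inv_uniq (a b : Gt) : a ** b = one -> b = inv a.
Proof. by move=> h; rewrite -(lie_mulKg a b) h lie_mulg1. Qed.
Lemma lie_invM (a b : Gt) : inv (a ** b) = inv b ** inv a.
Proof.
apply/esym/lie_inv_uniq; rewrite lie_mulA -(lie_mulA a) lie_mulgV lie_mulg1.
exact: lie_mulgV.
Qed.
Lemma lie_inv1 : inv one = one.
Proof. by apply/esym/lie_inv_uniq; rewrite lie_mul1g. Qed.

Lemma lie_mul_cvg (X : Type) (F : set_system X) (f g : X -> Gt) a b : Filter F ->
  f @ F --> a -> g @ F --> b -> (fun x => f x ** g x) @ F --> a ** b.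
Proof.
move=> FF hf hg.
exact: (cvg_comp (fun x => (f x, g x)) (fun p : Gt * Gt => lie_mul p.1 p.2)
  (cvg_pair hf hg) (@lie_mul_cont R n Gt (a, b))).
Qed.

Context (phi : chart R n Gt) (phi_atlas : atlas phi) (phi_one : dom phi one).
Let x0 := coord phi one.
Let cx0 : cod phi x0. Proof. exact: coord_cod. Qed.
Let px0 : param phi x0 = one. Proof. exact: paramK. Qed.

Definition conj_chart (a : Gt) (y : 'cV[C]_n) := coord phi (a ** param phi y ** inv a).

Lemma conj_chart0 a : conj_chart a x0 = x0.
Proof. by rewrite /conj_chart px0 lie_mulg1 lie_mulgV. Qed.

Lemma diff_linear m p (A : 'M[C]_(p, m)) x : differentiable (fun w : 'cV[C]_m => A *m w) x.
Proof. by apply: (@fdm_diff R m p _ x A); apply: fdm_mull; exact: fdm_id. Qed.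

Lemma diff_usub (u : 'cV[C]_(n + n)) : differentiable (fun u : 'cV[C]_(n + n) => usubmx u) u.
Proof.
have -> : (fun u : 'cV[C]_(n + n) => usubmx u) = (fun u => row_mx 1%:M 0 *m u).
  by apply: funext => v; rewrite -{2}(vsubmxK v) mul_row_col mul1mx mul0mx addr0.
exact: diff_linear.
Qed.
Lemma diff_dsub (u : 'cV[C]_(n + n)) : differentiable (fun u : 'cV[C]_(n + n) => dsubmx u) u.
Proof.
have -> : (fun u : 'cV[C]_(n + n) => dsubmx u) = (fun u => row_mx 0 1%:M *m u).
  by apply: funext => v; rewrite -{2}(vsubmxK v) mul_row_col mul1mx mul0mx add0r.
exact: diff_linear.
Qed.

Lemma param_cvg m (c : chart R n Gt) (f : 'cV[C]_m -> 'cV[C]_n) (u : 'cV[C]_m) : atlas c -> cod c (f u) ->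
  differentiable f u -> (fun v => param c (f v)) @ u --> param c (f u :> 'cV[C]_n).
Proof.
move=> ac cu df; apply: (@continuous_comp _ _ _ f (param c) u).
  exact: differentiable_continuous df.
exact: (chart_param_cont (atlas_chart ac) cu).
Qed.

(* The conjugation (p, q) |-> p q p^-1 in charts, on stacked vectors. *)
Definition conj2 (c : chart R n Gt) (u : 'cV[C]_(n + n)) : Gt :=
  param c (usubmx u) ** param phi (dsubmx u) ** inv (param c (usubmx u)).

Lemma conj2_cont (c : chart R n Gt) u : atlas c -> cod c (usubmx u) -> cod phi (dsubmx u) ->
  conj2 c @ u --> conj2 c u.
Proof.
move=> ac c1 c2.
have h1 : (fun u => param c (usubmx u)) @ u --> param c (usubmx u).
  exact: (@param_cvg _ c (fun u => usubmx u) u ac c1 (diff_usub u)).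
have h2 : (fun u => param phi (dsubmx u)) @ u --> param phi (dsubmx u).
  exact: (@param_cvg _ phi (fun u => dsubmx u) u phi_atlas c2 (diff_dsub u)).
apply: (@lie_mul_cvg _ (nbhs u)); first exact: (@lie_mul_cvg _ (nbhs u) _ _ _ _ _ h1 h2).
by apply: (@continuous_comp _ _ _ (fun u => param c (usubmx u)) inv u h1); apply: lie_inv_cont.
Qed.

Lemma conj2_diff (c : chart R n Gt) u : atlas c -> cod c (usubmx u) -> cod phi (dsubmx u) ->
  dom phi (conj2 c u) -> differentiable (fun u => coord phi (conj2 c u)) u.
Proof.
move=> ac c1 c2 dphi.
set p := param c (usubmx u) in dphi *; set q := param phi (dsubmx u) in dphi *.
have [d ad dd] := atlas_cover (p ** q); have [b ab db] := atlas_cover (inv p).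
pose f1 (w : 'cV[C]_n * 'cV[C]_n) := coord d (param c w.1 ** param phi w.2).
have F1 : differentiable f1 (usubmx u, dsubmx u) by apply: lie_mul_holo.
pose f2 x := coord b (inv (param c x)).
have F2 : differentiable f2 (usubmx u) by apply: lie_inv_holo.
pose f3 (w : 'cV[C]_n * 'cV[C]_n) := coord phi (param d w.1 ** param b w.2).
have E1 : f1 (usubmx u, dsubmx u) = coord d (p ** q) by [].
have E2 : f2 (usubmx u) = coord b (inv p) by [].
have K1 := paramK ad dd; have K2 := paramK ab db.
have F3 : differentiable f3 (coord d (p ** q), coord b (inv p)).
  apply: lie_mul_holo => //; try exact: coord_cod.
  by rewrite K1 K2.
pose g1 (v : 'cV[C]_(n + n)) := f1 (usubmx v, dsubmx v).
have G1 : differentiable g1 u.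
  apply: (@differentiable_comp _ _ _ _ (fun v : 'cV[C]_(n + n) => (usubmx v, dsubmx v)) f1 u).
    exact: (differentiable_pair (diff_usub u) (diff_dsub u)).
  exact: F1.
pose g2 (v : 'cV[C]_(n + n)) := f2 (usubmx v).
have G2 : differentiable g2 u.
  exact: (@differentiable_comp _ _ _ _ (fun v : 'cV[C]_(n + n) => usubmx v) f2 u (diff_usub u) F2).
have G3 : differentiable (fun v => f3 (g1 v, g2 v)) u.
  apply: (@differentiable_comp _ _ _ _ (fun v => (g1 v, g2 v)) f3 u).
    exact: (differentiable_pair G1 G2).
  exact: F3.
have [A hA] := diff_fdm G3.
(* near u the intermediate products stay in their charts *)
have n1 : \forall v \near u, dom d (param c (usubmx v) ** param phi (dsubmx v)).
  have : (fun v => param c (usubmx v) ** param phi (dsubmx v)) @ u --> p ** q.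
    apply: (@lie_mul_cvg _ (nbhs u)).
      exact: (@param_cvg _ c (fun u => usubmx u) u ac c1 (diff_usub u)).
    exact: (@param_cvg _ phi (fun u => dsubmx u) u phi_atlas c2 (diff_dsub u)).
  by apply; apply: dom_near.
have n2 : \forall v \near u, dom b (inv (param c (usubmx v))).
  have : (fun v => inv (param c (usubmx v))) @ u --> inv p.
    apply: (@cvg_comp _ _ _ (fun v => param c (usubmx v)) inv _ (nbhs p)).
      exact: (@param_cvg _ c (fun u => usubmx u) u ac c1 (diff_usub u)).
    exact: lie_inv_cont.
  by apply; apply: dom_near.
have n3 : \forall v \near u, coord phi (conj2 c v) = f3 (g1 v, g2 v).
  apply: filterS2 n1 n2 => v d1 d2.
  by rewrite /f3 /g1 /g2 /f1 /f2 /= !paramK.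
have [e e0 he] := (nbhs_nm _ _).1 n3.
by apply: (@fdm_diff R _ _ _ _ A); apply: (fdm_ext e0) hA.
Qed.

Lemma conj2_near (c : chart R n Gt) x : atlas c -> cod c x -> \forall u \near (col_mx x x0 : 'cV[C]_(n + n)),
  [/\ cod c (usubmx u), cod phi (dsubmx u) & dom phi (conj2 c u)].
Proof.
move=> ac cx; set u0 := col_mx x x0 : 'cV[C]_(n + n).
have c1 : cod c (usubmx u0) by rewrite col_mxKu.
have c2 : cod phi (dsubmx u0) by rewrite col_mxKd.
have n1 : \forall u \near u0, cod c (usubmx u).
  by apply: (differentiable_continuous (diff_usub u0)); apply: cod_near.
have n2 : \forall u \near u0, cod phi (dsubmx u).
  by apply: (differentiable_continuous (diff_dsub u0)); apply: cod_near.
have n3 : \forall u \near u0, dom phi (conj2 c u).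
  apply: (conj2_cont ac c1 c2); apply: dom_near => //.
  by rewrite /conj2 col_mxKu col_mxKd px0 lie_mulg1 lie_mulgV.
by near=> u; split; near: u.
Unshelve. all: by end_near. Qed.

Lemma nm_col (v w : 'cV[C]_n) : nm (col_mx v w) = nm v + nm w.
Proof.
rewrite /nm big_split_ord /=; congr (_ + _); apply: eq_bigr => i _; rewrite !big_ord1.
  by rewrite col_mxEu.
by rewrite col_mxEd.
Qed.

(** Ad is holomorphic: it is a partial derivative of the holomorphic map conj2. *)
Lemma Ad_holo (c : chart R n Gt) x : atlas c -> cod c x -> exists L : 'cV[C]_n -> 'M[C]_n,
  fdm (fun x => Ad phi (param c x)) x L /\ (forall (z : C) v, L (z *: v) = z *: L v).
Proof.
move=> ac cx; set u0 := col_mx x x0 : 'cV[C]_(n + n).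
have [r r0 hr] := (nbhs_nm _ _).1 (conj2_near ac cx).
have hA (u : 'cV[C]_(n + n)) : exists A : 'M[C]_(n, n + n), nm (u - u0) < r ->
    fdm (fun u => coord phi (conj2 c u)) u (fun w => A *m w).
  have [ur|ur] := ltP (nm (u - u0)) r; last by exists 0.
  have [] := hr _ ur; rewrite [_ + (u - u0)]addrC subrK => h1 h2 h3.
  by have [A ?] := diff_fdm (conj2_diff ac h1 h2 h3); exists A.
have /choice[A hA'] := hA.
pose f (i : 'I_n) (u : 'cV[C]_(n + n)) : C := coord phi (conj2 c u) i 0.
pose L (i : 'I_n) (u w : 'cV[C]_(n + n)) : C := (A u *m w) i 0.
have cL i u : nm (u - u0) < r -> cfd (f i) u (L i u).
  by move=> ur; split; [exact: (hA' u ur i 0) | move=> z v; rewrite /L -scalemxAr mxE].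
have AdE y i j : nm (y - x) < r -> Ad phi (param c y) i j =
    L i (col_mx y x0) (col_mx 0 (delta_mx j 0)).
  move=> yr; rewrite mxE; set u := col_mx y x0.
  have ur : nm (u - u0) < r.
    by rewrite /u /u0 opp_col_mx add_col_mx subrr nm_col nm0 addr0.
  apply: (@derive_cfd _ _ _ _ (fun w => L i u (col_mx 0 w))).
  split; last first.
    move=> z v; rewrite -(cL i u ur).2; congr (L i u _).
    by rewrite scale_col_mx scaler0.
  have g1 : fdm (fun v : 'cV[C]_n => col_mx y v) x0 (fun v => col_mx (0 : 'cV[C]_n) v).
    move=> k l; case: (split_ordP k) => k' ->.
      by apply: fd_eq (fd_cst (y k' l) x0) => v; rewrite col_mxEu// mxE.
    by apply: fd_eq (fd_coord k' l x0) => v; rewrite col_mxEd.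
  have k := @fd_comp R _ _ _ (fun w : 'cV[C]_n => col_mx y w) x0 _ _ (cL i u ur).1 g1.
  apply: fd_eq k => v //.
  by rewrite /f /= /conj2 col_mxKu col_mxKd.
pose v j : 'cV[C]_(n + n) := col_mx 0 (delta_mx j 0).
have hl ij : exists l, cfd (fun u => L ij.1 u (v ij.2)) u0 l.
  by apply: (@cfd_gradient R _ (f ij.1) (L ij.1) u0 r r0 _ (v ij.2)) => y; apply: cL.
have /choice[l hl'] := hl.
exists (fun w => \matrix_(i, j) l (i, j) (col_mx w 0)); split; last first.
  move=> z w; apply/matrixP => i j; rewrite !mxE -(hl' (i, j)).2; congr (l _ _).
  by rewrite scale_col_mx scaler0.
move=> i j.
have g1 : fdm (fun v : 'cV[C]_n => col_mx v x0) x (fun v => col_mx v (0 : 'cV[C]_n)).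
  move=> k q; case: (split_ordP k) => k' ->.
    by apply: fd_eq (fd_coord k' q x) => w; rewrite col_mxEu.
  by apply: fd_eq (fd_cst (x0 k' q) x) => w; rewrite col_mxEd// mxE.
have k := @fd_comp R _ _ _ (fun w : 'cV[C]_n => col_mx w x0) x _ _ (hl' (i, j)).1 g1; apply: (fd_ext r0 _ _ k) => [w wr|w] /=; last by rewrite mxE.
by apply: AdE; rewrite addrC addKr.
Qed.

Lemma conj_chart_fdm a : fdm (conj_chart a) x0 (fun w => Ad phi a *m w).
Proof.
have [c ac dc] := atlas_cover a; have cx := coord_cod dc.
have E := paramK ac dc.
have [h1 h2 h3] := nbhs_singleton (conj2_near ac cx).
have [A hA] := diff_fdm (conj2_diff ac h1 h2 h3).
have g1 : fdm (fun v : 'cV[C]_n => col_mx (coord c a) v) x0 (fun v => col_mx (0 : 'cV[C]_n) v).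
  move=> k l; case: (split_ordP k) => k' ->.
    by apply: fd_eq (fd_cst (coord c a k' l) x0) => v; rewrite col_mxEu// mxE.
  by apply: fd_eq (fd_coord k' l x0) => v; rewrite col_mxEd.
have hB : fdm (conj_chart a) x0 (fun w => rsubmx A *m w).
  have k := @fdm_comp R _ _ _ _ _ (fun w : 'cV[C]_n => col_mx (coord c a) w) x0 _ _ hA g1; apply: fdm_eq k => w /=.
    by rewrite /conj2 col_mxKu col_mxKd E.
  by rewrite -{2}(hsubmxK A) mul_row_col mulmx0 add0r.
have hB' := hB; apply: fdm_eq hB' => // w; congr (_ *m w); apply/matrixP => i j; rewrite mxE.
have -> : rsubmx A i j = (rsubmx A *m (delta_mx j 0 : 'cV[C]_n)) i 0 by rewrite -colE [RHS]mxE.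
apply: (@derive_cfd _ _ _ _ (fun w => (rsubmx A *m w) i 0)).
by split; [exact: (hB i 0) | move=> z v; rewrite -scalemxAr mxE].
Qed.

End LieGroup.

(** * Laws of the adjoint representation *)

Section AdjointLaws.
Context {R : realType} {n : nat} (Gt : complexLieGroup R n).
Local Notation C := R[i].
Local Notation "x ** y" := (@lie_mul R n Gt x y) (at level 40, left associativity).
Local Notation inv := (@lie_inv R n Gt).
Local Notation one := (@lie_one R n Gt).
Context (phi : chart R n Gt) (phi_atlas : atlas phi) (phi_one : dom phi one).
Let x0 := coord phi one.
Let cx0 : cod phi x0. Proof. exact: coord_cod. Qed.
Let px0 : param phi x0 = one. Proof. exact: paramK. Qed.
Local Notation Ad := (Ad phi).
Local Notation ad := (ad phi).

Lemma mulmx_ext p q (A B : 'M[C]_(p, q)) : (forall w : 'cV[C]_q, A *m w = B *m w) -> A = B.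
Proof. by move=> h; apply/trmx_inj/row_matrixP => i; rewrite -!tr_col !colE h. Qed.

Lemma Ad_unique a (f : 'cV[C]_n -> 'cV[C]_n) L : (\forall y \near x0, conj_chart phi a y = f y) ->
  fdm f x0 L -> forall w, Ad a *m w = L w.
Proof.
move=> /nbhs_nm[d d0 h] hf w.
have H := conj_chart_fdm phi_atlas phi_one a.
by apply: (fdm_unique H (fdm_ext d0 h _ hf)).
Qed.

Lemma conj_near a : \forall y \near x0, cod phi y /\ dom phi (a ** param phi y ** inv a).
Proof.
have n1 := cod_near phi_atlas cx0.
have : (fun y => a ** param phi y ** inv a) @ x0 --> a ** param phi x0 ** inv a.
  apply: (@lie_mul_cvg _ _ _ _ (nbhs x0)); last exact: cvg_cst.
  apply: (@lie_mul_cvg _ _ _ _ (nbhs x0)); first exact: cvg_cst.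
  exact: (chart_param_cont (atlas_chart phi_atlas) cx0).
rewrite px0 lie_mulg1 lie_mulgV => /(_ _ (dom_near phi_atlas phi_one)).
exact: filterS2 n1 => y h1 h2.
Qed.

Lemma Ad_one : Ad one = 1%:M.
Proof.
apply: mulmx_ext => w; rewrite mul1mx.
apply: (@Ad_unique one id id); last exact: fdm_id.
apply: filterS (cod_near phi_atlas cx0) => y cy.
by rewrite /conj_chart lie_inv1 lie_mulg1 lie_mul1g; have [] := codP phi_atlas cy.
Qed.

Lemma AdM a b : Ad (a ** b) = Ad a *m Ad b.
Proof.
apply: mulmx_ext => w; rewrite -mulmxA.
have hb := conj_chart_fdm phi_atlas phi_one b; have ha := conj_chart_fdm phi_atlas phi_one a.
have hab : fdm (conj_chart phi a \o conj_chart phi b) x0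
    ((fun w => Ad a *m w) \o (fun w => Ad b *m w)).
  by apply: fdm_comp hb; rewrite conj_chart0.
apply: (Ad_unique _ hab).
apply: filterS (conj_near b) => y [cy dy].
by rewrite /= {2}/conj_chart {2}/conj_chart paramK// /conj_chart lie_invM !lie_mulA.
Qed.

Lemma AdV a : Ad a *m Ad (inv a) = 1%:M.
Proof. by rewrite -AdM lie_mulgV Ad_one. Qed.

Lemma ad_fdm : fdm (fun x => Ad (param phi x)) x0 ad /\ forall z X, ad (z *: X) = z *: ad X.
Proof.
have [L [hL lz]] := Ad_holo phi_atlas phi_one phi_atlas cx0.
have E X : ad X = L X.
  apply/matrixP => i j; rewrite mxE.
  apply: (@derive_cfd R n (fun x => Ad (param phi x) i j) x0 (fun v => L v i j)).
  by split=> [|z v]; [exact: hL | rewrite lz mxE].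
by split=> [|z X]; [exact: fdm_eq hL | rewrite !E].
Qed.

Lemma adZ z X : ad (z *: X) = z *: ad X. Proof. exact: (ad_fdm.2). Qed.
Lemma adD X Y : ad (X + Y) = ad X + ad Y.
Proof. exact: (fdm_rlin ad_fdm.1).1. Qed.

Lemma fdm_lin m p q (T : 'cV[C]_m -> 'M[C]_(p, q)) x :
  (forall u v, T (u + v) = T u + T v) -> (forall z v, T (z *: v) = z *: T v) -> fdm T x T.
Proof.
move=> TD TZ.
have T0 : T 0 = 0 by rewrite -(scale0r 0) TZ scale0r.
have TE v i j : T v i j = \sum_k v k 0 * T (delta_mx k 0) i j.
  rewrite {1}[v]matrix_sum_delta (big_morph _ TD T0) summxE; apply: eq_bigr => k _.
  by rewrite big_ord1 TZ mxE.
move=> i j.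
have h := @fd_sum R m _ (index_enum 'I_m) xpredT (fun k v => v k 0 * T (delta_mx k 0) i j) x
  _ (fun k _ => fd_mul (fd_coord k 0 x) (fd_cst (T (delta_mx k 0) i j) x)).
apply: fd_eq h => v; first exact: TE.
by rewrite TE; apply: eq_bigr => k _; rewrite mulr0 addr0.
Qed.

Lemma Ad_ad a X : Ad a *m ad X *m Ad (inv a) = ad (Ad a *m X).
Proof.
have h1 : fdm (fun y => Ad a *m Ad (param phi y) *m Ad (inv a)) x0
    (fun X => Ad a *m ad X *m Ad (inv a)).
  by apply: fdm_mulr; apply: fdm_mull; exact: ad_fdm.1.
have h2 : fdm ((fun y => Ad (param phi y)) \o conj_chart phi a) x0 (ad \o (fun w => Ad a *m w)).
  apply: fdm_comp (conj_chart_fdm phi_atlas phi_one a).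
  by rewrite conj_chart0//; exact: ad_fdm.1.
have [d d0 h] := (nbhs_nm _ _).1 (conj_near a).
have h3 : fdm (fun y => Ad a *m Ad (param phi y) *m Ad (inv a)) x0 (ad \o (fun w => Ad a *m w)).
  apply: (fdm_ext d0 _ _ h2) => // w /h[cy dy] /=.
  by rewrite /conj_chart paramK// !AdM.
exact: (fdm_unique h1 h3).
Qed.

Lemma ad_ad Z X : ad Z *m ad X = ad (ad Z *m X) + ad X *m ad Z.
Proof.
have hA := ad_fdm.1.
have h1 : fdm (fun y => Ad (param phi y) *m ad X) x0 (fun Z => ad Z *m ad X).
  exact: fdm_mulr.
have hc : fdm (fun y => Ad (param phi y) *m X) x0 (fun Z => ad Z *m X).
  exact: fdm_mulr.
have h2 : fdm (fun y => ad (Ad (param phi y) *m X) *m Ad (param phi y)) x0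
    (fun Z => ad (ad Z *m X) *m Ad (param phi x0) + ad (Ad (param phi x0) *m X) *m ad Z).
  exact: (fdm_mul (fdm_comp (fdm_lin _ adD adZ) hc) hA).
have E : forall y, ad (Ad (param phi y) *m X) *m Ad (param phi y) = Ad (param phi y) *m ad X.
  move=> y; rewrite -Ad_ad -[LHS]mulmxA.
  have V : Ad (inv (param phi y)) *m Ad (param phi y) = 1%:M.
    by rewrite -AdM lie_mulVg Ad_one.
  exact: etrans (congr1 (mulmx (Ad (param phi y) *m ad X)) V) (mulmx1 _).
have h3 : fdm (fun y => Ad (param phi y) *m ad X) x0
    (fun Z => ad (ad Z *m X) *m Ad (param phi x0) + ad (Ad (param phi x0) *m X) *m ad Z).
  by apply: fdm_eq h2 => y; [exact: esym (E y) | exact: erefl].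
have e : ad Z *m ad X = ad (ad Z *m X) *m Ad (param phi x0) + ad (Ad (param phi x0) *m X) *m ad Z.
  exact: (fdm_unique h1 h3 Z).
move: e; rewrite px0 Ad_one.
(* the derivative behind ad is hidden from the unifier *)
by move: (Defs.ad phi) => A ->; rewrite mulmx1 mul1mx.
Qed.

(** sigma0 is the derivative of sigma at one, so conjugation by a fixed point
    of sigma commutes with sigma0. *)
Lemma sigma0_Ad (sigma : Gt -> Gt) sigma0 : involution_with_differential phi sigma sigma0 ->
  forall b w, sigma b = b -> sigma0 (Ad b *m w) = Ad b *m sigma0 w.
Proof.
move=> hs b w sb.
have s1 : sigma one = one.
  have := sigma_mul hs one one; rewrite lie_mul1g => h.
  by rewrite -(lie_mulKg (sigma one) (sigma one)) -h lie_mulVg.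
have sV a : sigma (inv a) = inv (sigma a).
  by apply: lie_inv_uniq; rewrite -(sigma_mul hs) lie_mulgV s1.
pose s y := coord phi (sigma (param phi y)).
have ns : \forall y \near x0, dom phi (sigma (param phi y)).
  have : (sigma \o param phi) @ x0 --> sigma (param phi x0).
    apply: continuous_comp; first exact: (chart_param_cont (atlas_chart phi_atlas) cx0).
    exact: (sigma_cont hs).
  by rewrite px0 s1 => /(_ _ (dom_near phi_atlas phi_one)).
pose D := cod phi `&` [set z | dom phi (sigma (param phi z))].
have oD : open D.
  rewrite openE => z [cz dz]; apply: filterI; first exact: cod_near.
  have : (sigma \o param phi) @ z --> sigma (param phi z).
    apply: continuous_comp; first exact: (chart_param_cont (atlas_chart phi_atlas) cz).
    exact: (sigma_cont hs).
  by apply; exact: dom_near.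
have D0 : D x0 by split=> //=; rewrite px0 s1.
have sf : fdm s x0 sigma0.
  have sm := sigma_smooth hs phi_atlas phi_atlas.
  have hf i j : fd (fun y => s y i j) x0 (fun v => (rdiff v (fun y => complex.Re (s y i j)) x0)%:C +
      'i * (rdiff v (fun y => complex.Im (s y i j)) x0)%:C).
    have [hr hi] := sm i j.
    apply: fd_eq (fd_add (fd_C1 oD (hr 1%N) D0) (fd_scale 'i (fd_C1 oD (hi 1%N) D0))) => // y.
    by rewrite -complexE.
  move=> i j; have h : fdm s x0 (fun v => rdiff_mx v s x0).
    move=> k l; apply: fd_eq (hf k l) => // v; rewrite mxE.
    exact: (complexE (_ +i* _)).
  apply: fd_eq (h i j) => // v; by rewrite -(sigma_diff hs v).
have c0 := conj_chart0 phi_atlas phi_one b.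
have hb := conj_chart_fdm phi_atlas phi_one b.
have s0 : s x0 = x0 by rewrite /s px0 s1.
have h1 : fdm (s \o conj_chart phi b) x0 (sigma0 \o (fun w => Ad b *m w)).
  by apply: fdm_comp hb; rewrite c0.
have h2 : fdm (conj_chart phi b \o s) x0 ((fun w => Ad b *m w) \o sigma0).
  by apply: fdm_comp sf; rewrite s0.
have : \forall y \near x0, s (conj_chart phi b y) = conj_chart phi b (s y).
  apply: filterS2 (conj_near b) ns => y [cy dy] dsy.
  rewrite /s /conj_chart !paramK//; congr coord.
  by rewrite !(sigma_mul hs) sV sb.
move=> /nbhs_nm[d d0 h].
have h3 : fdm (s \o conj_chart phi b) x0 ((fun w => Ad b *m w) \o sigma0).
  by apply: (fdm_ext d0 h _ h2).
exact: (fdm_unique h1 h3 w).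
Qed.

End AdjointLaws.

(** * Algebra of a compact real form *)

Section CompactLie.
Context {R : realType}.
Local Notation C := R[i].

Definition conjm p q (A : 'M[C]_(p, q)) : 'M[C]_(p, q) := map_mx Num.conj A.

Lemma adjE p q (A : 'M[C]_(p, q)) : A^t* = conjm A^T.
Proof. by apply/matrixP => i j; rewrite !mxE. Qed.
Lemma conjm_tr p q (A : 'M[C]_(p, q)) : (conjm A)^T = conjm A^T.
Proof. by apply/matrixP => i j; rewrite !mxE. Qed.
Lemma conjmK p q (A : 'M[C]_(p, q)) : conjm (conjm A) = A.
Proof. by apply/matrixP => i j; rewrite !mxE conjCK. Qed.
Lemma conjmM p q r (A : 'M[C]_(p, q)) (B : 'M[C]_(q, r)) : conjm (A *m B) = conjm A *m conjm B.
Proof. exact: map_mxM. Qed.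
Lemma conjmD p q (A B : 'M[C]_(p, q)) : conjm (A + B) = conjm A + conjm B.
Proof. exact: map_mxD. Qed.
Lemma conjmN p q (A : 'M[C]_(p, q)) : conjm (- A) = - conjm A.
Proof. exact: map_mxN. Qed.
Lemma conjm1 n : conjm (1%:M : 'M[C]_n) = 1%:M.
Proof. by apply/matrixP => i j; rewrite !mxE rmorph_nat. Qed.
Lemma adjM p q r (A : 'M[C]_(p, q)) (B : 'M[C]_(q, r)) : (A *m B)^t* = B^t* *m A^t*.
Proof. by rewrite !adjE trmx_mul conjmM. Qed.
Lemma adjK p q (A : 'M[C]_(p, q)) : (A^t* )^t* = A.
Proof. by apply/matrixP => i j; rewrite !mxE conjCK. Qed.
Lemma adjD p q (A B : 'M[C]_(p, q)) : (A + B)^t* = A^t* + B^t*.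
Proof. by rewrite !adjE linearD conjmD. Qed.
Lemma adjm1 n : (1%:M : 'M[C]_n)^t* = 1%:M.
Proof. by rewrite adjE trmx1 conjm1. Qed.

Context {n : nat}.
Implicit Types (x y z : 'cV[C]_n) (A F P Q : 'M[C]_n).

(** The adjoint representation of a complex semisimple Lie algebra, in the
    coordinates of an orthonormal basis of a compact real form. *)
Record compact_lie (AD : 'cV[C]_n -> 'M[C]_n) : Prop := CompactLie {
  clD : forall x y, AD (x + y) = AD x + AD y;
  clZ : forall (k : C) x, AD (k *: x) = k *: AD x;
  clJ : forall x y, AD x *m AD y = AD (AD x *m y) + AD y *m AD x;
  cl_tr : forall x y, \tr (AD x *m AD y) = - (x^T *m y) 0 0;
  cl_conj : forall x, AD (conjm x) = conjm (AD x) }.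

Context (AD : 'cV[C]_n -> 'M[C]_n) (L : compact_lie AD).

Lemma cl0 : AD 0 = 0. Proof. by rewrite -(scale0r 0) (clZ L) scale0r. Qed.
Lemma clN x : AD (- x) = - AD x. Proof. by rewrite -scaleN1r (clZ L) scaleN1r. Qed.
Lemma clB x y : AD (x - y) = AD x - AD y. Proof. by rewrite (clD L) clN. Qed.

Lemma dot_delta x k : (x^T *m (delta_mx k 0 : 'cV[C]_n)) 0 0 = x k 0.
Proof. by rewrite -colE [LHS]mxE mxE. Qed.

Lemma dot_ext x y : (forall z, (x^T *m z) 0 0 = (y^T *m z) 0 0) -> x = y.
Proof.
move=> h; apply/matrixP => i j; rewrite ord1 -[LHS]dot_delta -[RHS]dot_delta.
exact: h.
Qed.

Lemma cl_tr_ext x y : (forall z, \tr (AD x *m AD z) = \tr (AD y *m AD z)) -> x = y.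
Proof. by move=> h; apply: dot_ext => z; have := h z; rewrite !(cl_tr L) => /oppr_inj. Qed.

Lemma cl_inj x y : AD x = AD y -> x = y.
Proof. by move=> e; apply: cl_tr_ext => z; rewrite e. Qed.

Lemma mxtr3 A B P : \tr (A *m B *m P) = \tr (B *m P *m A).
Proof. by rewrite -mulmxA mxtrace_mulC. Qed.

Lemma mxtrB A B : \tr (A - B) = \tr A - \tr B. Proof. exact: linearB. Qed.

Lemma mxtr_comm A B P : \tr ((A *m B - B *m A) *m P) = \tr (A *m (B *m P - P *m B)).
Proof.
rewrite mulmxBl mulmxBr !mxtrB !mulmxA; congr (_ - _).
exact: mxtr3.
Qed.

(** Invariance of the Killing form. *)
Lemma cl_tr_skew x : (AD x)^T = - AD x.
Proof.
have h y z : ((AD x *m y)^T *m z) 0 0 = - (y^T *m (AD x *m z)) 0 0.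
  apply: oppr_inj; rewrite -!(cl_tr L).
  have -> : AD (AD x *m y) = AD x *m AD y - AD y *m AD x by rewrite (clJ L) addrK.
  have -> : AD (AD x *m z) = AD x *m AD z - AD z *m AD x by rewrite (clJ L) addrK.
  rewrite -mxtr_comm; move: (AD x) (AD y) (AD z) => A B P.
  have -> : (A *m B - B *m A) *m P = - ((B *m A - A *m B) *m P) by rewrite -[RHS]mulNmx opprB.
  exact: linearN.
apply: mulmx_ext => z; apply: dot_ext => w.
rewrite trmx_mul trmxK mulNmx linearN /= mulNmx [RHS]mxE -mulmxA.
by rewrite h opprK.
Qed.

Lemma cl_adj x : (AD x)^t* = - AD (conjm x).
Proof. by rewrite adjE cl_tr_skew conjmN (cl_conj L). Qed.

Definition aut F := F^T *m F = 1%:M /\ forall x, F *m AD x = AD (F *m x) *m F.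

Lemma aut_trr F : aut F -> F *m F^T = 1%:M.
Proof. by case=> h _; exact: mulmx1C. Qed.

Lemma autM F P : aut F -> aut P -> aut (F *m P).
Proof.
move=> [f1 f2] [p1 p2]; split=> [|x].
  by rewrite trmx_mul mulmxA -(mulmxA P^T) f1 mulmx1.
by rewrite -mulmxA p2 mulmxA f2 !mulmxA.
Qed.

Lemma autT F : aut F -> aut F^T.
Proof.
move=> aF; have [f1 f2] := aF; have f3 := aut_trr aF; split=> [|x].
  by rewrite trmxK.
have := f2 (F^T *m x); rewrite mulmxA f3 mul1mx => h.
have e : F^T *m (F *m AD (F^T *m x)) *m F^T = F^T *m (AD x *m F) *m F^T by rewrite h.
by move: e; rewrite mulmxA f1 mul1mx => ->; rewrite -!mulmxA f3 mulmx1.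
Qed.

Lemma aut_conj F : aut F -> aut (conjm F).
Proof.
move=> [f1 f2]; split=> [|x]; first by rewrite conjm_tr -conjmM f1 conjm1.
rewrite -{1}(conjmK x) (cl_conj L) -conjmM f2 conjmM -(cl_conj L) conjmM.
by rewrite conjmK.
Qed.

Lemma aut_adj F : aut F -> aut (F^t* ).
Proof. by move=> /autT/aut_conj; rewrite adjE. Qed.

Lemma clE z : AD z = \sum_k z k 0 *: AD (delta_mx k 0).
Proof.
rewrite {1}[z]matrix_sum_delta (big_morph AD (clD L) cl0); apply: eq_bigr => k _.
by rewrite big_ord1 (clZ L).
Qed.

(** The element of g nearest to Q for the trace form. *)
Definition adproj Q : 'cV[C]_n := \col_k (- \tr (Q *m AD (delta_mx k 0))).

Lemma tr_proj Q z : \tr (AD (adproj Q) *m AD z) = \tr (Q *m AD z).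
Proof.
rewrite (cl_tr L) mxE -sumrN [in RHS]clE mulmx_sumr (big_morph _ (@mxtraceD _ _) (@mxtrace0 _ _)).
by apply: eq_bigr => k _; rewrite !mxE -scalemxAr mxtraceZ mulNr opprK mulrC.
Qed.

Lemma adprojAD x : adproj (AD x) = x.
Proof. by apply: cl_tr_ext => z; rewrite tr_proj. Qed.

Definition defect Q x := Q *m AD x - AD x *m Q - AD (Q *m x).

(** How far an endomorphism is from being inner is controlled by how far it is
    from being a derivation. *)
Lemma defect_proj Q x k :
  ((Q - AD (adproj Q)) *m x) k 0 = \tr (defect Q x *m AD (delta_mx k 0)).
Proof.
rewrite -dot_delta; apply: oppr_inj; rewrite -(cl_tr L).
set y := adproj Q; set z := delta_mx k 0.
have hy := tr_proj Q (AD x *m z).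
have e1 : AD (AD x *m z) = AD x *m AD z - AD z *m AD x by rewrite (clJ L) addrK.
have e2 : AD ((Q - AD y) *m x) = AD (Q *m x) - (AD y *m AD x - AD x *m AD y).
  by rewrite mulmxBl clB [in RHS](clJ L) addrK.
rewrite e2 /defect; move: hy; rewrite e1 -/y.
move: (AD (Q *m x)) (AD y) (AD x) (AD z) => A Y X Z h.
by rewrite mulmxBl mxtrB mxtr_comm h -mxtr_comm [in RHS]mulmxBl mxtrB opprB.
Qed.

Lemma deriv_inner Q : (forall x, Q *m AD x = AD (Q *m x) + AD x *m Q) -> Q = AD (adproj Q).
Proof.
move=> h; apply/eqP; rewrite -subr_eq0; apply/eqP; apply: mulmx_ext => x.
rewrite mul0mx; apply/matrixP => k j; rewrite ord1 defect_proj.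
by rewrite /defect h addrK subrr mul0mx mxtrace0 mxE.
Qed.

Lemma nm_delta k : nm (delta_mx k 0 : 'cV[C]_n) = 1.
Proof.
rewrite /nm (bigD1 k)//= big_ord1 mxE !eqxx nc1 big1 ?addr0// => i /negbTE ik.
by rewrite big_ord1 mxE ik nc0.
Qed.

Lemma nc_tr A : nc (\tr A) <= nm A.
Proof.
apply: le_trans (nc_sum _ _ _) _; apply: ler_sum => i _.
by rewrite (bigD1 i)//= lerDl sumr_ge0// => j _; exact: nc_ge0.
Qed.

Lemma ad_bound : exists2 K : R, 0 < K & forall x, nm (AD x) <= K * nm x.
Proof.
pose K := \sum_k nm (AD (delta_mx k 0)) + 1.
have K0 : 0 <= \sum_k nm (AD (delta_mx k 0)) by apply: sumr_ge0 => k _; exact: nm_ge0.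
exists K => [|x]; first by rewrite /K; lra.
rewrite clE; apply: le_trans (nm_sum _ _ _) _.
apply: (@le_trans _ _ (\sum_k nm (AD (delta_mx k 0)) * nm x)).
  apply: ler_sum => k _; apply: le_trans (nmZ _ _) _; rewrite mulrC.
  by apply: ler_wpM2l; [exact: nm_ge0 | exact: nm_le].
by rewrite -mulr_suml; apply: ler_wpM2r; [exact: nm_ge0 | rewrite /K; lra].
Qed.

Lemma proj_bound : exists2 K : R, 0 < K & forall Q, nm (adproj Q) <= K * nm Q.
Proof.
pose M := \sum_k nm (AD (delta_mx k 0)).
have M0 : 0 <= M by apply: sumr_ge0 => k _; exact: nm_ge0.
exists ((n * 1)%:R * M + 1) => [|Q]; first by rewrite ltr_wpDl// mulr_ge0.
apply: (@le_trans _ _ ((n * 1)%:R * (M * nm Q))).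
  apply: nm_bound => i j; rewrite mxE ncN; apply: le_trans (nc_tr _) _.
  apply: le_trans (nmM _ _) _; rewrite mulrC; apply: ler_wpM2r; first exact: nm_ge0.
  by rewrite /M (bigD1 i)//= lerDl sumr_ge0// => k _; exact: nm_ge0.
by rewrite mulrA mulrDl mul1r lerDl nm_ge0.
Qed.

(** An automorphism near 1 is inner to first order. *)
Lemma aut_proj : exists2 K : R, 0 < K & forall F, aut F ->
  nm (F - 1%:M - AD (adproj (F - 1%:M))) <= K * nm (F - 1%:M) ^+ 2.
Proof.
have [K K0 hK] := ad_bound.
pose K' := (n * n)%:R * (K * K).
have K'0 : 0 <= K' by rewrite !mulr_ge0 ?(ltW K0).
exists (K' + 1) => [|F [_ hF]]; first by lra.
move EQ : (F - 1%:M) => Q.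
have FE : F = 1%:M + Q by rewrite -EQ addrC subrK.
have dE x : defect Q x = AD (Q *m x) *m Q.
  have := hF x; rewrite FE !mulmxDl !mul1mx (clD L) mulmxDr mulmx1 mulmxDl => h.
  rewrite /defect.
  have -> : Q *m AD x = AD x + AD (Q *m x) + (AD x *m Q + AD (Q *m x) *m Q) - AD x.
    by rewrite -h [_ + Q *m _]addrC addrK.
  move: (AD x) (AD (Q *m x)) (AD x *m Q) (AD (Q *m x) *m Q) => a b c d.
  rewrite -[a + b + (c + d)]addrA [a + _]addrC addrK addrAC [b + _]addrC addrK.
  by rewrite [c + d]addrC addrK.
apply: (@le_trans _ _ (K' * nm Q ^+ 2)); last first.
  by apply: ler_wpM2r; [exact: sqr_ge0 | lra].
rewrite /K' -mulrA; apply: nm_bound => i j.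
have -> : (Q - AD (adproj Q)) i j = ((Q - AD (adproj Q)) *m (delta_mx j 0 : 'cV[C]_n)) i 0.
  by rewrite -colE [RHS]mxE.
rewrite defect_proj dE; apply: le_trans (nc_tr _) _; apply: le_trans (nmM _ _) _.
have q0 := nm_ge0 Q.
have a1 := hK (Q *m (delta_mx j 0 : 'cV[C]_n)); have a2 := hK (delta_mx i 0 : 'cV[C]_n).
have a3 := nmM Q (delta_mx j 0 : 'cV[C]_n).
rewrite !nm_delta !mulr1 in a2 a3.
have -> : K * K * nm Q ^+ 2 = (K * nm Q) * nm Q * K by ring.
apply: ler_pM a2; rewrite ?nm_ge0//; apply: le_trans (nmM _ _) _.
apply: ler_wpM2r => //; apply: le_trans a1 _.
by apply: ler_wpM2l => //; exact: ltW.
Qed.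

End CompactLie.

(** * The adjoint group in an orthonormal basis *)

Section BasisChange.
Context {R : realType} {n : nat}.
Local Notation C := R[i].
Implicit Types (x y z : 'cV[C]_n) (A F : 'M[C]_n) (r s : 'cV[R]_n).

Lemma inj_unitmx A : (forall x, A *m x = 0 -> x = 0) -> A \in unitmx.
Proof.
move=> hA; rewrite -unitmx_tr -row_free_unit -kermx_eq0; apply/eqP/row_matrixP => i.
rewrite row0; apply: trmx_inj; rewrite trmx0; apply: hA.
apply: trmx_inj; rewrite trmx_mul trmxK trmx0; apply/sub_kermxP; exact: row_sub.
Qed.

Definition realv m (r : 'cV[R]_m) : 'cV[C]_m := map_mx (fun t => t%:C) r.

Lemma realv_delta (k : 'I_n) : delta_mx k 0 = realv (delta_mx k 0).
Proof. by apply/matrixP => i j; rewrite !mxE; case: (_ && _). Qed.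

Lemma conjm_realv m (r : 'cV[R]_m) : conjm (realv r) = realv r.
Proof. by apply/matrixP => i j; rewrite !mxE; apply: cE; rewrite !reim ?oppr0. Qed.

Context (e : 'I_n -> 'cV[C]_n).
Definition basis_mx : 'M[C]_n := \matrix_(i, j) e j i 0.
Local Notation E := basis_mx.

Lemma basisE x : E *m x = \sum_k x k 0 *: e k.
Proof.
apply/matrixP => i j; rewrite ord1 summxE mxE; apply: eq_bigr => k _.
by rewrite !mxE mulrC.
Qed.

Context (A : 'cV[C]_n -> 'M[C]_n).
Hypotheses (A_D : forall x y, A (x + y) = A x + A y)
  (A_Z : forall (c : C) x, A (c *: x) = c *: A x)
  (A_A : forall x y, A x *m A y = A (A x *m y) + A y *m A x)
  (A_tr : forall i j, \tr (A (e i) *m A (e j)) = - (i == j)%:R)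
  (A_real : forall k, conjm (invmx E *m A (e k) *m E) = invmx E *m A (e k) *m E).

Let A0 : A 0 = 0. Proof. by rewrite -(scale0r 0) A_Z scale0r. Qed.

Lemma killing_basis x y : \tr (A (E *m x) *m A (E *m y)) = - (x^T *m y) 0 0.
Proof.
have AE z : A (E *m z) = \sum_k z k 0 *: A (e k).
  by rewrite basisE (big_morph A A_D A0); apply: eq_bigr => k _; rewrite A_Z.
rewrite !AE mulmx_suml (big_morph _ (@mxtraceD _ _) (@mxtrace0 _ _)) mxE -sumrN.
apply: eq_bigr => i _; rewrite mulmx_sumr (big_morph _ (@mxtraceD _ _) (@mxtrace0 _ _)).
rewrite (bigD1 i)//= big1 ?addr0 => [|j ji].
  by rewrite -scalemxAl -scalemxAr !mxtraceZ A_tr eqxx !mxE mulrN1 mulrN.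
by rewrite -scalemxAl -scalemxAr !mxtraceZ A_tr eq_sym (negbTE ji) oppr0 !mulr0.
Qed.

Lemma basis_unit : E \in unitmx.
Proof.
apply: inj_unitmx => x x0; apply: dot_ext => z; rewrite trmx0 mul0mx.
apply: oppr_inj; rewrite -killing_basis x0 A0.
by rewrite mul0mx mxtrace0 mxE oppr0.
Qed.
Let EU := basis_unit.

Lemma basis_compact_lie : compact_lie (fun x => invmx E *m A (E *m x) *m E).
Proof.
have M F P : (invmx E *m F *m E) *m (invmx E *m P *m E) = invmx E *m (F *m P) *m E.
  by rewrite !mulmxA mulmxK.
have ke k : E *m delta_mx k 0 = e k.
  by apply/matrixP => i j; rewrite ord1 -colE !mxE.
split.
- by move=> x y; rewrite mulmxDr A_D mulmxDr mulmxDl.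
- by move=> k x; rewrite -scalemxAr A_Z -scalemxAr -scalemxAl.
- move=> x y; have -> : E *m (invmx E *m A (E *m x) *m E *m y) = A (E *m x) *m (E *m y).
    by rewrite !mulmxA mulmxV// mul1mx.
  rewrite (M (A (E *m x)) (A (E *m y))) (M (A (E *m y)) (A (E *m x))) -mulmxDl -mulmxDr.
  by rewrite -A_A.
- by move=> x y; rewrite M mxtrace_mulC !mulmxA mulmxV// mul1mx killing_basis.
move=> x; have AE z : invmx E *m A (E *m z) *m E = \sum_k z k 0 *: (invmx E *m A (e k) *m E).
  rewrite basisE (big_morph A A_D A0) mulmx_sumr mulmx_suml; apply: eq_bigr => k _.
  by rewrite A_Z -scalemxAr -scalemxAl.
rewrite !AE /conjm (big_morph _ (@map_mxD _ _ _ _ _) (map_mx0 _ _ _)).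
apply: eq_bigr => k _; rewrite mxE map_mxZ; congr (_ *: _); exact/esym/A_real.
Qed.

End BasisChange.

Lemma aut_of {R : realType} {n} (AD : 'cV[R[i]]_n -> 'M[R[i]]_n) (F P : 'M[R[i]]_n) :
  compact_lie AD -> F *m P = 1%:M -> (forall x, F *m AD x *m P = AD (F *m x)) -> aut AD F.
Proof.
move=> L FP h; have PF := mulmx1C FP.
split=> [|x]; last by rewrite -h -mulmxA PF mulmx1.
apply: mulmx_ext => x; rewrite mul1mx; apply: dot_ext => y.
have -> : (F^T *m F *m x)^T *m y = (F *m x)^T *m (F *m y).
  by rewrite !trmx_mul trmxK !mulmxA.
apply: oppr_inj; rewrite -!(cl_tr L) -!h.
move: (AD x) (AD y) => X Y.
have -> : F *m X *m P *m (F *m Y *m P) = F *m (X *m Y *m P).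
  by rewrite !mulmxA -(mulmxA (F *m X)) PF mulmx1.
by rewrite [LHS]mxtrace_mulC -(mulmxA (X *m Y)) PF mulmx1.
Qed.

Section RealForm.
Context {R : realType} {n : nat} (Gt : complexLieGroup R n).
Local Notation C := R[i].
Local Notation "x ** y" := (@lie_mul R n Gt x y) (at level 40, left associativity).
Local Notation inv := (@lie_inv R n Gt).
Local Notation one := (@lie_one R n Gt).
Context (phi : chart R n Gt) (phi_atlas : atlas phi) (phi_one : dom phi one).
Context (h : set 'cV[C]_n) (hc : compact_real_form phi h).
Context (e : 'I_n -> 'cV[C]_n) (he : orthonormal_basis phi h e).
Implicit Types (x y z : 'cV[C]_n) (A F : 'M[C]_n) (r s : 'cV[R]_n).
Local Notation E := (basis_mx e).

Let EU : E \in unitmx.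
Proof.
exact: (basis_unit (adD phi_atlas phi_one) (adZ phi_atlas phi_one) (let: And3 _ _ o := he in o)).
Qed.

Lemma in_basisE A : in_basis e A = invmx E *m A *m E. Proof. by []. Qed.
Lemma in_basisM A F : in_basis e (A *m F) = in_basis e A *m in_basis e F.
Proof. by rewrite !in_basisE !mulmxA mulmxK. Qed.
Lemma in_basis_mul A x : E *m (in_basis e A *m x) = A *m (E *m x).
Proof. by rewrite in_basisE !mulmxA mulmxV// mul1mx. Qed.

Definition AD x : 'M[C]_n := invmx E *m ad phi (E *m x) *m E.

Lemma adgE X : adg phi e X = AD (invmx E *m X).
Proof. by rewrite /AD mulKVmx. Qed.

Lemma h_real r : h (E *m realv r).
Proof.
rewrite basisE; have [hi _ _] := he.
elim/big_ind: _ => [|x y|k _]; [exact: real_form0 hc | exact: (real_formD hc) |].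
by rewrite mxE; apply: (real_formZ hc); exact: hi.
Qed.

Lemma h_coord X : h X -> exists r, X = E *m realv r.
Proof.
move=> hX; have [_ hr _] := he; have [r ->] := hr X hX.
by exists (\col_k r k); rewrite basisE; apply: eq_bigr => k _; rewrite !mxE.
Qed.

Lemma E_inj x y : E *m x = E *m y -> x = y.
Proof. by move=> xy; rewrite -(mulKmx EU x) xy mulKmx. Qed.

(** A map that preserves the real form has real entries. *)
Lemma real_entries A : (forall X, h X -> h (A *m X)) -> conjm (in_basis e A) = in_basis e A.
Proof.
move=> hA; apply/matrixP => i j.
have [r hr] := h_coord (hA _ (h_real (delta_mx j 0))).
move: hr; rewrite -in_basis_mul => /E_inj hr.
have E1 : in_basis e A i j = realv r i 0.
  by rewrite -hr -realv_delta -colE [RHS]mxE.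
by rewrite [LHS]mxE E1 -{2}(conjm_realv r) [RHS]mxE.
Qed.

Lemma AD_compact : compact_lie AD.
Proof.
apply: basis_compact_lie (adD phi_atlas phi_one) (adZ phi_atlas phi_one) (ad_ad phi_atlas phi_one) _ _.
  by have [] := he.
move=> k; apply: real_entries => X hX; apply: (real_form_bracket hc) => //.
by have [] := he.
Qed.

Lemma adjoint_aut F : adjoint_group phi e F -> aut AD F.
Proof.
move=> [a _ <-]; apply: (@aut_of _ _ _ _ (in_basis e (Ad phi (inv a))) AD_compact).
  by rewrite -in_basisM AdV// in_basisE mulmx1 mulVmx.
move=> x; have t := congr1 (in_basis e) (Ad_ad phi_atlas phi_one a (E *m x)).
rewrite -(in_basis_mul (Ad phi a) x) in_basisM in_basisM in t; exact: t.
Qed.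

Lemma adjoint1 : adjoint_group phi e 1%:M.
Proof.
exists one; first exact: I.
by rewrite (Ad_one phi_atlas phi_one) in_basisE mulmx1 mulVmx.
Qed.

Lemma adjointM F P : adjoint_group phi e F -> adjoint_group phi e P -> adjoint_group phi e (F *m P).
Proof.
move=> [a _ <-] [b _ <-]; exists (a ** b); first exact: I.
by rewrite (AdM phi_atlas phi_one) in_basisM.
Qed.

Lemma adjointT F : adjoint_group phi e F -> adjoint_group phi e F^T.
Proof.
move=> aF; have [f1 _] := adjoint_aut aF; move: aF => [a _ aF].
exists (inv a); first exact: I.
have I : F *m in_basis e (Ad phi (inv a)) = 1%:M.
  by rewrite -aF -in_basisM AdV// in_basisE mulmx1 mulVmx.
by rewrite -[LHS]mul1mx -f1 -mulmxA I mulmx1.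
Qed.

Context (sigma0 : 'cV[C]_n -> 'cV[C]_n) (sc : is_conjugation h sigma0).
Context (sigma : Gt -> Gt) (sinv : involution_with_differential phi sigma sigma0).

Lemma sigma0_fixed X : h X <-> sigma0 X = X.
Proof.
split=> [hX|]; first by have := sc hX (real_form0 hc); rewrite scaler0 addr0 subr0.
have [Y [Z [hY hZ ->]]] := real_form_span hc X.
rewrite sc// => /addrI/eqP; rewrite -subr_eq0 -opprD oppr_eq0 -scalerDr scaler_eq0 (negbTE (neq0Ci _)) /=.
by rewrite -mulr2n -scaler_nat scaler_eq0 pnatr_eq0 => /eqP ->; rewrite scaler0 addr0.
Qed.

(** The isotropy group preserves the real form, where the Killing form is
    definite, so it is unitary. *)
Lemma isotropy_unitary b : isotropy_group phi sigma e b ->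
  adjoint_group phi e b /\ b *m b^t* = 1%:M.
Proof.
move=> [a /= sa <-]; have aG : adjoint_group phi e (in_basis e (Ad phi a)) by exists a.
split=> //; rewrite adjE -conjm_tr real_entries.
  exact: aut_trr (adjoint_aut aG).
move=> X /sigma0_fixed hX; apply/sigma0_fixed.
by rewrite (sigma0_Ad phi_atlas phi_one sinv)// hX.
Qed.

Lemma isotropy1 : isotropy_group phi sigma e 1%:M.
Proof.
exists one; last by rewrite (Ad_one phi_atlas phi_one) in_basisE mulmx1 mulVmx.
have := sigma_mul sinv one one; rewrite lie_mul1g => s1 /=.
by rewrite -(lie_mulKg (sigma one) (sigma one)) -s1 lie_mulVg.
Qed.

Lemma cartan_coset F : cartan [set F *m b | b in isotropy_group phi sigma e] = F *m F^t*.
Proof.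
have uniq : forall P, [set a *m a^t* | a in [set F *m b | b in isotropy_group phi sigma e]] P ->
    P = F *m F^t*.
  move=> _ [_ [b /isotropy_unitary[_ bb] <-] <-].
  by rewrite adjM mulmxA -(mulmxA F) bb mulmx1.
apply: uniq; apply: (@xgetI _ _ _ (F *m F^t* )).
by exists F => //; exists 1%:M; [exact: isotropy1 | rewrite mulmx1].
Qed.

Lemma conjmZ p q (k : C) (A : 'M[C]_(p, q)) : conjm (k *: A) = k^* *: conjm A.
Proof. exact: map_mxZ. Qed.

Lemma dcartan_real r : dcartan phi e ('i *: (E *m realv r)) = (2 * 'i) *: AD (realv r).
Proof.
have L := AD_compact.
rewrite /dcartan adgE -scalemxAr mulKmx// (cl_adj L) conjmZ conjCi conjm_realv.
by rewrite -(clN L) -scaleNr opprK -(clD L) -scalerDl -(clZ L) mulr_natl mulr2n.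
Qed.

Context (gN : 'M[C]_n -> 'M[C]_n -> 'M[C]_n -> R) (gNm : invariant_metric phi h e gN).

Lemma metricE F r s : adjoint_group phi e F ->
  gN (F *m F^t* ) (F *m ((2 * 'i) *: AD (realv r)) *m F^t* )
    (F *m ((2 * 'i) *: AD (realv s)) *m F^t* ) = \sum_k r k 0 * s k 0.
Proof.
move=> aF; have t1 r' : tangentN phi h e 1%:M ((2 * 'i) *: AD (realv r')).
  exists 1%:M, (E *m realv r'); split; rewrite ?adjm1 ?mulmx1 ?mul1mx ?dcartan_real//.
    exact: adjoint1.
  exact: h_real.
have := metric_invariant gNm aF adjoint1.
rewrite adjm1 mulmx1 => /(_ _ _ (t1 r) (t1 s)); rewrite mulmx1 => ->.
have := metric_base gNm (h_real r) (h_real s); rewrite !dcartan_real.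
have [_ _ orth] := he.
have k := killing_basis (adD phi_atlas phi_one) (adZ phi_atlas phi_one) orth
  ('i *: realv r) ('i *: realv s).
rewrite /killing (scalemxAr 'i E (realv r)) (scalemxAr 'i E (realv s)) k => hh; apply: complexI; apply: etrans hh _.
rewrite mxE -sumrN rmorph_sum; apply: eq_bigr => j _; rewrite !mxE rmorphM /=.
by move: (r j 0) (s j 0) => a b; apply: cE; rewrite !reim; ring.
Qed.

End RealForm.

(** * Automorphisms near the identity *)

Section NearIdentity.
Context {R : realType} {n : nat}.
Local Notation C := R[i].
Implicit Types (x y z : 'cV[C]_n) (F : 'M[C]_n).

Lemma box_compact (r : R) : 0 <= r -> exists B : set 'cV[C]_n,
  [/\ compact B, B 0, forall u, nm u <= r -> B u & forall u, B u -> nm u <= n%:R * (2 * r)].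
Proof.
move=> r0; pose T := 'rV[R]_(n + n).
pose X : set T := [set v | forall i, `[- r, r]%classic (v ord0 i)].
have cX : compact X by apply: (@rV_compact R (n + n) (fun=> `[- r, r]%classic)) => i; exact: segment_compact.
pose m (v : T) : 'cV[C]_n := \col_i (v ord0 (lshift n i) +i* v ord0 (rshift n i)).
have mc : continuous m.
  move=> v P /nbhs_nm[d d0 hP].
  pose e' := d / (2 * (n%:R + 1)); have n0 : 0 <= n%:R :> R by [].
  have e0 : 0 < e' by rewrite divr_gt0// mulr_gt0//; lra.
  have : \forall v' \near (v : T), forall i, `|v ord0 i - (v' : T) ord0 i| < e'.
    apply: (@filter_forall _ _ (fun i v' => `|v ord0 i - (v' : T) ord0 i| < e') (nbhs (v : T))) => i.
    by have /cvgrPdist_lt := @coord_continuous R 1 (n + n) ord0 i v; apply.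
  apply: filterS => v' hv; rewrite /= -(subrK (m v) (m v')) addrC; apply: hP.
  apply: (@le_lt_trans _ _ ((n * 1)%:R * (2 * e'))).
    apply: nm_bound => i j; rewrite !mxE /nc /=.
    have := hv (lshift n i); have := hv (rshift n i); rewrite ![`|v _ _ - _|]distrC.
    lra.
  have dE : d = (n%:R + 1) * (2 * e') by rewrite /e'; field; lra.
  by rewrite [X in _ < X]dE muln1 ltr_pM2r ?mulr_gt0//; lra.
exists (m @` X); split.
- by apply: continuous_compact => //; apply: continuous_subspaceT.
- exists 0; last by apply/matrixP => i j; rewrite !mxE.
  by move=> i /=; rewrite mxE in_itv /= r0 oppr_le0 r0.
- move=> u ur; have un i : nc (u i 0) <= r := le_trans (nm_le u i 0) ur.
  exists (row_mx (\row_i complex.Re (u i 0)) (\row_i complex.Im (u i 0))).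
    move=> i /=; rewrite in_itv /= -ler_norml; case: (split_ordP i) => j ->.
      by rewrite row_mxEl mxE; apply: le_trans (nc_Re _) (un j).
    by rewrite row_mxEr mxE; apply: le_trans (nc_Im _) (un j).
  apply/matrixP => i j; rewrite ord1 mxE row_mxEl row_mxEr !mxE.
  by case: (u i 0).
move=> _ [v vX <-]; rewrite -[n in n%:R]muln1; apply: nm_bound => i j.
rewrite mxE /nc /=; have := vX (lshift n i); have := vX (rshift n i).
by rewrite /= !in_itv /= -!ler_norml; lra.
Qed.

Context (AD : 'cV[C]_n -> 'M[C]_n) (L : compact_lie AD).

(** A family a of automorphisms tangent to AD that is locally a right
    multiplicative family fills a neighbourhood of 1: minimise the distance from
    a(u)^-1 F to 1; at the minimum, moving along the projection of a(u)^-1 F - 1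
    would decrease it. *)
Lemma fills_near1 (a : 'cV[C]_n -> 'M[C]_n) (r1 : R) : 0 < r1 ->
  (forall u, aut AD (a u)) -> a 0 = 1%:M -> fdm a 0 AD ->
  (forall u, nm u < r1 -> exists l, fdm a u l) ->
  (forall u, nm u < r1 -> forall d : R, 0 < d -> exists2 d' : R, 0 < d' &
     forall v, nm v < d' -> exists2 u', nm (u' - u) < d & a u' = a u *m a v) ->
  exists2 eta : R, 0 < eta & forall F, aut AD F -> nm (F - 1%:M) < eta -> exists u, F = a u.
Proof.
move=> r10 aA a1 ad1 ac am.
have [K1 K10 hK1] := aut_proj L; have [K2 K20 hK2] := ad_bound L; have [K3 K30 hK3] := @proj_bound R n AD.
pose N := nm (1%:M : 'M[C]_n); have N0 : 0 <= N by exact: nm_ge0.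
pose k := 1 / (2 * K3); have k0 : 0 < k by rewrite divr_gt0 ?mulr_gt0.
have [d0 d00 hd0] := fdm_small ad1 k0.
pose m := Num.min r1 d0; have m0 : 0 < m by rewrite lt_min r10.
have lip u : nm u < d0 -> nm (a u - 1%:M - AD u) <= k * nm u.
  by move=> /hd0; rewrite add0r a1.
pose r := m / (2 * (n%:R + 1)); have n0 : 0 <= n%:R :> R by [].
have r0 : 0 < r by rewrite divr_gt0// mulr_gt0//; lra.
have rm : n%:R * (2 * r) < m.
  have -> : m = (n%:R + 1) * (2 * r) by rewrite /r; field; lra.
  by rewrite ltr_pM2r ?mulr_gt0//; lra.
have [B [cB B0 hB1 hB2]] := box_compact (ltW r0).
have Bm u : B u -> [/\ nm u < r1, nm u < d0 & nm u < m].
  move=> /hB2 h; have um : nm u < m by apply: le_lt_trans h _.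
  by split=> //; move: um; rewrite lt_min => /andP[].
have low u : nm u < d0 -> k * nm u <= nm (a u - 1%:M).
  move=> ud; have h1 := lip u ud; have h2 := hK3 (AD u); rewrite (adprojAD L) in h2.
  have h3 : nm (AD u) <= nm (a u - 1%:M) + nm (a u - 1%:M - AD u).
    by rewrite -[X in nm X <= _](subKr (a u - 1%:M)); exact: nmB.
  have h4 : 2 * k * nm u <= nm (AD u).
    have -> : 2 * k = K3^-1 by rewrite /k; field; apply: lt0r_neq0.
    by rewrite mulrC ler_pdivrMr// mulrC.
  lra.
pose M := N + (K2 + k) * m + 1.
have M0 : 0 < M by rewrite /M; have := mulr_gt0 (addr_gt0 K20 k0) m0; lra.
have up u : B u -> nm (a u) <= M.
  move=> /Bm[_ ud um]; have h1 := lip u ud; have h2 := hK2 u.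
  have -> : a u = a u - 1%:M - AD u + AD u + 1%:M by rewrite !subrK.
  have h3 := nmD (a u - 1%:M - AD u + AD u) (1%:M : 'M[C]_n).
  have h4 := nmD (a u - 1%:M - AD u) (AD u).
  have : (K2 + k) * nm u <= (K2 + k) * m by apply: ler_wpM2l; lra.
  by rewrite /M -/N in h3 *; lra.
pose eta := Num.min (Num.min 1 (k * r / (2 * (M + 1)))) (1 / (4 * (K1 + K2 * K3))).
have KK : 0 < K1 + K2 * K3 by rewrite addr_gt0 ?mulr_gt0.
have M1 : 0 < 2 * (M + 1) by lra.
have eta0 : 0 < eta.
  rewrite !lt_min ltr01 /=; apply/andP; split; apply: divr_gt0 => //; apply: mulr_gt0 => //.
exists eta => // F aF; rewrite !lt_min => /andP[/andP[F1 F2] F3].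
pose f u := nm ((a u)^T *m F - 1%:M).
have fc : {within B, continuous f}.
  apply: continuous_in_subspaceT => u /set_mem/Bm[ur _ _]; apply/cont_nm => e e0.
  have [l hl] := ac u ur; have F0 := nm_ge0 F.
  have [|d d0' hd] := fdm_cont hl (e := e / (nm F + 1)); first by rewrite divr_gt0//; lra.
  exists d => // w /hd h.
  have E1 : (a (u + w))^T *m F - 1%:M - ((a u)^T *m F - 1%:M) = (a (u + w) - a u)^T *m F.
    by rewrite opprB addrA subrK linearB /= mulmxBl.
  have h1 : nm ((a (u + w) - a u)^T *m F) <= e.
    apply: le_trans (nmM _ _) _; rewrite nmT.
    move: h; rewrite ltr_pdivlMr; last lra.
    by have := nm_ge0 (a (u + w) - a u); nra.
  rewrite ler_norml; rewrite /f -E1 in h1 *.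
  move: ((a (u + w))^T *m F - 1%:M) ((a u)^T *m F - 1%:M) h1 => X Y h1.
  have := nmD (X - Y) Y; have := nmB X (X - Y); rewrite subrK subKr; lra.
have [|u1 /set_mem Bu1 hmin] := compact_EVT_min _ cB fc; first by exists 0.
have {}hmin u : B u -> f u1 <= f u by move=> /mem_set; exact: hmin.
have f1 : f u1 <= nm (F - 1%:M).
  by apply: le_trans (hmin 0 B0) _; rewrite /f a1 trmx1 mul1mx.
have aT u : a u *m (a u)^T = 1%:M by apply: aut_trr (aA u).
have u1r : nm u1 < r.
  have [_ u1d _] := Bm _ Bu1; have l1 := low _ u1d; have u1M := up _ Bu1.
  rewrite ltNge; apply/negP => ru.
  have e1 : F - a u1 = a u1 *m ((a u1)^T *m F - 1%:M).
    by rewrite mulmxBr mulmxA aT mul1mx mulmx1.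
  have h1 := nmM (a u1) ((a u1)^T *m F - 1%:M); rewrite -e1 -/(f u1) in h1.
  have h2 : nm (a u1 - 1%:M) <= nm (F - 1%:M) + nm (F - a u1).
    have -> : a u1 - 1%:M = (F - 1%:M) - (F - a u1).
      by rewrite opprB [RHS]addrC addrA subrK.
    exact: nmB.
  have g0 : 0 <= f u1 by exact: nm_ge0.
  have h3 : nm (a u1) * f u1 <= M * nm (F - 1%:M) by apply: ler_pM; rewrite ?nm_ge0.
  move: F2; rewrite ltr_pdivlMr// => F2.
  have h4 : k * r <= k * nm u1 by apply: ler_wpM2l => //; exact: ltW.
  have h5 := nm_ge0 (F - 1%:M); nra.
exists u1; move EP : ((a u1)^T *m F) => P.
have fP : f u1 = nm (P - 1%:M) by rewrite /f EP.
have aP : aut AD P by rewrite -EP; apply: autM => //; exact: autT.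
have PE : F = a u1 *m P by rewrite -EP mulmxA aT mul1mx.
have [q0|q0] := eqVneq (P - 1%:M) 0.
  by rewrite PE; move/eqP: q0; rewrite subr_eq0 => /eqP ->; rewrite mulmx1.
exfalso; have qg : 0 < nm (P - 1%:M) by exact: nm_gt0.
have q1 : nm (P - 1%:M) < 1 by rewrite -fP; apply: le_lt_trans f1 F1.
have q2 : (K1 + K2 * K3) * nm (P - 1%:M) <= 1 / 4.
  have : nm (P - 1%:M) < 1 / (4 * (K1 + K2 * K3)) by rewrite -fP; exact: le_lt_trans f1 F3.
  rewrite ltr_pdivlMr ?mulr_gt0//; move: (nm _) (K1 + _) => q KK'; lra.
have kP := hK1 _ aP; set y := adproj AD (P - 1%:M) in kP.
have y1 := hK3 (P - 1%:M); rewrite -/y in y1; have y2 := hK2 y.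
have [u1r1 _ _] := Bm _ Bu1.
have eps0 : 0 < 1 / (4 * K3 * (N + 1)) by rewrite divr_gt0 ?mulr_gt0//; lra.
have [d1 d10 hd1] := fdm_small ad1 eps0.
have [|d2 d20 hd2] := am u1 u1r1 (r - nm u1); first by rewrite subr_gt0.
pose t := Num.min (1 / 2) (Num.min d1 d2 / (nm y + 1)); have yg := nm_ge0 y.
have t0 : 0 < t by rewrite lt_min !divr_gt0 ?lt_min ?d10//; lra.
have t1 : t <= 1 / 2 by rewrite ge_min lexx.
have ty : nm (t%:C *: y) < Num.min d1 d2.
  have : t <= Num.min d1 d2 / (nm y + 1) by rewrite ge_min lexx orbT.
  rewrite ler_pdivlMr; last lra.
  by rewrite nmrZ gtr0_norm//; lra.
move: ty; rewrite lt_min => /andP[ty1 ty2].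
have [u' hu' au'] := hd2 _ ty2.
have Bu' : B u'.
  apply: hB1; rewrite -(subrK u1 u'); have := nmD (u' - u1) u1; lra.
have := hmin u' Bu'; apply/negP; rewrite -ltNge.
have := hd1 _ ty1; rewrite add0r a1 => hr.
set rho := a (t%:C *: y) - 1%:M - AD (t%:C *: y) in hr.
have aE : (a (t%:C *: y))^T = 1%:M - t%:C *: AD y + rho^T.
  have -> : a (t%:C *: y) = 1%:M + t%:C *: AD y + rho.
    rewrite /rho (clZ L); move: (a _) (t%:C *: AD y) => X Y.
    by rewrite -[X - 1%:M - Y]addrA -opprD [RHS]addrC subrK.
  by rewrite !linearD /= trmx1 linearZ /= (cl_tr_skew L) scalerN.
have fE : (a u')^T *m F - 1%:M = (1 - t)%:C *: (P - 1%:M) +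
   (t%:C *: (P - 1%:M - AD y) - t%:C *: (AD y *m (P - 1%:M)) + rho^T *m P).
  rewrite au' trmx_mul -mulmxA EP aE !mulmxDl mul1mx mulNmx -scalemxAl.
  rewrite mulmxBr mulmx1 !scalerBr rmorphB /= !scalerBl !scale1r.
  move: (AD y *m P) (AD y) (rho^T *m P) (t%:C) => X Y Z s.
  move: (Y *m P) => W.
  by apply/matrixP => i j; rewrite !mxE; move: (W i j) (Y i j) (Z i j) => w v o; ring.
rewrite fP /f fE.
have b1 := nmD ((1 - t)%:C *: (P - 1%:M)) (t%:C *: (P - 1%:M - AD y) - t%:C *: (AD y *m (P - 1%:M)) + rho^T *m P).
have b2 := nmD (t%:C *: (P - 1%:M - AD y) - t%:C *: (AD y *m (P - 1%:M))) (rho^T *m P).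
have b3 := nmB (t%:C *: (P - 1%:M - AD y)) (t%:C *: (AD y *m (P - 1%:M))).
have b4 := nmM (AD y) (P - 1%:M); have b5 := nmM rho^T P; rewrite nmT in b5.
rewrite !nmrZ (gtr0_norm t0) ger0_norm in b1 b3 hr; last lra.
have b6 : nm P <= N + nm (P - 1%:M) by rewrite -{1}(subrK 1%:M P) addrC; exact: nmD.
move: (nm (P - 1%:M)) qg q1 q2 kP y1 b1 b2 b3 b4 b6 => q qg q1 q2 kP y1 b1 b2 b3 b4 b6.
have c1 : nm rho <= t * q / (4 * (N + 1)).
  apply: le_trans hr _; have -> : t * q / (4 * (N + 1)) = 1 / (4 * K3 * (N + 1)) * (t * (K3 * q)).
    by field; rewrite !lt0r_neq0//; lra.
  by apply: ler_wpM2l; [exact: ltW | apply: ler_wpM2l; [exact: ltW|]].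
have c2 : nm rho * nm P <= t * q / 4.
  have -> : t * q / 4 = t * q / (4 * (N + 1)) * (N + 1) by field; lra.
  by apply: ler_pM c1 _; rewrite ?nm_ge0//; lra.
have c3 : nm (AD y) * q <= K2 * K3 * q * q.
  apply: ler_wpM2r; first exact: ltW.
  by apply: le_trans y2 _; rewrite -mulrA; apply: ler_wpM2l => //; exact: ltW.
have c4 : (K1 + K2 * K3) * q * q <= 1 / 4 * q by apply: ler_wpM2r => //; exact: ltW.
have c5 : t * nm (P - 1%:M - AD y) + t * nm (AD y *m (P - 1%:M)) <= t * (1 / 4 * q).
  rewrite -mulrDr; apply: ler_wpM2l; first exact: ltW.
  by move: c4; rewrite !mulrDl expr2 in kP *; lra.
have tq := mulr_gt0 t0 qg; lra.
Qed.
End NearIdentity.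

(** * The adjoint group is open in the automorphism group *)

Section AdjointOpen.
Context {R : realType} {n : nat} (Gt : complexLieGroup R n).
Local Notation C := R[i].
Local Notation "x ** y" := (@lie_mul R n Gt x y) (at level 40, left associativity).
Local Notation one := (@lie_one R n Gt).
Context (phi : chart R n Gt) (phi_atlas : atlas phi) (phi_one : dom phi one).
Context (h : set 'cV[C]_n) (hc : compact_real_form phi h).
Context (e : 'I_n -> 'cV[C]_n) (he : orthonormal_basis phi h e).
Local Notation E := (basis_mx e).
Let x0 := coord phi one.
Let cx0 : cod phi x0. Proof. exact: coord_cod. Qed.
Let px0 : param phi x0 = one. Proof. exact: paramK. Qed.

Let EU : E \in unitmx.
Proof.
exact: (basis_unit (adD phi_atlas phi_one) (adZ phi_atlas phi_one) (let: And3 _ _ o := he in o)).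
Qed.

Definition local_Ad (u : 'cV[C]_n) : 'M[C]_n := in_basis e (Ad phi (param phi (x0 + E *m u))).

Lemma affine_fdm u : fdm (fun u : 'cV[C]_n => x0 + E *m u) u (mulmx E).
Proof.
have h1 := fdm_add (fdm_cst x0 u) (fdm_mull E (fdm_id u)).
by apply: fdm_eq h1 => v //; rewrite add0r.
Qed.

Lemma local_Ad_mul u : cod phi (x0 + E *m u) -> forall d : R, 0 < d -> exists2 d' : R, 0 < d' &
  forall v, nm v < d' -> exists2 u', nm (u' - u) < d & local_Ad u' = local_Ad u *m local_Ad v.
Proof.
move=> cu d d0; set g := param phi (x0 + E *m u).
have [dg cg] := codP phi_atlas cu.
have cv : (fun v => g ** param phi (x0 + E *m v)) @ (0 : 'cV[C]_n) --> g ** param phi (x0 + E *m 0).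
  apply: (@lie_mul_cvg _ _ _ _ (nbhs (0 : 'cV[C]_n))); first exact: cvg_cst.
  apply: (@param_cvg _ _ _ _ phi (fun v => x0 + E *m v) 0 phi_atlas).
    by rewrite mulmx0 addr0.
  by apply: (@fdm_diff R n n _ 0 E); exact: affine_fdm.
rewrite mulmx0 addr0 px0 lie_mulg1 in cv.
pose d'' := d / (nm (invmx E) + 1); have i0 := nm_ge0 (invmx E).
have d''0 : 0 < d'' by rewrite divr_gt0//; lra.
have n1 : \forall q \near g, dom phi q := dom_near phi_atlas dg.
have n2 : \forall q \near g, nm (coord phi q - coord phi g) < d''.
  apply: (@near_coord R n Gt phi g (fun y => nm (y - coord phi g) < d'')) => //.
  by apply/nbhs_nm; exists d'' => // w; rewrite addrC addKr.
have [d' d'0 hd'] := (nbhs_nm _ _).1 (cv _ (filterI n1 n2)).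
exists d' => // v /hd'; rewrite add0r => /= -[dq cq].
exists (invmx E *m (coord phi (g ** param phi (x0 + E *m v)) - x0)).
  have -> : u = invmx E *m (coord phi g - x0) by rewrite cg addrC addKr mulKmx.
  rewrite -mulmxBr opprB addrA subrK.
  apply: le_lt_trans (nmM _ _) _; move: cq; rewrite ltr_pdivlMr; last lra.
  by have := nm_ge0 (coord phi (g ** param phi (x0 + E *m v)) - coord phi g); nra.
rewrite /local_Ad (mulKVmx EU) [x0 + _]addrC subrK (paramK phi_atlas dq) (AdM phi_atlas phi_one).
exact: (in_basisM phi_atlas phi_one he).
Qed.

(** The adjoint group is open in the automorphism group. *)
Theorem adjoint_near1 : exists2 eta : R, 0 < eta &
  forall F, aut (AD phi e) F -> nm (F - 1%:M) < eta -> adjoint_group phi e F.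
Proof.
have L := AD_compact phi_atlas phi_one hc he.
have [d d0 hd] := (nbhs_nm _ _).1 (cod_near phi_atlas cx0).
pose r1 := d / (nm E + 1); have e0 := nm_ge0 E.
have r10 : 0 < r1 by rewrite divr_gt0//; lra.
have cu u : nm u < r1 -> cod phi (x0 + E *m u).
  rewrite ltr_pdivlMr => [ur|]; last lra.
  by apply: hd; have := nmM E u; have := nm_ge0 u; nra.
have aG u : adjoint_group phi e (local_Ad u) by exists (param phi (x0 + E *m u)).
have fa u l : fdm (fun x => Ad phi (param phi x)) (x0 + E *m u) l ->
    fdm local_Ad u (fun v => invmx E *m l (E *m v) *m E).
  move=> hl; have k := @fdm_comp R _ _ _ _ _ (fun u : 'cV[C]_n => x0 + E *m u) u _ _ hl (affine_fdm u).
  exact: (fdm_mulr E (fdm_mull (invmx E) k)).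
have [|||||eta eta0 heta] := @fills_near1 R n (AD phi e) L local_Ad r1 r10.
- by move=> u; exact: (adjoint_aut phi_atlas phi_one hc he).
- by rewrite /local_Ad mulmx0 addr0 px0 (Ad_one phi_atlas phi_one) in_basisE mulmx1 mulVmx.
- apply: (fa 0 (ad phi)); rewrite mulmx0 addr0; exact: (ad_fdm phi_atlas phi_one).1.
- move=> u /cu cu'; have [l [hl _]] := Ad_holo phi_atlas phi_one phi_atlas cu'.
  by exists (fun v => invmx E *m l (E *m v) *m E); exact: fa.
- by move=> u /cu; exact: local_Ad_mul.
by exists eta => // F aF /(heta F aF)[u ->].
Qed.

End AdjointOpen.

(** * Holomorphic frames with values in the adjoint group *)

Section Transport.
Context {R : realType} (U : riemannSurface R) (U_sc : simply_connected R U).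
Local Notation C := R[i].

Lemma mder_cst p q (A : 'M[C]_(p, q)) z : mder (fun=> A) z 0.
Proof. by apply: fdm_eq (fdm_cst A z) => // w; rewrite scaler0. Qed.

Lemma surface_const p q (H : U -> 'M[C]_(p, q)) :
  (forall c, atlas c -> forall z, cod c z -> mder (fun y => H (param c y)) z 0) ->
  forall x y, H x = H y.
Proof.
move=> hH; apply: (surface_locally_constant U_sc) => x.
have [c ac dx] := atlas_cover x; have cx := coord_cod dx.
have Ex := paramK ac dx.
have hn : \forall y \near coord c x, H (param c y) - H x = 0.
  apply: (@growth R p q (fun y => H (param c y) - H x) (fun=> 0) (coord c x) 0 (lexx 0)).
    apply: filterS (cod_near ac cx) => y cy; split; last by rewrite nm0 mul0r.
    by have := mder_add (hH c ac y cy) (mder_cst (- H x) y); rewrite addr0.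
  by rewrite Ex subrr.
have := near_coord ac dx hn; have := dom_near ac dx.
by apply: filterS2 => y dy; rewrite paramK// => /eqP; rewrite subr_eq0 => /eqP.
Qed.

Lemma mder_lin m p q (T : 'cV[C]_m -> 'M[C]_(p, q)) (x : 'cV[C]_1 -> 'cV[C]_m) z B :
  (forall u v, T (u + v) = T u + T v) -> (forall z v, T (z *: v) = z *: T v) ->
  mder x z B -> mder (fun y => T (x y)) z (T B).
Proof.
move=> TD TZ h; have k := fdm_comp (fdm_lin (x z) TD TZ) h.
by apply: fdm_eq k => // w; rewrite /= TZ.
Qed.

Context {n : nat} (AD : 'cV[C]_n -> 'M[C]_n) (L : compact_lie AD) (G : set 'M[C]_n).
Hypotheses (G1 : G 1%:M)
  (GM : forall F P, G F -> G P -> G (F *m P)) (GT : forall F, G F -> G F^T)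
  (G_near : exists2 eta : R, 0 < eta & forall F, aut AD F -> nm (F - 1%:M) < eta -> G F).

(** Solutions of F' = F AD(x) stay in the group: they are automorphisms, as the
    transported bracket has zero derivative, and the group is open among these. *)
Theorem transport (x : chart R 1 U -> 'cV[C]_1 -> 'cV[C]_n) p0 : holform x ->
  exists F : U -> 'M[C]_n, [/\ F p0 = 1%:M, forall p, G (F p) &
    forall c, atlas c -> forall z, cod c z ->
      mder (fun y => F (param c y)) z (F (param c z) *m AD (x c z))].
Proof.
move=> [xh xc].
have hA : holform (fun c z => AD (x c z)).
  split=> [c ac z cz|c d ac ad z cz dz T hT].
    by have [B hB] := xh c ac z cz; exists (AD B); apply: mder_lin hB; [exact: clD L | exact: clZ L].
  by rewrite (xc c d ac ad z cz dz T hT) (clZ L).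
have [F [F0 Fu hF]] := ode_surface U_sc p0 hA.
exists F; split=> //.
have orth p : F p *m (F p)^T = 1%:M.
  rewrite (@surface_const _ _ (fun p => F p *m (F p)^T) _ p p0) ?F0 ?trmx1 ?mulmx1// => c ac z cz.
  have h := hF c ac z cz; have := mder_mul h (mder_tr h).
  rewrite trmx_mul (cl_tr_skew L) -mulmxA -mulmxDr mulNmx subrr mulmx0; exact.
have orth' p : (F p)^T *m F p = 1%:M by exact: mulmx1C.
have brk p y : F p *m AD ((F p)^T *m y) *m (F p)^T = AD y.
  rewrite (@surface_const _ _ (fun p => F p *m AD ((F p)^T *m y) *m (F p)^T) _ p p0).
    by rewrite F0 trmx1 !mul1mx mulmx1.
  move=> c ac z cz; have h := hF c ac z cz.
  have hu := mder_mulr y (mder_tr h).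
  have ha := mder_lin (clD L) (clZ L) hu.
  have := mder_mul (mder_mul h ha) (mder_tr h).
  rewrite trmx_mul (cl_tr_skew L) mulNmx mulNmx (clN L).
  set P := F (param c z); set u := P^T *m y; set v := x c z.
  have -> : AD v *m P^T *m y = AD v *m u by rewrite /u mulmxA.
  have J := clJ L v u.
  have -> : (P *m AD v *m AD u + P *m - AD (AD v *m u)) *m P^T + P *m AD u *m - (AD v *m P^T) = 0.
    move: (AD v) (AD u) (AD (AD v *m u)) J => V W X J.
    rewrite !mulmxN mulmxBl !mulmxA -(mulmxA P V W) J mulmxDr mulmxDl -(mulmxA P W V).
    by rewrite [X in X - _ - _]addrC addrK subrr.
  by [].
have Faut p : aut AD (F p).
  split=> // y; rewrite -(brk p (F p *m y)) mulmxA orth' mul1mx.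
  by rewrite -mulmxA orth' mulmx1.
have step p : \forall q \near p, G (F q) = G (F p).
  have [eta eta0 heta] := G_near.
  have [c ac dp] := atlas_cover p; have cp := coord_cod dp; have Ep := paramK ac dp.
  have hp := hF c ac _ cp.
  have f0 := nm_ge0 (F p).
  have [|d d0 hd] := fdm_cont hp (e := eta / (nm (F p) + 1)).
    by rewrite divr_gt0//; lra.
  have nq : \forall q \near p, nm (coord c q - coord c p) < d.
    apply: (@near_coord R 1 U c p (fun y => nm (y - coord c p) < d)) => //.
    by apply/nbhs_nm; exists d => // w; rewrite addrC addKr.
  apply: filterS2 (dom_near ac dp) nq => q dq cq.
  have := hd _ cq; rewrite [coord c p + _]addrC subrK Ep paramK// => {}cq.
  have GS : G ((F p)^T *m F q).
    apply: heta; first by apply: autM (Faut q); exact: autT.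
    rewrite -(orth' p) -mulmxBr; apply: le_lt_trans (nmM _ _) _; rewrite nmT.
    move: cq; rewrite ltr_pdivlMr; last lra.
    by have := nm_ge0 (F q - F p); nra.
  apply/propext; split=> hG.
    have -> : F p = F q *m ((F p)^T *m F q)^T.
      by rewrite trmx_mul trmxK mulmxA orth mul1mx.
    by apply: GM => //; exact: GT.
  have -> : F q = F p *m ((F p)^T *m F q) by rewrite mulmxA orth mul1mx.
  exact: GM.
move=> p; have -> : G (F p) = G (F p0) by exact: (surface_locally_constant U_sc step).
by rewrite F0.
Qed.

End Transport.

(** * Vector-valued functions of class C^k *)

Section VectorCalculus.
Context {R : realType} {n : nat}.
Local Notation C := R[i].
Implicit Types (A : 'cV[R]_n).

Lemma cV_norm_le A e : 0 <= e -> (forall k, `|A k 0| <= e) -> `|A| <= e.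
Proof.
move=> e0 hA; rewrite -[`|A|]/(mx_norm A) mx_normrE; apply: bigmax_le => // -[i j] _ /=.
by rewrite ord1.
Qed.

Lemma cV_norm_entry A k : `|A k 0| <= `|A|.
Proof.
rewrite -[`|A|]/(mx_norm A) mx_normrE.
exact: (le_bigmax _ (fun ij : 'I_n * 'I_1 => `|A ij.1 ij.2|) (k, 0)).
Qed.

Lemma rder_coord (f : R -> 'cV[R]_n) t (l : 'cV[R]_n) k : rder f t l -> rder (fun s => f s k 0) t (l k 0).
Proof.
move=> h e /h[d d0 hd]; exists d => // s /hd; apply: le_trans.
by have := cV_norm_entry (f s - f t - (s - t) *: l) k; rewrite !mxE.
Qed.

Lemma rder_col (f : R -> 'cV[R]_n) t (l : 'cV[R]_n) : (forall k, rder (fun s => f s k 0) t (l k 0)) -> rder f t l.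
Proof.
move=> h e e0.
have : forall k, \forall s \near t, `|f s k 0 - f t k 0 - (s - t) * l k 0| <= e * `|s - t|.
  move=> k; have [d d0 hd] := h k e e0.
  apply/nbhs_ballP; exists d => // s; rewrite /ball /= distrC => /hd; exact.
move=> /filter_forall/nbhs_ballP[d /= d0 hd]; exists d => // s sd.
apply: cV_norm_le => [|k]; first by rewrite mulr_ge0// ltW.
by rewrite !mxE; apply: (hd s); rewrite /ball /= distrC.
Qed.

Context {m : nat}.
Implicit Types (D : set 'cV[C]_m) (F : 'cV[C]_m -> 'cV[R]_n).

Lemma rdiff_coord k D F v x i : Ck_on k.+1 D F -> D x ->
  (rdiff v F x) i 0 = rdiff v (fun y => F y i 0) x.
Proof.
move=> h Dx; have := rder_coord i (Ck_derivable v h Dx).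
by move=> /(rder_rdiff (g := fun y => F y i 0))[_ ->].
Qed.

Lemma Ck_coord k D F i : open D -> Ck_on k D F -> Ck_on k D (fun y => F y i 0).
Proof.
move=> oD; elim: k F => [|k IH] F hF.
  split=> // x /(Ck_cont hF)/cont_nm hx; apply/cont_nm => e /hx[d d0 hd].
  exists d => // w /hd; apply: le_trans.
  by have := cV_norm_entry (F (x + w) - F x) i; rewrite !mxE.
split=> [|v]; first exact: Ck_cont (IH F (Ck_le hF)).
split=> [x Dx|]; first by have [] := rder_rdiff (g := fun y => F y i 0) (rder_coord i (Ck_derivable v hF Dx)).
apply: Ck_ext (IH _ (hF.2 v).2) => // x Dx; exact: rdiff_coord hF Dx.
Qed.

Lemma rdiff_col k D F v x : (forall i, Ck_on k.+1 D (fun y => F y i 0)) -> D x ->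
  rder (fun t : R => F (x + t%:C *: v)) 0 (\col_i rdiff v (fun y => F y i 0) x).
Proof.
move=> h Dx; apply: rder_col => i; rewrite mxE.
exact: (Ck_derivable v (h i) Dx).
Qed.

Lemma Ck_col k D F : open D -> (forall i, Ck_on k D (fun y => F y i 0)) -> Ck_on k D F.
Proof.
move=> oD; elim: k F => [|k IH] F hF.
  split=> // x Dx; apply/cont_nm => e e0.
  have : forall i, \forall y \near x, `|F y i 0 - F x i 0| <= e.
    move=> i; have /cont_nm/(_ e e0)[d d0 hd] := Ck_cont (hF i) Dx.
    by apply/nbhs_nm; exists d.
  move=> /filter_forall/nbhs_nm[d d0 hd]; exists d => // w /hd hw.
  by apply: cV_norm_le => [|i]; [exact: ltW | rewrite !mxE].
split=> [|v]; first exact: Ck_cont (IH F (fun i => Ck_le (hF i))).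
split=> [x Dx|]; first by have [] := rder_rdiff (rdiff_col v hF Dx).
apply: IH => i; apply: Ck_ext ((hF i).2 v).2 => // x Dx.
by have [_ ->] := rder_rdiff (rdiff_col v hF Dx); rewrite mxE.
Qed.

End VectorCalculus.

(** * Minimal surfaces and their complex gradient *)

Section MinimalSurfaces.
Context {R : realType} {n : nat}.
Local Notation C := R[i].
Implicit Types (F : 'cV[C]_1 -> 'cV[R]_n) (D : set 'cV[C]_1) (z v w : 'cV[C]_1) (u : 'cV[R]_n).

Lemma dotD u u' (w : 'cV[R]_n) : dot (u + u') w = dot u w + dot u' w.
Proof. by rewrite /dot -big_split; apply: eq_bigr => i _; rewrite mxE mulrDl. Qed.
Lemma dotsym u u' : dot u u' = dot u' u.
Proof. by apply: eq_bigr => i _; rewrite mulrC. Qed.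

Lemma ord2P (i : 'I_2) : i = ord0 \/ i = lift ord0 ord0.
Proof. by case: i => [[|[|//]] h]; [left|right]; exact: val_inj. Qed.

Lemma half_traceE (d : 'I_2 -> 'cV[R]_n) (dd : 'I_2 -> 'I_2 -> 'cV[R]_n) (l : R) :
  let o := lift ord0 ord0 : 'I_2 in let W := dd ord0 ord0 + dd o o in
  let ginv : 'M[R]_2 := invmx (\matrix_(i, j) dot (d i) (d j)) in
  let normal u := u - \sum_i \sum_j (ginv i j * dot u (d j)) *: d i in
  dot (d ord0) (d ord0) = l -> dot (d o) (d o) = l -> dot (d ord0) (d o) = 0 ->
  2^-1 *: (\sum_i \sum_j ginv i j *: normal (dd i j)) =
    2^-1 *: (l^-1 *: (W - ((l^-1 * dot W (d ord0)) *: d ord0 + (l^-1 * dot W (d o)) *: d o))).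
Proof.
move=> o W ginv normal h00 h11 h01.
have gE : ginv = (l^-1)%:M.
  rewrite /ginv -invmx_scalar; congr invmx; apply/matrixP => i j; rewrite !mxE.
  by case: (ord2P i) => ->; case: (ord2P j) => ->; rewrite ?h00 ?h11 ?h01 // dotsym h01.
have sE (A : 'I_2 -> 'I_2 -> 'cV[R]_n) : \sum_i \sum_j ginv i j *: A i j =
    l^-1 *: (A ord0 ord0 + A o o).
  rewrite !big_ord_recl !big_ord0 gE !mxE /= !mulr1n !mulr0n.
  by rewrite !scale0r !addr0 !add0r scalerDr.
have nE u : normal u = u - ((l^-1 * dot u (d ord0)) *: d ord0 + (l^-1 * dot u (d o)) *: d o).
  rewrite /normal; congr (_ - _); under eq_bigr do under eq_bigr do rewrite -scalerA.
  by rewrite sE scalerDr !scalerA.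
rewrite sE !nE /W !dotD; move: (d ord0) (d o) (dd _ _) (dd _ _) => a b p q.
congr (_ *: (_ *: _)); apply/matrixP => i j; rewrite !mxE.
by move: (dot p a) (dot p b) (dot q a) (dot q b) => *; ring.
Qed.

Lemma mean_curvatureE F z (l : R) : let d0 := rdiff dirx F z in let d1 := rdiff diry F z in
  let W := rdiff dirx (rdiff dirx F) z + rdiff diry (rdiff diry F) z in
  dot d0 d0 = l -> dot d1 d1 = l -> dot d0 d1 = 0 ->
  mean_curvature_vector F z =
    2^-1 *: (l^-1 *: (W - ((l^-1 * dot W d0) *: d0 + (l^-1 * dot W d1) *: d1))).
Proof.
pose dir (i : 'I_2) : 'cV[C]_1 := if i == 0 then dirx else diry.
exact: (@half_traceE (fun i => rdiff (dir i) F z) (fun i j => rdiff (dir i) (rdiff (dir j) F) z) l).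
Qed.

Lemma rlin1E (l : 'cV[C]_1 -> C) v : rlin l ->
  l v = (complex.Re (v 0 0))%:C * l dirx + (complex.Im (v 0 0))%:C * l diry.
Proof.
move=> h; rewrite (rlinE v h) big_ord1.
have -> : delta_mx 0 0 = dirx :> 'cV[C]_1 by apply/matrixP => i j; rewrite !ord1 !mxE.
by have -> : 'i *: dirx = diry :> 'cV[C]_1 by apply/matrixP => i j; rewrite !mxE mulr1.
Qed.

(** The complex gradient 2i df/dz, whose imaginary part along v is the
    derivative of F along v. *)
Definition cgrad F z : 'cV[C]_n :=
  \col_k ((rdiff diry F z k 0)%:C + 'i * (rdiff dirx F z k 0)%:C).

Context (D : set 'cV[C]_1) (oD : open D).

Lemma fd_coord1 F z k : smooth_on D F -> D z ->
  fd (fun y => (F y k 0)%:C) z (fun v => (rdiff v F z k 0)%:C).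
Proof.
move=> sF Dz; apply: fd_eq (fd_C1 oD (Ck_coord k oD (sF 1%N)) Dz) => // v.
by rewrite (rdiff_coord v k (sF 1%N) Dz).
Qed.

Lemma im_grad (a b c : R) (w : C) : c%:C = (complex.Re w)%:C * a%:C + (complex.Im w)%:C * b%:C ->
  c = complex.Im (w * (b%:C + 'i * a%:C)).
Proof. by move=> e; rewrite -[c]/(complex.Re (c%:C)) e !reim; ring. Qed.

Lemma cgradE F z v k : smooth_on D F -> D z ->
  rdiff v F z k 0 = complex.Im (v 0 0 * cgrad F z k 0).
Proof.
move=> sF Dz; have [r _] := fd_coord1 k sF Dz.
rewrite mxE; apply: im_grad; exact: (rlin1E v r).
Qed.

Lemma Im_mul_inj (a b : C) : (forall v : 'cV[C]_1, complex.Im (v 0 0 * a) = complex.Im (v 0 0 * b)) -> a = b.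
Proof.
move=> h; apply: cE; last by have := h (const_mx 1); rewrite mxE !mul1r.
by have := h (const_mx 'i); rewrite mxE !reim !mul0r !add0r !mul1r.
Qed.

Lemma smooth_rdiff F v : smooth_on D F -> smooth_on D (rdiff v F).
Proof. by move=> h k; have [_ /(_ v)[]] := h k.+1. Qed.

Lemma rder_sum I (r : seq I) (f : I -> R -> R) t (l : I -> R) : (forall i, rder (f i) t (l i)) ->
  rder (fun s => \sum_(i <- r) f i s) t (\sum_(i <- r) l i).
Proof.
move=> h; elim: r => [|i r IH].
  have -> : (fun s => \sum_(i <- [::]) f i s) = cst 0 by apply: funext => s; rewrite big_nil.
  by rewrite big_nil; apply/rderP; exact: is_derive_cst.
have -> : (fun s => \sum_(j <- i :: r) f j s) = (fun s => f i s + \sum_(j <- r) f j s).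
  by apply: funext => s; rewrite big_cons.
by rewrite big_cons; exact: rder_add.
Qed.

Lemma rdiff_dot (a b : 'cV[C]_1 -> 'cV[R]_n) z w : smooth_on D a -> smooth_on D b -> D z ->
  rder (fun t : R => dot (a (z + t%:C *: w)) (b (z + t%:C *: w))) 0
    (dot (rdiff w a z) (b z) + dot (a z) (rdiff w b z)).
Proof.
move=> sa sb Dz.
have E0 : z + (0 : R)%:C *: w = z by rewrite scale0r addr0.
have ha k := rder_coord k (Ck_derivable w (sa 1%N) Dz).
have hb k := rder_coord k (Ck_derivable w (sb 1%N) Dz).
rewrite /dot -big_split /=; apply: rder_sum => k.
by have := rder_mul (ha k) (hb k); rewrite /= E0.
Qed.

Lemma clairaut_vec F z v w : smooth_on D F -> D z -> rdiff w (rdiff v F) z = rdiff v (rdiff w F) z.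
Proof.
move=> sF Dz.
have E a b k : rdiff a (rdiff b F) z k 0 = rdiff a (rdiff b (fun y => F y k 0)) z.
  rewrite (rdiff_coord a k (smooth_rdiff b sF 1%N) Dz).
  apply/esym; apply: (rdiff_ext oD Dz _ _).2 => [y Dy|].
    by rewrite (rdiff_coord b k (sF 1%N) Dy).
  exact: (rder_rdiff (g := fun y => rdiff b F y k 0) (rder_coord k (Ck_derivable a (smooth_rdiff b sF 1%N) Dz))).1.
apply/matrixP => k j; rewrite ord1.
exact: etrans (E w v k) (etrans (clairaut v w oD (Ck_coord k oD (sF 2%N)) Dz) (esym (E v w k))).
Qed.

Lemma harmonic_alg (dx dy xx xy yx yy z1 z2 : 'cV[R]_n) : yx = xy -> z1 = 0 -> z2 = 0 ->
  dot xx dx + dot dx xx = dot xy dy + dot dy xy ->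
  dot yx dx + dot dx yx = dot yy dy + dot dy yy ->
  dot xx dy + dot dx xy = dot xx 0 + dot dx z1 ->
  dot yx dy + dot dx yy = dot yx 0 + dot dx z2 ->
  dot (xx + yy) dx = 0 /\ dot (xx + yy) dy = 0.
Proof.
have d0 u : dot u 0 = 0 by apply: big1 => i _; rewrite mxE mulr0.
move=> -> -> ->; rewrite !d0 !dotD (dotsym dx xx) (dotsym dy xy) (dotsym dx xy) (dotsym dy yy) (dotsym dx yy).
move: (dot xx dx) (dot xx dy) (dot xy dx) (dot xy dy) (dot yy dx) (dot yy dy) => a b c d f g.
by split; lra.
Qed.

(** A conformal minimal immersion is harmonic. *)
Lemma minimal_harmonic F : smooth_on D F ->
  (forall z, D z -> exists2 l : R, 0 < l &
     forall v w, dot (rdiff v F z) (rdiff w F z) = l * complex.Re ((v 0 0)^* * w 0 0)) ->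
  forall z, D z -> mean_curvature_vector F z = 0 ->
  rdiff dirx (rdiff dirx F) z + rdiff diry (rdiff diry F) z = 0.
Proof.
move=> sF conf z Dz mz.
have cf y : D y -> exists2 l : R, l != 0 & [/\ dot (rdiff dirx F y) (rdiff dirx F y) = l,
    dot (rdiff diry F y) (rdiff diry F y) = l & dot (rdiff dirx F y) (rdiff diry F y) = 0].
  move=> /conf[l l0 hl]; exists l; first by rewrite gt_eqF.
  by split; rewrite hl !mxE; move: l {l0 hl} => l; rewrite !reim; ring.
have sx := smooth_rdiff dirx sF; have sy := smooth_rdiff diry sF.
have eqd (a b c d : 'cV[C]_1 -> 'cV[R]_n) w : smooth_on D a -> smooth_on D b -> smooth_on D c ->
    smooth_on D d -> (forall y, D y -> dot (a y) (b y) = dot (c y) (d y)) ->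
    dot (rdiff w a z) (b z) + dot (a z) (rdiff w b z) =
    dot (rdiff w c z) (d z) + dot (c z) (rdiff w d z).
  move=> sa sb sc sd h.
  have [d1 <-] := rder_rdiff (g := fun y => dot (a y) (b y)) (rdiff_dot w sa sb Dz).
  have [d2 <-] := rder_rdiff (g := fun y => dot (c y) (d y)) (rdiff_dot w sc sd Dz).
  by have [_ ->] := rdiff_ext oD Dz h d1.
have h1 w := eqd _ _ _ _ w sx sx sy sy (fun y Dy => let: ex_intro2 _ _ (And3 p q _) := cf y Dy in etrans p (esym q)).
have s0 : smooth_on D (fun=> 0 : 'cV[R]_n).
  by move=> k; apply: Ck_col => // i; apply: Ck_ext (Ck_cst k D 0) => // y _; rewrite mxE.
have d0 u : dot u 0 = 0 by apply: big1 => i _; rewrite mxE mulr0.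
have h2 w := eqd _ _ _ _ w sx sy sx s0 (fun y Dy => let: ex_intro2 _ _ (And3 _ _ q) := cf y Dy in etrans q (esym (d0 _))).
have [l l0 [e1 e2 e3]] := cf z Dz.
have cl := clairaut_vec dirx diry sF Dz.
have z0 w : rdiff w (fun=> 0 : 'cV[R]_n) z = 0.
  by rewrite /rdiff; exact: derive1_cst.
set W := rdiff dirx (rdiff dirx F) z + rdiff diry (rdiff diry F) z.
have [Wx Wy] : dot W (rdiff dirx F z) = 0 /\ dot W (rdiff diry F z) = 0.
  exact: (harmonic_alg cl (z0 dirx) (z0 diry) (h1 dirx) (h1 diry) (h2 dirx) (h2 diry)).
have := etrans (esym mz) (mean_curvatureE e1 e2 e3); rewrite -/W.
move: Wx Wy; move: W (rdiff dirx F z) (rdiff diry F z) => W dx dy -> ->.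
rewrite !mulr0 !scale0r addr0 subr0 => /esym/eqP.
by rewrite !scaler_eq0 invr_eq0 pnatr_eq0 /= invr_eq0 (negbTE l0) => /eqP.
Qed.

Lemma cauchy_riemann (a b c d p q : R) (w : C) : p = complex.Im (w * (c%:C + 'i * a%:C)) ->
  q = complex.Im (w * (b%:C + 'i * d%:C)) -> b = - a -> c = d ->
  w * (d%:C + 'i * a%:C) = q%:C + 'i * p%:C.
Proof. by move=> -> -> -> ->; apply: cE; rewrite !reim; ring. Qed.

(** The complex gradient of a harmonic map is holomorphic: these are the
    Cauchy-Riemann equations. *)
Lemma harmonic_cgrad F z : smooth_on D F -> D z ->
  rdiff dirx (rdiff dirx F) z + rdiff diry (rdiff diry F) z = 0 ->
  exists B, mder (cgrad F) z B.
Proof.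
move=> sF Dz hz.
have sx := smooth_rdiff dirx sF; have sy := smooth_rdiff diry sF.
have cl := clairaut_vec dirx diry sF Dz.
exists (\col_k ((rdiff dirx (rdiff diry F) z k 0)%:C + 'i * (rdiff dirx (rdiff dirx F) z k 0)%:C)).
move=> k j.
have h := fd_add (fd_coord1 k sy Dz) (fd_scale 'i (fd_coord1 k sx Dz)).
apply: fd_eq h => [y|v]; first by rewrite !mxE.
have e1 := cgradE v k sx Dz; have e2 := cgradE v k sy Dz.
have e3 : rdiff diry (rdiff diry F) z k 0 = - rdiff dirx (rdiff dirx F) z k 0.
  move/eqP: hz; rewrite addrC addr_eq0 => /eqP/(congr1 (fun u : 'cV[R]_n => u k 0)) hz.
  by apply: (etrans hz); rewrite mxE.
have e4 := congr1 (fun u : 'cV[R]_n => u k 0) cl.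
rewrite [in X in _ = complex.Im X]mxE in e1; rewrite [in X in _ = complex.Im X]mxE in e2.
rewrite [LHS]mxE [X in _ * X]mxE; exact: (cauchy_riemann e1 e2 e3 e4).
Qed.

End MinimalSurfaces.

(** * The surface of a holomorphic frame *)

Section Frames.
Context {R : realType} {n : nat}.
Local Notation C := R[i].

Definition imv (x : 'cV[C]_n) : 'cV[R]_n := map_mx (@complex.Im R) x.

Context (AD : 'cV[C]_n -> 'M[C]_n) (L : compact_lie AD).

Lemma AD_imv x : AD x - AD (conjm x) = (2 * 'i) *: AD (realv (imv x)).
Proof.
rewrite -(clB L) -(clZ L); congr AD; apply/matrixP => k j; rewrite !mxE.
by move: (x k j) => w; apply: cE; rewrite !reim; ring.
Qed.

(** The derivative of F F^* for a holomorphic frame F with F' = F AD(y). *)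
Lemma frame_fdm (F : 'cV[C]_1 -> 'M[C]_n) z y : mder F z (F z *m AD y) ->
  fdm (fun w => F w *m (F w)^t* ) z
    (fun v => F z *m (AD (v 0 0 *: y) - AD (conjm (v 0 0 *: y))) *m (F z)^t* ).
Proof.
move=> h; apply: fdm_eq (fdm_mul h (fdm_adj h)) => // v.
rewrite scalemxAr -(clZ L) [in RHS]adjM (cl_adj L).
move: (AD _) (AD _) (F z) => A A' P.
by rewrite mulNmx mulmxN mulmxBr mulmxBl !mulmxA.
Qed.

Lemma frame_rdiff (F : 'cV[C]_1 -> 'M[C]_n) z y v : mder F z (F z *m AD y) ->
  rdiff_mx v (fun w => F w *m (F w)^t* ) z =
    F z *m ((2 * 'i) *: AD (realv (imv (v 0 0 *: y)))) *m (F z)^t*.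
Proof. by move=> h; rewrite (fdm_rdiff v (frame_fdm h)) AD_imv. Qed.

Lemma frame_dz (F : 'cV[C]_1 -> 'M[C]_n) z y : aut AD (F z) -> mder F z (F z *m AD y) ->
  dz (fun w => F w *m (F w)^t* ) z *m invmx (F z *m (F z)^t* ) = AD (F z *m y).
Proof.
move=> aF h; have [f1 f2] := aF; have f3 := aut_trr aF; have [g1 _] := aut_adj L aF.
have uP : F z *m (F z)^t* \in unitmx.
  by rewrite unitmx_mul (mulmx1_unit f3).1 (mulmx1_unit g1).2.
have eP : (F z)^t* *m invmx (F z *m (F z)^t* ) = (F z)^T.
  have q : (F z)^T *m (F z *m (F z)^t* ) = (F z)^t* by rewrite mulmxA f1 mul1mx.
  by rewrite -{1}q mulmxK.
have -> : dz (fun w => F w *m (F w)^t* ) z = F z *m AD y *m (F z)^t*.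
  rewrite /dz (fdm_rdiff dirx (frame_fdm h)) (fdm_rdiff diry (frame_fdm h)).
  rewrite /dirx /diry !mxE -!(clB L) scalemxAl scalemxAr -(clZ L) -mulmxBl -mulmxBr -(clB L).
  rewrite scalemxAl scalemxAr -(clZ L); congr (_ *m _ *m _); congr AD.
  apply/matrixP => i j; rewrite !mxE; move: (y i j) => w.
  have i2 : 'i * 'i = -1 :> C by rewrite -expr2 sqrCi.
  apply: (@mulfI _ (2 : C)); first by rewrite pnatr_eq0.
  by rewrite mulrA divff ?pnatr_eq0// mul1r; apply: cE; rewrite !reim; ring.
by rewrite -mulmxA eP f2 -mulmxA f3 mulmx1.
Qed.

Lemma frame_smooth (D : set 'cV[C]_1) (H B : 'cV[C]_1 -> 'M[C]_n) : open D ->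
  (forall z, D z -> mder H z (B z)) -> smooth_mx_on D (fun w => H w *m (H w)^t* ).
Proof.
move=> oD hH.
have S i j k : Ck_on k D (fun y => complex.Re (H y i j)) /\ Ck_on k D (fun y => complex.Im (H y i j)).
  apply: (@hol_Ck R 1 D (fun y => H y i j) (fun z v => v 0 0 * B z i j)) => // z Dz.
  split=> [|a v]; last by rewrite mxE mulrA.
  by apply: fd_eq (hH z Dz i j) => // v; rewrite mxE.
have cRe (a b : C) : complex.Re (a * b^*) = complex.Re a * complex.Re b + complex.Im a * complex.Im b.
  by rewrite !reim; ring.
have cIm (a b : C) : complex.Im (a * b^*) = complex.Im a * complex.Re b + -1 * (complex.Re a * complex.Im b).
  by rewrite !reim; ring.
move=> i j; split=> k.
  apply: (Ck_ext oD (f := fun y => \sum_l (complex.Re (H y i l) * complex.Re (H y j l) +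
     complex.Im (H y i l) * complex.Im (H y j l)))) => [y _|].
    by rewrite mxE Re_sum; apply: eq_bigr => l _; rewrite !mxE -cRe.
  apply: Ck_sum => // l; apply: Ck_add => //; apply: Ck_mul => //;
  by [have [] := S i l k | have [] := S j l k].
apply: (Ck_ext oD (f := fun y => \sum_l (complex.Im (H y i l) * complex.Re (H y j l) +
     -1 * (complex.Re (H y i l) * complex.Im (H y j l))))) => [y _|].
  by rewrite mxE Im_sum; apply: eq_bigr => l _; rewrite !mxE -cIm.
apply: Ck_sum => // l; apply: Ck_add => //; apply: Ck_mul => //;
  try exact: Ck_cst; try apply: Ck_mul => //;
by [have [] := S i l k | have [] := S j l k].
Qed.

Definition line (X : 'cV[C]_n) : set 'cV[C]_n := [set k *: X | k in [set k | k != 0]].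

Lemma affine_domE j (X : 'cV[C]_n) : affine_dom j (line X) <-> X j 0 != 0.
Proof.
split=> [[_ [k /= k0 <-]]|X0]; first by rewrite mxE mulf_eq0 negb_or => /andP[].
by exists X => //; exists 1; rewrite /= ?oner_eq0 ?scale1r.
Qed.

Lemma affine_coordE j (X : 'cV[C]_n) : X j 0 != 0 -> affine_coord j (line X) = (X j 0)^-1 *: X.
Proof.
move=> X0; set S := [set (Y j 0)^-1 *: Y | Y in line X `&` [set Y | Y j 0 != 0]].
have uS : forall Y, S Y -> Y = (X j 0)^-1 *: X.
  move=> _ [_ [[k /= k0 <-] /= _] <-]; rewrite mxE scalerA invfM mulrAC mulVf// mul1r.
  by [].
apply: uS; apply: (@xgetI _ _ _ ((X j 0)^-1 *: X)); exists X => //.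
by split=> //; exists 1; rewrite /= ?oner_eq0 ?scale1r.
Qed.

Lemma line_holomorphic (X : 'cV[C]_1 -> 'cV[C]_n) (nu : 'cV[C]_1 -> set 'cV[C]_n) z B j :
  mder X z B -> (\forall w \near z, nu w = line (X w)) -> affine_dom j (nu z) ->
  (\forall w \near z, affine_dom j (nu w)) /\ differentiable (fun w => affine_coord j (nu w)) z.
Proof.
move=> hX hnu; rewrite (nbhs_singleton hnu) affine_domE => Xj.
have nX : \forall w \near z, X w j 0 != 0.
  have [d d0 hd] := fd_cont (hX j 0) (nc_gt0 Xj).
  apply/nbhs_nm; exists d => // w /hd h; apply: contraTneq h => ->.
  by rewrite sub0r ncN ltxx.
split; first by apply: filterS2 hnu nX => w -> Xw; apply/affine_domE.
have [d d0 hd] := (nbhs_nm _ _).1 (filterI hnu nX).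
pose A : 'M[C]_(n, 1) := \col_i (- B j 0 / (X z j 0) ^+ 2 * X z i 0 + (X z j 0)^-1 * B i 0).
apply: (@fdm_diff R 1 n _ z A).
have hg : fdm (fun w => (X w j 0)^-1 *: X w) z (fun v => A *m v).
  move=> i k; rewrite ord1; apply: fd_eq (fd_mul (fd_inv Xj (hX j 0)) (hX i 0)) => v.
    by rewrite mxE.
  by rewrite !mxE big_ord1 !mxE; move: (v 0 0) (X z j 0)^-1 => a b; rewrite !mulNr; ring.
apply: (fdm_ext d0 _ _ hg) => // w /hd[nuw Xw].
by rewrite nuw affine_coordE.
Qed.

End Frames.

(** * The gradient form and the Gauss map *)

Section Gradient.
Context {R : realType} {n : nat} (U : riemannSurface R).
Local Notation C := R[i].

Lemma chart_conformal (f0 : U -> 'cV[R]_n) c : conformal_immersion_Rn f0 -> atlas c ->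
  forall z, cod c z -> exists2 l : R, 0 < l & forall v w,
    dot (rdiff v (fun y => f0 (param c y)) z) (rdiff w (fun y => f0 (param c y)) z) =
    l * complex.Re ((v 0 0)^* * w 0 0).
Proof. by move=> [_ cf] ac z cz; exact: (cf c ac z cz). Qed.

Lemma cgrad_compat (f0 : U -> 'cV[R]_n) :
  (forall c, atlas c -> smooth_on (cod c) (fun y => f0 (param c y))) ->
  forall c d, atlas c -> atlas d -> forall z, cod c z -> dom d (param c z) ->
  forall T, mder (fun w => coord d (param c w)) z T ->
  cgrad (fun y => f0 (param c y)) z =
    T 0 0 *: cgrad (fun y => f0 (param d y)) (coord d (param c z)).
Proof.
move=> sf c d ac ad z cz dz T hT; set z' := coord d (param c z).
have cz' : cod d z' by exact: coord_cod.
have oc := chart_open_cod (atlas_chart ac); have od := chart_open_cod (atlas_chart ad).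
apply/matrixP => k j; rewrite ord1 [RHS]mxE; apply: Im_mul_inj => v.
have e1 := cgradE oc v k (sf c ac) cz.
have e2 := cgradE od (v 0 0 *: T) k (sf d ad) cz'.
have h1 := fd_coord1 oc k (sf c ac) cz.
have h2 := fd_coord1 od k (sf d ad) cz'.
have h3 := @fd_comp R _ _ _ (fun w => coord d (param c w)) z _ _ h2 hT.
have [r r0 hr] := (nbhs_nm _ _).1 (near_param ac cz (dom_near ad dz)).
have h4 : fd (fun y => (f0 (param c y) k 0)%:C) z
    ((fun v => (rdiff v (fun y => f0 (param d y)) z' k 0)%:C) \o (fun w : 'cV[C]_1 => w 0 0 *: T)).
  by apply: (fd_ext r0 _ _ h3) => // w /hr dw /=; rewrite paramK.
have e3 : rdiff v (fun y => f0 (param c y)) z k 0 = rdiff (v 0 0 *: T) (fun y => f0 (param d y)) z' k 0.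
  exact: complexI (fd_unique h1 h4 v).
have q (a : C) : complex.Im ((v 0 0 *: T) 0 0 * a) = complex.Im (v 0 0 * (T 0 0 * a)).
  by rewrite mxE mulrA.
exact: etrans (esym e1) (etrans e3 (etrans e2 (q _))).
Qed.

Lemma cgrad_holform (f0 : U -> 'cV[R]_n) : conformal_immersion_Rn f0 -> minimal f0 ->
  holform (fun (c : chart R 1 U) z => cgrad (fun y => f0 (param c y)) z).
Proof.
move=> cf mf; have [sf _] := cf; split; last exact: cgrad_compat.
move=> c ac z cz; have oc := chart_open_cod (atlas_chart ac).
apply: (harmonic_cgrad oc (sf c ac) cz).
apply: (minimal_harmonic oc (sf c ac) (chart_conformal cf ac) cz); exact: mf.
Qed.

End Gradient.

Section GaussMap.
Context {R : realType} {n : nat} (Gt : complexLieGroup R n).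
Local Notation C := R[i].
Context (phi : chart R n Gt) (phi_atlas : atlas phi) (phi_one : dom phi (lie_one Gt)).
Context (h : set 'cV[C]_n) (hc : compact_real_form phi h).
Context (e : 'I_n -> 'cV[C]_n) (he : orthonormal_basis phi h e).
Local Notation E := (basis_mx e).
Local Notation AD := (AD phi e).
Context (U : riemannSurface R).

Let EU : E \in unitmx.
Proof.
exact: (basis_unit (adD phi_atlas phi_one) (adZ phi_atlas phi_one) (let: And3 _ _ o := he in o)).
Qed.

(** When f_z f^-1 is read in the charts as a form xi with values in g, the
    Gauss map is the line of xi. *)
Lemma gaussE (f : U -> set 'M[C]_n) (xi : chart R 1 U -> 'cV[C]_1 -> 'cV[C]_n) :
  (forall c, atlas c -> forall z, cod c z ->
     dz (fun y => cartan (f (param c y))) z *m invmx (cartan (f (param c z))) = AD (xi c z)) ->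
  (forall c d, atlas c -> atlas d -> forall z, cod c z -> dom d (param c z) ->
   forall T, mder (fun w => coord d (param c w)) z T ->
     xi c z = T 0 0 *: xi d (coord d (param c z))) ->
  (forall c, atlas c -> forall z, cod c z -> xi c z != 0) ->
  forall c, atlas c -> forall z, cod c z ->
  right_gauss_map phi e f (param c z) = line (E *m xi c z).
Proof.
have L := AD_compact phi_atlas phi_one hc he.
move=> hxi hcomp xi0 c ac z cz; have [dz' Ez] := codP ac cz.
apply/seteqP; split=> X.
  move=> [d [k [ad dd k0 /= hX]]].
  have cz' := coord_cod dd; have Ed := paramK ad dd.
  move: hX (hxi d ad _ cz'); rewrite Ed => hX hd.
  rewrite (adgE phi_atlas phi_one he) hd -(clZ L) in hX; have {}hX := cl_inj L hX.
  have [T hT] := transition ac ad cz dd.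
  have hc' := hcomp c d ac ad z cz dd T hT.
  have T0 : T 0 0 != 0 by apply: contraNneq (xi0 c ac z cz) => T0; rewrite hc' T0 scale0r.
  exists (k / T 0 0); first by rewrite /= mulf_neq0 ?invr_eq0.
  by rewrite hc' -scalemxAr scalerA divfK// scalemxAr -hX mulKVmx.
move=> [k /= k0 <-]; exists c, k; split=> //=.
rewrite (adgE phi_atlas phi_one he) -scalemxAr mulKmx// (clZ L) Ez.
by rewrite hxi.
Qed.

End GaussMap.

(** * From minimal surfaces to the symmetric space *)

Section PartOne.
Context {R : realType} {n : nat} (Gt : complexLieGroup R n).
Local Notation C := R[i].
Context (phi : chart R n Gt) (phi_atlas : atlas phi) (phi_one : dom phi (lie_one Gt)).
Context (h : set 'cV[C]_n) (hc : compact_real_form phi h).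
Context (sigma0 : 'cV[C]_n -> 'cV[C]_n) (sc : is_conjugation h sigma0).
Context (sigma : Gt -> Gt) (sinv : involution_with_differential phi sigma sigma0).
Context (e : 'I_n -> 'cV[C]_n) (he : orthonormal_basis phi h e).
Context (gN : 'M[C]_n -> 'M[C]_n -> 'M[C]_n -> R) (gNm : invariant_metric phi h e gN).
Context (U : riemannSurface R) (U_sc : simply_connected R U).
Local Notation E := (basis_mx e).
Local Notation AD := (AD phi e).
Local Notation G := (adjoint_group phi e).

Let EU : E \in unitmx.
Proof.
exact: (basis_unit (adD phi_atlas phi_one) (adZ phi_atlas phi_one) (let: And3 _ _ o := he in o)).
Qed.
Let L : compact_lie AD. Proof. by have := AD_compact phi_atlas phi_one hc he. Qed.

Lemma adjoint_transport (x : chart R 1 U -> 'cV[C]_1 -> 'cV[C]_n) : holform x ->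
  exists F : U -> 'M[C]_n, (forall p, G (F p)) /\
    forall c, atlas c -> forall z, cod c z ->
      mder (fun y => F (param c y)) z (F (param c z) *m AD (x c z)).
Proof.
move=> hx; have [[p0 _]|noU] := pselect (exists p0 : U, True).
  have [F [_ hG hF]] := transport U_sc L
    (adjoint1 phi_atlas phi_one he) (adjointM phi_atlas phi_one he)
    (adjointT phi_atlas phi_one hc he) (adjoint_near1 phi_atlas phi_one hc he) p0 hx.
  by exists F.
exists (fun=> 1%:M); split=> [p|c ac z cz]; first exact: (adjoint1 phi_atlas phi_one he).
by case: noU; exists (param c z).
Qed.

Lemma frame_metric (F : 'cV[C]_1 -> 'M[C]_n) z y v w : G (F z) -> mder F z (F z *m AD y) ->
  gN (F z *m (F z)^t* ) (rdiff_mx v (fun w => F w *m (F w)^t* ) z)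
    (rdiff_mx w (fun w => F w *m (F w)^t* ) z) =
  \sum_k complex.Im (v 0 0 * y k 0) * complex.Im (w 0 0 * y k 0).
Proof.
move=> GF hF; rewrite !(frame_rdiff L _ hF).
rewrite (metricE phi_atlas phi_one hc he gNm)//.
by apply: eq_bigr => k _; rewrite !mxE.
Qed.

Theorem minimal_to_symmetric (f0 : U -> 'cV[R]_n) : conformal_immersion_Rn f0 -> minimal f0 ->
  exists f : U -> set 'M[C]_n,
    [/\ conformal_immersion_N phi sigma e gN f,
        holomorphic_to_projective (right_gauss_map phi e f)
      & same_metric (induced_N gN f) (induced_Rn f0)].
Proof.
move=> cf mf; have [sf cfm] := cf.
have hy := cgrad_holform cf mf.
set y := fun (c : chart R 1 U) z => cgrad (fun y => f0 (param c y)) z in hy.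
have [F [FG hF]] := adjoint_transport hy.
pose f (p : U) := [set F p *m b | b in isotropy_group phi sigma e].
have cE p : cartan (f p) = F p *m (F p)^t*.
  exact: (cartan_coset phi_atlas phi_one hc he sc sinv).
have cEc c : (fun y => cartan (f (param c y))) = (fun y => F (param c y) *m (F (param c y))^t* ).
  by apply: funext => z; exact: cE.
have same : same_metric (induced_N gN f) (induced_Rn f0).
  move=> c ac z cz v w; rewrite /induced_N cEc cE.
  have oc := chart_open_cod (atlas_chart ac).
  apply: etrans (frame_metric v w (FG _) (hF c ac z cz)) _.
  apply: eq_bigr => k _; congr (_ * _); apply: esym; exact: (cgradE oc _ k (sf c ac) cz).
have Faut p : aut AD (F p) by exact: (adjoint_aut phi_atlas phi_one hc he).
pose xi c z := F (param c z) *m y c z.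
have y0 c : atlas c -> forall z, cod c z -> y c z != 0.
  move=> ac z cz; apply/eqP => y0; have oc := chart_open_cod (atlas_chart ac).
  have [l l0 hl] := cfm c ac z cz; have := hl dirx dirx.
  rewrite !mxE mulr1 /induced_Rn.
  have -> : rdiff dirx (fun y => f0 (param c y)) z = 0.
    apply/matrixP => k j; rewrite ord1; apply: etrans (cgradE oc dirx k (sf c ac) cz) _.
    by have := congr1 (fun u : 'cV[C]_n => u k 0) y0; rewrite /y => ->; rewrite !mxE mulr0.
  rewrite /dot big1 => [|i _]; last by rewrite mxE mul0r.
  by rewrite conjC1 /= mulr1 => l00; rewrite -l00 ltxx in l0.
have Finj p (u : 'cV[C]_n) : F p *m u = 0 -> u = 0.
  by move=> u0; rewrite -[u]mul1mx -(Faut p).1 -mulmxA u0 mulmx0.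
have xi0 c : atlas c -> forall z, cod c z -> xi c z != 0.
  by move=> ac z cz; apply: contraNneq (y0 c ac z cz) => /Finj ->.
have gauss : forall c, atlas c -> forall z, cod c z ->
    right_gauss_map phi e f (param c z) = line (E *m xi c z).
  apply: (gaussE phi_atlas phi_one hc he) => // [c ac z cz|c d ac ad z cz dz' T hT].
    rewrite cEc cE; exact: (frame_dz L (Faut _) (hF c ac z cz)).
  by rewrite /xi (hy.2 c d ac ad z cz dz' T hT) -scalemxAr paramK.
have gauss' (p : U) : exists (c : chart R 1 U) z, [/\ atlas c, cod c z & param c z = p].
  have [c ac dp] := atlas_cover p; exists c, (coord c p).
  by split=> //; [exact: coord_cod | exact: paramK].
exists f; split=> //.
  split=> [p|c ac|c ac z cz]; first by exists (F p).
    rewrite cEc; apply: (frame_smooth (chart_open_cod (atlas_chart ac))) => z cz.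
    exact: hF c ac z cz.
  have [l l0 hl] := cfm c ac z cz; exists l => // v w.
  by rewrite (same c ac z cz v w) hl.
split=> [p|c ac z cz j].
  have [c [z [ac cz <-]]] := gauss' p; rewrite gauss//.
  exists (E *m xi c z) => //; apply: contraNneq (xi0 c ac z cz) => x0.
  by rewrite -(mulKmx EU (xi c z)) x0 mulmx0.
have [B hB] := hy.1 c ac z cz.
apply: (line_holomorphic (mder_mull E (mder_mul (hF c ac z cz) hB))).
by apply: filterS (cod_near ac cz) => w cw; rewrite gauss.
Qed.

End PartOne.

(** * Real parts of primitives *)

Section RealPart.
Context {R : realType} {n : nat} (U : riemannSurface R) (U_sc : simply_connected R U).
Local Notation C := R[i].

Lemma holform_primitive (y : chart R 1 U -> 'cV[C]_1 -> 'cV[C]_n) : holform y ->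
  exists g : U -> 'cV[C]_n, forall c, atlas c -> forall z, cod c z ->
    mder (fun w => g (param c w)) z (y c z).
Proof.
move=> [yh yc]; have [[p0 _]|noU] := pselect (exists p0 : U, True); last first.
  by exists (fun=> 0) => c ac z cz; case: noU; exists (param c z).
(* F' = F N with N strictly upper triangular integrates the row y^T *)
pose N (y : 'cV[C]_n) : 'M[C]_(1 + n) := block_mx 0 y^T 0 0.
have ND u v : N (u + v) = N u + N v by rewrite /N add_block_mx linearD /= !addr0.
have NZ k v : N (k *: v) = k *: N v by rewrite /N scale_block_mx linearZ /= !scaler0.
have hN : holform (fun c z => N (y c z)).
  split=> [c ac z cz|c d ac ad z cz dz' T hT].
    by have [B hB] := yh c ac z cz; exists (N B); exact: mder_lin hB.
  by rewrite (yc c d ac ad z cz dz' T hT) NZ.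
have [F [F0 _ hF]] := ode_surface U_sc p0 hN.
have mN (A : 'M[C]_(1 + n)) v : A *m N v = block_mx 0 (ulsubmx A *m v^T) 0 (dlsubmx A *m v^T).
  by rewrite -{1}(submxK A) mulmx_block !mulmx0 !addr0.
have ul p : ulsubmx (F p) = 1%:M.
  rewrite (@surface_const _ _ U_sc _ _ (fun p => ulsubmx (F p)) _ p p0).
    by rewrite F0 -[RHS](@block_mxKul _ 1 n 1 n _ 0 0 1%:M) -scalar_mx_block.
  move=> c ac z cz i j; have := hF c ac z cz (lshift n i) (lshift n j).
  apply: fd_eq => [w|w]; first by rewrite !mxE.
  by rewrite mN [RHS]mxE block_mxEul !mxE.
exists (fun p => (ursubmx (F p))^T) => c ac z cz i j.
have := hF c ac z cz (lshift n j) (rshift 1 i).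
apply: fd_eq => [w|w]; first by rewrite !mxE.
by rewrite mN ul mul1mx [RHS]mxE block_mxEur !mxE !ord1.
Qed.

Lemma normal_part0 (a b : 'cV[R]_n) (l : R) :
  2^-1 *: (l^-1 *: (0 - ((l^-1 * dot 0 a) *: a + (l^-1 * dot 0 b) *: b))) = 0.
Proof.
have d0 u : dot 0 u = 0 :> R by apply: big1 => i _; rewrite mxE mul0r.
by rewrite !d0 !mulr0 !scale0r addr0 subr0 !scaler0.
Qed.

(** The imaginary part of the primitive of an isotropic holomorphic form is a
    conformal minimal immersion. *)
Lemma realize (y : chart R 1 U -> 'cV[C]_1 -> 'cV[C]_n) (I : surface_metric) : holform y ->
  conformal I ->
  (forall c, atlas c -> forall z, cod c z -> forall v w, I c z v w =
     \sum_k complex.Im (v 0 0 * y c z k 0) * complex.Im (w 0 0 * y c z k 0)) ->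
  exists f0 : U -> 'cV[R]_n, [/\ conformal_immersion_Rn f0, minimal f0 & same_metric (induced_Rn f0) I].
Proof.
move=> hy cI IE; have [g hg] := holform_primitive hy.
pose f0 p := imv (g p).
have sf c : atlas c -> smooth_on (cod c) (fun w => f0 (param c w)).
  move=> ac k; have oc := chart_open_cod (atlas_chart ac); apply: Ck_col => // i.
  have [||_ h] := @hol_Ck R 1 (cod c) (fun w => g (param c w) i 0) (fun z v => v 0 0 * y c z i 0) k.
  - exact: oc.
  - move=> z cz; split=> [|a v]; last by rewrite mxE mulrA.
    by apply: fd_eq (hg c ac z cz i 0) => // v; rewrite mxE.
  by apply: Ck_ext h => // w _; rewrite mxE.
have rd c : atlas c -> forall z, cod c z -> forall v k,
    rdiff v (fun w => f0 (param c w)) z k 0 = complex.Im (v 0 0 * y c z k 0).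
  move=> ac z cz v k; have oc := chart_open_cod (atlas_chart ac).
  have e1 := rdiff_coord v k (sf c ac 1%N) cz.
  have e2 := (fd_rdiff v (hg c ac z cz k 0)).2.
  have e3 : (fun w => f0 (param c w) k 0) = (fun w => complex.Im (g (param c w) k 0)).
    by apply: funext => w; rewrite mxE.
  have q : complex.Im ((v 0 0 *: y c z) k 0) = complex.Im (v 0 0 * y c z k 0) by rewrite mxE.
  exact: etrans e1 (etrans (congr1 (fun F => rdiff v F z) e3) (etrans e2 q)).
have same : same_metric (induced_Rn f0) I.
  by move=> c ac z cz v w; rewrite IE//; apply: eq_bigr => k _; congr (_ * _); exact: rd.
have cf : conformal (induced_Rn f0).
  by move=> c ac z cz; have [l l0 hl] := cI c ac z cz; exists l => // v w; rewrite same.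
exists f0; split=> // c ac z cz.
have oc := chart_open_cod (atlas_chart ac); have [l l0 hl] := cf c ac z cz.
have [B hB] := hy.1 c ac z cz.
have rr u v k : rdiff u (rdiff v (fun w => f0 (param c w))) z k 0 = complex.Im (u 0 0 * v 0 0 * B k 0).
  apply: etrans (rdiff_coord u k (smooth_rdiff v (sf c ac) 1%N) cz) _.
  have h := fd_scale (v 0 0) (hB k 0).
  have e2 := (fd_rdiff u h).2.
  have r1 := fd_rderIm u h.
  have d1 := (rder_rdiff (g := fun w => complex.Im (v 0 0 * y c w k 0)) r1).1.
  have e3 : forall w, cod c w -> complex.Im (v 0 0 * y c w k 0) = rdiff v (fun w => f0 (param c w)) w k 0.
    by move=> w cw; apply: esym; exact: rd.
  have [_ e4] := rdiff_ext oc cz e3 d1.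
  apply: etrans e4 (etrans e2 _); rewrite [in LHS]mxE; congr complex.Im.
  by rewrite mulrCA mulrA.
set F := fun w => f0 (param c w).
have W0 : rdiff dirx (rdiff dirx F) z + rdiff diry (rdiff diry F) z = 0.
  apply/matrixP => k j; rewrite ord1; apply: etrans (mxE _ _ _ _) _.
  apply: etrans (congr2 +%R (rr dirx dirx k) (rr diry diry k)) _.
  rewrite !mxE; move: (B k 0) => b; rewrite !reim; ring.
have e1 : dot (rdiff dirx F z) (rdiff dirx F z) = l.
  by apply: etrans (hl dirx dirx) _; rewrite !mxE; move: l {hl l0} => l; rewrite !reim; ring.
have e2 : dot (rdiff diry F z) (rdiff diry F z) = l.
  by apply: etrans (hl diry diry) _; rewrite !mxE; move: l {hl l0 e1} => l; rewrite !reim; ring.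
have e3 : dot (rdiff dirx F z) (rdiff diry F z) = 0.
  by apply: etrans (hl dirx diry) _; rewrite !mxE; move: l {hl l0 e1 e2} => l; rewrite !reim; ring.
apply: etrans (mean_curvatureE e1 e2 e3) _; rewrite W0.
exact: normal_part0.
Qed.

End RealPart.

(** * Hermitian families of automorphisms *)

Section HermitianMaps.
Context {R : realType} {n : nat}.
Local Notation C := R[i].
Implicit Types (F P : 'cV[C]_1 -> 'M[C]_n) (z v w : 'cV[C]_1).

Lemma fdm_dirE p q (F : 'cV[C]_1 -> 'M[C]_(p, q)) z l : fdm F z l -> forall v,
  l v = (complex.Re (v 0 0))%:C *: l dirx + (complex.Im (v 0 0))%:C *: l diry.
Proof. by move=> h v; apply/matrixP => i j; rewrite !mxE; exact: (rlin1E v (h i j).1). Qed.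

Lemma fdm_scal p q (m : 'cV[C]_1 -> C) (N : 'cV[C]_1 -> 'M[C]_(p, q)) z m' l :
  fd m z m' -> fdm N z l -> fdm (fun w => m w *: N w) z (fun v => m' v *: N z + m z *: l v).
Proof. by move=> hm hN i j; apply: fd_eq (fd_mul hm (hN i j)) => w; rewrite !mxE. Qed.

Context (D : set 'cV[C]_1) (oD : open D).

Lemma smooth_fdm F z : smooth_mx_on D F -> D z -> fdm F z (fun v => rdiff_mx v F z).
Proof.
move=> sF Dz i j; have [hr hi] := sF i j.
apply: fd_eq (fd_add (fd_C1 oD (hr 1%N) Dz) (fd_scale 'i (fd_C1 oD (hi 1%N) Dz))) => y.
  by rewrite -complexE.
by rewrite mxE; exact: (complexE (_ +i* _)).
Qed.

Lemma smooth_rdiff_mx F u : smooth_mx_on D F -> smooth_mx_on D (rdiff_mx u F).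
Proof.
move=> sF i j; have [hr hi] := sF i j; split=> k.
  have -> : (fun y => complex.Re (rdiff_mx u F y i j)) = rdiff u (fun y => complex.Re (F y i j)).
    by apply: funext => y; rewrite mxE.
  by have [_ /(_ u)[]] := hr k.+1.
have -> : (fun y => complex.Im (rdiff_mx u F y i j)) = rdiff u (fun y => complex.Im (F y i j)).
  by apply: funext => y; rewrite mxE.
by have [_ /(_ u)[]] := hi k.+1.
Qed.

Lemma rdiff_mxE u F z i j : rdiff_mx u F z i j =
  rdiff u (fun y => complex.Re (F y i j)) z +i* rdiff u (fun y => complex.Im (F y i j)) z.
Proof. by rewrite mxE. Qed.

Lemma conj_half : (2^-1 : C)^* = 2^-1.
Proof. by rewrite fmorphV rmorph_nat. Qed.

Lemma clairaut_mx F u v z : smooth_mx_on D F -> D z ->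
  rdiff_mx u (rdiff_mx v F) z = rdiff_mx v (rdiff_mx u F) z.
Proof.
move=> sF Dz; apply/matrixP => i j; have [hr hi] := sF i j.
have Re_r a b : rdiff a (fun y => complex.Re (rdiff_mx b F y i j)) z =
    rdiff a (rdiff b (fun y => complex.Re (F y i j))) z.
  by congr (rdiff a _ z); apply: funext => y; rewrite mxE.
have Im_r a b : rdiff a (fun y => complex.Im (rdiff_mx b F y i j)) z =
    rdiff a (rdiff b (fun y => complex.Im (F y i j))) z.
  by congr (rdiff a _ z); apply: funext => y; rewrite mxE.
have e1 := etrans (Re_r u v) (etrans (clairaut v u oD (hr 2%N) Dz) (esym (Re_r v u))).
have e2 := etrans (Im_r u v) (etrans (clairaut v u oD (hi 2%N) Dz) (esym (Im_r v u))).
exact: (etrans (rdiff_mxE u _ z i j) (etrans (congr2 (@Complex R) e1 e2) (esym (rdiff_mxE v _ z i j)))).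
Qed.

Lemma herm_rdiff F v z : smooth_mx_on D F -> (forall w, D w -> (F w)^t* = F w) -> D z ->
  (rdiff_mx v F z)^t* = rdiff_mx v F z.
Proof.
move=> sF hF Dz; have h := smooth_fdm sF Dz.
have [d d0 hd] := open_nm oD Dz.
have h2 : fdm F z (fun v => (rdiff_mx v F z)^t* ).
  by apply: (fdm_ext d0 _ _ (fdm_adj h)) => // w /hd Dw; rewrite hF.
exact: (fdm_unique h2 h v).
Qed.

Lemma adj_trC (P : 'M[C]_n) : (P^T)^t* = (P^t* )^T.
Proof. by rewrite !adjE conjm_tr. Qed.

Lemma adjmZ k (A : 'M[C]_n) : (k *: A)^t* = k^* *: A^t*.
Proof. by apply/matrixP => i j; rewrite !mxE rmorphM. Qed.

Lemma dbar_alg (X Y P S A Ax Ay Mx My Lxx Lxy Lyx Lyy : 'M[C]_n) (mu : C) :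
  X^t* = X -> Y^t* = Y -> P^t* = P -> P^T *m P = 1%:M ->
  S = 2^-1 *: (X - 'i *: Y) -> A = S *m P^T ->
  Mx = 2^-1 *: (Lxx - 'i *: Lyx) -> My = 2^-1 *: (Lxy - 'i *: Lyy) ->
  Lyx = Lxy -> Lxx^t* = Lxx -> Lyy^t* = Lyy ->
  X^T *m P = - (P^T *m X) -> Y^T *m P = - (P^T *m Y) ->
  Ax = Mx *m P^T + S *m X^T -> Ay = My *m P^T + S *m Y^T ->
  Ax + 'i *: Ay = mu *: A -> mu *: S = mu^* *: S^t*.
Proof.
move=> hX hY hP PP SE AE MxE MyE Ls hLx hLy sX sY AxE AyE e.
have St : S^t* = 2^-1 *: (X + 'i *: Y).
  rewrite SE adjmZ adjD hX -scaleN1r scalerA adjmZ hY.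
  rewrite conj_half.
  by congr (_ *: (_ + _ *: _)); apply: cE; rewrite !reim; ring.
have XY : X + 'i *: Y = 2 *: S^t*.
  by rewrite St scalerA divff ?scale1r// pnatr_eq0.
have h2 := conj_half.
have muS : mu *: S = 2^-1 *: (Lxx + Lyy) - 2 *: (S *m P^T *m S^t* ).
  have -> : mu *: S = (mu *: A) *m P by rewrite AE -scalemxAl -mulmxA PP mulmx1.
  rewrite -e AxE AyE mulmxDl -scalemxAl !mulmxDl -!mulmxA PP sX sY !mulmx1 !mulmxN.
  have -> : 2 *: (S *m (P^T *m S^t* )) = S *m (P^T *m X) + 'i *: (S *m (P^T *m Y)).
    have e3 : S *m (P^T *m (2 *: S^t* )) = 2 *: (S *m (P^T *m S^t* )) by rewrite -scalemxAr -scalemxAr.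
    by rewrite -e3 -XY mulmxDr mulmxDr -scalemxAr -scalemxAr.
  rewrite MxE MyE Ls; move: (S *m _) (S *m _) => U V.
  apply/matrixP => i j; rewrite !mxE.
  move: (U i j) (V i j) (Lxx i j) (Lxy i j) (Lyy i j) (2^-1 : C) => a b c d f g.
  by apply: cE; rewrite !reim; ring.
have : (mu *: S)^t* = mu *: S.
  rewrite muS adjD adjmZ h2 adjD hLx hLy -scaleN1r scalerA adjmZ !adjM adjK adj_trC hP mulmxA.
  by congr (_ + _ *: _); apply: cE; rewrite !reim; ring.
by rewrite adjmZ => ->.
Qed.

Lemma mu_alg (X Y : 'M[C]_n) (mu : C) :
  mu *: (2^-1 *: (X - 'i *: Y)) = mu^* *: (2^-1 *: (X - 'i *: Y))^t* ->
  X^t* = X -> Y^t* = Y -> (complex.Im mu)%:C *: X + (- complex.Re mu)%:C *: Y = 0.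
Proof.
move=> e hX hY; apply/matrixP => i j.
have := congr1 (fun A : 'M[C]_n => A i j) e.
have eX := congr1 (fun A : 'M[C]_n => A i j) hX; have eY := congr1 (fun A : 'M[C]_n => A i j) hY.
rewrite !mxE in eX eY; rewrite !mxE rmorphM rmorphB rmorphM /= eX eY.
rewrite conj_half.
have -> : ('i : C)^* = - 'i by rewrite conjCi.
have muE : mu = (complex.Re mu)%:C + 'i * (complex.Im mu)%:C by apply: cE; rewrite !reim; ring.
rewrite {1 2}muE; have -> : ((complex.Re mu)%:C + 'i * (complex.Im mu)%:C)^* =
   (complex.Re mu)%:C - 'i * (complex.Im mu)%:C :> C.
  by apply: cE; rewrite !reim; ring.
have -> : (- complex.Re mu)%:C = - (complex.Re mu)%:C :> C by apply: cE; rewrite !reim ?oppr0.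
move: ((complex.Re mu)%:C : C) ((complex.Im mu)%:C : C) (X i j) (Y i j) => p q x y h.
have i0 : 'i != 0 :> C := neq0Ci _.
have i2 : 'i * 'i = -1 :> C by rewrite -expr2 sqrCi.
have i02 : 2 * 2^-1 = 1 :> C by rewrite divff// pnatr_eq0.
apply: (mulfI i0); rewrite mulr0.
move: h i2 i02; move: ('i : C) (2^-1 : C) => ii t h i2 i02.
move/eqP: h; rewrite -subr_eq0 => /eqP h; apply: etrans h.
by rewrite -[LHS]mul1r -i02; ring.
Qed.

Context (AD : 'cV[C]_n -> 'M[C]_n) (L : compact_lie AD).

Lemma adproj_fdm F z l : fdm F z l -> fdm (fun w => adproj AD (F w)) z (fun v => adproj AD (l v)).
Proof.
move=> hF k j; have h := fdm_mulr (AD (delta_mx k 0)) hF.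
have h2 := fd_opp (@fd_sum R 1 _ (index_enum 'I_n) xpredT
  (fun i w => (F w *m AD (delta_mx k 0)) i i) z _ (fun i _ => h i i)).
by apply: fd_eq h2 => w; rewrite mxE.
Qed.

(** The tangent vectors at 1 of a hermitian family of automorphisms are of the
    form i ad(r), with r in the compact real form. *)
Lemma aut_tangent (Q : 'cV[C]_1 -> 'M[C]_n) z l : fdm Q z l -> Q z = 1%:M ->
  (\forall w \near z, aut AD (Q w) /\ (Q w)^t* = Q w) ->
  forall v, exists r : 'cV[R]_n, l v = (2 * 'i) *: AD (realv r).
Proof.
move=> hQ Q1 /nbhs_nm[d d0 hn] v.
have der x : l v *m AD x = AD (l v *m x) + AD x *m l v.
  have h1 := fdm_mulr (AD x) hQ.
  have h2 := fdm_mul (@fdm_comp R _ _ _ _ _ (fun w => Q w *m x) z _ _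
    (fdm_lin (Q z *m x) (clD L) (clZ L)) (fdm_mulr x hQ)) hQ.
  have h3 : fdm (fun w => AD (Q w *m x) *m Q w) z (fun v => l v *m AD x).
    by apply: (fdm_ext d0 _ _ h1) => // w /hn[[_ ->]].
  by have := fdm_unique h3 h2 v; rewrite /= Q1 mulmx1 mul1mx.
have herm : (l v)^t* = l v.
  have h2 : fdm Q z (fun v => (l v)^t* ) by apply: (fdm_ext d0 _ _ (fdm_adj hQ)) => // w /hn[_ ->].
  exact: (fdm_unique h2 hQ v).
have := deriv_inner L der; move: (adproj AD (l v)) => s ls.
exists (\col_k (2^-1 * imv s k 0)); rewrite ls -(clZ L); congr AD.
have : conjm s = - s.
  by apply: (cl_inj L); move: herm; rewrite ls (cl_adj L) (clN L) => <-; rewrite opprK.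
move=> /matrixP hs; apply/matrixP => k j; rewrite ord1; have := hs k 0; rewrite !mxE.
move: (s k 0) => a ha.
have ra : complex.Re a = 0.
  have := congr1 (@complex.Re R) ha; rewrite !reim => /eqP.
  by rewrite -subr_eq0 opprK -mulr2n mulrn_eq0 => /eqP.
have i2 : 2 * 2^-1 = 1 :> R by rewrite divff// pnatr_eq0.
apply: cE; rewrite !reim ?ra; first by ring.
move: (complex.Im a) (2^-1 : R) i2 => b t i2; transitivity (2 * t * b); [by rewrite i2 mul1r | ring].
Qed.

Lemma log_dbar (ax ay N lx ly x : 'cV[C]_n) (mx my m : C) : m != 0 ->
  ax = mx *: N + m *: lx -> ay = my *: N + m *: ly -> ly = 'i *: lx -> x = m *: N ->
  ax + 'i *: ay = ((mx + 'i * my) / m) *: x.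
Proof.
move=> m0 -> -> -> ->; rewrite scalerA divfK//; apply/matrixP => k j; rewrite !mxE.
have i2 : 'i * 'i = -1 :> C by rewrite -expr2 sqrCi.
move: (N k j) (lx k j) i2; move: ('i : C) => ii u w i2.
have -> : mx * u + m * w + ii * (my * u + m * (ii * w)) = (mx + ii * my) * u + (1 + ii * ii) * (m * w) by ring.
by rewrite i2 subrr mul0r addr0.
Qed.

Lemma AD_dbar (Ax Ay A : 'M[C]_n) (ax ay x : 'cV[C]_n) mu : Ax = AD ax -> Ay = AD ay ->
  ax + 'i *: ay = mu *: x -> A = AD x -> Ax + 'i *: Ay = mu *: A.
Proof. by move=> -> -> e ->; rewrite -!(clZ L) -(clD L) e. Qed.

Lemma complex_linear (c a b x : 'cV[C]_n) (w mu : C) :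
  c = (complex.Re w)%:C *: a + (complex.Im w)%:C *: b -> a + 'i *: b = mu *: x -> mu = 0 -> w *: a = c.
Proof.
move=> -> e mu0; rewrite mu0 scale0r in e.
have i2 : 'i * 'i = -1 :> C by rewrite -expr2 sqrCi.
have -> : b = 'i *: a.
  by move/eqP: e; rewrite addr_eq0 => /eqP ->; rewrite scalerN scalerA i2 scaleN1r opprK.
by rewrite scalerA -scalerDl; congr (_ *: _); apply: cE; rewrite !reim; ring.
Qed.

(** If the line of xi = P_z P^-1 varies holomorphically and P is an immersion
    at z, then xi itself is holomorphic at z: dbar xi = mu xi, and the symmetry
    of second derivatives makes mu P_z hermitian. *)
Lemma gauss_holomorphic P z (m : 'cV[C]_1 -> C) m' (N : 'cV[C]_1 -> 'cV[C]_n) l :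
  smooth_mx_on D P -> (forall w, D w -> aut AD (P w) /\ (P w)^t* = P w) -> D z ->
  let xi w := adproj AD (dz P w *m (P w)^T) in
  (forall w, D w -> dz P w *m (P w)^T = AD (xi w)) ->
  (\forall w \near z, xi w = m w *: N w) -> fd m z m' -> fdm N z l ->
  l diry = 'i *: l dirx -> m z != 0 ->
  (forall v, rdiff_mx v P z = 0 -> v 0 0 = 0) ->
  exists B, mder xi z B.
Proof.
move=> sP aP Dz xi xiE nmN hm hN lN m0 imm.
have hP := smooth_fdm sP Dz.
have sx := smooth_rdiff_mx dirx sP; have sy := smooth_rdiff_mx diry sP.
pose Mv v := 2^-1 *: (rdiff_mx v (rdiff_mx dirx P) z - 'i *: rdiff_mx v (rdiff_mx diry P) z).
have hS : fdm (dz P) z Mv.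
  exact: (fdm_scale 2^-1 (fdm_add (smooth_fdm sx Dz) (fdm_opp (fdm_scale 'i (smooth_fdm sy Dz))))).
pose Av v := Mv v *m (P z)^T + dz P z *m (rdiff_mx v P z)^T.
have hA : fdm (fun w => dz P w *m (P w)^T) z Av by exact: (fdm_mul hS (fdm_tr hP)).
have hxi : fdm xi z (fun v => adproj AD (Av v)) by exact: (adproj_fdm hA).
have [d d0 hd] := open_nm oD Dz.
have AvE v : Av v = AD (adproj AD (Av v)).
  have h1 := @fdm_comp R _ _ _ _ _ xi z _ _ (fdm_lin (xi z) (clD L) (clZ L)) hxi.
  have h2 : fdm (AD \o xi) z Av by apply: (fdm_ext d0 _ _ hA) => // w /hd Dw; rewrite /= -xiE.
  exact: (fdm_unique h2 h1 v).
have xi'E v : adproj AD (Av v) = m' v *: N z + m z *: l v.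
  have [d1 d10 hd1] := (nbhs_nm _ _).1 nmN.
  have h2 : fdm xi z (fun v => m' v *: N z + m z *: l v).
    by apply: (fdm_ext d10 _ _ (fdm_scal hm hN)).
  exact: (fdm_unique hxi h2 v).
pose mu := (m' dirx + 'i * m' diry) / m z.
have i2 : 'i * 'i = -1 :> C by rewrite -expr2 sqrCi.
have dbar : adproj AD (Av dirx) + 'i *: adproj AD (Av diry) = mu *: xi z.
  exact: (log_dbar m0 (xi'E dirx) (xi'E diry) lN (nbhs_singleton nmN)).
have [aPz hPz] := aP z Dz; have [PP _] := aPz.
have skew v : (rdiff_mx v P z)^T *m P z = - ((P z)^T *m rdiff_mx v P z).
  have h1 := fdm_mul (fdm_tr hP) hP.
  have h2 : fdm (fun w => (P w)^T *m P w) z (fun=> 0).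
    by apply: (fdm_ext d0 _ _ (fdm_cst 1%:M z)) => // w /hd/aP[[-> _] _].
  by apply/eqP; rewrite -addr_eq0; apply/eqP; exact: (fdm_unique h1 h2 v).
have hX := herm_rdiff dirx sP (fun w Dw => (aP w Dw).2) Dz.
have hY := herm_rdiff diry sP (fun w Dw => (aP w Dw).2) Dz.
have hXX := herm_rdiff dirx sx (fun w Dw => herm_rdiff dirx sP (fun w Dw => (aP w Dw).2) Dw) Dz.
have hYY := herm_rdiff diry sy (fun w Dw => herm_rdiff diry sP (fun w Dw => (aP w Dw).2) Dw) Dz.
have eA : Av dirx + 'i *: Av diry = mu *: (dz P z *m (P z)^T).
  exact: (AD_dbar (AvE dirx) (AvE diry) dbar (xiE z Dz)).
have muS := dbar_alg hX hY hPz PP (erefl (dz P z)) (erefl _) (erefl (Mv dirx)) (erefl (Mv diry))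
  (clairaut_mx dirx diry sP Dz) hXX hYY (skew dirx) (skew diry) (erefl (Av dirx)) (erefl (Av diry)) eA.
have v0 := mu_alg muS hX hY.
pose v : 'cV[C]_1 := const_mx (complex.Im mu +i* - complex.Re mu).
have mu0 : mu = 0.
  have hv : v 0 0 = complex.Im mu +i* - complex.Re mu by rewrite mxE.
  have ev := fdm_dirE hP v; rewrite hv in ev.
  have h := imm v (etrans ev v0); rewrite hv in h.
  have h1 := congr1 (@complex.Re R) h; have h2 := congr1 (@complex.Im R) h.
  by apply: cE; move: h1 h2 => /= h1 h2; [apply: oppr_inj; rewrite oppr0|].
have dirE := fdm_dirE hxi.
exists (adproj AD (Av dirx)); apply: fdm_eq hxi => v'; first exact: erefl.
exact: (complex_linear (dirE v') dbar mu0).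
Qed.

End HermitianMaps.

(** * From the symmetric space to minimal surfaces *)

Section HermitianMapsIntoG.
Context {R : realType} {n : nat}.
Local Notation C := R[i].
Context (AD : 'cV[C]_n -> 'M[C]_n) (L : compact_lie AD) (G : set 'M[C]_n).
Hypotheses (Gaut : forall F, G F -> aut AD F) (G1 : G 1%:M)
  (GM : forall F P, G F -> G P -> G (F *m P)) (GT : forall F, G F -> G F^T).
Context (U : riemannSurface R) (U_sc : simply_connected R U).
Hypothesis transp : forall x : chart R 1 U -> 'cV[C]_1 -> 'cV[C]_n, holform x ->
  exists F : U -> 'M[C]_n, (forall p, G (F p)) /\
    forall c, atlas c -> forall z, cod c z ->
      mder (fun y => F (param c y)) z (F (param c z) *m AD (x c z)).

(** Tangent vectors of the Cartan image. *)
Lemma cartan_tangent (D : set 'cV[C]_1) P z a : open D -> D z -> smooth_mx_on D P ->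
  (forall w, D w -> aut AD (P w) /\ (P w)^t* = P w) -> G a -> P z = a *m a^t* ->
  forall v, exists r : 'cV[R]_n, rdiff_mx v P z = a *m ((2 * 'i) *: AD (realv r)) *m a^t*.
Proof.
move=> oD Dz sP aP Ga Pz v.
have aa := Gaut Ga; have [a1 _] := aa; have a2 := aut_trr aa; have aT := autT aa.
have c1 : a^t* *m (a^T)^t* = 1%:M by rewrite -adjM a1 adjm1.
have c2 : (a^T)^t* *m a^t* = 1%:M by rewrite -adjM a2 adjm1.
have hQ := fdm_mulr ((a^T)^t* ) (fdm_mull a^T (smooth_fdm oD sP Dz)).
have [||r hr] := aut_tangent L hQ _ _ v.
- by rewrite Pz mulmxA a1 mul1mx.
- apply: filterS (open_nbhs_nbhs (conj oD Dz)) => w Dw; have [aw hw] := aP w Dw.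
  by move: (P w) aw hw => Q aw hw; split;
    [apply: autM (aut_adj L aT); exact: autM | rewrite !adjM adjK hw mulmxA].
exists r; rewrite -hr; move: (rdiff_mx v P z) => V.
by rewrite !mulmxA a2 mul1mx -mulmxA c2 mulmx1.
Qed.

Lemma rdiff_mx_chart (P : U -> 'M[C]_n) :
  (forall c, atlas c -> smooth_mx_on (cod c) (fun y => P (param c y))) ->
  forall c d, atlas c -> atlas d -> forall z, cod c z -> dom d (param c z) ->
  forall T, mder (fun w => coord d (param c w)) z T -> forall v,
  rdiff_mx v (fun y => P (param c y)) z =
    rdiff_mx (v 0 0 *: T) (fun y => P (param d y)) (coord d (param c z)).
Proof.
move=> sP c d ac ad z cz dz' T hT v; have cz' := coord_cod dz'.
have h1 := smooth_fdm (chart_open_cod (atlas_chart ac)) (sP c ac) cz.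
have h2 := smooth_fdm (chart_open_cod (atlas_chart ad)) (sP d ad) cz'.
have h3 := @fdm_comp R _ _ _ _ _ (fun w => coord d (param c w)) z _ _ h2 hT.
have [r r0 hr] := (nbhs_nm _ _).1 (near_param ac cz (dom_near ad dz')).
have h4 : fdm (fun y => P (param c y)) z ((fun v => rdiff_mx v (fun y => P (param d y))
    (coord d (param c z))) \o (fun w : 'cV[C]_1 => w 0 0 *: T)).
  by apply: (fdm_ext r0 _ _ h3) => // w /hr dw /=; rewrite paramK.
exact: (fdm_unique h1 h4 v).
Qed.

Lemma dz_alg (X Y A B S S' : 'M[C]_n) (t : C) : S = 2^-1 *: (X - 'i *: Y) ->
  X = (complex.Re t)%:C *: A + (complex.Im t)%:C *: B ->
  Y = (complex.Re ('i * t))%:C *: A + (complex.Im ('i * t))%:C *: B ->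
  S' = 2^-1 *: (A - 'i *: B) -> S = t *: S'.
Proof.
move=> -> -> -> ->; apply/matrixP => i j; rewrite !mxE.
by move: (A i j) (B i j) (2^-1 : C) => a b g; apply: cE; rewrite !reim; ring.
Qed.

Lemma dz_chart (P : U -> 'M[C]_n) :
  (forall c, atlas c -> smooth_mx_on (cod c) (fun y => P (param c y))) ->
  forall c d, atlas c -> atlas d -> forall z, cod c z -> dom d (param c z) ->
  forall T, mder (fun w => coord d (param c w)) z T ->
  dz (fun y => P (param c y)) z = T 0 0 *: dz (fun y => P (param d y)) (coord d (param c z)).
Proof.
move=> sP c d ac ad z cz dz' T hT; have cz' := coord_cod dz'.
have h2 := smooth_fdm (chart_open_cod (atlas_chart ad)) (sP d ad) cz'.
have ex := rdiff_mx_chart sP ac ad cz dz' hT dirx; have ey := rdiff_mx_chart sP ac ad cz dz' hT diry.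
have fx := etrans ex (fdm_dirE h2 _); have fy := etrans ey (fdm_dirE h2 _).
have qx : (dirx 0 0 *: T) 0 0 = T 0 0 :> C by rewrite !mxE mul1r.
have qy : (diry 0 0 *: T) 0 0 = 'i * T 0 0 :> C by rewrite !mxE.
rewrite qx in fx; rewrite qy in fy.
exact: (dz_alg (erefl _) fx fy (erefl _)).
Qed.

Lemma herm_zero (X Y S : 'M[C]_n) : S = 2^-1 *: (X - 'i *: Y) -> S = 0 ->
  X^t* = X -> Y^t* = Y -> X = 0.
Proof.
move=> -> /eqP; rewrite scaler_eq0 invr_eq0 pnatr_eq0 /= subr_eq0 => /eqP XY hX hY.
have : X = - X.
  by rewrite -{1}hX XY adjmZ hY conjCi scaleNr.
move=> /matrixP XX; apply/matrixP => i j; have := XX i j; rewrite !mxE => /eqP.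
by rewrite -subr_eq0 opprK -mulr2n mulrn_eq0 => /eqP.
Qed.

Lemma frame_alg (K P B X Y S l : 'M[C]_n) (v : C) : P^t* = P -> X^t* = X -> Y^t* = Y ->
  S = 2^-1 *: (X - 'i *: Y) -> S = B *m P ->
  l = (complex.Re v)%:C *: X + (complex.Im v)%:C *: Y ->
  (v *: (K *m - B) *m P + K *m l) *m K^t* + (K *m P) *m (v *: (K *m - B))^t* = 0.
Proof.
move=> hP hX hY SE SB lE.
have St : S^t* = 2^-1 *: (X + 'i *: Y).
  rewrite SE adjmZ conj_half adjD hX -scaleN1r scalerA adjmZ hY.
  by congr (_ *: (_ + _ *: _)); apply: cE; rewrite !reim; ring.
have lS : l = v *: S + v^* *: S^t*.
  rewrite lE St SE; apply/matrixP => i j; rewrite !mxE.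
  have i2 : 2^-1 = (2^-1)%:C :> C by rewrite fmorphV rmorph_nat.
  have h2 : 2 * 2^-1 = 1 :> R by rewrite divff// pnatr_eq0.
  rewrite i2; move: (X i j) (Y i j) (2^-1 : R) h2 => x y t h2.
  have E1 (q : R) : q = 2 * t * q by rewrite h2 mul1r.
  by apply: cE; rewrite !reim; rewrite [LHS]E1; ring.
have e1 : v *: (K *m - B) *m P + K *m (v *: (B *m P) + v^* *: (P *m B^t* )) =
    v^* *: (K *m P *m B^t* ).
  by rewrite mulmxDr -!scalemxAr -scalemxAl mulmxN mulNmx scalerN !mulmxA addrA addNr add0r.
have e2 : (v *: (K *m - B))^t* = - (v^* *: (B^t* *m K^t* )).
  have BN : (- B)^t* = - B^t* by rewrite -scaleN1r adjmZ rmorphN1 scaleN1r.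
  by rewrite adjmZ adjM BN mulNmx scalerN.
have e3 : S^t* = P *m B^t* by rewrite SB adjM hP.
by rewrite lS e3 SB e1 e2 mulmxN -scalemxAl -scalemxAr !mulmxA subrr.
Qed.

Lemma dz_frame (a X Y S : 'M[C]_n) x s : X = a *m ((2 * 'i) *: AD x) *m a^t* ->
  Y = a *m ((2 * 'i) *: AD s) *m a^t* -> S = 2^-1 *: (X - 'i *: Y) -> aut AD a ->
  exists u, S *m (a *m a^t* )^T = AD u.
Proof.
move=> -> -> -> aa; have [_ a2] := aa; have a3 := aut_trr aa.
have b1 := aut_trr (aut_adj L aa).
exists (a *m (2^-1 *: ((2 * 'i) *: x - 'i *: ((2 * 'i) *: s)))).
have -> : 2^-1 *: (a *m ((2 * 'i) *: AD x) *m a^t* - 'i *: (a *m ((2 * 'i) *: AD s) *m a^t* )) =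
    a *m AD (2^-1 *: ((2 * 'i) *: x - 'i *: ((2 * 'i) *: s))) *m a^t*.
  rewrite (clZ L (2^-1)) (clB L) (clZ L 'i) (clZ L _ x) (clZ L _ s).
  move: ((2 * 'i) *: AD x) ((2 * 'i) *: AD s) => V W.
  by rewrite -scalemxAr -scalemxAl mulmxBr mulmxBl -scalemxAr -scalemxAl.
move: (_ *: _) => u; rewrite trmx_mul -!mulmxA (mulmxA (a^t* )) b1 mul1mx.
by rewrite mulmxA a2 -mulmxA a3 mulmx1.
Qed.

Lemma aut_pullback (Q : 'M[C]_n) x : aut AD Q -> Q *m AD (Q^T *m x) = AD x *m Q.
Proof. by move=> aQ; rewrite aQ.2 mulmxA (aut_trr aQ) mul1mx. Qed.

Lemma xi_fdm (D : set 'cV[C]_1) P z : open D -> D z -> smooth_mx_on D P ->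
  exists l, fdm (fun w => adproj AD (dz P w *m (P w)^T)) z l.
Proof.
move=> oD Dz sP.
have sx := smooth_fdm oD (smooth_rdiff_mx dirx sP) Dz; have sy := smooth_fdm oD (smooth_rdiff_mx diry sP) Dz.
have h1 := fdm_scale 2^-1 (fdm_add sx (fdm_opp (fdm_scale 'i sy))).
by eexists; exact: (adproj_fdm AD (fdm_mul h1 (fdm_tr (smooth_fdm oD sP Dz)))).
Qed.

Context (P : U -> 'M[C]_n) (Pa : forall p, exists2 a, G a & P p = a *m a^t* ).
Context (sP : forall c, atlas c -> smooth_mx_on (cod c) (fun y => P (param c y))).
Local Notation Pc c := (fun y => P (param c y)).

Lemma P_aut p : aut AD (P p) /\ (P p)^t* = P p.
Proof.
have [a Ga ->] := Pa p; split; last by rewrite adjM adjK.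
by apply: autM (Gaut Ga) _; apply: (aut_adj L); exact: Gaut.
Qed.

Lemma P_inv p : invmx (P p) = (P p)^T.
Proof.
have [[p1 _] _] := P_aut p; have u := (mulmx1_unit p1).2.
by rewrite -[LHS]mul1mx -p1 mulmxK.
Qed.

(** The g-valued form P_z P^-1. *)
Definition xi (c : chart R 1 U) z := adproj AD (dz (Pc c) z *m (P (param c z))^T).

Let oc (c : chart R 1 U) : atlas c -> open (cod c).
Proof. by move=> ac; exact: chart_open_cod (atlas_chart ac). Qed.

Lemma xiE c : atlas c -> forall z, cod c z -> dz (Pc c) z *m (P (param c z))^T = AD (xi c z).
Proof.
move=> ac z cz; have [a Ga Pz] := Pa (param c z).
have T v := cartan_tangent (oc ac) cz (sP ac) (fun w _ => P_aut (param c w)) Ga Pz v.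
have [r hr] := T dirx; have [s hs] := T diry.
have [u hu] := dz_frame hr hs (erefl (dz (Pc c) z)) (Gaut Ga).
have au : dz (Pc c) z *m (P (param c z))^T = AD u.
  exact: (etrans (congr1 (fun Q : 'M[C]_n => dz (Pc c) z *m Q^T) Pz) hu).
exact: (etrans au (esym (congr1 AD (etrans (congr1 (adproj AD) au) (adprojAD L u))))).
Qed.

Lemma xi_chart c d : atlas c -> atlas d -> forall z, cod c z -> dom d (param c z) ->
  forall T, mder (fun w => coord d (param c w)) z T -> xi c z = T 0 0 *: xi d (coord d (param c z)).
Proof.
move=> ac ad z cz dz' T hT; apply: (cl_inj L); rewrite (clZ L).
rewrite -(xiE ac cz) -(xiE ad (coord_cod dz')) (dz_chart sP ac ad cz dz' hT) -scalemxAl.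
by rewrite (paramK ad dz').
Qed.

Lemma dz_xi c : atlas c -> forall z, cod c z -> dz (Pc c) z = AD (xi c z) *m P (param c z).
Proof.
move=> ac z cz; have [[p1 _] _] := P_aut (param c z).
by rewrite -(xiE ac cz) -mulmxA p1 mulmx1.
Qed.

Lemma P_herm c : atlas c -> forall z, cod c z -> forall v,
  (rdiff_mx v (Pc c) z)^t* = rdiff_mx v (Pc c) z.
Proof.
by move=> ac z cz v; exact: (herm_rdiff (oc ac) v (sP ac) (fun w _ => (P_aut (param c w)).2) cz).
Qed.

Lemma xi_neq0 c : atlas c -> forall z, cod c z ->
  (forall v, rdiff_mx v (Pc c) z = 0 -> v 0 0 = 0) -> xi c z != 0.
Proof.
move=> ac z cz imm; apply/eqP => x0.
have d0 : dz (Pc c) z = 0 by rewrite (dz_xi ac cz) x0 (cl0 L) mul0mx.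
have X0 := herm_zero (erefl (dz (Pc c) z)) d0 (P_herm ac cz dirx) (P_herm ac cz diry).
have := imm dirx X0; rewrite mxE => /eqP.
by rewrite oner_eq0.
Qed.

Lemma xi_mder c z (N : 'cV[C]_1 -> 'cV[C]_n) l j (E : 'M[C]_n) : atlas c -> cod c z ->
  (\forall w \near z, xi c w = (E *m xi c w) j 0 *: N w) -> fdm N z l ->
  l diry = 'i *: l dirx -> (E *m xi c z) j 0 != 0 ->
  (forall v, rdiff_mx v (Pc c) z = 0 -> v 0 0 = 0) -> exists B, mder (xi c) z B.
Proof.
move=> ac cz nmN hN lN m0 imm; have [lx hx] := xi_fdm (oc ac) cz (sP ac).
exact: (gauss_holomorphic (oc ac) L (sP ac) (fun w _ => P_aut (param c w)) cz
    (fun w cw => xiE ac cw) nmN (fdm_mull E hx j 0) hN lN m0 imm).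
Qed.

(** A map with holomorphic xi comes from a holomorphic frame: K' = - K AD(xi)
    makes K P K^* constant. *)
Theorem holomorphic_frame : holform xi -> exists F y,
  [/\ forall p, G (F p), forall p, P p = F p *m (F p)^t*, holform y &
    forall c, atlas c -> forall z, cod c z ->
    mder (fun w => F (param c w)) z (F (param c z) *m AD (y c z))].
Proof.
move=> xih.
have nxi : holform (fun c z => - xi c z).
  split=> [c ac z cz|c d ac ad z cz dz' T hT].
    by have [B hB] := xih.1 c ac z cz; exists (- B); exact: mder_opp.
  by rewrite (xi_chart ac ad cz dz' hT) scalerN.
have [K [KG hK]] := transp nxi.
pose H p := K p *m P p *m (K p)^t*.
have Hc p q : H p = H q.
  apply: (surface_const U_sc) => c ac z cz.
  have hP := smooth_fdm (oc ac) (sP ac) cz.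
  have hk := hK c ac z cz; rewrite (clN L) in hk.
  have hh := P_herm ac cz; have SB := dz_xi ac cz.
  have hH := fdm_mul (fdm_mul hk hP) (fdm_adj hk).
  apply: fdm_eq hH => w; first exact: erefl.
  rewrite scaler0; apply: esym.
  exact: (frame_alg (K (param c z)) (P_aut (param c z)).2 (hh dirx) (hh diry) (erefl _) SB (fdm_dirE hP w)).
have [a0 Ga0 Ha0] : exists2 a0, G a0 & forall p, H p = a0 *m a0^t*.
  have [[p0 _]|noU] := pselect (exists p0 : U, True); last first.
    by exists 1%:M => [|p]; [exact: G1 | case: noU; exists p].
  have [a Ga Pe] := Pa p0; exists (K p0 *m a); first exact: GM.
  by move=> p; rewrite (Hc p p0) /H Pe adjM !mulmxA.
pose F p := (K p)^T *m a0.
have GF p : G (F p).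
  by apply: GM Ga0; exact: GT.
have PE p : P p = F p *m (F p)^t*.
  have [k1 _] := Gaut (KG p).
  have c1 : (K p)^t* *m ((K p)^T)^t* = 1%:M by rewrite -adjM k1 adjm1.
  have e1 : F p *m (F p)^t* = (K p)^T *m (a0 *m a0^t* ) *m ((K p)^T)^t* by rewrite /F adjM !mulmxA.
  rewrite e1 -(Ha0 p) /H !mulmxA k1 mul1mx.
  by rewrite -mulmxA c1 mulmx1.
pose y (c : chart R 1 U) z := (F (param c z))^T *m xi c z.
have hF c : atlas c -> forall z, cod c z ->
    mder (fun w => F (param c w)) z (F (param c z) *m AD (y c z)).
  move=> ac z cz; have := mder_mulr a0 (mder_tr (hK c ac z cz)).
  have ez : F (param c z) *m AD (y c z) = AD (xi c z) *m F (param c z).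
    exact: (aut_pullback (xi c z) (Gaut (GF (param c z)))).
  rewrite trmx_mul (cl_tr_skew L) (clN L) opprK -mulmxA => hk.
  exact: (eq_rect _ (fun A => mder _ z A) hk _ (esym ez)).
have hy : holform y.
  split=> [c ac z cz|c d ac ad z cz dz' T hT].
    have [B hB] := xih.1 c ac z cz.
    by have k := mder_mul (mder_tr (hF c ac z cz)) hB; eexists; exact: k.
  by rewrite /y (xi_chart ac ad cz dz' hT) -scalemxAr paramK.
by exists F, y.
Qed.

End HermitianMapsIntoG.

Section PartTwo.
Context {R : realType} {n : nat} (Gt : complexLieGroup R n).
Local Notation C := R[i].
Context (phi : chart R n Gt) (phi_atlas : atlas phi) (phi_one : dom phi (lie_one Gt)).
Context (h : set 'cV[C]_n) (hc : compact_real_form phi h).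
Context (sigma0 : 'cV[C]_n -> 'cV[C]_n) (sc : is_conjugation h sigma0).
Context (sigma : Gt -> Gt) (sinv : involution_with_differential phi sigma sigma0).
Context (e : 'I_n -> 'cV[C]_n) (he : orthonormal_basis phi h e).
Context (gN : 'M[C]_n -> 'M[C]_n -> 'M[C]_n -> R) (gNm : invariant_metric phi h e gN).
Context (U : riemannSurface R) (U_sc : simply_connected R U).
Local Notation E := (basis_mx e).
Local Notation AD := (AD phi e).
Local Notation G := (adjoint_group phi e).

Let EU : E \in unitmx.
Proof.
exact: (basis_unit (adD phi_atlas phi_one) (adZ phi_atlas phi_one) (let: And3 _ _ o := he in o)).
Qed.
Let L : compact_lie AD. Proof. by have := AD_compact phi_atlas phi_one hc he. Qed.
Let Gaut F : G F -> aut AD F. Proof. exact: (adjoint_aut phi_atlas phi_one hc he). Qed.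

Lemma coset_cartan (x : set 'M[C]_n) : symmetric_space phi sigma e x ->
  exists2 a, G a & cartan x = a *m a^t*.
Proof. by move=> [a Ga <-]; exists a => //; exact: (cartan_coset phi_atlas phi_one hc he sc sinv). Qed.

Theorem symmetric_to_minimal (f : U -> set 'M[C]_n) : conformal_immersion_N phi sigma e gN f ->
  holomorphic_to_projective (right_gauss_map phi e f) ->
  exists f0 : U -> 'cV[R]_n,
    [/\ conformal_immersion_Rn f0, minimal f0 & same_metric (induced_Rn f0) (induced_N gN f)].
Proof.
move=> [fN sP cI] [_ hol].
pose P p := cartan (f p).
have Pa p : exists2 a, G a & P p = a *m a^t* by exact: coset_cartan.
have imm c : atlas c -> forall z, cod c z -> forall v, rdiff_mx v (fun y => P (param c y)) z = 0 -> v 0 0 = 0.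
  move=> ac z cz v v0; have [a Ga Pz] := Pa (param c z).
  have [l l0 hl] := cI c ac z cz; have := hl v v; rewrite /induced_N.
  have m0 := metricE phi_atlas phi_one hc he gNm (0 : 'cV[R]_n) (0 : 'cV[R]_n) Ga.
  have r0 : realv (0 : 'cV[R]_n) = 0 by apply/matrixP => i j; rewrite !mxE.
  rewrite r0 (cl0 L) scaler0 mulmx0 mul0mx in m0.
  rewrite big1 in m0; last by move=> k _; rewrite mxE mul0r.
  move=> hv; have {}hv : 0 = l * complex.Re ((v 0 0)^* * v 0 0).
    apply: etrans (esym m0) (etrans _ hv).
    exact: (congr2 (fun Q V => gN Q V V) (esym Pz) (esym v0)).
  move/esym/eqP: hv; rewrite mulf_eq0 (gt_eqF l0) /= !reim.
  move: (v 0 0) => t; rewrite mulNr opprK => /eqP hh.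
  by apply: cE; rewrite !reim; nra.
pose x := xi AD P.
have x0 c (ac : atlas c) z (cz : cod c z) : x c z != 0.
  exact: (xi_neq0 L Gaut Pa sP ac cz (imm c ac z cz)).
have gauss : forall c, atlas c -> forall z, cod c z ->
    right_gauss_map phi e f (param c z) = line (E *m x c z).
  apply: (gaussE phi_atlas phi_one hc he) => [c ac z cz|c d ac ad z cz dz' T hT|c ac z cz].
  - exact: (etrans (congr1 (mulmx _) (P_inv L Gaut Pa (param c z))) (xiE L Gaut Pa sP ac cz)).
  - exact: (xi_chart L Gaut Pa sP ac ad cz dz' hT).
  - exact: x0.
have xih : holform x.
  split=> [c ac z cz|c d ac ad z cz dz' T hT]; last exact: (xi_chart L Gaut Pa sP ac ad cz dz' hT).
  have [j jE] : exists j, (E *m x c z) j 0 != 0.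
    apply/existsP; apply: contraT => /existsPn hj; case/eqP: (x0 c ac z cz).
    rewrite -(mulKmx EU (x c z)); have -> : E *m x c z = 0; last by rewrite mulmx0.
    by apply/matrixP => i k; rewrite ord1 [RHS]mxE; apply/eqP; rewrite -[_ == _]negbK hj.
  have aff : affine_dom j (right_gauss_map phi e f (param c z)).
    by rewrite gauss//; apply/affine_domE.
  have [nA dA] := hol c ac z cz j aff; have [A0 hA0] := diff_fdm dA.
  pose N w := invmx E *m affine_coord j (right_gauss_map phi e f (param c w)).
  have nmN : \forall w \near z, x c w = (E *m x c w) j 0 *: N w.
    apply: filterS2 (cod_near ac cz) nA => w cw; rewrite /N gauss// => /affine_domE mw.
    by rewrite affine_coordE// -scalemxAr mulKmx// scalerA divff// scale1r.
  have dE : diry = 'i *: dirx :> 'cV[C]_1 by apply/matrixP => k l; rewrite !mxE mulr1.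
  have lN : invmx E *m (A0 *m diry) = 'i *: (invmx E *m (A0 *m dirx)).
    by rewrite dE -!scalemxAr.
  exact: (xi_mder L Gaut Pa sP ac cz nmN (fdm_mull (invmx E) hA0) lN jE (imm c ac z cz)).
have [F [y [GF PE hy hF]]] := holomorphic_frame L Gaut (adjoint1 phi_atlas phi_one he)
  (adjointM phi_atlas phi_one he) (adjointT phi_atlas phi_one hc he) U_sc
  (adjoint_transport phi_atlas phi_one hc he U_sc) Pa sP xih.
apply: (realize U_sc hy cI) => c ac z cz v w.
rewrite /induced_N.
have -> : (fun y => cartan (f (param c y))) = (fun y => F (param c y) *m (F (param c y))^t* ).
  by apply: funext => u; exact: PE.
have -> : cartan (f (param c z)) = F (param c z) *m (F (param c z))^t* by exact: PE.
exact: (frame_metric phi_atlas phi_one hc he gNm v w (GF (param c z)) (hF c ac z cz)).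
Qed.

End PartTwo.

(** * The correspondence *)

Theorem mainTheorem1 (R : realType) (n : nat) (Gt : complexLieGroup R n)
    (Gt_sc : simply_connected R Gt)
    (phi : chart R n Gt) (phi_atlas : atlas phi) (phi_one : dom phi (lie_one Gt))
    (g_semisimple : semisimple phi)
    (h : set 'cV[R[i]]_n) (h_compact : compact_real_form phi h)
    (sigma0 : 'cV[R[i]]_n -> 'cV[R[i]]_n)
    (sigma0_conj : is_conjugation h sigma0)
    (sigma : Gt -> Gt)
    (sigma_inv : involution_with_differential phi sigma sigma0)
    (e : 'I_n -> 'cV[R[i]]_n) (e_basis : orthonormal_basis phi h e)
    (gN : 'M[R[i]]_n -> 'M[R[i]]_n -> 'M[R[i]]_n -> R)
    (gN_metric : invariant_metric phi h e gN)
    (U : riemannSurface R) (U_sc : simply_connected R U) :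
  (forall f0 : U -> 'cV[R]_n,
     conformal_immersion_Rn f0 -> minimal f0 ->
     exists f : U -> set 'M[R[i]]_n,
       [/\ conformal_immersion_N phi sigma e gN f,
           holomorphic_to_projective (right_gauss_map phi e f)
         & same_metric (induced_N gN f) (induced_Rn f0)]) /\
  (forall f : U -> set 'M[R[i]]_n,
     conformal_immersion_N phi sigma e gN f ->
     holomorphic_to_projective (right_gauss_map phi e f) ->
     exists f0 : U -> 'cV[R]_n,
       [/\ conformal_immersion_Rn f0, minimal f0
         & same_metric (induced_Rn f0) (induced_N gN f)]).
Proof.
split=> [f0 cf mf|f cf hf].
  exact: (minimal_to_symmetric phi_atlas phi_one h_compact sigma0_conj sigma_inv e_basis
    gN_metric U_sc cf mf).
exact: (symmetric_to_minimal phi_atlas phi_one h_compact sigma0_conj sigma_inv e_basis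
  gN_metric U_sc cf hf).
Qed.
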